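(* Let $F$ be a number field with ring of integers $R$, $G$ a finite flat commutative group scheme over $\mathrm{Spec}(R)$, $\mathfrak A=\mathcal O_{G^*}$. Then the map $$\overline\psi:H^1(\mathrm{Spec}(R),G)\to\overline K_0(\mathfrak A,R^c),\qquad\pi\mapsto\text{class of }\iota_{\mathfrak A,R^c}([\mathcal L_\pi,\mathfrak A;\xi_\pi])$$ is an injective group homomorphism.
   Context: $G^*$ is the Cartier dual, $A=\mathfrak A\otimes_RF$, $\Gamma=G(F^c)$, so $A\otimes_FF^c=F^c[\Gamma]$; $R^c$ is the integral closure of $R$ in $F^c$. $H^1(\mathrm{Spec}(R),G)$ is the group of isomorphism classes of $G$-torsors. For a $G$-torsor $\pi:X\to\mathrm{Spec}(R)$, $\mathcal O_X$ is an $\mathcal O_G$-comodule, hence an $\mathfrak A$-module, locally free of rank one, giving a line bundle $\mathcal M_\pi$ on $G^*$; with $\pi_0$ the trivial torsor, $\mathcal L_\pi=\mathcal M_\pi\otimes\mathcal M_{\pi_0}^{-1}$ (equivalently, the line bundle of the $\mathbf G_m$-torsor $G(\pi)$ over $G^*$ from the extension $1\to\mathbf G_m\to G(\pi)\to G^*\to1$ corresponding to $\pi$ under $H^1(\mathrm{Spec}R,G)\cong\mathrm{Ext}^1(G^*,\mathbf G_m)$). A $G$-equivariant isomorphism $X\otimes_RR^c\cong G\otimes_RR^c$ induces by functoriality an $\mathfrak A\otimes_RR^c$-isomorphism $\xi_\pi:\mathcal L_\pi\otimes_RR^c\cong\mathfrak A\otimes_RR^c$. The relative $K$-group $K_0(\mathfrak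 A,\Lambda)$ is generated by classes $[L_1,L_2;\lambda]$ ($L_i$ f.g. projective $\mathfrak A$-modules, $\lambda:L_1\otimes_R\Lambda\cong L_2\otimes_R\Lambda$) modulo exact-sequence and composition relations; $\iota_{\mathfrak A,R^c}:K_0(\mathfrak A,R^c)\to K_0(\mathfrak A,F^c)$ is scalar extension. With $J_f(A)$ the restricted product of the $A_v^\times$ with respect to $\mathfrak M_v^\times$ ($\mathfrak M$ the maximal order), $U_f(\mathfrak A)=\prod_v\mathfrak A_v^\times$, $\Delta':A^\times\to J_f(A)/U_f(\mathfrak A)\times(A\otimes_FF^c)^\times$, $a\mapsto(a,a^{-1})$, one has a natural isomorphism $K_0(\mathfrak A,F^c)\cong\mathrm{Cok}(\Delta')$; $\overline K_0(\mathfrak A,F^c)$ is the further quotient $\big(J_f(A)/U_f(\mathfrak A)\times(A\otimes_FF^c)^\times/\Gamma\big)/(\text{image of }A^\times)$, and $\overline K_0(\mathfrak A,R^c)$ is the image of $K_0(\mathfrak A,R^c)$ in $\overline K_0(\mathfrak A,F^c)$ under $\iota_{\mathfrak A,R^c}$ followed by the projection. The class $\overline\psi(\pi)$ is independent of the choice of $\xi_\pi$ and depends only on the isomorphism class of $\pi$. *)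

(* Defs.v *)
From HB Require Import structures.
From mathcomp Require Import all_boot all_order all_algebra all_field.
From mathcomp Require Import boolp classical_sets functions cardinality.
Set Implicit Arguments.
Unset Strict Implicit.
Unset Printing Implicit Defensive.
Import GRing.Theory.
Local Open Scope ring_scope.
Local Open Scope quotient_scope.

Section Tensor.
Variables (R : comPzRingType) (M N : lmodType R).
Implicit Types (P : lmodType R) (s t : seq (M * N)).

Definition bilin P (b : M -> N -> P) : Prop :=
  (forall n, linear (b^~ n)) /\ (forall m, linear (b m)).

Definition tsum (P : nmodType) (b : M -> N -> P) s : P :=
  \sum_(p <- s) b p.1 p.2.

(* M (x) N is the set of formal sums of pairs, two of them being identified
   when no bilinear map separates them; the universal property is [tlift]. *)
Definition tequiv s t : bool :=
  `[< forall P (b : M -> N -> P), bilin b -> tsum b s = tsum b t >].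

Fact tequiv_equiv : equiv_class_of tequiv.
Proof.
split=> [s|s t|t s u].
- exact/asboolP.
- by apply/idP/idP => /asboolP h; apply/asboolP => P b /h.
- move=> /asboolP h /asboolP k; apply/asboolP => P b hb.
  by rewrite (h _ _ hb) (k _ _ hb).
Qed.
Canonical tequiv_equivRel := EquivRelPack tequiv_equiv.

Definition tensor : Type := {eq_quot tequiv}.
HB.instance Definition _ := Choice.on tensor.
HB.instance Definition _ := Quotient.on tensor.

Definition tlift (P : nmodType) (b : M -> N -> P) (x : tensor) : P :=
  tsum b (repr x).

Definition tens (m : M) (n : N) : tensor  := \pi_tensor [:: (m, n)].

Lemma tlift_pi P (b : M -> N -> P) s :
  bilin b -> tlift b (\pi_tensor s) = tsum b s.
Proof.
move=> hb; rewrite /tlift; have : \pi_tensor (repr (\pi_tensor s)) = \pi_tensor s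
  by rewrite reprK.
by move=> /eqmodP/asboolP; apply.
Qed.

Lemma tensor_ext (x y : tensor) :
  (forall P (b : M -> N -> P), bilin b -> tlift b x = tlift b y) -> x = y.
Proof.
by move=> h; rewrite -[x]reprK -[y]reprK; apply/eqmodP/asboolP => P b /h.
Qed.

Definition tzero : tensor  := \pi_tensor [::].
Definition tadd (x y : tensor) : tensor := \pi_tensor (repr x ++ repr y).
Definition topp (x : tensor) : tensor :=
  \pi_tensor [seq (- p.1, p.2) | p <- repr x].
Definition tscale (a : R) (x : tensor) : tensor :=
  \pi_tensor [seq (a *: p.1, p.2) | p <- repr x].

Section BilinTheory.
Variables (P : lmodType R) (b : M -> N -> P) (hb : bilin b).

Lemma bilinDl m m' n : b (m + m') n = b m n + b m' n.
Proof. by have := hb.1 n 1 m m'; rewrite !scale1r. Qed.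
Lemma bilin0l n : b 0 n = 0.
Proof. by apply: (@addrI _ (b 0 n)); rewrite -bilinDl !addr0. Qed.
Lemma bilinZl a m n : b (a *: m) n = a *: b m n.
Proof. by have := hb.1 n a m 0; rewrite addr0 bilin0l addr0. Qed.
Lemma bilinNl m n : b (- m) n = - b m n.
Proof. by rewrite -scaleN1r bilinZl scaleN1r. Qed.
Lemma bilinDr m n n' : b m (n + n') = b m n + b m n'.
Proof. by have := hb.2 m 1 n n'; rewrite !scale1r. Qed.
Lemma bilin0r m : b m 0 = 0.
Proof. by apply: (@addrI _ (b m 0)); rewrite -bilinDr !addr0. Qed.
Lemma bilinZr a m n : b m (a *: n) = a *: b m n.
Proof. by have := hb.2 m a n 0; rewrite addr0 bilin0r addr0. Qed.

Lemma tlift0 : tlift b tzero = 0.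
Proof. by rewrite tlift_pi // /tsum big_nil. Qed.
Lemma tlift_add x y : tlift b (tadd x y) = tlift b x + tlift b y.
Proof. by rewrite tlift_pi // /tsum big_cat. Qed.
Lemma tlift_opp x : tlift b (topp x) = - tlift b x.
Proof.
rewrite tlift_pi // /tlift /tsum big_map -sumrN.
by apply: eq_bigr => p _; rewrite bilinNl.
Qed.
Lemma tlift_scale a x : tlift b (tscale a x) = a *: tlift b x.
Proof.
rewrite tlift_pi // /tlift /tsum big_map scaler_sumr.
by apply: eq_bigr => p _; rewrite bilinZl.
Qed.
Lemma tlift_tens m n : tlift b (tens m n) = b m n.
Proof. by rewrite tlift_pi // /tsum big_seq1. Qed.
End BilinTheory.

Fact taddA : associative tadd.
Proof. by move=> x y z; apply: tensor_ext => P b hb; rewrite !tlift_add ?addrA. Qed.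
Fact taddC : commutative tadd.
Proof. by move=> x y; apply: tensor_ext => P b hb; rewrite !tlift_add // addrC. Qed.
Fact tadd0 : left_id tzero tadd.
Proof. by move=> x; apply: tensor_ext => P b hb; rewrite tlift_add // tlift0 // add0r. Qed.
Fact taddN : left_inverse tzero topp tadd.
Proof.
move=> x; apply: tensor_ext => P b hb.
by rewrite tlift_add // tlift_opp // addNr tlift0.
Qed.
HB.instance Definition _ := GRing.isZmodule.Build tensor taddA taddC tadd0 taddN.

Fact tscaleA a c x : tscale a (tscale c x) = tscale (a * c) x.
Proof. by apply: tensor_ext => P b hb; rewrite !tlift_scale // scalerA. Qed.
Fact tscale1 : left_id 1 tscale.
Proof. by move=> x; apply: tensor_ext => P b hb; rewrite !tlift_scale // scale1r. Qed.
Fact tscaleDr : right_distributive tscale +%R.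
Proof.
move=> a x y; apply: tensor_ext => P b hb.
by rewrite tlift_scale // !tlift_add // !tlift_scale // scalerDr.
Qed.
Fact tscaleDl x : {morph tscale^~ x : a c / a + c}.
Proof.
move=> a c; apply: tensor_ext => P b hb.
by rewrite tlift_add // !tlift_scale // scalerDl.
Qed.
HB.instance Definition _ :=
  GRing.Zmodule_isLmodule.Build R tensor tscaleA tscale1 tscaleDr tscaleDl.

Lemma tliftP P (b : M -> N -> P) : bilin b -> linear (tlift b).
Proof.
by move=> hb a x y; rewrite (tlift_add hb (a *: x) y) (tlift_scale hb).
Qed.

Lemma tens_bilin : bilin tens.
Proof.
split=> [n a m m'|m a n n']; apply: tensor_ext => P b hb.
  by rewrite (tliftP hb) !tlift_tens // (bilinDl hb) (bilinZl hb).
by rewrite (tliftP hb) !tlift_tens // (bilinDr hb) (bilinZr hb).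
Qed.

Lemma tensE x : x = \sum_(p <- repr x) tens p.1 p.2.
Proof.
have h : {morph (\pi_tensor : seq (M * N) -> tensor) : s t / s ++ t >-> s + t}.
  move=> s t; apply: tensor_ext => P b hb.
  by rewrite (tlift_add hb) !tlift_pi // /tsum big_cat.
rewrite -[LHS]reprK; elim: (repr x) => [|[m n] s ih]; first by rewrite big_nil.
by rewrite big_cons -ih -h.
Qed.

Lemma tensor_eq (V : zmodType) (f g : tensor -> V) :
  {morph f : x y / x + y} -> {morph g : x y / x + y} ->
  (forall m n, f (tens m n) = g (tens m n)) -> f =1 g.
Proof.
have h0 (k : tensor -> V) : {morph k : x y / x + y} -> k 0 = 0.
  by move=> kD; apply: (@addrI _ (k 0)); rewrite -kD !addr0.
move=> fD gD h x; rewrite (tensE x).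
elim: (repr x) => [|p s ih]; first by rewrite big_nil !h0.
by rewrite big_cons fD gD h ih.
Qed.

Lemma tlin_eq (V : lmodType R) (f g : tensor -> V) : linear f -> linear g ->
  (forall m n, f (tens m n) = g (tens m n)) -> f =1 g.
Proof.
move=> hf hg; apply: tensor_eq => x y.
  by have := hf 1 x y; rewrite !scale1r.
by have := hg 1 x y; rewrite !scale1r.
Qed.

End Tensor.

Section TensorMaps.
Variable R : comPzRingType.
Implicit Types M N P : lmodType R.

Definition tmap M N M' N' (f : M -> M') (g : N -> N') : tensor M N -> tensor M' N' :=
  tlift (fun m n => tens (f m) (g n)).

Definition tswap M N : tensor M N -> tensor N M := tlift (fun m n => tens n m).

Definition tassoc M N P : tensor (tensor M N) P -> tensor M (tensor N P) :=
  tlift (fun x p => tlift (fun m n => tens m (tens n p)) x).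

Lemma bilin_tmap M N M' N' (f : M -> M') (g : N -> N') :
  linear f -> linear g -> bilin (fun m n => tens (f m) (g n)).
Proof.
move=> hf hg; split=> [n a m m'|m a n n'] /=.
  by rewrite hf (bilinDl (tens_bilin _ _)) (bilinZl (tens_bilin _ _)).
by rewrite hg (bilinDr (tens_bilin _ _)) (bilinZr (tens_bilin _ _)).
Qed.

Lemma tmap_linear M N M' N' (f : M -> M') (g : N -> N') :
  linear f -> linear g -> linear (tmap f g).
Proof. by move=> hf hg; apply/tliftP/bilin_tmap. Qed.

Lemma tmap_tens M N M' N' (f : M -> M') (g : N -> N') m n :
  linear f -> linear g -> tmap f g (tens m n) = tens (f m) (g n).
Proof. by move=> hf hg; rewrite /tmap tlift_tens //; apply: bilin_tmap. Qed.
End TensorMaps.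

(* MathComp's [comAlgType] excludes the zero ring, which a tensor product of
   algebras may be; so an R-algebra is here a ring with a structure map. *)
Record calg (R : comPzRingType) := CAlg {
  calg_ring : comPzRingType;
  calg_str : {rmorphism R -> calg_ring}
}.
Definition calg_sort (R : comPzRingType) (A : calg R) : Type := calg_ring A.
Coercion calg_sort : calg >-> Sortclass.

Section CAlgModule.
Variables (R : comPzRingType) (A : calg R).
HB.instance Definition _ := GRing.ComPzRing.on (calg_sort A).
Let scale (a : R) (x : A) : A := calg_str A a * x.
Fact calg_scaleA a b x : scale a (scale b x) = scale (a * b) x.
Proof. by rewrite /scale mulrA rmorphM. Qed.
Fact calg_scale1 : left_id 1 scale.
Proof. by move=> x; rewrite /scale rmorph1 mul1r. Qed.
Fact calg_scaleDr : right_distributive scale +%R.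
Proof. by move=> a x y; rewrite /scale mulrDr. Qed.
Fact calg_scaleDl x : {morph scale^~ x : a b / a + b}.
Proof. by move=> a b; rewrite /scale rmorphD mulrDl. Qed.
HB.instance Definition _ := GRing.Zmodule_isLmodule.Build R (calg_sort A)
  calg_scaleA calg_scale1 calg_scaleDr calg_scaleDl.

Lemma cscalerAl (a : R) (x y : A) : a *: (x * y) = (a *: x) * y.
Proof. exact: mulrA. Qed.
Lemma cscalerAr (a : R) (x y : A) : a *: (x * y) = x * (a *: y).
Proof. by rewrite mulrC cscalerAl mulrC. Qed.
End CAlgModule.

Section TensorAlgebra.
Variables (R : comPzRingType) (A B : calg R).
Local Notation T := (tensor A B).

Definition tmul (x y : T) : T :=
  tlift (fun (a : A) (b : B) => tmap (fun a' : A => a * a') (fun b' : B => b * b') y) x.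
Definition tone : T := tens (1 : A) (1 : B).

Fact lmul_linear (C : calg R) (c : C) : linear (fun c' : C => c * c').
Proof. by move=> a x y; rewrite mulrDr cscalerAr. Qed.

Fact tmul_bilin (y : T) :
  bilin (fun (a : A) (b : B) => tmap (fun a' : A => a * a') (fun b' : B => b * b') y).
Proof.
have k (a : A) (b : B) : linear (tmap (fun a' : A => a * a') (fun b' : B => b * b')).
  by apply: tmap_linear; apply: lmul_linear.
split=> [b c a a'|a c b b'] /=; move: y; apply: tlin_eq => //.
- by move=> d x y; rewrite !k !scalerDr !scalerA (mulrC c) addrACA.
- move=> m n; rewrite !tmap_tens; try exact: lmul_linear.
  by rewrite mulrDl -cscalerAl (tens_bilin _ _).1.
- by move=> d x y; rewrite !k !scalerDr !scalerA (mulrC c) addrACA.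
- move=> m n; rewrite !tmap_tens; try exact: lmul_linear.
  by rewrite mulrDl -cscalerAl (tens_bilin _ _).2.
Qed.

Lemma tmul_tens a b a' b' :
  tmul (tens a b) (tens a' b') = tens (a * a') (b * b').
Proof.
by rewrite /tmul tlift_tens ?tmap_tens //; try exact: lmul_linear; exact: tmul_bilin.
Qed.

Fact tmul_linl y : linear (tmul^~ y).
Proof. exact/tliftP/tmul_bilin. Qed.

Fact tmulC : commutative tmul.
Proof.
have linr x : linear (tmul x).
  move=> c y y'; move: x; apply: tlin_eq.
  - exact: tmul_linl.
  - move=> d x x'; rewrite !tmul_linl !scalerDr !scalerA (mulrC c).
    by rewrite addrACA.
  move=> m n; rewrite /tmul !tlift_tens; try exact: tmul_bilin.
  by apply: tmap_linear; apply: lmul_linear.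
move=> x; apply: tlin_eq => [||a' b']; [exact: linr | exact: tmul_linl |].
move: x; apply: tlin_eq => [||a b]; [exact: tmul_linl | exact: linr |].
by rewrite !tmul_tens mulrC (mulrC b).
Qed.

Fact tmul_linr x : linear (tmul x).
Proof. by move=> c y y'; rewrite !(tmulC x) tmul_linl. Qed.

Fact tmulDl : left_distributive tmul +%R.
Proof. by move=> x y z; have := tmul_linl z 1 x y; rewrite !scale1r. Qed.
Fact tmulA : associative tmul.
Proof.
move=> x y z; move: x; apply: tlin_eq => [||a b].
- exact: tmul_linl.
- by move=> c x x'; rewrite !tmul_linl.
move: y; apply: tlin_eq => [||a' b'].
- by move=> c y y'; rewrite tmul_linl tmul_linr.
- by move=> c y y'; rewrite tmul_linr tmul_linl.
move: z; apply: tlin_eq => [||c d].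
- by move=> e z z'; rewrite !tmul_linr.
- by move=> e z z'; rewrite !tmul_linr.
by rewrite !tmul_tens !mulrA.
Qed.
Fact tmul1 : left_id tone tmul.
Proof.
move=> x; move: x; apply: tlin_eq => [|//|a b]; first exact: tmul_linr.
by rewrite tmul_tens !mul1r.
Qed.
HB.instance Definition _ :=
  GRing.Zmodule_isComPzRing.Build (tensor A B) tmulA tmulC tmul1 tmulDl.
Lemma tensM a b a' b' : (tens a b : T) * tens a' b' = tens (a * a') (b * b').
Proof. exact: tmul_tens. Qed.
Lemma tensM_linl (y : T) : linear (fun x : T => x * y).
Proof. exact: tmul_linl. Qed.
Lemma tensM_linr (x : T) : linear (fun y : T => x * y).
Proof. exact: tmul_linr. Qed.
Fact tscalerAl (c : R) (x y : T) : c *: (x * y) = (c *: x) * y.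
Proof.
have h0 : tmul 0 y = 0 by exact: (tlift0 (tmul_bilin y)).
by have := tmul_linl y c x 0; rewrite !addr0 h0 addr0.
Qed.

Definition talg_str (c : R) : T := c *: (1 : T).
Fact talg_str_zmod : zmod_morphism talg_str.
Proof. by move=> a b; rewrite /talg_str scalerBl. Qed.
Fact talg_str_monoid : monoid_morphism talg_str.
Proof.
split=> [|a b]; rewrite /talg_str ?scale1r //.
by rewrite -tscalerAl mul1r scalerA.
Qed.
HB.instance Definition _ := GRing.isZmodMorphism.Build R T talg_str talg_str_zmod.
HB.instance Definition _ := GRing.isMonoidMorphism.Build R T talg_str talg_str_monoid.
Definition talg : calg R := CAlg talg_str.
End TensorAlgebra.

Section Dual.
Variables (R : comPzRingType) (M : lmodType R).

Definition lin_form : {pred M -> R^o} := fun f => `[< linear f >].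
Fact lin_form_submod : GRing.submod_closed lin_form.
Proof.
split; first by apply/asboolP => a x y; rewrite scaler0 addr0.
move=> c f g /asboolP hf /asboolP hg; apply/asboolP => a x y.
have e (z : M) : (c *: f + g) z = c *: f z + g z by [].
by rewrite !e hf hg !scalerDr !scalerA (mulrC c) addrACA.
Qed.
HB.instance Definition _ := GRing.isSubmodClosed.Build R (M -> R^o) lin_form
  (GRing.submod_closed_semi lin_form_submod).

Record dual : Type := Dual { dual_fun :> M -> R^o; dualP : dual_fun \in lin_form }.
HB.instance Definition _ := [isSub for dual_fun].
HB.instance Definition _ := [Choice of dual by <:].
HB.instance Definition _ := [SubChoice_isSubLmodule of dual by <:].

Lemma dual_lin (f : dual) : linear f.
Proof. exact/asboolP/dualP. Qed.
Definition mkdual (f : M -> R^o) (hf : linear f) : dual :=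
  Dual (asboolT hf : f \in lin_form).
Lemma dual_eq (f g : dual) : f =1 g -> f = g.
Proof. by move=> h; apply: val_inj; apply: funext. Qed.
Lemma dualDE (f g : dual) x : (f + g) x = f x + g x.
Proof. by []. Qed.
End Dual.

Section ModuleProps.
Variables (R : comPzRingType) (M : lmodType R).

Definition fingen : Prop := exists n (v : 'I_n -> M),
  forall x, exists c : 'I_n -> R, x = \sum_(i < n) c i *: v i.

Definition fgproj : Prop := exists n (i : {linear M -> 'rV[R]_n})
  (p : {linear 'rV[R]_n -> M}), forall x, p (i x) = x.

Definition flat : Prop := forall (N N' : lmodType R) (f : {linear N -> N'}),
  injective f -> injective (tmap f (fun x : M => x)).

Definition faithfully_flat : Prop :=
  flat /\ forall N : lmodType R, (forall z : tensor N M, z = 0) -> forall y : N, y = 0.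

Definition is_basis n (b : 'I_n -> M) : Prop :=
  forall x, exists! c : 'rV[R]_n, x = \sum_(i < n) c 0 i *: b i.
End ModuleProps.

(* Finite flat commutative group schemes over Spec R, through their coordinate
   (Hopf) algebras. *)
Record group_scheme (R : comPzRingType) := GroupScheme {
  gs_alg : calg R;
  gs_mul : gs_alg -> tensor gs_alg gs_alg;
  gs_unit : gs_alg -> R;
  gs_inv : gs_alg -> gs_alg;
  gs_mul_hom : linear gs_mul /\ monoid_morphism gs_mul;
  gs_unit_hom : linear (gs_unit : gs_alg -> R^o) /\ monoid_morphism gs_unit;
  gs_inv_hom : linear gs_inv /\ monoid_morphism gs_inv;
  gs_mulA : forall x,
    tassoc (tmap gs_mul id (gs_mul x)) = tmap id gs_mul (gs_mul x);
  gs_mul1 : forall x, tlift (fun a b => gs_unit a *: b) (gs_mul x) = x;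
  gs_mulV : forall x,
    tlift (fun a b => gs_inv a * b) (gs_mul x) = calg_str gs_alg (gs_unit x);
  gs_mulC : forall x, tswap (gs_mul x) = gs_mul x;
  gs_finite : fingen gs_alg;
  gs_flat : flat gs_alg
}.

Section TensorLemmas.
Variable R : comPzRingType.
Implicit Types M N P : lmodType R.

Lemma lin0 M P (f : M -> P) : linear f -> f 0 = 0.
Proof.
move=> hf; apply: (@addrI _ (f 0)).
by have := hf 1 0 0; rewrite scaler0 scale1r !addr0.
Qed.
Lemma linD M P (f : M -> P) : linear f -> {morph f : x y / x + y}.
Proof. by move=> hf x y; have := hf 1 x y; rewrite !scale1r. Qed.
Lemma linZ M P (f : M -> P) : linear f -> forall a x, f (a *: x) = a *: f x.
Proof. by move=> hf a x; have := hf a x 0; rewrite (lin0 hf) !addr0. Qed.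

Lemma regE (a : R) (u : R^o) : a *: u = a * u.
Proof. by []. Qed.
Lemma regM_bilin : bilin (fun a b : R^o => a * b : R^o).
Proof. by split=> [b c x y|a c x y] /=; rewrite !regE ?mulrDl ?mulrDr ?mulrA // (mulrC a). Qed.

Lemma id_linear M : linear (@id M). Proof. by []. Qed.

Lemma bilin_comp M N M' N' P (b : M' -> N' -> P) (f : M -> M') (g : N -> N') :
  bilin b -> linear f -> linear g -> bilin (fun m n => b (f m) (g n)).
Proof.
move=> hb hf hg; split=> [n a m m'|m a n n'] /=; first by rewrite hf hb.1.
by rewrite hg hb.2.
Qed.

Lemma tlift_tmap M N M' N' P (b : M' -> N' -> P) (f : M -> M') (g : N -> N') z :
  bilin b -> linear f -> linear g ->
  tlift b (tmap f g z) = tlift (fun m n => b (f m) (g n)) z.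
Proof.
move=> hb hf hg; move: z; apply: tlin_eq.
- by move=> c x y; rewrite tmap_linear // tliftP.
- exact/tliftP/bilin_comp.
by move=> m n; rewrite tmap_tens // !tlift_tens //; exact: bilin_comp.
Qed.

Lemma linear_comp M N P (f : N -> P) (g : M -> N) :
  linear f -> linear g -> linear (f \o g).
Proof. by move=> hf hg a x y /=; rewrite hg hf. Qed.

Lemma tassoc_bilin M N P :
  bilin (fun x (p : P) => tlift (fun (m : M) (n : N) => tens m (tens n p)) x).
Proof.
have hb p : bilin (fun (m : M) (n : N) => tens m (tens n p)).
  apply: (bilin_comp (tens_bilin _ _)); first exact: id_linear.
  exact: (tens_bilin _ _).1.
split=> [p|x a p p'] /=; first exact: tliftP.
move: x; apply: tlin_eq.
- exact: tliftP.
- move=> c x y; rewrite !tliftP // !scalerDr !scalerA (mulrC a).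
  by rewrite addrACA.
by move=> m n; rewrite !tlift_tens // (tens_bilin _ _).2 (tens_bilin _ _).2.
Qed.

Lemma tassoc_tens M N P (m : M) (n : N) (p : P) :
  tassoc (tens (tens m n) p) = tens m (tens n p).
Proof.
rewrite /tassoc tlift_tens; last exact: tassoc_bilin.
rewrite tlift_tens //; apply: (bilin_comp (tens_bilin _ _)).
  exact: id_linear.
exact: (tens_bilin _ _).1.
Qed.

Lemma tassoc_linear M N P : linear (@tassoc R M N P).
Proof. exact/tliftP/tassoc_bilin. Qed.

Lemma tens3_eq M N P (V : lmodType R) (f g : tensor (tensor M N) P -> V) :
  linear f -> linear g ->
  (forall m n p, f (tens (tens m n) p) = g (tens (tens m n) p)) -> f =1 g.
Proof.
move=> hf hg h; apply: tlin_eq => // x p; move: x; apply: tlin_eq => [||m n //].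
  by move=> a x y; rewrite (tens_bilin _ _).1 hf.
by move=> a x y; rewrite (tens_bilin _ _).1 hg.
Qed.

Lemma tswap_bilin M N : bilin (fun (m : M) (n : N) => tens n m).
Proof. by split=> [n|m]; [exact: (tens_bilin _ _).2|exact: (tens_bilin _ _).1]. Qed.
End TensorLemmas.

Section CartierDual.
Variables (R : comPzRingType) (G : group_scheme R).
Local Notation O := (gs_alg G).
Local Notation D := (@gs_mul R G).

Definition cdual_ring : Type := dual O.
HB.instance Definition _ := GRing.Lmodule.on cdual_ring.

Fact conv_bilin (f g : dual O) : bilin (fun a b => f a * g b : R^o).
Proof.
exact: bilin_comp (regM_bilin R) (dual_lin f) (dual_lin g).
Qed.

Fact conv_linear (f g : dual O) :
  linear (fun h => tlift (fun a b => f a * g b : R^o) (D h)).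
Proof.
exact: linear_comp (tliftP (conv_bilin f g)) (gs_mul_hom G).1.
Qed.

(* The product of O(G^* ) is dual to the comultiplication of O(G). *)
Definition conv (f g : cdual_ring) : cdual_ring := mkdual (conv_linear f g).
Definition conv1 : cdual_ring := mkdual (gs_unit_hom G).1.

Fact convA : associative conv.
Proof.
move=> f g k; apply: dual_eq => h /=.
pose T (y : tensor O O) : R^o := tlift (fun b c => g b * k c : R^o) y.
have hT : linear T by apply/tliftP/conv_bilin.
pose b3 (a : O) y : R^o := f a * T y.
have hb3 : bilin b3.
  exact: bilin_comp (regM_bilin R) (dual_lin f) hT.
pose T' (y : tensor O O) : R^o := tlift (fun b c => f b * g c : R^o) y.
have hT' : linear T' by apply/tliftP/conv_bilin.
pose b3' y (a : O) : R^o := T' y * k a.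
have hb3' : bilin b3'.
  exact: bilin_comp (regM_bilin R) hT' (dual_lin k).
have D_lin := (gs_mul_hom G).1.
transitivity (tlift b3 (tmap id D (D h))).
  by rewrite tlift_tmap //; exact: id_linear.
rewrite -gs_mulA; transitivity (tlift b3' (tmap D id (D h))); last first.
  by rewrite tlift_tmap //; exact: id_linear.
move: (tmap D id (D h)); apply: tens3_eq.
- by move=> c x y; rewrite tassoc_linear tliftP.
- exact: tliftP.
move=> m n p; rewrite tassoc_tens !tlift_tens // /b3 /b3' /T /T'.
by rewrite !tlift_tens ?mulrA //; exact: conv_bilin.
Qed.

Fact convC : commutative conv.
Proof.
move=> f g; apply: dual_eq => h /=; rewrite -{1}gs_mulC.
move: (D h); apply: tlin_eq.
- exact: linear_comp (tliftP (conv_bilin f g)) (tliftP (tswap_bilin _ _)).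
- exact/tliftP/conv_bilin.
move=> m n; rewrite /tswap tlift_tens; last exact: tswap_bilin.
by rewrite !tlift_tens 1?mulrC //; exact: conv_bilin.
Qed.

Fact conv_1l : left_id conv1 conv.
Proof.
move=> f; apply: dual_eq => h /=.
have hb : bilin (fun a b : O => gs_unit a *: b).
  by split=> [b c x y|a c x y] /=; rewrite ?(gs_unit_hom G).1 ?scalerDl ?scalerDr !scalerA // mulrC.
rewrite -{2}(gs_mul1 h); move: (D h); apply: tlin_eq.
- exact/tliftP/(conv_bilin conv1 f).
- by move=> c x y; rewrite tliftP // dual_lin.
move=> m n; rewrite !tlift_tens //; last exact: (conv_bilin conv1 f).
by rewrite (linZ (dual_lin f)).
Qed.

Fact convDl : left_distributive conv +%R.
Proof.
move=> f g k; apply: dual_eq => h; rewrite dualDE.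
rewrite -[LHS]/(tlift (fun u v => (f + g) u * k v : R^o) (D h)).
rewrite -[RHS]/(tlift (fun u v => f u * k v : R^o) (D h)
  + tlift (fun u v => g u * k v : R^o) (D h)).
rewrite [in LHS]/tlift [in RHS]/tlift /tsum -big_split.
by apply: eq_bigr => p _; rewrite dualDE mulrDl.
Qed.

HB.instance Definition _ := GRing.Zmodule_isComPzRing.Build cdual_ring
  convA convC conv_1l convDl.

Definition cdual_str (c : R) : cdual_ring := c *: conv1.
Fact cdual_str_zmod : zmod_morphism cdual_str.
Proof. by move=> a b; rewrite /cdual_str scalerBl. Qed.
Fact cdual_str_monoid : monoid_morphism cdual_str.
Proof.
split=> [|a b]; first exact: scale1r.
have e (x : cdual_ring) : (a *: conv1) * x = a *: x.
  rewrite -{2}(mul1r x); apply: dual_eq => h /=.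
  rewrite /tlift /tsum [RHS]regE mulr_sumr.
  by apply: eq_bigr => p _; rewrite mulrA.
by rewrite /cdual_str e scalerA.
Qed.
HB.instance Definition _ :=
  GRing.isZmodMorphism.Build R cdual_ring cdual_str cdual_str_zmod.
HB.instance Definition _ :=
  GRing.isMonoidMorphism.Build R cdual_ring cdual_str cdual_str_monoid.

(* The coordinate ring of the Cartier dual G^*. *)
Definition cdual : calg R := CAlg cdual_str.
End CartierDual.

Section ScalarExtension.
Variables (R : comPzRingType) (A : calg R).

Definition res (L : lmodType (calg_ring A)) : Type := L.
Section Res.
Variable L : lmodType (calg_ring A).
HB.instance Definition _ := GRing.Zmodule.on (res L).
Let scale (a : R) (x : res L) : res L := calg_str A a *: (x : L).
Fact res_scaleA a b x : scale a (scale b x) = scale (a * b) x.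
Proof. by rewrite /scale scalerA rmorphM. Qed.
Fact res_scale1 : left_id 1 scale.
Proof. by move=> x; rewrite /scale rmorph1 scale1r. Qed.
Fact res_scaleDr : right_distributive scale +%R.
Proof. by move=> a x y; rewrite /scale scalerDr. Qed.
Fact res_scaleDl x : {morph scale^~ x : a b / a + b}.
Proof. by move=> a b; rewrite /scale rmorphD scalerDl. Qed.
HB.instance Definition _ := GRing.Zmodule_isLmodule.Build R (res L)
  res_scaleA res_scale1 res_scaleDr res_scaleDl.
Lemma resE (a : R) (x : res L) : a *: x = calg_str A a *: (x : L).
Proof. by []. Qed.
End Res.

Definition ext (L : lmodType (calg_ring A)) (S : calg R) : Type := tensor (res L) S.

Section Ext.
Variables (L : lmodType (calg_ring A)) (S : calg R).
HB.instance Definition _ := GRing.Zmodule.on (ext L S).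

Definition ext_scale (z : tensor A S) (x : ext L S) : ext L S :=
  tlift (fun (a : A) (s : S) =>
    tmap (fun l : res L => a *: (l : L) : res L) (fun t : S => s * t) x
      : tensor (res L) S) z.

Fact res_mul_linear (a : A) : linear (fun l : res L => a *: (l : L) : res L).
Proof. by move=> c x y; rewrite !resE scalerDr !scalerA mulrC. Qed.

Fact ext_scale_bilin (x : ext L S) : bilin (fun (a : A) (s : S) =>
  tmap (fun l : res L => a *: (l : L) : res L) (fun t : S => s * t) x
    : tensor (res L) S).
Proof.
have k (a : A) (s : S) : linear (tmap (fun l : res L => a *: (l : L) : res L) (fun t : S => s * t)).
  by apply: tmap_linear; [exact: res_mul_linear|exact: lmul_linear].
split=> [s c a a'|a c s s'] /=; move: x; apply: tlin_eq => //.
- by move=> d x y; rewrite !k !scalerDr !scalerA (mulrC c) addrACA.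
- move=> l t; rewrite !tmap_tens; try exact: lmul_linear; try exact: res_mul_linear.
  by rewrite scalerDl -scalerA (tens_bilin _ _).1.
- by move=> d x y; rewrite !k !scalerDr !scalerA (mulrC c) addrACA.
- move=> l t; rewrite !tmap_tens; try exact: lmul_linear; try exact: res_mul_linear.
  by rewrite mulrDl -cscalerAl (tens_bilin _ _).2.
Qed.

Lemma ext_scale_tens (a : A) (s : S) (l : res L) (t : S) :
  ext_scale (tens a s) (tens l t) = tens (a *: (l : L) : res L) (s * t).
Proof.
rewrite /ext_scale (tlift_tens (ext_scale_bilin _)) tmap_tens //.
  exact: res_mul_linear.
exact: lmul_linear.
Qed.

Fact ext_scale_linl x : linear ((fun z => ext_scale z x) : tensor A S -> tensor (res L) S).
Proof. exact/tliftP/ext_scale_bilin. Qed.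
Fact ext_scale_linr z : linear (ext_scale z : tensor (res L) S -> tensor (res L) S).
Proof.
move=> c x y; move: z; apply: tlin_eq.
- exact: ext_scale_linl.
- move=> d z z'; rewrite !ext_scale_linl !scalerDr !scalerA (mulrC c).
  by rewrite addrACA.
move=> a s; rewrite /ext_scale !tlift_tens; try exact: ext_scale_bilin.
by apply: tmap_linear; [exact: res_mul_linear|exact: lmul_linear].
Qed.
Fact ext_scaleA z w x : ext_scale z (ext_scale w x) = ext_scale (z * w) x.
Proof.
move: z; apply: tlin_eq => [||a s].
- exact: ext_scale_linl.
- by move=> c z z'; rewrite tensM_linl ext_scale_linl.
move: w; apply: tlin_eq => [||b t].
- by move=> c w w'; rewrite ext_scale_linl ext_scale_linr.
- by move=> c w w'; rewrite tensM_linr ext_scale_linl.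
move: x; apply: tlin_eq => [||l u].
- by move=> c x x'; rewrite !ext_scale_linr.
- exact: ext_scale_linr.
by rewrite tensM !ext_scale_tens scalerA mulrA.
Qed.
Fact ext_scale1 : left_id 1 ext_scale.
Proof.
move=> x; move: x; apply: tlin_eq => [|//|l t]; first exact: ext_scale_linr.
by rewrite -[1]/(tens (1 : A) (1 : S)) ext_scale_tens scale1r mul1r.
Qed.
Fact ext_scaleDr : right_distributive ext_scale +%R.
Proof. by move=> z x y; rewrite (linD (ext_scale_linr z)). Qed.
Fact ext_scaleDl x : {morph ext_scale^~ x : a b / a + b}.
Proof. by move=> a b; rewrite (linD (ext_scale_linl x)). Qed.
HB.instance Definition _ := GRing.Zmodule_isLmodule.Build (tensor A S) (ext L S)
  ext_scaleA ext_scale1 ext_scaleDr ext_scaleDl.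
End Ext.

Definition ext_map (L : lmodType (calg_ring A)) (S S' : calg R) (g : S -> S') :
  ext L S -> ext L S' := tmap (fun l : res L => l) g.
End ScalarExtension.

Section BaseChange.
Variables (R : comPzRingType) (A : calg R) (S S' : calg R) (g : S -> S').
Hypothesis hg : linear g /\ monoid_morphism g.
Implicit Types L : lmodType (calg_ring A).

Lemma extZ_tens L (T : calg R) (a : A) (s : T) (l : res L) (t : T) :
  (tens a s : tensor A T) *: (tens l t : ext L T) = tens (a *: (l : L) : res L) (s * t).
Proof. exact: ext_scale_tens. Qed.

Lemma extZ_linr L (T : calg R) (z : tensor A T) :
  linear ((fun x : ext L T => z *: x) : tensor (res L) T -> tensor (res L) T).
Proof. exact: ext_scale_linr. Qed.

Lemma extZ_linl L (T : calg R) (x : ext L T) :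
  linear ((fun z : tensor A T => z *: x) : tensor A T -> tensor (res L) T).
Proof. exact: ext_scale_linl. Qed.

Lemma ext_scale_str L (T : calg R) (c : R) (x : ext L T) :
  c *: (x : tensor (res L) T) = (c *: (1 : tensor A T)) *: x.
Proof. by rewrite (linZ (extZ_linl x)) scale1r. Qed.

Lemma ext_linear_res L L' (T : calg R) (f : ext L T -> ext L' T) :
  linear f -> linear (f : tensor (res L) T -> tensor (res L') T).
Proof. by move=> hf c x y; rewrite !ext_scale_str hf. Qed.

Lemma ext_map_linear L : linear (@ext_map R A L S S' g : tensor (res L) S -> tensor (res L) S').
Proof. by apply: tmap_linear => //; exact: hg.1. Qed.

Lemma ext_map_tens L (l : res L) (s : S) :
  ext_map g (tens l s : ext L S) = (tens l (g s) : ext L S').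
Proof. by apply: tmap_tens => //; exact: hg.1. Qed.

Lemma ext_map_scale L (a : A) (s : S) (x : ext L S) :
  ext_map g ((tens a s : tensor A S) *: x) = (tens a (g s) : tensor A S') *: ext_map g x.
Proof.
move: x; apply: tlin_eq => [||l t].
- exact: linear_comp (@ext_map_linear L) (@extZ_linr L S (tens a s)).
- exact: linear_comp (@extZ_linr L S' (tens a (g s))) (@ext_map_linear L).
by rewrite extZ_tens !ext_map_tens extZ_tens (hg.2.2 s t).
Qed.

Section Iso.
Variables (L1 L2 : lmodType (calg_ring A)) (f : ext L1 S -> ext L2 S).
Hypothesis hf : linear f.

Definition base_change : ext L1 S' -> ext L2 S' :=
  tlift (fun (l : res L1) (s' : S') =>
    (tens (1 : A) s' : tensor A S') *: ext_map g (f (tens l (1 : S)))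
      : tensor (res L2) S').

Fact base_change_bilin : bilin (fun (l : res L1) (s' : S') =>
    (tens (1 : A) s' : tensor A S') *: ext_map g (f (tens l (1 : S)))
      : tensor (res L2) S').
Proof.
split=> [s' c l l'|l c s s'] /=.
  rewrite (tens_bilin (res L1) S).1 (ext_linear_res hf) (@ext_map_linear L2).
  exact: extZ_linr.
by rewrite (tens_bilin A S').2 extZ_linl.
Qed.

Lemma base_change_res : linear (base_change : tensor (res L1) S' -> tensor (res L2) S').
Proof. exact/tliftP/base_change_bilin. Qed.

Lemma base_change_tens (l : res L1) (s' : S') : base_change (tens l s') =
  (tens (1 : A) s' : tensor A S') *: ext_map g (f (tens l (1 : S))).
Proof. exact: (tlift_tens base_change_bilin). Qed.

Fact base_change_linear : linear base_change.
Proof.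
have key (z : tensor A S') (x : ext L1 S') : base_change (z *: x) = z *: base_change x.
  move: z; apply: tlin_eq => [||a s].
  - exact: linear_comp base_change_res (extZ_linl x).
  - exact: (extZ_linl (base_change x)).
  move: x; apply: tlin_eq => [||l t].
  - exact: linear_comp base_change_res (@extZ_linr L1 S' (tens a s)).
  - exact: linear_comp (@extZ_linr L2 S' (tens a s)) base_change_res.
  rewrite extZ_tens !base_change_tens scalerA tensM mulr1.
  have -> : (tens (a *: (l : L1) : res L1) (1 : S) : ext L1 S) =
            (tens a (1 : S) : tensor A S) *: (tens l (1 : S) : ext L1 S).
    by rewrite extZ_tens mulr1.
  rewrite (linZ hf) ext_map_scale scalerA tensM mul1r hg.2.1 mulr1.
  by [].
by move=> z x y; rewrite (linD base_change_res) key.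
Qed.

Lemma base_change_ext_map (x : ext L1 S) : base_change (ext_map g x) = ext_map g (f x).
Proof.
move: x; apply: tlin_eq => [||l s].
- exact: linear_comp base_change_res (@ext_map_linear L1).
- exact: linear_comp (@ext_map_linear L2) (ext_linear_res hf).
have e : (tens l s : ext L1 S) = (tens (1 : A) s : tensor A S) *: (tens l (1 : S) : ext L1 S).
  by rewrite extZ_tens scale1r mulr1.
by rewrite ext_map_tens base_change_tens e (linZ hf) ext_map_scale.
Qed.
End Iso.

Lemma base_changeK L1 L2 (f : ext L1 S -> ext L2 S) (k : ext L2 S -> ext L1 S) :
  linear f -> linear k -> cancel f k -> cancel (base_change f) (base_change k).
Proof.
move=> hf hk fK; move=> x; move: x; apply: tlin_eq => [||l s].
- exact: linear_comp (base_change_res hk) (base_change_res hf).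
- by [].
rewrite base_change_tens // (linZ (base_change_linear hk)) base_change_ext_map //.
by rewrite fK ext_map_tens extZ_tens hg.2.1 scale1r mulr1.
Qed.

Lemma base_change_bij L1 L2 (f : ext L1 S -> ext L2 S) :
  linear f -> bijective f -> bijective (base_change f).
Proof.
move=> hf [k fK kK]; have hk : linear k.
  by move=> c x y; apply: (can_inj fK); rewrite hf !kK.
by exists (base_change k); apply: base_changeK.
Qed.
End BaseChange.

Section RelativeK0.
Variables (R : comPzRingType) (A : calg R) (S : calg R).

Record triple := Triple {
  tr_dom : lmodType (calg_ring A);
  tr_cod : lmodType (calg_ring A);
  tr_dom_fgproj : fgproj tr_dom;
  tr_cod_fgproj : fgproj tr_cod;
  tr_iso : ext tr_dom S -> ext tr_cod S;
  tr_iso_linear : linear tr_iso;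
  tr_iso_bij : bijective tr_iso
}.

Arguments tr_iso : clear implicits.

Definition short_exact (L' L L'' : lmodType (calg_ring A))
    (i : {linear L' -> L}) (p : {linear L -> L''}) : Prop :=
  [/\ injective i, (forall z, exists y, p y = z)
    & forall y, p y = 0 <-> exists x, y = i x].

Definition ext_fun (L L' : lmodType (calg_ring A)) (f : L -> L') :
  ext L S -> ext L' S := tmap (f : res L -> res L') (fun s : S => s).

(* Equality of formal sums of signed triples, [(true, t)] being t and [(false, t)] being
   -t, in K_0(A, S); the group law is concatenation. *)
Inductive k0_eq : seq (bool * triple) -> seq (bool * triple) -> Prop :=
| k0_refl s : k0_eq s s
| k0_sym s s' : k0_eq s s' -> k0_eq s' s
| k0_trans s s' s'' : k0_eq s s' -> k0_eq s' s'' -> k0_eq s s''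
| k0_cat s s' t t' : k0_eq s s' -> k0_eq t t' -> k0_eq (s ++ t) (s' ++ t')
| k0_comm s t : k0_eq (s ++ t) (t ++ s)
| k0_cancel t : k0_eq [:: (true, t); (false, t)] [::]
| k0_exact t' t t''
    (i1 : {linear tr_dom t' -> tr_dom t}) (p1 : {linear tr_dom t -> tr_dom t''})
    (i2 : {linear tr_cod t' -> tr_cod t}) (p2 : {linear tr_cod t -> tr_cod t''}) :
    short_exact i1 p1 -> short_exact i2 p2 ->
    (forall x, tr_iso t (ext_fun i1 x) = ext_fun i2 (tr_iso t' x)) ->
    (forall x, tr_iso t'' (ext_fun p1 x) = ext_fun p2 (tr_iso t x)) ->
    k0_eq [:: (true, t)] [:: (true, t'); (true, t'')]
| k0_comp L1 L2 L3 h1 h2 h3 f12 l12 b12 f23 l23 b23 l13 b13 :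
    k0_eq [:: (true, @Triple L1 L3 h1 h3 (f23 \o f12) l13 b13)]
          [:: (true, @Triple L1 L2 h1 h2 f12 l12 b12);
              (true, @Triple L2 L3 h2 h3 f23 l23 b23)].

(* The modules of the triples range over all of lmodType, so K_0 lives in too
   large a universe to be declared a zmodType. *)
Definition K0 : Type := {c : seq (bool * triple) -> Prop | exists s, c = k0_eq s}.
Definition k0_class (s : seq (bool * triple)) : K0 :=
  exist _ (k0_eq s) (ex_intro _ s erefl).
Definition k0_repr (x : K0) : seq (bool * triple) := projT1 (cid (svalP x)).
End RelativeK0.

Arguments tr_iso {R A S} t _.
Arguments tr_iso_linear {R A S} t _ _ _.

Section K0Extension.
Variables (R : comPzRingType) (A : calg R) (S S' : calg R) (g : S -> S').
Hypothesis hg : linear g /\ monoid_morphism g.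

Definition triple_ext (t : triple A S) : triple A S' :=
  Triple (tr_dom_fgproj t) (tr_cod_fgproj t)
    (base_change_linear hg (tr_iso_linear t))
    (base_change_bij hg (tr_iso_linear t) (tr_iso_bij t)).

Definition k0_ext (x : K0 A S) : K0 A S' :=
  k0_class [seq (p.1, triple_ext p.2) | p <- k0_repr x].
End K0Extension.

Section QuotientGroup.
Variables (V : zmodType) (N : V -> Prop).

Definition subgroup (S : V -> Prop) : Prop :=
  S 0 /\ forall x y, S x -> S y -> S (x - y).

(* The quotient of V by the subgroup generated by N. *)
Definition gen_subgroup (x : V) : Prop :=
  forall S, subgroup S -> (forall y, N y -> S y) -> S x.
Definition qg_rel (x y : V) : bool := `[< gen_subgroup (x - y) >].

Lemma gen_subgroupP : subgroup gen_subgroup.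
Proof.
split=> [S [S0 _] _ //|x y hx hy S hS hN].
by apply: hS.2; [exact: hx|exact: hy].
Qed.
Lemma gen_subgroupN x : gen_subgroup x -> gen_subgroup (- x).
Proof. by rewrite -sub0r; apply: gen_subgroupP.2; exact: gen_subgroupP.1. Qed.
Lemma gen_subgroupD x y : gen_subgroup x -> gen_subgroup y -> gen_subgroup (x + y).
Proof. by move=> hx /gen_subgroupN; rewrite -{2}[y]opprK; apply: gen_subgroupP.2. Qed.

Fact qg_rel_equiv : equiv_class_of qg_rel.
Proof.
split=> [x|x y|y x z].
- by apply/asboolP; rewrite subrr; exact: gen_subgroupP.1.
- by apply/asboolP/asboolP => /gen_subgroupN; rewrite opprB.
move=> /asboolP hx /asboolP hz; apply/asboolP.
by have := gen_subgroupD hx hz; rewrite addrA subrK.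
Qed.
Canonical qg_rel_equivRel := EquivRelPack qg_rel_equiv.

Definition quotg : Type := {eq_quot qg_rel}.
HB.instance Definition _ := Choice.on quotg.
HB.instance Definition _ := Quotient.on quotg.

Definition qproj (x : V) : quotg := \pi_quotg x.

Lemma qproj_eq x y : qproj x = qproj y <-> gen_subgroup (x - y).
Proof.
split=> [/eqmodP/asboolP //|h]; by apply/eqmodP/asboolP.
Qed.
Lemma gen_repr x : gen_subgroup (repr (qproj x) - x).
Proof. by apply/qproj_eq; rewrite /qproj reprK. Qed.

Definition qg_add (x y : quotg) : quotg := qproj (repr x + repr y).
Definition qg_opp (x : quotg) : quotg := qproj (- repr x).

Lemma qg_add_proj x y : qg_add (qproj x) (qproj y) = qproj (x + y).
Proof.
apply/qproj_eq; have := gen_subgroupD (gen_repr x) (gen_repr y).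
by rewrite addrACA -opprD.
Qed.
Lemma qg_opp_proj x : qg_opp (qproj x) = qproj (- x).
Proof. by apply/qproj_eq; have := gen_subgroupN (gen_repr x); rewrite opprD. Qed.
Lemma qprojP x : exists y, x = qproj y.
Proof. by exists (repr x); rewrite /qproj reprK. Qed.

Fact qg_addA : associative qg_add.
Proof.
move=> x y z; have [[a ->] [b ->] [c ->]] := And3 (qprojP x) (qprojP y) (qprojP z).
by rewrite !qg_add_proj addrA.
Qed.
Fact qg_addC : commutative qg_add.
Proof. by move=> x y; rewrite /qg_add addrC. Qed.
Fact qg_add0 : left_id (qproj 0) qg_add.
Proof. by move=> x; have [a ->] := qprojP x; rewrite qg_add_proj add0r. Qed.
Fact qg_addN : left_inverse (qproj 0) qg_opp qg_add.
Proof.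
by move=> x; have [a ->] := qprojP x; rewrite qg_opp_proj qg_add_proj addNr.
Qed.
HB.instance Definition _ :=
  GRing.isZmodule.Build quotg qg_addA qg_addC qg_add0 qg_addN.
End QuotientGroup.

Section QuotientRing.
Variables (B : comPzRingType) (I : B -> Prop).

Definition ideal (J : B -> Prop) : Prop :=
  [/\ J 0, (forall x y, J x -> J y -> J (x - y)) & (forall a x, J x -> J (a * x))].

(* The quotient of B by the ideal generated by I. *)
Definition gen_ideal (x : B) : Prop :=
  forall J, ideal J -> (forall y, I y -> J y) -> J x.

Lemma gen_idealP : ideal gen_ideal.
Proof.
split=> [J [] //|x y hx hy J hJ hI|a x hx J hJ hI]; have [_ h h'] := hJ.
  by apply: h; [exact: hx|exact: hy].
by apply: h'; exact: hx.
Qed.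
Definition quotr : Type := quotg gen_ideal.
HB.instance Definition _ := GRing.Zmodule.on quotr.
Definition rproj (x : B) : quotr := qproj gen_ideal x.

Lemma rproj_eq x y : rproj x = rproj y <-> gen_ideal (x - y).
Proof.
split=> [/qproj_eq h|h]; first by apply: h => //; have [] := gen_idealP.
by apply/qproj_eq => S _; apply.
Qed.
Definition qr_mul (x y : quotr) : quotr := rproj (repr x * repr y).
Lemma rprojP x : exists y, x = rproj y.
Proof. exact: qprojP. Qed.
Lemma rprojD x y : rproj x + rproj y = rproj (x + y).
Proof. exact: qg_add_proj. Qed.
Lemma qr_mul_proj x y : qr_mul (rproj x) (rproj y) = rproj (x * y).
Proof.
have [_ hB hM] := gen_idealP.
have e z : gen_ideal (repr (rproj z) - z).
  by apply/rproj_eq; rewrite /rproj /qproj reprK.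
apply/rproj_eq.
have := hB _ _ (hM (repr (rproj x)) _ (e y)) (hM (- y) _ (e x)).
rewrite mulNr opprK !mulrBr [y * x]mulrC [y * _]mulrC.
by rewrite addrA subrK.
Qed.
Fact qr_mulA : associative qr_mul.
Proof.
move=> x y z; have [[a ->] [b ->] [c ->]] := And3 (rprojP x) (rprojP y) (rprojP z).
by rewrite !qr_mul_proj mulrA.
Qed.
Fact qr_mulC : commutative qr_mul.
Proof. by move=> x y; rewrite /qr_mul mulrC. Qed.
Fact qr_mul1 : left_id (rproj 1) qr_mul.
Proof. by move=> x; have [a ->] := rprojP x; rewrite qr_mul_proj mul1r. Qed.
Fact qr_mulDl : left_distributive qr_mul +%R.
Proof.
move=> x y z; have [[a ->] [b ->] [c ->]] := And3 (rprojP x) (rprojP y) (rprojP z).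
by rewrite rprojD !qr_mul_proj rprojD mulrDl.
Qed.
HB.instance Definition _ :=
  GRing.Zmodule_isComPzRing.Build quotr qr_mulA qr_mulC qr_mul1 qr_mulDl.
Lemma rprojM x y : rproj (x * y) = rproj x * rproj y.
Proof. by rewrite -qr_mul_proj. Qed.
Lemma rprojB x y : rproj (x - y) = rproj x - rproj y.
Proof. by apply: (@addIr _ (rproj y)); rewrite subrK rprojD subrK. Qed.
End QuotientRing.

Section Units.
Variable B : comPzRingType.

(* The group of units of B, written additively: a unit together with its
   inverse. *)
Record units : Type := Units { upair :> B * B; upairP : upair.1 * upair.2 == 1 }.
HB.instance Definition _ := [isSub for upair].
HB.instance Definition _ := [Choice of units by <:].

Definition uval (u : units) : B := (upair u).1.

Fact umul_proof (u v : units) : (u.1 * v.1) * (u.2 * v.2) == 1 :> B.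
Proof. by rewrite mulrACA !(eqP (upairP _)) mul1r. Qed.
Definition umul (u v : units) : units := Units (upair := (u.1 * v.1, u.2 * v.2)) (umul_proof u v).
Fact uone_proof : (1 : B, 1 : B).1 * (1 : B, 1 : B).2 == 1.
Proof. by rewrite mul1r. Qed.
Definition uone : units := Units uone_proof.
Fact uinv_proof (u : units) : u.2 * u.1 == 1 :> B.
Proof. by rewrite mulrC upairP. Qed.
Definition uinv (u : units) : units := Units (upair := (u.2, u.1)) (uinv_proof u).
Fact umulA : associative umul.
Proof. by move=> u v w; apply: val_inj; rewrite /= !mulrA. Qed.
Fact umulC : commutative umul.
Proof. by move=> u v; apply: val_inj; rewrite /= mulrC (mulrC u.2). Qed.
Fact umul1 : left_id uone umul.
Proof. by move=> u; apply: val_inj; rewrite /= !mul1r; case: (upair u). Qed.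
Fact umulV : left_inverse uone uinv umul.
Proof.
move=> u; apply: val_inj => /=.
by rewrite (eqP (upairP u)) mulrC (eqP (upairP u)).
Qed.
HB.instance Definition _ := GRing.isZmodule.Build units umulA umulC umul1 umulV.
End Units.

Section Completion.
Variables (R : comPzRingType) (p : R -> Prop).

Definition ideal_pow (n : nat) : R -> Prop :=
  gen_ideal (fun y => exists s : 'I_n -> R, (forall i, p (s i)) /\ y = \prod_i s i).

Definition coherent : {pred nat -> R} :=
  fun x => `[< forall n, ideal_pow n (x n.+1 - x n) >].

Fact coherent_subring : GRing.subring_closed coherent.
Proof.
split.
- by apply/asboolP => n; rewrite subrr; case: (gen_idealP (fun y =>
    exists s : 'I_n -> R, (forall i, p (s i)) /\ y = \prod_i s i)).
- move=> x y /asboolP hx /asboolP hy; apply/asboolP => n.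
  have [_ hB _] := gen_idealP (fun y =>
    exists s : 'I_n -> R, (forall i, p (s i)) /\ y = \prod_i s i).
  rewrite -[X in ideal_pow n X]/(x n.+1 - y n.+1 - (x n - y n)).
  by rewrite opprD addrACA -opprD; apply: hB; [exact: hx|exact: hy].
move=> x y /asboolP hx /asboolP hy; apply/asboolP => n.
have [_ hB hM] := gen_idealP (fun y =>
  exists s : 'I_n -> R, (forall i, p (s i)) /\ y = \prod_i s i).
rewrite -[X in ideal_pow n X]/(x n.+1 * y n.+1 - (x n * y n)).
have := hB _ _ (hM (x n.+1) _ (hy n)) (hM (- y n) _ (hx n)).
rewrite mulNr opprK !mulrBr [y n * x n.+1]mulrC [y n * x n]mulrC.
by rewrite addrA subrK.
Qed.
HB.instance Definition _ :=
  GRing.isSubringClosed.Build (nat -> R) coherent coherent_subring.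

Record cohseq : Type := Cohseq { cohseq_val :> nat -> R; cohseqP : cohseq_val \in coherent }.
HB.instance Definition _ := [isSub for cohseq_val].
HB.instance Definition _ := [Choice of cohseq by <:].
HB.instance Definition _ := 
  GRing.SubChoice_isSubComPzRing.Build (nat -> R) coherent cohseq coherent_subring.

(* The p-adic completion lim R / p^n. *)
Definition completion : Type :=
  quotr (fun x : cohseq => forall n, ideal_pow n (x n)).
HB.instance Definition _ := GRing.ComPzRing.on completion.

Fact cst_coherent (a : R) : (fun _ : nat => a) \in coherent.
Proof.
apply/asboolP => n; rewrite subrr; case: (gen_idealP (fun y =>
  exists s : 'I_n -> R, (forall i, p (s i)) /\ y = \prod_i s i)) => //.
Qed.
Definition to_completion (a : R) : completion :=
  rproj (fun x : cohseq => forall n, ideal_pow n (x n)) (Cohseq (cst_coherent a)).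
Fact to_completion_zmod : zmod_morphism to_completion.
Proof.
move=> a b; rewrite /to_completion -rprojB; congr rproj.
exact: val_inj.
Qed.
Fact to_completion_monoid : monoid_morphism to_completion.
Proof.
split=> [|a b]; first by congr rproj; exact: val_inj.
by rewrite /to_completion -rprojM; congr rproj; exact: val_inj.
Qed.
HB.instance Definition _ :=
  GRing.isZmodMorphism.Build R completion to_completion to_completion_zmod.
HB.instance Definition _ :=
  GRing.isMonoidMorphism.Build R completion to_completion to_completion_monoid.
Definition completion_alg : calg R := CAlg to_completion.
End Completion.

Section IntegralClosure.
Variables (R K : comNzRingType) (f : {rmorphism R -> K}).
Definition integral_pred : {pred K} := fun x => `[< integralOver f x >].
Fact integral_subring : GRing.subring_closed integral_pred.
Proof.
split=> [|x y|x y]; first exact/asboolP/integral1.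
  by move=> /asboolP hx /asboolP hy; apply/asboolP/integral_sub.
by move=> /asboolP hx /asboolP hy; apply/asboolP/integral_mul.
Qed.
HB.instance Definition _ :=
  GRing.isSubringClosed.Build K integral_pred integral_subring.

Record int_closure : Type :=
  IntClosure { int_val : K; int_valP : int_val \in integral_pred }.
HB.instance Definition _ := [isSub for int_val].
HB.instance Definition _ := [Choice of int_closure by <:].
HB.instance Definition _ := [SubChoice_isSubComNzRing of int_closure by <:].

HB.instance Definition _ := GRing.RMorphism.copy int_val (val : int_closure -> K).

Definition to_int_closure (a : R) : int_closure :=
  IntClosure (asboolT (integral_id f a) : f a \in integral_pred).
Fact to_int_closure_zmod : zmod_morphism to_int_closure.
Proof. by move=> a b; apply: val_inj; rewrite /= rmorphB. Qed.
Fact to_int_closure_monoid : monoid_morphism to_int_closure.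
Proof. by split=> [|a b]; apply: val_inj; rewrite /= ?rmorph1 ?rmorphM. Qed.
HB.instance Definition _ :=
  GRing.isZmodMorphism.Build R int_closure to_int_closure to_int_closure_zmod.
HB.instance Definition _ :=
  GRing.isMonoidMorphism.Build R int_closure to_int_closure to_int_closure_monoid.
End IntegralClosure.
Arguments int_val {R K f} _.

Section Torsors.
Variables (R : comPzRingType) (G : group_scheme R).
Local Notation O := (gs_alg G).
Local Notation D := (@gs_mul R G).

(* Affine R-schemes X = Spec C with a right action of G. *)
Record gspace := GSpace {
  gsp_alg : calg R;
  gsp_act : gsp_alg -> tensor gsp_alg O;
  gsp_act_hom : linear gsp_act /\ monoid_morphism gsp_act;
  gsp_actA : forall c,
    tassoc (tmap gsp_act id (gsp_act c)) = tmap id D (gsp_act c);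
  gsp_act1 : forall c, tlift (fun c h => gs_unit h *: c) (gsp_act c) = c
}.

(* A torsor is affine because G is finite. The last field says that
   X x G -> X x X, (x, g) |-> (x, xg) is an isomorphism. *)
Record torsor := Torsor {
  tors_space :> gspace;
  tors_fflat : faithfully_flat (gsp_alg tors_space);
  tors_free : bijective (tlift (fun a b : gsp_alg tors_space =>
    (tens a (1 : O) : tensor (gsp_alg tors_space) O) * gsp_act b))
}.

Definition trivial_space : gspace.
Proof.
refine (@GSpace O D (gs_mul_hom G) (@gs_mulA _ G) _).
move=> h; rewrite -{1}gs_mulC -{2}(gs_mul1 h).
have hb : bilin (fun a b : O => gs_unit a *: b).
  split=> [b c x y|a c x y] /=; last by rewrite scalerDr !scalerA mulrC.
  by rewrite (gs_unit_hom G).1 scalerDl scalerA.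
have hb' : bilin (fun a b : O => gs_unit b *: a).
  by split=> [b|a]; [exact: hb.2|exact: hb.1].
move: (D h); apply: tlin_eq.
- exact: linear_comp (tliftP hb') (tliftP (tswap_bilin _ _)).
- exact: tliftP.
by move=> m n; rewrite /tswap tlift_tens ?tlift_tens //; exact: tswap_bilin.
Defined.

Definition gspace_iso (X Y : gspace) : Prop :=
  exists f : gsp_alg X -> gsp_alg Y,
    [/\ linear f, monoid_morphism f, bijective f
      & forall c, gsp_act (f c) = tmap f id (gsp_act c)].

(* Z is the quotient of X x Y by the action (x, y) |-> (x g, y g^-1) of G:
   its algebra is the equalizer of the functions f(xg, y) and f(x, yg), and
   G acts on it through Y. *)
Definition contracted_product (X Y Z : torsor) : Prop :=
  exists f : gsp_alg Z -> tensor (gsp_alg X) (gsp_alg Y),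
    [/\ linear f /\ monoid_morphism f, injective f,
        forall z, (exists c, z = f c) <->
          tassoc (tmap (@gsp_act X) id z) =
          tmap id (fun b => tswap (@gsp_act Y b)) z
      & forall c, tassoc (tmap f id (gsp_act c)) = tmap id (@gsp_act Y) (f c)].

Definition torsor_iso (X Y : torsor) : Prop := gspace_iso X Y.

(* H^1(Spec R, G), as the set of isomorphism classes of torsors; its group law
   is the contracted product. *)
Definition H1 : Type := {x : torsor -> Prop | exists X : torsor, x = torsor_iso X}.
Definition h1_class (X : torsor) : H1 :=
  exist _ (torsor_iso X) (ex_intro _ X erefl).

Section SpaceModule.
Variable X : gspace.
Local Notation C := (gsp_alg X).

Definition space_mod : Type := C.
HB.instance Definition _ := GRing.Zmodule.on space_mod.
Definition space_scale (a : cdual_ring G) (c : space_mod) : space_mod :=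
  tlift (fun (c : C) (h : O) => (a h : R) *: c) (gsp_act (c : C)).

Fact space_bilin (a : dual O) : bilin (fun (c : C) (h : O) => (a h : R) *: c).
Proof.
split=> [h r x y|c r x y] /=; first by rewrite scalerDr !scalerA mulrC.
by rewrite dual_lin scalerDl scalerA.
Qed.
Fact space_scale_linear (a : cdual_ring G) : linear (space_scale a : C -> C).
Proof. exact: linear_comp (tliftP (space_bilin a)) (gsp_act_hom X).1. Qed.
Fact space_scaleA a b c : space_scale a (space_scale b c) = space_scale (a * b) c.
Proof.
pose k (c : C) (y : tensor O O) : C :=
  (tlift (fun u v => a u * b v : R^o) y : R) *: c.
have hab : linear (tlift (fun u v => a u * b v : R^o)) by apply/tliftP/conv_bilin.
have hk : bilin k.
  split=> [y r x z|x r y z] /=; rewrite /k; first by rewrite scalerDr !scalerA mulrC.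
  by rewrite hab scalerDl scalerA.
transitivity (tlift k (tmap id D (gsp_act (c : C)))); last first.
  by rewrite (tlift_tmap _ hk (@id_linear _ _) (gs_mul_hom G).1).
pose k' (y : tensor C O) (h : O) : C :=
  (b h : R) *: tlift (fun (c : C) (h : O) => (a h : R) *: c) y.
have hk' : bilin k'.
  split=> [y r x z|x r y z] /=; rewrite /k'.
    by rewrite (tliftP (space_bilin a)) scalerDr !scalerA mulrC.
  by rewrite dual_lin scalerDl scalerA.
rewrite -gsp_actA; transitivity (tlift k' (tmap (@gsp_act X) id (gsp_act (c : C)))).
  rewrite (tlift_tmap _ hk' (gsp_act_hom X).1 (@id_linear _ _)).
  rewrite /space_scale; move: (gsp_act (c : C)); apply: tlin_eq.
  - exact: linear_comp (space_scale_linear a) (tliftP (space_bilin b)).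
  - by apply/tliftP; apply: bilin_comp hk' (gsp_act_hom X).1 (@id_linear _ _).
  move=> m n; rewrite (tlift_tens (space_bilin b)).
  rewrite (tlift_tens (bilin_comp hk' (gsp_act_hom X).1 (@id_linear _ _))).
  exact: (linZ (space_scale_linear a)).
move: (tmap _ id (gsp_act (c : C))); apply: tens3_eq.
- exact: tliftP.
- exact: linear_comp (tliftP hk) (@tassoc_linear _ _ _ _).
move=> m n p; rewrite tassoc_tens !tlift_tens // /k /k'.
rewrite (tlift_tens (space_bilin a)) tlift_tens; last exact: conv_bilin.
by rewrite scalerA mulrC.
Qed.
Fact space_scale1 : left_id 1 space_scale.
Proof. by move=> c; exact: gsp_act1. Qed.
Fact space_scaleDr : right_distributive space_scale +%R.
Proof. by move=> a x y; rewrite (linD (space_scale_linear a)). Qed.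
Fact space_scaleDl c : {morph space_scale^~ c : a b / a + b}.
Proof.
move=> a b; rewrite /space_scale /tlift /tsum -big_split.
by apply: eq_bigr => p _; exact: scalerDl.
Qed.
HB.instance Definition _ := GRing.Zmodule_isLmodule.Build (cdual_ring G) space_mod
  space_scaleA space_scale1 space_scaleDr space_scaleDl.
End SpaceModule.

(* M_pi (x) M_{pi_0}^{-1} *)
Definition torsor_line (X : torsor) : lmodType (cdual_ring G) :=
  tensor (space_mod X) (dual (space_mod trivial_space)).

Definition dual_regular : lmodType (cdual_ring G) := (cdual_ring G)^o.

Lemma fgproj_regular : fgproj dual_regular.
Proof.
pose i (x : dual_regular) : 'rV[cdual_ring G]_1 := \row_(k < 1) (x : cdual_ring G).
pose p (v : 'rV[cdual_ring G]_1) : dual_regular := v 0 0.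
have hi : linear i by move=> a x y; apply/rowP => k; rewrite !mxE.
have hp : linear p by move=> a x y; rewrite /p !mxE.
pose i' := GRing.isLinear.Build _ _ _ _ i hi.
pose p' := GRing.isLinear.Build _ _ _ _ p hp.
pose iL : {linear dual_regular -> 'rV[cdual_ring G]_1} := HB.pack i i'.
pose pL : {linear 'rV[cdual_ring G]_1 -> dual_regular} := HB.pack p p'.
by exists 1%N, iL, pL => x; rewrite /= /p /i mxE.
Qed.

Section Trivialization.
Variables (X : torsor) (S : calg R).
Local Notation C := (gsp_alg X).

(* The coaction X_S x G -> X_S of a base change X_S = Spec (C (x) S). *)
Definition act_ext (Y : gspace) : tensor (gsp_alg Y) S -> tensor (tensor (gsp_alg Y) S) O :=
  tlift (fun c s => tmap (fun d => tens d s) id (gsp_act c)).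

Definition equivariant_iso (phi : tensor C S -> tensor O S) : Prop :=
  [/\ linear phi /\ monoid_morphism phi,
      forall s, phi (tens (1 : C) s) = tens (1 : O) s,
      bijective phi
    & forall z, act_ext (Y := trivial_space) (phi z) = tmap phi id (act_ext z)].

(* xi : L_pi (x) S -> A (x) S is induced by phi, through
   (M_pi (x) M_{pi_0}^-1) (x) S -> (M_{pi_0} (x) M_{pi_0}^-1) (x) S -> A (x) S. *)
Definition induced_by (phi : tensor C S -> tensor O S)
    (xi : ext (A := cdual G) (torsor_line X) S -> ext (A := cdual G) dual_regular S) : Prop :=
  forall (m : space_mod X) (f : dual (space_mod trivial_space)) (s : S),
    xi (tens (tens m f : res (A := cdual G) (torsor_line X)) s) =
    tmap (f : O -> res (A := cdual G) dual_regular) (fun t : S => t)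
      (phi (tens (m : C) s)).

Definition torsor_triv
    (xi : ext (A := cdual G) (torsor_line X) S -> ext (A := cdual G) dual_regular S) : Prop :=
  [/\ linear xi, bijective xi & exists2 phi, equivariant_iso phi & induced_by phi xi].
End Trivialization.
End Torsors.

Section Places.
Variable R : comPzRingType.

Record place := Place {
  place_ideal :> R -> Prop;
  place_idealP : ideal place_ideal;
  place_proper : ~ place_ideal 1;
  place_prime : forall a b, place_ideal (a * b) -> place_ideal a \/ place_ideal b;
  place_nonzero : exists2 a, place_ideal a & a <> 0
}.
End Places.

(* R is meant to be the ring of integers of the number field K, and C an
   algebraic closure of K, with inclusion j. *)
Section IdelicGroups.
Variables (R : comPzRingType) (A K C : calg R) (j : K -> C).
Local Notation AK := (tensor A K).
Local Notation AC := (tensor A C).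
Local Notation Rv v := (completion_alg (@place_ideal R v)).

(* For a finite place v, the completion of K at v is K (x)_R R_v. *)
Definition Kv (v : place R) : calg R := talg K (Rv v).
Definition K_to_Kv (v : place R) (x : K) : Kv v := tens x (1 : Rv v).
Definition Rv_to_Kv (v : place R) (x : Rv v) : Kv v := tens (1 : K) x.
Local Notation Av v := (tensor A (Kv v)).

Definition AK_to_Av (v : place R) : AK -> Av v := tmap id (@K_to_Kv v).

Definition is_order (T : AK -> Prop) : Prop :=
  [/\ T 1, (forall x y, T x -> T y -> T (x - y)), (forall x y, T x -> T y -> T (x * y)),
      (exists n (e : 'I_n -> AK),
         forall x, T x <-> exists c : 'I_n -> R, x = \sum_(i < n) c i *: e i)
    & forall x, exists2 r : R, r <> 0 & T (r *: x)].

(* A_K being commutative and separable, its maximal order contains all the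
   others. *)
Definition max_order (x : AK) : Prop := exists2 T, is_order T & T x.

(* The completion at v of the maximal order: the subring of A_v generated by
   the maximal order and R_v. *)
Definition max_order_at (v : place R) (z : Av v) : Prop :=
  forall T : Av v -> Prop, T 1 -> (forall x y, T x -> T y -> T (x - y)) ->
    (forall x y, T x -> T y -> T (x * y)) ->
    (forall x, max_order x -> T (AK_to_Av v x)) ->
    (forall r : Rv v, T (tens (1 : A) (Rv_to_Kv r))) -> T z.

Lemma max_order_atM (v : place R) (x y : Av v) :
  max_order_at x -> max_order_at y -> max_order_at (x * y).
Proof.
move=> hx hy T T1 TB TM Tm Tr; apply: (TM); first exact: hx.
exact: hy.
Qed.

Definition max_order_unit (v : place R) (u : units (Av v)) : Prop :=
  max_order_at (uval u) /\ max_order_at (uval (- u)).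

Lemma max_order_unit0 v : @max_order_unit v 0.
Proof. by split=> T. Qed.
Lemma max_order_unitN v (u : units (Av v)) : max_order_unit u -> max_order_unit (- u).
Proof. by case=> h h'; split=> //; rewrite opprK. Qed.
Lemma max_order_unitD v (u w : units (Av v)) :
  max_order_unit u -> max_order_unit w -> max_order_unit (u + w).
Proof.
by move=> [h h'] [k k']; split; [exact: max_order_atM h k|rewrite opprD; exact: max_order_atM h' k'].
Qed.

(* J_f(A), written additively. *)
Record ideles : Type := Ideles {
  idele_val :> forall v : place R, units (Av v);
  idelesP : finite_set [set v | ~ max_order_unit (idele_val v)]
}.
HB.instance Definition _ := gen_eqMixin ideles.
HB.instance Definition _ := gen_choiceMixin ideles.

Lemma ideles_eq (x y : ideles) : (forall v, x v = y v) -> x = y.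
Proof.
case: x y => [x hx] [y hy] /= h.
have e : x = y by exact: functional_extensionality_dep.
by move: hx hy; rewrite e => hx hy; congr Ideles; exact: Prop_irrelevance.
Qed.

Fact ideles0P : finite_set [set v : place R | ~ max_order_unit (0 : units (Av v))].
Proof.
rewrite (_ : mkset _ = set0); first exact: finite_set0.
by rewrite -subset0 => v; case; exact: max_order_unit0.
Qed.
Fact idelesNP (x : ideles) : finite_set [set v | ~ max_order_unit (- x v)].
Proof.
by apply: sub_finite_set (idelesP x) => v /= h k; apply: h; exact: max_order_unitN.
Qed.
Fact idelesDP (x y : ideles) : finite_set [set v | ~ max_order_unit (x v + y v)].
Proof.
have h : finite_set ([set v | ~ max_order_unit (x v)] `|`
    [set v | ~ max_order_unit (y v)])%classic.
  by rewrite finite_setU; split; exact: idelesP.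
apply: sub_finite_set h => v /= h.
have [hx|hx] := pselect (max_order_unit (x v)); last by left.
by right=> hy; apply: h; exact: max_order_unitD.
Qed.
Fact idelesA : associative (fun x y => Ideles (idelesDP x y)).
Proof. by move=> x y z; apply: ideles_eq => v; exact: addrA. Qed.
Fact idelesC : commutative (fun x y => Ideles (idelesDP x y)).
Proof. by move=> x y; apply: ideles_eq => v; exact: addrC. Qed.
Fact ideles0 : left_id (Ideles ideles0P) (fun x y => Ideles (idelesDP x y)).
Proof. by move=> x; apply: ideles_eq => v; exact: add0r. Qed.
Fact idelesN : left_inverse (Ideles ideles0P) (fun x => Ideles (idelesNP x))
  (fun x y => Ideles (idelesDP x y)).
Proof. by move=> x; apply: ideles_eq => v; exact: addNr. Qed.
HB.instance Definition _ :=
  GRing.isZmodule.Build ideles idelesA idelesC ideles0 idelesN.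

(* U_f(A) *)
Definition unit_ideles (x : ideles) : Prop := forall v : place R,
  exists u : units (tensor A (Rv v)), uval (x v) = tmap id (@Rv_to_Kv v) (uval u).

(* The image of A_K^* under Delta'. *)
Definition principal (x : quotg unit_ideles * units AC) : Prop :=
  exists (a : units AK) (i : ideles),
    [/\ forall v, uval (i v) = AK_to_Av v (uval a), x.1 = qproj unit_ideles i
      & uval x.2 = tmap id j (uval (- a))].

Definition cok : Type := quotg principal.
HB.instance Definition _ := GRing.Zmodule.on cok.
HB.instance Definition _ := Quotient.on cok.

Section Natural.
Variable t : triple A C.

(* The value at a triple [L_1, L_2; lambda], L_1 and L_2 of constant rank n, of
   the natural isomorphism K_0(A, C) -> Cok(Delta'). For i = 1, 2, let b_i be
   a basis of L_i (x) K, let e_i v be a basis of L_i (x) R_v, and let M_i v be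
   the matrix of e_i v with respect to b_i; let mu be the matrix of lambda. *)
Definition idelic_class (c : cok) : Prop :=
  exists (n : nat)
    (b1 : 'I_n -> ext (tr_dom t) K) (b2 : 'I_n -> ext (tr_cod t) K)
    (e1 : forall v, 'I_n -> ext (tr_dom t) (Rv v))
    (e2 : forall v, 'I_n -> ext (tr_cod t) (Rv v))
    (M1 M2 : forall v, 'M[Av v]_n) (mu : 'M[AC]_n)
    (i : ideles) (u : units AC),
  [/\ is_basis b1 /\ is_basis b2,
      forall v, is_basis (e1 v) /\ is_basis (e2 v),
      forall v k,
        ext_map (@Rv_to_Kv v) (e1 v k) =
          \sum_(l < n) M1 v k l *: ext_map (@K_to_Kv v) (b1 l) /\
        ext_map (@Rv_to_Kv v) (e2 v k) =
          \sum_(l < n) M2 v k l *: ext_map (@K_to_Kv v) (b2 l),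
      forall k, tr_iso t (ext_map j (b1 k)) =
        \sum_(l < n) mu k l *: ext_map j (b2 l)
    & [/\ forall v, uval (i v) * \det (M2 v) = \det (M1 v), uval u = \det mu
        & c = qproj principal (qproj unit_ideles i, u)]].
End Natural.

(* The natural isomorphism K_0(A, C) -> Cok(Delta'): every element of K_0(A, C)
   is the class of one triple of modules of constant rank, and its value does
   not depend on the triple. *)
Definition k0_to_cok (x : K0 A C) : cok :=
  xget 0 [set c | exists2 t, x = k0_class [:: (true, t)] & idelic_class t c].

Variable Gamma : units AC -> Prop.

Definition principal_bar (x : quotg unit_ideles * quotg Gamma) : Prop :=
  exists2 y, principal y & x = (y.1, qproj Gamma y.2).

Definition k0bar : Type := quotg principal_bar.
HB.instance Definition _ := GRing.Zmodule.on k0bar.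
Definition cok_to_k0bar (c : cok) : k0bar :=
  qproj principal_bar ((repr c).1, qproj Gamma (repr c).2).
Definition k0_to_k0bar (x : K0 A C) : k0bar := cok_to_k0bar (k0_to_cok x).
End IdelicGroups.

Section GeometricPoints.
Variables (R : comPzRingType) (G : group_scheme R) (C : calg R).

(* G(C) as a subgroup of (O(G^* ) (x) C)^* = Hom_R(O(G), C)^*. *)
Definition points (u : units (tensor (cdual G) C)) : Prop :=
  exists g : gs_alg G -> C, (linear g /\ monoid_morphism g) /\
    forall h, g h =
      tlift (fun (f : cdual G) (s : C) => ((f : dual (gs_alg G)) h : R) *: s) (uval u).
End GeometricPoints.

Section NumberField.
Variables (F : fieldExtType rat) (Fc : closedFieldType) (iota : {rmorphism F -> Fc}).

Definition ring_of_integers : comNzRingType := int_closure (@intmul F 1).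
Local Notation R := ring_of_integers.

Definition RF : {rmorphism R -> F} := @int_val _ _ (@intmul F 1).
Definition RFc : {rmorphism R -> Fc} := iota \o RF.
Definition Rc : comNzRingType := int_closure RFc.

Definition F_alg : calg R := CAlg RF.
Definition Fc_alg : calg R := CAlg RFc.
Definition Rc_alg : calg R := CAlg (to_int_closure RFc).

Definition F_to_Fc (x : F_alg) : Fc_alg := iota x.
Definition Rc_to_Fc (x : Rc_alg) : Fc_alg := int_val (x : Rc).
Fact Rc_to_Fc_hom : linear Rc_to_Fc /\ monoid_morphism Rc_to_Fc.
Proof. by []. Qed.

Variable G : group_scheme R.
Local Notation A := (cdual G).

Definition K0bar : zmodType := k0bar F_to_Fc (@points R G Fc_alg).
Definition K0_to_K0bar (x : K0 A Rc_alg) : K0bar :=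
  k0_to_k0bar F_to_Fc (@points R G Fc_alg) (k0_ext Rc_to_Fc_hom x).

(* K0bar(A, R^c), as a subset of K0bar(A, F^c). *)
Definition K0bar_Rc (k : K0bar) : Prop := exists x, k = K0_to_K0bar x.

Section PsiBar.
Variable X : torsor G.
Variable xi : ext (A := A) (torsor_line X) Rc_alg -> ext (A := A) (dual_regular G) Rc_alg.

Definition line_class (hL : fgproj (torsor_line X)) (lin : linear xi)
    (bij : bijective xi) : K0 A Rc_alg :=
  k0_class [:: (true, Triple (A := A) hL (fgproj_regular G) lin bij)].
End PsiBar.

(* A trivialization xi_pi exists, and psi (pi) is the class of [L_pi, A; xi_pi]
   for all of them. *)
Definition is_psibar (psi : H1 G -> K0bar) : Prop :=
  forall X : torsor G, (exists xi, @torsor_triv R G X Rc_alg xi) /\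
    (forall xi, @torsor_triv R G X Rc_alg xi ->
      exists hL lin bij,
        psi (h1_class X) = K0_to_K0bar (@line_class X xi hL lin bij)).
End NumberField.

(* Main.v *)
Require Import Defs.
From HB Require Import structures.
From mathcomp Require Import all_boot all_order all_algebra all_field.
From mathcomp Require Import boolp classical_sets functions cardinality.
From mathcomp Require Import ring.
Set Implicit Arguments.
Unset Strict Implicit.
Unset Printing Implicit Defensive.
Import GRing.Theory.
Local Open Scope ring_scope.

(* Write C for the algebra of a torsor X and A for the algebra of G^*. Since C is
   a Galois object, A and C together span End_R(C); comparing ranks modulo the
   maximal ideals of A and applying Nakayama's lemma shows that C is locally free
   of rank one over A. An isomorphism X = G over a ring S is the same as a point
   chi : C -> S, and the trivialization of L_X = C (x) C_0^-1 that it induces sends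
   m (x) f to val chi m f = sum f(m_1) (x) chi(m_0). So if m generates C over F and
   f generates C_0^-1 over F, with e_v = alpha_v m and e'_v = alpha'_v f local
   generators, then psi(X) is the class of ((alpha_v alpha'_v)_v, val chi m f).
   That this class depends on nothing else but the class in K_0(A, R^c) follows
   from invariance of determinants of isomorphisms between projective modules,
   presented as images of idempotent matrices.

   Additivity: in the algebra of the contracted product of X and Y, a subring of
   C_X (x) C_Y, the element sum m_0 (x) f(m_1) m' has value
   (val m f) (val m' f), and it is a local generator when m, m' and f are.

   Injectivity: equality of the values of X and Y in the idelic quotient means that,
   after translating the point of Y by a point of G over F^c, the embeddings of C_X
   and C_Y in O(G) (x) F^c defined by the two points have the same image locally at
   every place, hence the same image; this gives an isomorphism of torsors. *)

(** * Ideals and semilocal rings *)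

(** The value of [k0_to_cok] is a choice among the idelic classes of all triples representing a
    class, so no value of psi can be computed before the idelic class is known to be constant on
    [k0_eq]. A chain of relations in [k0_eq] runs through projective modules that need not have
    bases over K or R_v; hence a determinant defined for images of idempotents. It compares the
    given isomorphism over F^c with isomorphisms over K and over each R_v, and these have to be
    produced: modules isomorphic over F^c have equal ranks at every maximal ideal of A, and A modulo
    p is finite, so isomorphisms modulo the maximal ideals over p can be glued by Chinese
    remaindering ([local_iso]). Localization at a place is never formed. A property at p is stated
    up to a multiplier s outside p; the admissible multipliers form an ideal, and an ideal contained
    in no place contains 1 ([place_cover], [str_cover]). The line M_0^-1 and its data f0, i0 are
    fixed for all torsors, so that only im, chi and m depend on X in the value (im + i0, val chi m
    f0). *)

Section Ideals.
Variable B : comPzRingType.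
Implicit Types (J m : B -> Prop) (M : lmodType B).

Definition submod M (N : M -> Prop) : Prop :=
  [/\ N 0, forall x y, N x -> N y -> N (x + y) & forall a x, N x -> N (a *: x)].

Lemma submodN M (N : M -> Prop) x : submod N -> N x -> N (- x).
Proof. by case=> _ _ NZ Nx; rewrite -scaleN1r; exact: NZ. Qed.
Lemma submodB M (N : M -> Prop) x y : submod N -> N x -> N y -> N (x - y).
Proof. by move=> hN Nx Ny; case: (hN) => _ ND _; apply: ND => //; exact: submodN. Qed.
Lemma submod_sum M (N : M -> Prop) I (r : seq I) (P : pred I) (F : I -> M) :
  submod N -> (forall i, P i -> N (F i)) -> N (\sum_(i <- r | P i) F i).
Proof. by case=> N0 ND _ h; elim/big_ind: _. Qed.

Lemma ideal0 J : ideal J -> J 0. Proof. by case. Qed.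
Lemma idealB J x y : ideal J -> J x -> J y -> J (x - y). Proof. by case=> _ h _; exact: h. Qed.
Lemma idealMl J a x : ideal J -> J x -> J (a * x). Proof. by case=> _ _ h; exact: h. Qed.
Lemma idealMr J a x : ideal J -> J x -> J (x * a). Proof. by rewrite mulrC; exact: idealMl. Qed.
Lemma idealN J x : ideal J -> J x -> J (- x).
Proof. by move=> hJ Jx; rewrite -sub0r; apply: idealB => //; exact: ideal0. Qed.
Lemma idealD J x y : ideal J -> J x -> J y -> J (x + y).
Proof. by move=> hJ Jx Jy; rewrite -[y]opprK; apply: idealB => //; exact: idealN. Qed.
Lemma ideal_sum J I (r : seq I) (P : pred I) (F : I -> B) :
  ideal J -> (forall i, P i -> J (F i)) -> J (\sum_(i <- r | P i) F i).
Proof.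
move=> hJ h; elim/big_ind: _ => //; first exact: ideal0.
by move=> x y; exact: idealD.
Qed.
Lemma idealBC J x y : ideal J -> J (x - y) -> J (y - x).
Proof. by move=> hJ /(idealN hJ); rewrite opprB. Qed.
(** Elimination of the last generator v: its own relation reads u v = sum of d_j y_j modulo N with u
    = 1 - d_max, which removes v from the other relations once these are multiplied by u. *)
Lemma nakayama M (I : B -> Prop) (N : M -> Prop) n (x : 'I_n -> M) :
  ideal I -> submod N ->
  (forall i, exists2 c : 'I_n -> B, (forall j, I (c j)) & N (x i - \sum_j c j *: x j)) ->
  exists2 s, I (1 - s) & forall i, N (s *: x i).
Proof.
move=> hI hN; elim: n x => [|n ih] x h.
  by exists 1; rewrite ?subrr; [exact: ideal0|case].
have [d Id Nd] := h ord_max; set v := x ord_max in Nd.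
pose u := 1 - d ord_max.
pose y i := x (widen_ord (leqnSn n) i).
have Nu : N (u *: v - \sum_j d (widen_ord (leqnSn n) j) *: y j).
  by move: Nd; rewrite big_ord_recr /= -/v scalerBl scale1r opprD addrA addrAC.
have [|s Is Ns] := ih y.
  move=> i; have [c Ic Nc] := h (widen_ord (leqnSn n) i).
  (* The i-th relation times u, with u v replaced; the last summand, d_max on the diagonal, turns u
     y_i back into y_i. *)
  exists (fun j => u * c (widen_ord (leqnSn n) j)
            + c ord_max * d (widen_ord (leqnSn n) j) + (i == j)%:R * d ord_max).
    by move=> j; do ![apply: idealD => //]; apply: idealMl.
  have e : \sum_j (u * c (widen_ord (leqnSn n) j)
      + c ord_max * d (widen_ord (leqnSn n) j) + (i == j)%:R * d ord_max) *: y j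
    = u *: (\sum_j c (widen_ord (leqnSn n) j) *: y j)
      + c ord_max *: (\sum_j d (widen_ord (leqnSn n) j) *: y j) + d ord_max *: y i.
    rewrite !scaler_sumr -!big_split /=.
    transitivity (\sum_j ((u * c (widen_ord (leqnSn n) j) + c ord_max * d (widen_ord (leqnSn n) j))
        *: y j + ((i == j)%:R * d ord_max) *: y j)).
      by apply: eq_bigr => j _; rewrite scalerDl.
    rewrite big_split /=; congr (_ + _).
      by apply: eq_bigr => j _; rewrite scalerDl !scalerA.
    rewrite (bigD1 i) //= eqxx mul1r big1 ?addr0 // => j /negPf ji.
    by rewrite eq_sym ji mul0r scale0r.
  rewrite e; move: Nc; rewrite big_ord_recr /= -/v -/(y i) => Nc.
  have [_ ND NZ] := hN.
  have := ND _ _ (NZ u _ Nc) (NZ (c ord_max) _ Nu).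
  set S1 := \sum_j _; set S2 := \sum_j _.
  rewrite !scalerBr scalerDr !scalerA [c ord_max * u]mulrC.
  suff -> : u *: y i - (u *: S1 + (u * c ord_max) *: v) + ((u * c ord_max) *: v - c ord_max *: S2)
     = y i - (u *: S1 + c ord_max *: S2 + d ord_max *: y i) by [].
  rewrite {1}/u scalerBl scale1r !opprD !addrA.
  rewrite addrNK -!addrA; congr (_ + _); rewrite addrC -!addrA; congr (_ + _).
exists (s * u).
  have -> : 1 - s * u = (1 - s) + s * d ord_max.
    by rewrite /u; ring.
  by apply: idealD => //; exact: idealMl.
have [_ ND NZ] := hN.
move=> i; case: (unliftP ord_max i) => [j ->|->].
  have -> : lift ord_max j = widen_ord (leqnSn n) j by apply: val_inj; rewrite /= /bump leqNgt ltn_ord.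
  by rewrite mulrC -scalerA; apply: NZ; exact: Ns.
rewrite -/v -scalerA.
have -> : s *: (u *: v) = s *: (u *: v - \sum_j d (widen_ord (leqnSn n) j) *: y j)
   + \sum_j d (widen_ord (leqnSn n) j) *: (s *: y j).
  rewrite scalerBr scaler_sumr; under [X in _ = _ + X]eq_bigr => j _ do rewrite scalerA mulrC -scalerA.
  by rewrite subrK.
by apply: ND; [exact: NZ|apply: submod_sum => // j _; apply: NZ; exact: Ns].
Qed.

Definition maxideal m : Prop :=
  [/\ ideal m, ~ m 1 & forall x, ~ m x -> exists y, m (1 - x * y)].

Lemma maxidealP m : maxideal m -> ideal m. Proof. by case. Qed.

Lemma maxideal_prime m a b : maxideal m -> m (a * b) -> m a \/ m b.
Proof.
case=> hm _ h mab; case: (pselect (m a)) => [|/h [y my]]; [by left|right].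
have := idealD hm (idealMl b hm my) (idealMl y hm mab).
by congr (m _); ring.
Qed.

Definition prime_ideal m : Prop :=
  [/\ ideal m, ~ m 1 & forall a b, m (a * b) -> m a \/ m b].

Lemma maxideal_primeideal m : maxideal m -> prime_ideal m.
Proof. by move=> hm; case: (hm) => *; split=> // a b; exact: maxideal_prime. Qed.

(** Linear dependence over the fraction field of B/m with denominators cleared. Gaussian elimination
    without division, with pivot [v i0 ord_max]; if the last coordinate vanishes modulo m
    throughout, it is dropped along with the last vector. *)
Lemma prime_dependent m n (v : 'I_n.+1 -> 'I_n -> B) : prime_ideal m ->
  exists c : 'I_n.+1 -> B, (exists i, ~ m (c i)) /\ forall j, m (\sum_i c i * v i j).
Proof.
case=> hm m1 mP; elim: n v => [|n ih] v.
  by exists (fun=> 1); split=> [|[]//]; exists ord0.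
have [[i0 hi0]|h] := pselect (exists i, ~ m (v i ord_max)); last first.
  have [c [[i ci] hc]] := ih (fun i j => v (widen_ord (leqnSn _) i) (widen_ord (leqnSn _) j)).
  exists (fun i => if unlift ord_max i is Some k then c k else 0); split.
    by exists (lift ord_max i); rewrite liftK.
  move=> j; case: (unliftP ord_max j) => [k ->|->].
    rewrite big_ord_recr /= unlift_none mul0r addr0.
    have := hc k; congr (m _); apply: eq_bigr => a _.
    have ea p (x : 'I_p) : widen_ord (leqnSn p) x = lift ord_max x.
      by apply: val_inj; rewrite /= /bump leqNgt ltn_ord.
    by rewrite !ea liftK.
  apply: ideal_sum => // a _; apply: idealMl => //.
  by apply: contrapT => hh; apply: h; exists a.
pose w (i : 'I_n.+1) (j : 'I_n) : B :=
  v i0 ord_max * v (lift i0 i) (lift ord_max j) - v (lift i0 i) ord_max * v i0 (lift ord_max j).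
have [c [[i ci] hc]] := ih w.
pose c0 := - \sum_i c i * v (lift i0 i) ord_max.
exists (fun i => if unlift i0 i is Some k then c k * v i0 ord_max else c0); split.
  by exists (lift i0 i); rewrite liftK => /mP [].
move=> j; rewrite (bigD1_ord i0) //= unlift_none.
under eq_bigr => a _ do rewrite liftK.
case: (unliftP ord_max j) => [k ->|->].
  have := hc k; congr (m _); rewrite /c0 mulNr mulr_suml -sumrN -big_split /=.
  apply: eq_bigr => a _; rewrite /w mulrBr addrC; congr (_ - _); last by rewrite mulrA.
  by rewrite mulrA.
rewrite (_ : _ + _ = 0); first exact: ideal0.
rewrite /c0 mulNr mulr_suml -sumrN -big_split /= big1 // => a _.
by rewrite -mulrA [v i0 _ * _]mulrC mulrA addNr.
Qed.
End Ideals.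

(** * Finite quotients and Chinese remaindering *)

Definition fin_mod (V : zmodType) (J : V -> Prop) : Prop :=
  exists s : seq V, forall x, exists2 r, r \in s & J (x - r).

Section FiniteIndex.

Lemma count_lt (T : eqType) (P Q : pred T) (s : seq T) r :
  (forall z, P z -> Q z) -> r \in s -> Q r -> ~~ P r -> (count P s < count Q s)%N.
Proof.
move=> PQ rs Qr Pr; rewrite -(size_filter Q) -(count_predC P) count_filter -addn1 leq_add //.
  by apply: sub_count => z /= Pz; rewrite Pz PQ.
by rewrite -has_count; apply/hasP; exists r; rewrite ?mem_filter ?Qr.
Qed.

(** Each J n is a union of classes modulo J0, so a strict inclusion loses at least one of the
    finitely many representatives. *)
Lemma chain_stab (V : zmodType) (J0 : V -> Prop) (J : nat -> V -> Prop) :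
  fin_mod J0 -> (forall n x y, J0 y -> J n (x + y) <-> J n x) ->
  (forall n x, J n.+1 x -> J n x) -> exists n, forall x, J n x -> J n.+1 x.
Proof.
case=> s hs hJ0 hJ; apply: contrapT => /forallNP h.
pose f n := count (fun r => `[< J n r >]) s.
have f_dec n : (f n.+1 < f n)%N.
  have /existsNP [x /not_implyP [Jx nJx]] := h n.
  have [r rs hr] := hs x.
  have Jr k : J k x <-> J k r by rewrite -{1}[x](subrK r) addrC hJ0.
  apply: (@count_lt _ _ _ _ r) => // [z /asboolP hz||].
  - exact/asboolP/hJ.
  - exact/asboolP/Jr.
  - by apply/asboolPn => /Jr.
have f_le n : (f n + n <= f 0)%N.
  elim: n => [|n ih]; first by rewrite addn0.
  by rewrite addnS -addSn (leq_trans _ ih) // leq_add2r.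
by have := f_le (f 0%N).+1; rewrite addnS ltnNge leq_addl.
Qed.

Variables (B : comPzRingType) (J0 : B -> Prop) (hJ0 : ideal J0) (fJ0 : fin_mod J0).

(** Induction on the number of representatives modulo J0 outside J: if x lies outside J and is not
    invertible modulo J, then J + xB is proper and contains one more representative. *)
Lemma ex_maxideal (J : B -> Prop) : ideal J -> (forall x, J0 x -> J x) -> ~ J 1 ->
  exists2 m, maxideal m & forall x, J x -> m x.
Proof.
have [s hs] := fJ0.
pose f (J : B -> Prop) := count (fun r => `[< ~ J r >]) s.
have [k] := ubnP (f J); elim: k J => // k ih J Jk hJ J0J J1.
have [h|/existsNP [x /not_implyP [nJx hx]]] :=
  pselect (forall x, ~ J x -> exists y, J (1 - x * y)).
  by exists J.
pose J' z := exists y, J (z - x * y).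
have JJ' z : J z -> J' z by move=> Jz; exists 0; rewrite mulr0 subr0.
have J'x : J' x by exists 1; rewrite mulr1 subrr; exact: ideal0.
have hJ' : ideal J'.
  split; first by apply: JJ'; exact: ideal0.
    move=> a b [c hc] [d hd]; exists (c - d).
    by have := idealB hJ hc hd; congr (J _); ring.
  move=> a z [y hy]; exists (a * y).
  by have := idealMl a hJ hy; congr (J _); ring.
have J'1 : ~ J' 1 by move=> [y hy]; apply: hx; exists y.
have J0J' z : J0 z -> J' z by move=> /J0J /JJ'.
suff lt : (f J' < k)%N.
  by have [m hm J'm] := ih J' lt hJ' J0J' J'1; exists m => // z /JJ' /J'm.
have [r rs hr] := hs x.
have J'r : J' r by rewrite -[r](subKr x); apply: idealB => //; exact: J0J'.
have nJr : ~ J r.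
  by move=> Jr; apply: nJx; rewrite -(subrK r x); apply: idealD => //; exact: J0J.
rewrite -ltnS; apply: leq_trans Jk; rewrite ltnS.
apply: (@count_lt _ _ _ _ r) => // [z /asboolP hz||].
- by apply/asboolP => /JJ'.
- exact/asboolP.
- by apply/asboolPn; apply.
Qed.

Let maxover (m : B -> Prop) := maxideal m /\ forall x, J0 x -> m x.

Lemma maxideal_sep (m m' : B -> Prop) : maxideal m -> maxideal m' -> m <> m' -> exists2 e, m e & ~ m' e.
Proof.
move=> hm hm' mm'; apply: contrapT => h.
have mm x : m x -> m' x by move=> mx; apply: contrapT => m'x; apply: h; exists x.
apply: mm'; apply/funext => x; apply/propext; split=> [/mm//|m'x].
apply: contrapT; case: (hm) => im m1 hmm /hmm [y my]; case: (hm') => im' m'1 _; apply: m'1.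
by rewrite -(subrK (x * y) 1); apply: idealD => //; [exact: mm|exact: idealMr].
Qed.

(** L is an arbitrary list of subsets because it will be a list of candidates, among which the
    maximal ideals are not singled out. *)
Lemma maxideal_idem (m : B -> Prop) (L : seq (B -> Prop)) : maxideal m ->
  exists e, m (1 - e) /\ forall m', List.In m' L -> maxideal m' -> m' <> m -> m' e.
Proof.
move=> hm; case: (hm) => im m1 hmm; elim: L => [|m' L [e [me he]]].
  by exists 1; split=> //; rewrite subrr; exact: ideal0.
have [[hm' m'm]|h] := pselect (maxideal m' /\ m' <> m); last first.
  by exists e; split=> // m'' [<- h1 h2|]; [case: h|exact: he].
have [f m'f mf] := maxideal_sep hm' hm m'm; have [y my] := hmm f mf.
exists (e * (f * y)); split.
  have := idealD im me (idealMl e im my); congr (m _); ring.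
move=> m'' [<- _ _|i h1 h2].
  by apply: idealMl; [exact: maxidealP|apply: idealMr => //; exact: maxidealP].
by apply: idealMr; [exact: maxidealP|exact: he].
Qed.

(* Chinese remaindering over the finitely many maximal ideals containing J0. *)
Lemma semilocal_choice (H : lmodType B) (good : (B -> Prop) -> H -> Prop) :
  (forall m, maxideal m -> (forall x, J0 x -> m x) -> exists h, good m h) ->
  (forall m, maxideal m -> (forall x, J0 x -> m x) ->
     forall a h x, m a -> good m h -> good m (h + a *: x)) ->
  exists h, forall m, maxideal m -> (forall x, J0 x -> m x) -> good m h.
Proof.
move=> g1 g2; have [s hs] := fJ0.
pose P (T : seq B) x := exists2 r, r \in T & J0 (x - r).
(* An ideal containing J0 is the union of the classes of the representatives it contains, so the
   subsets of s list all candidates. *)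
pose Ts := [seq mask (val b) s | b : (size s).-tuple bool].
have [h hh] : exists h, forall m, List.In m (map P Ts) -> maxover m -> good m h.
  elim: (map P Ts) => [|m L [h ih]]; first by exists 0.
  have [mo|nmo] := pselect (maxover m); last by exists h => m' [<- /nmo|]; [|exact: ih].
  have [y gy] := g1 m mo.1 mo.2; have [e [me he]] := maxideal_idem L mo.1.
  exists (h + e *: (y - h)) => m' iL mo'.
  have [->|m'm] := pselect (m' = m).
    have -> : h + e *: (y - h) = y + (1 - e) *: (h - y).
      by rewrite scalerBl scale1r addrA (addrC y (h - y)) subrK -scalerN opprB.
    by apply: g2; case: mo.
  case: iL => [/esym//|iL]; apply: g2; [by case: mo'|by case: mo'| |exact: ih].
  by apply: he => //; case: mo'.
exists h => m mm J0m; apply: hh; last by split.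
have -> : m = P [seq r <- s | `[< m r >]].
  have im := maxidealP mm; apply/funext => x; apply/propext; split.
    move=> mx; have [r rs hr] := hs x; exists r => //; rewrite mem_filter rs andbT.
    apply/asboolP; rewrite -(subKr x r); apply: idealB => //; exact: J0m.
  case=> r; rewrite mem_filter => /andP [/asboolP mr _] /J0m mxr.
  by rewrite -(subrK r x); exact: idealD.
apply/List.in_map; pose b := [tuple of map (fun r => `[< m r >]) (in_tuple s)].
have mem_In (T : eqType) (x : T) l : x \in l -> List.In x l.
  by elim: l => //= y l ih; rewrite inE => /predU1P [->|/ih]; [left|right].
by apply: mem_In; rewrite filter_mask; apply/mapP; exists b; rewrite ?mem_enum.
Qed.

(** The multipliers a with aM in N form an ideal J; were it proper, Nakayama's lemma at a maximal
    ideal m containing J would produce a multiplier s with 1 - s in m. *)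
Lemma semilocal_gen (M : lmodType B) (N : M -> Prop) n (x : 'I_n -> M) :
  submod N -> (forall y, exists c, y = \sum_i c i *: x i) ->
  (forall a y, J0 a -> N (a *: y)) ->
  (forall m, maxideal m -> (forall x, J0 x -> m x) -> forall i,
     exists2 c : 'I_n -> B, (forall j, m (c j)) & N (x i - \sum_j c j *: x j)) ->
  forall y, N y.
Proof.
move=> hN gen J0N hm; pose J a := forall y, N (a *: y).
have iJ : ideal J.
  case: (hN) => N0 ND NZ; split=> [y|a b ha hb y|a b hb y].
  - by rewrite scale0r.
  - by rewrite scalerBl; exact: submodB.
  - by rewrite -scalerA; apply: NZ; exact: hb.
suff J1 : J 1 by move=> y; rewrite -[y]scale1r; exact: J1.
apply: contrapT => J1.
have [|m mm Jm] := ex_maxideal iJ _ J1; first by move=> a ha y; exact: J0N.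
have J0m a : J0 a -> m a by move=> ha; apply: Jm => y; exact: J0N.
have [s ms Ns] := nakayama (maxidealP mm) hN (hm m mm J0m).
have Js : J s.
  move=> y; have [c ->] := gen y; rewrite scaler_sumr; apply: submod_sum => // i _.
  by rewrite scalerA mulrC -scalerA; case: hN => _ _; apply.
case: (mm) => im m1 _; apply: m1; rewrite -(subrK s 1).
by apply: idealD => //; exact: Jm.
Qed.
End FiniteIndex.

(** * The ring of integers *)

(** The properties of the ring of integers on which everything else rests. [dk_inv] is the local
    principality of nonzero ideals: scaled by u/v, the vector c becomes integral and primitive at
    p. *)
Record dedekind_like (R : comPzRingType) : Prop := DedekindLike {
  dk_dom : forall a b : R, a * b = 0 -> a = 0 \/ b = 0;
  dk_nz : 1 <> 0 :> R;
  dk_fin : forall a : R, a <> 0 -> fin_mod (fun x : R => exists y, x = a * y);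
  dk_inv : forall (p : place R) n (c : 'I_n -> R), (exists i, c i <> 0) ->
    exists u v (r : 'I_n -> R),
      [/\ v <> 0, forall i, u * c i = v * r i & exists i, ~ p (r i)];
  dk_place : exists p : place R, True
}.

(** * Places of a ring with finite residue rings *)

Section DedekindTheory.
Variable R : comPzRingType.
Hypothesis fin : forall a : R, a <> 0 -> fin_mod (fun x : R => exists y, x = a * y).
Implicit Types p : place R.

Lemma principal_ideal (a : R) : ideal (fun x => exists y, x = a * y).
Proof.
split; first by exists 0; rewrite mulr0.
  by move=> _ _ [x ->] [y ->]; exists (x - y); rewrite mulrBr.
by move=> b _ [x ->]; exists (b * x); rewrite mulrCA.
Qed.

Lemma fin_modW (V : zmodType) (J J' : V -> Prop) :
  (forall x, J x -> J' x) -> fin_mod J -> fin_mod J'.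
Proof. by move=> h [s hs]; exists s => x; have [r rs /h] := hs x; exists r. Qed.

Lemma fin_mod_ideal (J : R -> Prop) a : ideal J -> a <> 0 -> J a -> fin_mod J.
Proof.
move=> iJ a0 Ja; apply: fin_modW (fin a0) => _ [y ->].
exact: idealMr.
Qed.

Lemma place_fin p : fin_mod p.
Proof. by have [a pa a0] := place_nonzero p; exact: fin_mod_ideal (place_idealP p) a0 pa. Qed.

Lemma place_prime_ideal p : prime_ideal p.
Proof. by split; [exact: place_idealP|exact: place_proper|exact: place_prime]. Qed.

Lemma prime_fin_max (m : R -> Prop) : prime_ideal m -> fin_mod m -> maxideal m.
Proof.
move=> [im m1 mP] fm; split=> // s ms.
pose J n x := exists y, m (x - s ^+ n * y).
have [||n hn] := chain_stab (J := J) fm.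
- move=> n x y my; split=> [] [z hz]; exists z.
    by have := idealB im hz my; congr (m _); ring.
  by have := idealD im hz my; congr (m _); ring.
- by move=> n x [y hy]; exists (s * y); move: hy; rewrite exprSr mulrA.
have [|y] := hn (s ^+ n); first by exists 1; rewrite mulr1 subrr; exact: ideal0.
rewrite exprSr -mulrA -{1}[s ^+ n]mulr1 -mulrBr => /mP [|]; last by exists y.
elim: n {hn} => [/m1 //|n ih]; rewrite exprS => /mP [/ms //|]; exact: ih.
Qed.

Lemma place_max p : maxideal p.
Proof. exact: prime_fin_max (place_prime_ideal p) (place_fin p). Qed.

Lemma place_invert p s : ~ p s -> exists y, p (1 - s * y).
Proof. by have [_ _ h] := place_max p; exact: h. Qed.

Lemma mk_place (m : R -> Prop) a : maxideal m -> m a -> a <> 0 ->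
  exists p : place R, place_ideal p = m.
Proof.
move=> hm ma a0; have [im m1 mP] := maxideal_primeideal hm.
have h : exists2 a, m a & a <> 0 by exists a.
by exists (Place im m1 mP h).
Qed.

(** Local-global principle. The existence of a place gives J a nonzero element, so that J has finite
    index; if proper, it would lie in a maximal ideal, which is a place. *)
Lemma place_cover (J : R -> Prop) : (exists p : place R, True) -> ideal J -> (forall p, exists2 s, J s & ~ p s) -> J 1.
Proof.
move=> [p0 _] iJ h; have [a Ja pa] := h p0.
have a0 : a <> 0 by move=> a0; apply: pa; rewrite a0; exact: ideal0 (place_idealP p0).
apply: contrapT => J1.
have [|m mm Jm] := ex_maxideal (fin a0) iJ _ J1.
  by move=> _ [y ->]; exact: idealMr.
have [p pm] := mk_place mm (Jm _ Ja) a0.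
by have [s Js ps] := h p; apply: ps; rewrite pm; exact: Jm.
Qed.

(** Up to a factor outside p, high powers of p are divisible by b. The decreasing ideals J n = p^n +
    bR become stationary, so that J n = p J n + bR, and Nakayama's lemma applies. *)
Lemma place_pow_sub p b : b <> 0 ->
  exists n s, ~ p s /\ forall y, ideal_pow p n y -> exists z, s * y = b * z.
Proof.
move=> b0; have ip := place_idealP p.
have iP n : ideal (ideal_pow p n) by exact: gen_idealP.
pose J n x := exists y z, [/\ ideal_pow p n y & x = y + b * z].
have [||n hn] := chain_stab (J := J) (fin b0).
- move=> n x _ [w ->]; split=> [] [y [z [hy e]]]; exists y.
    by exists (z - w); split=> //; rewrite mulrBr addrA -e addrK.
  by exists (z + w); split=> //; rewrite e mulrDr addrA.
- move=> n x [y [z [hy ->]]]; exists y, z; split=> //.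
  apply: hy; first exact: iP.
  move=> _ [s [ps ->]]; rewrite big_ord_recr /=.
  apply: (idealMr (s ord_max) (iP n)).
  by move=> K iK; apply; exists (fun i => s (widen_ord (leqnSn n) i)).
have [l hl] := fin b0.
(* The representatives modulo b that lie in J n, with 0 in place of the others; together with b they
   generate J n. *)
pose x (i : 'I_(size l)) : R^o := if pselect (J n l`_i) then l`_i else 0.
pose N (y : R^o) := exists z, y = b * z.
have hN : submod N.
  split; first by exists 0; rewrite mulr0.
    by move=> _ _ [y ->] [z ->]; exists (y + z); rewrite mulrDr.
  by move=> a _ [y ->]; exists (a * y); rewrite regE mulrCA.
have JN y z : J n y -> J n (y - b * z).
  by move=> [u [v [hu ->]]]; exists u, (v - z); split=> //; rewrite mulrBr addrA.
have pJ y : ideal_pow p n y -> J n y by move=> hy; exists y, 0; rewrite mulr0 addr0.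
have gen y : J n y -> exists i z, y = x i + b * z.
  move=> Jy; have [r rl [z ryz]] := hl y.
  have ri : (index r l < size l)%N by rewrite index_mem.
  exists (Ordinal ri), z; rewrite /x /= nth_index //.
  have er : r = y - b * z by rewrite -ryz subKr.
  case: (pselect (J n r)) => [? /=|[]]; first by rewrite er subrK.
  by rewrite er; exact: JN.
have Jx i : J n (x i).
  by rewrite /x; case: (pselect (J n l`_i)) => /= [//|_]; apply: pJ; exact: ideal0.
(* Since J n is contained in J (n+1), each x i is, modulo b, a sum of products of elements of p with
   elements of p^n, and the latter are again some x k modulo b. *)
have [|s ps Ns] := @nakayama R R^o p N _ x ip hN.
  move=> i; have [y [z [hy exi]]] := hn _ (Jx i).
  pose K (y : R) := exists2 c, (forall j, p (c j)) & N (y - \sum_j c j *: x j : R^o).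
  suff [c pc [w hw]] : K y.
    exists c => //; exists (w + z).
    by rewrite exi addrAC hw mulrDr.
  apply: (hy K); first split.
  - by exists (fun=> 0) => [j|]; [exact: ideal0|rewrite big1 ?subr0 => [|j _]; [case: hN|rewrite scale0r]].
  - move=> u v [c pc hc] [d pd hd]; exists (fun j => c j - d j) => [j|]; first exact: idealB.
    have := submodB hN hc hd; congr (N _).
    under [X in _ = _ - X]eq_bigr => j _ do rewrite scalerBl.
    by rewrite sumrB !opprD !opprK addrACA.
  - move=> a u [c pc hc]; exists (fun j => a * c j) => [j|]; first exact: idealMl.
    case: hN => _ _ /(_ a _ hc); congr (N _); rewrite scalerBr scaler_sumr; congr (_ - _).
    by apply: eq_bigr => j _; rewrite scalerA.
  move=> _ [t [pt ->]]; rewrite big_ord_recr /=.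
  have [|k [w ->]] := gen (\prod_(i0 < n) t (widen_ord (leqnSn n) i0)).
    by apply: pJ => K' iK; apply; exists (fun i => t (widen_ord (leqnSn n) i)).
  exists (fun j => if j == k then t ord_max else 0) => [j|].
    by case: eqP => // _; exact: ideal0.
  exists (w * t ord_max); rewrite (bigD1 k) //= eqxx big1 => [|j /negPf ->]; last by rewrite scale0r.
  by rewrite addr0 regE; ring.
exists n, s; split=> [p1|y /pJ /gen [i [z ->]]].
  by apply: (place_proper (p := p)) => //; rewrite -(subrK s 1); exact: idealD.
by have [w hw] := Ns i; exists (w + s * z); rewrite mulrDr -[s * x i]/(s *: x i) hw; ring.
Qed.
End DedekindTheory.

(** z acts on the nonzero vector (y i) through an integral matrix, so it is a root of the
    characteristic polynomial; M is transposed because eigenvectors are rows. *)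
Lemma eigen_integral (R : comNzRingType) (K : fieldType) (f : {rmorphism R -> K})
    n (y : 'I_n -> K) (z : K) (M : 'I_n -> 'I_n -> R) i0 : y i0 != 0 ->
  (forall i, z * y i = \sum_j f (M i j) * y j) -> integralOver f z.
Proof.
move=> y0 h; pose A := \matrix_(i, j) M j i.
exists (char_poly A); first exact: char_poly_monic.
rewrite map_char_poly -eigenvalue_root_char.
apply/eigenvalueP; exists (\row_i y i); last first.
  by apply: contraNneq y0 => /rowP /(_ i0); rewrite !mxE => ->.
apply/rowP => i; rewrite !mxE h; apply: eq_bigr => j _.
by rewrite !mxE mulrC.
Qed.

(** * Finiteness and invertibility of ideals in the ring of integers *)

Section RingOfIntegers.
Variable F : fieldExtType rat.
Local Notation R := (ring_of_integers F).
Local Notation RF := (@RF F).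

Lemma RF_inj : injective RF.
Proof. exact: val_inj. Qed.

Lemma RFP (x : F) : integralOver (@intmul F 1) x -> exists a : R, RF a = x.
Proof. by move=> h; exists (IntClosure (asboolT h)). Qed.

Lemma RF_int (c : int) : RF c%:~R = c%:~R.
Proof. by rewrite rmorph_int. Qed.

Lemma RF_closed (x : F) : integralOver RF x -> exists a : R, RF a = x.
Proof.
case=> q qm qx; apply: RFP; apply: (integral_root_monic (p := map_poly RF q)) => //.
  exact: monic_map.
apply/integral_poly => i; rewrite coef_map /=.
exact/asboolP/int_valP.
Qed.

Lemma intrF_eq0 (c : int) : (c%:~R == 0 :> F) = (c == 0).
Proof.
by rewrite -(rmorph_int (in_alg F)) fmorph_eq0 intr_eq0.
Qed.

(** c is the leading coefficient of an integer polynomial vanishing at x: c x maps the span of 1, x,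
    ..., x^(n-1) into itself with integer coefficients, so it is integral. *)
Lemma RF_frac (x : F) : exists (a : R) (c : int), c != 0 /\ RF a = c%:~R * x.
Proof.
have /polyOver1P [q Dq] := minPolyOver 1%AS x.
have qx : root (map_poly (in_alg F) q) x by rewrite -Dq root_minPoly.
have q0 : q != 0 by rewrite -(map_poly_eq0 (in_alg F)) -Dq monic_neq0 ?monic_minPoly.
have [r [a a0 Dr]] := rat_poly_scale q.
have r0 : r != 0.
  by apply: contraNneq q0 => r0; rewrite Dr r0 rmorph0 scaler0.
have rx : root (map_poly (@intmul F 1) r) x.
  move: qx; rewrite Dr map_polyZ rootZ; last by rewrite scaler_eq0 invr_eq0 intr_eq0 oner_eq0 orbF.
  rewrite -map_poly_comp /=; congr (root _ x); apply: eq_map_poly => i /=.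
  by rewrite -[RHS](rmorph_int (in_alg F)).
pose n := (size r).-1; pose c := lead_coef r.
have n0 : (0 < n)%N.
  rewrite /n -subn1 subn_gt0 ltn_neqAle size_poly_gt0 r0 andbT eq_sym.
  apply: contraTneq rx => /eqP /size_poly1P [d d0 ->].
  by rewrite map_polyC rootC /= intrF_eq0.
have c0 : c != 0 by rewrite lead_coef_eq0.
have [a' Da] : exists a' : R, RF a' = c%:~R * x.
  apply: RFP.
  pose M (i j : 'I_n) : int := if i.+1 == n then - r`_j else (j == i.+1 :> nat)%:Z * c.
  apply: (@eigen_integral _ _ _ n (fun i => x ^+ i) _ M (Ordinal n0)).
    by rewrite expr0 oner_eq0.
  move=> i; rewrite -mulrA -exprS /M.
  case: eqP => [->|/eqP ni].
    move: rx; rewrite rootE horner_coef size_map_inj_poly ?rmorph0 //; last first.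
      by move=> u v /eqP; rewrite -subr_eq0 -rmorphB intrF_eq0 subr_eq0 => /eqP.
    have -> : size r = n.+1 by rewrite prednK // size_poly_gt0.
    rewrite big_ord_recr /= coef_map /= addrC addr_eq0 => /eqP.
    rewrite -[r`_n]/c => ->; rewrite -sumrN; apply: eq_bigr => j _.
    by rewrite coef_map /= rmorphN mulNr.
  have ni' : (i.+1 < n)%N by rewrite ltn_neqAle ni ltn_ord.
  rewrite (bigD1 (Ordinal ni')) //= eqxx mul1r big1 ?addr0 // => j.
  by rewrite -val_eqE /= => /negPf ->; rewrite mul0r mul0r.
by exists a', c.
Qed.

Lemma ROI_dom (a b : R) : a * b = 0 -> a = 0 \/ b = 0.
Proof.
move=> ab; have /eqP : RF a * RF b = 0 by rewrite -rmorphM ab rmorph0.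
by rewrite mulf_eq0 => /orP [] /eqP h; [left|right]; apply: RF_inj; rewrite h rmorph0.
Qed.

Lemma ROI_norm (a : R) : a <> 0 -> exists b (N : nat), (0 < N)%N /\ a * b = N%:R.
Proof.
move=> a0; have a0' : RF a != 0 by apply/eqP => h; apply: a0; apply: RF_inj; rewrite h rmorph0.
have [b [c [c0 Db]]] := RF_frac (RF a)^-1.
exists (b * (Num.sg c)%:~R), `|c|%N; split; first by rewrite absz_gt0.
apply: RF_inj; rewrite !rmorphM /= Db rmorph_int mulrCA mulrA mulfVK // rmorph_nat.
by rewrite -intrM mulrC -[X in X%:~R]Num.Theory.normrEsg -abszE.
Qed.

(** A rational dependency, cleared of denominators and divided by p as long as possible; the sum of
    the absolute values of the coefficients decreases at each division. This bounds the dimension of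
    R/pR without an integral basis. *)
Lemma ROI_dependent (p : nat) (x : 'I_(\dim {:F}).+1 -> R) : prime p ->
  exists c : 'I_(\dim {:F}).+1 -> int,
    (exists i, ~~ (p %| c i)%Z) /\ \sum_i (c i)%:~R * x i = 0.
Proof.
move=> pp; pose X := [tuple RF (x i) | i < (\dim {:F}).+1].
have nX : ~~ free X.
  apply/negP => fX; have := dimvS (subvf <<X>>).
  by rewrite (eqP (fX : free X)) size_tuple ltnn.
have [k [k0 hk]] : exists k : 'I_(\dim {:F}).+1 -> rat,
    (exists i, k i != 0) /\ \sum_i k i *: X`_i = 0.
  apply: contrapT => h; move/negP: nX; apply; apply/freeP => k hk i.
  by apply/eqP; apply: contrapT => /negP ki; apply: h; exists k; split=> //; exists i.
have [c [c0 hc]] : exists c : 'I_(\dim {:F}).+1 -> int,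
    (exists i, c i != 0) /\ \sum_i (c i)%:~R * x i = 0.
  pose D := \prod_i denq (k i).
  have D0 : D != 0 by apply/prodf_neq0 => i _; exact: denq_neq0.
  have e i : exists c : int, c%:~R = k i * D%:~R.
    exists (numq (k i) * \prod_(j | j != i) denq (k j)).
    have intM (a b : int) : (a * b)%:~R = a%:~R * b%:~R :> rat by exact: intrM.
    rewrite /D (bigD1 i isT) !intM mulrA; congr (_ * _).
    by rewrite -{2}[k i]divq_num_den mulfVK // intr_eq0 denq_neq0.
  pose c i := projT1 (cid (e i)); have hc i : (c i)%:~R = k i * D%:~R := projT2 (cid (e i)).
  exists c; split.
    case: k0 => i ki; exists i; rewrite -(@intr_eq0 rat) hc mulf_neq0 //.
    by rewrite intr_eq0.
  apply: RF_inj; rewrite rmorph0 rmorph_sum /=.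
  transitivity ((D%:~R : rat) *: \sum_i k i *: X`_i); last by rewrite hk scaler0.
  rewrite scaler_sumr.
  apply: eq_bigr => i _; rewrite -[int_val (c i)%:~R]/(RF (c i)%:~R) RF_int scalerA mulrC [D%:~R * _]mulrC -hc.
  rewrite -tnth_nth tnth_mktuple mulrC -(rmorph_int (in_alg F)) /=.
  by rewrite -scalerAl mul1r.
have [m] := ubnP (\sum_i `|c i|)%N.
elim: m c c0 hc => // m ih c c0 hc lt.
have [h|/existsNP [i /negP hi]] := pselect (forall i, (p %| c i)%Z); last by exists c; split=> //; exists i.
pose d i := (c i %/ p)%Z; have ed i : c i = d i * p by rewrite divzK.
have p0 : (p%:Z)%:~R != 0 :> F by rewrite intrF_eq0 eqz_nat -lt0n prime_gt0.
apply: (ih d).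
- case: c0 => i ci; exists i; apply: contraNneq ci => di; by rewrite ed di mul0r.
- apply: RF_inj; apply: (mulIf p0); rewrite rmorph0 mul0r.
  transitivity (RF (\sum_i (c i)%:~R * x i)); last by rewrite hc rmorph0.
  rewrite !rmorph_sum /= mulr_suml; apply: eq_bigr => i _.
  have iv (e : int) : int_val (e%:~R : R) = e%:~R by exact: RF_int.
  by rewrite !iv mulrAC -intrM -ed.
rewrite ltnS in lt; apply: leq_trans lt; case: c0 => i ci.
rewrite (bigD1 i) //= [X in (_ < X)%N](bigD1 i) //= -addSn leq_add //; last first.
  by apply: leq_sum => j _; rewrite [c j]ed abszM leq_pmulr // absz_nat prime_gt0.
rewrite [c i]ed abszM absz_nat ltn_Pmulr ?prime_gt1 // absz_gt0.
by apply: contraNneq ci => di; rewrite ed di mul0r.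
Qed.

(** A family of maximal size independent modulo p exists by [ROI_dependent]; its combinations with
    coefficients 0, ..., p-1 represent R modulo p. *)
Lemma ROI_fin_prime (p : nat) : prime p -> fin_mod (fun x : R => exists y, x = p%:R * y).
Proof.
move=> pp.
pose indep k := exists x : 'I_k -> R, forall c : 'I_k -> int,
  (exists y, \sum_i (c i)%:~R * x i = p%:R * y) -> forall i, (p %| c i)%Z.
have [k [x ix] nk] : exists2 k, indep k & ~ indep k.+1.
  apply: contrapT => h.
  have hi k : indep k.
    by elim: k => [|k ih]; [exists (fun=> 0) => c _ []|apply: contrapT => hk; apply: h; exists k].
  have [x hx] := hi (\dim {:F}).+1; have [c [[i ci] hc]] := ROI_dependent x pp.
  by move/negP: ci; apply; apply: hx; exists 0; rewrite hc mulr0.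
(* The digits are indexed by [p.-1.+1], which equals p, so that [inord] applies. *)
exists [seq \sum_i (f i)%:R * x i | f : {ffun 'I_k -> 'I_p.-1.+1}] => z.
pose x' (i : 'I_k.+1) := if unlift ord0 i is Some j then x j else z.
have [c [y hy] [i0 ci0]] : exists2 c : 'I_k.+1 -> int,
    (exists y, \sum_i (c i)%:~R * x' i = p%:R * y) & exists i, ~ (p %| c i)%Z.
  apply: contrapT => h; apply: nk; exists x' => c hc i.
  by apply: contrapT => hi; apply: h; exists c => //; exists i.
have x'0 : x' ord0 = z by rewrite /x' unlift_none.
have x'S i : x' (lift ord0 i) = x i by rewrite /x' liftK.
move: hy; rewrite big_ord_recl x'0; under eq_bigr => i _ do rewrite x'S.
move=> hy.
have c0 : ~ (p %| c ord0)%Z.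
  move=> /dvdzP [e he].
  have hi : forall i, (p %| c (lift ord0 i))%Z.
    apply: (ix (fun i => c (lift ord0 i))); exists (y - e%:~R * z).
    rewrite mulrBr -hy he rmorphM /=.
    have -> : (p%:Z)%:~R = p%:R :> R by [].
    ring.
  case: (unliftP ord0 i0) => [j e0|e0]; apply: ci0; rewrite e0 // he dvdz_mull //.
have cop : coprimez p (c ord0).
  rewrite /coprimez /gcdz /= eqz_nat -/(coprime _ _) prime_coprime //.
  by apply/negP => h; apply: c0.
(* v inverts the coefficient of z modulo p, so z is congruent to minus the sum of v c_i x_i, whose
   coefficients are then reduced to digits. *)
have [[u v] /= huv] := coprimezP _ _ cop.
have hp w : exists f : 'I_p.-1.+1, exists q : int, w = f%:Z + p%:Z * q.
  exists (inord `|(w %% p)%Z|%N), (w %/ p)%Z.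
  rewrite inordK.
    by rewrite gez0_abs ?modz_ge0 ?eqz_nat -?lt0n ?prime_gt0 // addrC mulrC -divz_eq.
  rewrite prednK ?prime_gt0 // -ltz_nat gez0_abs ?modz_ge0 ?eqz_nat -?lt0n ?prime_gt0 //.
  by rewrite ltz_pmod // ltz_nat prime_gt0.
pose g i := projT1 (cid (hp (- v * c (lift ord0 i)))).
have [q hq] : exists q : 'I_k -> int, forall i, - v * c (lift ord0 i) = (g i)%:Z + p%:Z * q i.
  exists (fun i => projT1 (cid (projT2 (cid (hp (- v * c (lift ord0 i)))))) ) => i.
  exact: (projT2 (cid (projT2 (cid (hp (- v * c (lift ord0 i))))))).
exists (\sum_i ([ffun i => g i] i)%:R * x i).
  by apply/mapP; exists [ffun i => g i]; rewrite ?mem_enum.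
exists (u%:~R * z + v%:~R * y + \sum_i (q i)%:~R * x i).
have ez : z = (u * p + v * c ord0)%:~R * z by rewrite huv mul1r.
rewrite {1}ez.
under eq_bigr => i _ do rewrite ffunE.
have e i : (g i)%:R = - (v%:~R * (c (lift ord0 i))%:~R) - p%:R * (q i)%:~R :> R.
  have := congr1 (fun t : int => t%:~R : R) (hq i).
  rewrite rmorphD !rmorphM rmorphN /= => e.
  have -> : (g i)%:R = ((g i)%:Z)%:~R :> R by [].
  by rewrite -mulNr e addrK.
under eq_bigr => i _ do rewrite e mulrBl mulNr.
rewrite sumrB sumrN !mulrDr mulr_sumr rmorphD !rmorphM /=.
have <- : v%:~R * (\sum_i (c (lift ord0 i))%:~R * x i) =
    \sum_i (v%:~R * (c (lift ord0 i))%:~R * x i).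
  by rewrite mulr_sumr; apply: eq_bigr => i _; rewrite mulrA.
have -> : p%:R * (v%:~R * y) = v%:~R * (p%:R * y) by rewrite mulrCA.
rewrite -hy.
under [X in _ - (_ - X)]eq_bigr => i _ do rewrite -mulrA.
have -> : (p%:Z)%:~R = p%:R :> R by [].
ring.
Qed.

Lemma ROI_fin_nat (N : nat) : (0 < N)%N -> fin_mod (fun x : R => exists y, x = N%:R * y).
Proof.
have [m] := ubnP N; elim: m N => // m ih N; rewrite ltnS => Nm N0.
have [N1|N1] := leqP N 1.
  have -> : N = 1%N by apply/eqP; rewrite eqn_leq N1.
  by exists [:: 0] => x; exists 0; rewrite ?inE // subr0; exists x; rewrite mul1r.
have pp := pdiv_prime N1; set p := pdiv N in pp *.
have eN : N = (p * (N %/ p))%N by rewrite mulnC divnK ?pdiv_dvd.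
have N'0 : (0 < N %/ p)%N by rewrite divn_gt0 ?prime_gt0 // pdiv_leq.
have [|s hs] := ih (N %/ p)%N _ N'0.
  by apply: leq_trans Nm; rewrite ltn_Pdiv ?prime_gt1.
have [t ht] := ROI_fin_prime pp.
exists [seq r + p%:R * r' | r <- t, r' <- s] => x.
have [r rt [y hy]] := ht x; have [r' rs [z hz]] := hs y.
exists (r + p%:R * r'); first exact: allpairs_f.
exists z; rewrite {1}eN natrM -mulrA -hz mulrBr -hy; ring.
Qed.

Lemma ROI_fin (a : R) : a <> 0 -> fin_mod (fun x : R => exists y, x = a * y).
Proof.
move=> a0; have [b [N [N0 ab]]] := ROI_norm a0.
by apply: fin_modW (ROI_fin_nat N0) => _ [y ->]; exists (b * y); rewrite mulrA ab.
Qed.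

(** A maximal ideal containing 2: if 2 y = 1, a monic integral equation of y multiplied by 2^n
    expresses 1 as an even integer. *)
Lemma ROI_place : exists p : place R, True.
Proof.
have two : 2%:R <> 0 :> R.
  by move=> /(congr1 RF) /eqP; rewrite rmorph_nat rmorph0 -(rmorph_nat (in_alg F)) fmorph_eq0.
have [|m hm Jm] := ex_maxideal (ROI_fin two) (principal_ideal (2%:R : R)) (fun _ => id).
  case=> y /(congr1 RF); rewrite rmorph1 rmorphM rmorph_nat => e.
  have [q qm qy] : integralOver (@intmul F 1) (RF y) by exact/asboolP/int_valP.
  have q0 : (0 < size q)%N by rewrite size_poly_gt0 monic_neq0.
  pose n := (size q).-1; have sq : size q = n.+1 by rewrite /n prednK.
  have : \sum_(i < n.+1) (q`_i * 2%:Z ^+ (n - i))%:~R = 0 :> F.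
    transitivity (2%:R ^+ n * (map_poly (@intmul F 1) q).[RF y]).
      rewrite horner_coef size_map_inj_poly ?rmorph0 //; last first.
        by move=> u v /eqP; rewrite -subr_eq0 -rmorphB intrF_eq0 subr_eq0 => /eqP.
      rewrite sq mulr_sumr; apply: eq_bigr => i _; rewrite coef_map /= rmorphM rmorphXn /=.
      rewrite mulrCA; congr (_ * _).
      have in_ : (i <= n)%N by rewrite -ltnS.
      by rewrite -[X in 2%:R ^+ X * _](subnK in_) exprD -mulrA -exprMn -e expr1n mulr1.
    by rewrite (rootP qy) mulr0.
  rewrite big_ord_recr /= subnn expr0 mulr1 -{1}[n]/((size q).-1) -rmorph_sum /=.
  have -> : q`_n = 1 by move: qm; rewrite monicE => /eqP.
  rewrite -rmorphD => /eqP; rewrite intrF_eq0.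
  have -> : \sum_(i < n) q`_i * 2%:Z ^+ (n - i) = 2%:Z * (\sum_(i < n) q`_i * 2%:Z ^+ (n - i.+1)).
    by rewrite mulr_sumr; apply: eq_bigr => i _; rewrite mulrCA -exprS subnSK.
  set S := \sum_i _ => /eqP /(congr1 (fun t => (t %% 2)%Z)).
  by rewrite mulrC modzMDl.
by have [p _] := mk_place hm (Jm _ (ex_intro _ 1 (esym (mulr1 _)))) two; exists p.
Qed.

(** For a nonzero a in p, let k + 1 be the least exponent such that s p^(k+1) lies in aR for some s
    outside p. By minimality some y in p^k has s y outside aR, and z = s y / a. *)
Lemma ROI_inverse (p : place R) : exists z : F,
  (forall a, p a -> exists r, RF r = z * RF a) /\ forall r, RF r <> z.
Proof.
have ip := place_idealP p; have [a pa a0] := place_nonzero p.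
pose P n := exists s, ~ p s /\ forall y, ideal_pow p n y -> exists z, s * y = a * z.
have exP : exists n, `[< P n >].
  have [n [s [ps hs]]] := place_pow_sub ROI_fin p a0.
  by exists n; apply/asboolP; exists s.
case: (ex_minnP exP) => -[|k] /asboolP [s [ps hs]] kmin.
  case: ps; have [|z] := hs 1; last by rewrite mulr1 => ->; exact: idealMr.
  move=> K iK; apply; exists (fun=> 0); split; first by case.
  by rewrite big_ord0.
have [y [hy ny]] : exists y, ideal_pow p k y /\ forall z, s * y <> a * z.
  apply: contrapT => h; suff /kmin : `[< P k >] by rewrite ltnn.
  apply/asboolP; exists s; split=> // y hy.
  by apply: contrapT => hz; apply: h; exists y; split=> // z e; apply: hz; exists z.
have a0' : RF a != 0 by apply/eqP => h; apply: a0; apply: RF_inj; rewrite h rmorph0.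
exists (RF (s * y) / RF a); split=> [b pb|r hr].
  have [|z hz] := hs (y * b).
    have iP : ideal (ideal_pow p k.+1) by exact: gen_idealP.
    apply: (hy (fun y => ideal_pow p k.+1 (y * b))); first split.
    - by rewrite mul0r; exact: ideal0.
    - by move=> u v hu hv; rewrite mulrBl; exact: (idealB iP hu hv).
    - by move=> u v hv; rewrite -mulrA; exact: (idealMl u iP hv).
    move=> _ [t [pt ->]] K iK; apply.
    exists (fun i => if unlift ord_max i is Some j then t j else b); split.
      by move=> i; case: unlift.
    rewrite big_ord_recr /= unlift_none; congr (_ * _); apply: eq_bigr => i _.
    have -> : widen_ord (leqnSn k) i = lift ord_max i.
      by apply: val_inj; rewrite /= /bump leqNgt ltn_ord.
    by rewrite liftK.
  by exists z; apply: (mulfI a0'); rewrite [RHS]mulrA [RF a * (_ / _)]mulrC divfK // -!rmorphM -hz mulrA.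
by apply: (ny r); apply: RF_inj; rewrite [RHS]rmorphM hr [RHS]mulrC divfK.
Qed.

(** Let D be the set of t with all t c_i integral. If no t in D made the vector primitive at p, the
    element z of [ROI_inverse] would map D into itself, hence also the nonzero ideal D c_j0; this
    ideal being finitely generated, z would be integral. *)
Lemma ROI_inv (p : place R) n (c : 'I_n -> R) : (exists i, c i <> 0) ->
    exists u v (r : 'I_n -> R),
      [/\ v <> 0, forall i, u * c i = v * r i & exists i, ~ p (r i)].
Proof.
case=> j0 c0; have a0 : RF (c j0) != 0 by apply/eqP => h; apply: c0; apply: RF_inj; rewrite h rmorph0.
pose D (t : F) := forall i, exists r, RF r = t * RF (c i).
have [[t [Dt [i [r [hr pr]]]]]|h] := pselect (exists t, D t /\ exists i r, RF r = t * RF (c i) /\ ~ p r).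
  have [u [d [d0 hd]]] := RF_frac t.
  pose s i := projT1 (cid (Dt i)); have hs i : RF (s i) = t * RF (c i) := projT2 (cid (Dt i)).
  exists u, d%:~R, s; split.
  - move=> /(congr1 RF) /eqP; rewrite rmorph0 RF_int intrF_eq0; exact/negP.
  - by move=> k; apply: RF_inj; rewrite !rmorphM /= RF_int hs hd mulrA.
  by exists i => psi; apply: pr; have -> : r = s i by apply: RF_inj; rewrite hr hs.
have [z [hz nz]] := ROI_inverse p.
have Dz t : D t -> D (z * t).
  move=> Dt i; have [r hr] := Dt i.
  have pr : p r by apply: contrapT => pr; apply: h; exists t; split=> //; exists i, r.
  by have [r' hr'] := hz r pr; exists r'; rewrite hr' hr mulrA.
pose J (r : R) := exists2 t, D t & RF r = t * RF (c j0).
have [s hs] := ROI_fin c0.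
(* Generators of D c_j0: the representatives modulo c_j0 that belong to it, and c_j0 itself, placed
   first so that the generator of index 0 is nonzero. *)
pose g := c j0 :: [seq r <- s | `[< J r >]].
have D1 : D 1 by move=> i; exists (c i); rewrite mul1r.
have DR (r : R) t : D t -> D (RF r * t).
  by move=> Dt i; have [r' hr'] := Dt i; exists (r * r'); rewrite rmorphM /= hr' mulrA.
have DB t t' : D t -> D t' -> D (t - t').
  move=> Dt Dt' i; have [r hr] := Dt i; have [r' hr'] := Dt' i.
  by exists (r - r'); rewrite rmorphB /= hr hr' mulrBl.
have gJ (i : 'I_(size g)) : J g`_i.
  have : g`_i \in g by rewrite mem_nth.
  rewrite inE => /predU1P [->|]; first by exists 1; rewrite ?mul1r.
  by rewrite mem_filter => /andP [/asboolP].
have gM (i : 'I_(size g)) : exists M : 'I_(size g) -> R,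
    z * RF g`_i = \sum_j RF (M j) * RF g`_j.
  have [t Dt ht] := gJ i; have [x hx] := Dz t Dt j0.
  have [r rs [y hy]] := hs x.
  have Jr : J r.
    exists (z * t - RF y); first by apply: DB; [exact: Dz|rewrite -[RF y]mulr1; exact: DR].
    by rewrite mulrBl -hx -rmorphM mulrC -hy -rmorphB subKr.
  have rg : r \in [seq r <- s | `[< J r >]] by rewrite mem_filter rs andbT; apply/asboolP.
  have lt : (index r [seq r <- s | `[< J r >]] < size [seq r <- s | `[< J r >]])%N by rewrite index_mem.
  exists (fun j : 'I_(size g) => if unlift ord0 j is Some k then (k == Ordinal lt)%:R else y).
  rewrite big_ord_recl unlift_none (bigD1 (Ordinal lt)) //= liftK eqxx rmorph1 mul1r big1.
    by rewrite addr0 nth_index // ht mulrA -hx -rmorphM mulrC -hy -rmorphD subrK.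
  by move=> j /negPf jk; rewrite liftK jk rmorph0 mul0r.
pose M i := projT1 (cid (gM i)).
have [] := @RF_closed z; last by move=> r /nz.
apply: (@eigen_integral _ _ _ _ (fun i : 'I_(size g) => RF g`_i) _ M ord0) => //.
by move=> i; exact: (projT2 (cid (gM i))).
Qed.

Lemma ROI_dedekind : dedekind_like R.
Proof.
split; [exact: ROI_dom|exact/eqP/oner_neq0|exact: ROI_fin|exact: ROI_inv|exact: ROI_place].
Qed.
End RingOfIntegers.

(** * Localization and completion *)

Section QuotientModule.
Variables (R : comPzRingType) (V : lmodType R) (N : V -> Prop) (hN : submod N).

Lemma gen_subgroup_submod x : gen_subgroup N x <-> N x.
Proof.
split=> [h|Nx S _]; last exact.
apply: h => //; split=> [|y z]; first by case: hN.
exact: submodB.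
Qed.

Definition quotm (_ : submod N) : Type := quotg N.
HB.instance Definition _ := GRing.Zmodule.on (quotm hN).
Definition mproj (x : V) : quotm hN := qproj N x.
Definition qm_scale (a : R) (x : quotm hN) : quotm hN := mproj (a *: repr x).

Lemma mproj_eq x y : mproj x = mproj y <-> N (x - y).
Proof. by rewrite -gen_subgroup_submod; exact: qproj_eq. Qed.
Lemma mprojP (z : quotm hN) : exists x, z = mproj x. Proof. exact: qprojP. Qed.
Lemma mprojD x y : mproj (x + y) = mproj x + mproj y.
Proof. by rewrite -[RHS]/(qg_add (mproj x) (mproj y)) qg_add_proj. Qed.
Lemma qm_scaleE a x : qm_scale a (mproj x) = mproj (a *: x).
Proof.
apply/mproj_eq; rewrite -scalerBr; case: hN => _ _; apply.
by apply/mproj_eq; rewrite /mproj /qproj reprK.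
Qed.
Fact qm_scaleA a b x : qm_scale a (qm_scale b x) = qm_scale (a * b) x.
Proof. by have [y ->] := mprojP x; rewrite !qm_scaleE scalerA. Qed.
Fact qm_scale1 : left_id 1 qm_scale.
Proof. by move=> x; have [y ->] := mprojP x; rewrite qm_scaleE scale1r. Qed.
Fact qm_scaleDr : right_distributive qm_scale +%R.
Proof.
move=> a x y; have [x' ->] := mprojP x; have [y' ->] := mprojP y.
by rewrite -mprojD !qm_scaleE -mprojD scalerDr.
Qed.
Fact qm_scaleDl x : {morph qm_scale^~ x : a b / a + b}.
Proof. by move=> a b; have [y ->] := mprojP x; rewrite !qm_scaleE -mprojD scalerDl. Qed.
HB.instance Definition _ := GRing.Zmodule_isLmodule.Build R (quotm hN)
  qm_scaleA qm_scale1 qm_scaleDr qm_scaleDl.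
Lemma mproj_lin : linear mproj.
Proof. by move=> a x y; rewrite mprojD -qm_scaleE. Qed.
Lemma mproj_eq0 x : mproj x = 0 <-> N x.
Proof. by rewrite -[0]/(mproj 0) mproj_eq subr0. Qed.
End QuotientModule.

Record frac_field (R : comPzRingType) (K : calg R) : Prop := FracField {
  ff_inj : injective (calg_str K);
  ff_frac : forall x : K, exists (d a : R), d <> 0 /\ calg_str K d * x = calg_str K a;
  ff_inv : forall d : R, d <> 0 -> exists k : K, calg_str K d * k = 1
}.

Section Localization.
Variables (R : comPzRingType) (dom : forall a b : R, a * b = 0 -> a = 0 \/ b = 0).
Hypothesis nz : 1 <> 0 :> R.
Variables (K : calg R) (ffK : frac_field K) (N : lmodType R).
Let f := calg_str K.

Lemma dom_neq0 (a b : R) : a <> 0 -> b <> 0 -> a * b <> 0.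
Proof. by move=> a0 b0 /dom []. Qed.

(** Meaningful only when e x is integral, and 0 otherwise; the germs used below look only at
    multiples of a denominator of x. *)
Definition frac_num (x : K) (e : R) : R := xget 0 [set a | f a = f e * x]%classic.

Lemma frac_numE x e a : f a = f e * x -> frac_num x e = a.
Proof.
move=> h; apply: (ff_inj ffK); rewrite -/f h.
by rewrite /frac_num; case: xgetP => [b -> //|/(_ a)]; case.
Qed.

Let germ0 (h : R -> N) : Prop := exists2 d, d <> 0 & forall e, h (d * e) = 0.

Lemma germ0_submod : @submod R (R -> N) germ0.
Proof.
split; first by exists 1.
- move=> h h' [d d0 hd] [d' d'0 hd']; exists (d * d'); first exact: dom_neq0.
  move=> e; rewrite -[X in X = _]/(h (d * d' * e) + h' (d * d' * e)).
  by rewrite -mulrA hd mulrCA hd' addr0.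
- move=> a h [d d0 hd]; exists d => // e.
  by rewrite -[X in X = _]/(a *: h (d * e)) hd scaler0.
Qed.

(* An element of K (x) N is sent to the germ at 0, for divisibility, of the
   function mapping a denominator to the corresponding numerator. *)
Lemma frac_tens_eq0 (y : N) : tens (1 : K) y = 0 -> exists2 d : R, d <> 0 & d *: y = 0.
Proof.
pose b (x : K) (y : N) : quotm germ0_submod := mproj germ0_submod (fun e => frac_num x e *: y).
have hb : bilin b.
  split=> [z c x x'|x c z z'] /=; rewrite /b -mproj_lin; apply/mproj_eq.
    have [d [a [d0 hd]]] := ff_frac ffK x; have [d' [a' [d'0 hd']]] := ff_frac ffK x'.
    exists (d * d'); first exact: dom_neq0.
    move=> e; rewrite -[X in X = _]/(frac_num (c *: x + x') (d * d' * e) *: z -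
      (c *: (frac_num x (d * d' * e) *: z) + frac_num x' (d * d' * e) *: z)).
    rewrite (@frac_numE x _ (a * (d' * e))); last first.
      by rewrite !rmorphM /= -hd -/f; ring.
    rewrite (@frac_numE x' _ (a' * (d * e))); last first.
      by rewrite !rmorphM /= -hd' -/f; ring.
    rewrite (@frac_numE _ _ (c * (a * (d' * e)) + a' * (d * e))).
      by rewrite scalerDl scalerA subrr.
    rewrite !(rmorphD, rmorphM) /= -hd -hd' -/f.
    by rewrite -[c *: x]/(f c * x); ring.
  exists 1 => // e; rewrite -[X in X = _]/(frac_num x (1 * e) *: (c *: z + z') -
    (c *: (frac_num x (1 * e) *: z) + frac_num x (1 * e) *: z')).
  by rewrite scalerDr !scalerA mulrC subrr.
move=> h; have : tlift b (tens (1 : K) y) = 0 by rewrite h (lin0 (tliftP hb)).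
rewrite tlift_tens // => /mproj_eq0 [d d0 hd]; exists d => //.
by have := hd 1; rewrite mulr1 (@frac_numE _ _ d) // mulr1.
Qed.
End Localization.

(** * Completion at an ideal *)

Section CompletionTheory.
Variables (R : comPzRingType) (p : R -> Prop) (ip : ideal p).
Local Notation cmp := (to_completion p).

Lemma ideal_pow_ideal n : ideal (ideal_pow p n). Proof. exact: gen_idealP. Qed.

Lemma ideal_pow_pow t n : p t -> ideal_pow p n (t ^+ n).
Proof.
move=> pt J iJ; apply; exists (fun=> t); split=> //.
by rewrite prodr_const card_ord.
Qed.

Lemma ideal_pow_mul a t n : p t -> ideal_pow p n (a * t ^+ n).
Proof.
by move=> pt; have [_ _] := ideal_pow_ideal n; apply; exact: ideal_pow_pow.
Qed.

Lemma completion_eq (x y : cohseq p) :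
  rproj (fun x : cohseq p => forall n, ideal_pow p n (x n)) x =
  rproj (fun x : cohseq p => forall n, ideal_pow p n (x n)) y <->
  forall n, ideal_pow p n (x n - y n).
Proof.
rewrite rproj_eq; split=> [h|h J _]; last by apply.
apply: (h (fun x : cohseq p => forall n, ideal_pow p n (x n))) => //; split.
- by move=> n; exact: ideal0 (ideal_pow_ideal n).
- by move=> u v hu hv n; exact: idealB (ideal_pow_ideal n) (hu n) (hv n).
- by move=> u v hv n; exact: idealMl (ideal_pow_ideal n) (hv n).
Qed.

Lemma completion_approx (r : completion p) a b : cmp a = cmp b * r ->
  forall n, exists c, ideal_pow p n (a - b * c).
Proof.
have [x ->] := rprojP r; rewrite /to_completion -rprojM => /completion_eq h n.
by exists (x n); exact: h.
Qed.

(** Geometric series: with t = 1 - s y in p, the partial sums of y (1 + t + t^2 + ...) are coherent,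
    and s times the n-th one is 1 - t^n. *)
Lemma completion_unit s y : p (1 - s * y) -> exists t, cmp s * t = 1.
Proof.
set t := 1 - s * y => pt.
pose x n := y * \sum_(i < n) t ^+ i.
have hx : x \in coherent p.
  apply/asboolP => n; rewrite /x -mulrBr big_ord_recr /= addrAC subrr add0r.
  exact: ideal_pow_mul.
exists (rproj (fun x : cohseq p => forall n, ideal_pow p n (x n)) (Cohseq hx)).
rewrite /to_completion -rprojM -[RHS]/(rproj _ (1 : cohseq p)); apply/completion_eq => n /=.
rewrite -[X in ideal_pow p n X]/(s * (y * \sum_(i < n) t ^+ i) - 1).
have -> : s * (y * \sum_(i < n) t ^+ i) - 1 = (-1) * t ^+ n.
  have -> : s * (y * \sum_(i < n) t ^+ i) = (1 - t) * \sum_(i < n) t ^+ i.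
    have -> : 1 - t = s * y by rewrite /t opprB addrC subrK.
    by rewrite mulrA.
  elim: n => [|n ih]; first by rewrite big_ord0 mulr0 sub0r expr0 mulN1r.
  by rewrite big_ord_recr /= mulrDr addrAC ih exprS; ring.
exact: ideal_pow_mul.
Qed.
End CompletionTheory.

(** * Torsion-free modules and dual bases over R *)

Section ModuleTheory.
Variable R : comPzRingType.
Implicit Types M N P : lmodType R.

Definition torsion_free M := forall (r : R) (x : M), r <> 0 -> r *: x = 0 -> x = 0.

Lemma flat_torsion_free M : (forall a b : R, a * b = 0 -> a = 0 \/ b = 0) ->
  flat M -> torsion_free M.
Proof.
move=> dom fM r x r0 rx.
pose g (y : R^o) : R^o := r * y.
have hg : linear g by move=> a u v; rewrite /g !regE; ring.
pose gm := GRing.isLinear.Build _ _ _ _ g hg.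
pose gL : {linear R^o -> R^o} := HB.pack g gm.
have gI : injective gL.
  move=> u v /eqP; rewrite /= /g -subr_eq0 -mulrBr => /eqP /dom [/r0 //|/eqP].
  by rewrite subr_eq0 => /eqP.
have hs : bilin (fun (a : R^o) (x : M) => a *: x).
  by split=> [y a u v|u a v w] /=; rewrite ?scalerDl ?scalerDr !scalerA // mulrC.
have h : tens (1 : R^o) x = 0.
  apply: (fM _ _ _ gI); rewrite [RHS](lin0 (tmap_linear _ (@id_linear _ _))) //.
  rewrite tmap_tens // /= /g mulr1.
  have -> : (r : R^o) = r *: (1 : R^o) by rewrite regE mulr1.
  by rewrite (bilinZl (tens_bilin _ _)) -(bilinZr (tens_bilin _ _)) rx (bilin0r (tens_bilin _ _)).
by have := tlift_tens hs 1 x; rewrite h (lin0 (tliftP hs)) scale1r.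
Qed.

Definition contr N M (f : dual M) : tensor N M -> N := tlift (fun n m => (f m : R) *: n).

Lemma contr_bilin N M (f : dual M) : bilin (fun (n : N) (m : M) => (f m : R) *: n).
Proof.
split=> [h r x y|c r x y] /=; first by rewrite scalerDr !scalerA mulrC.
by rewrite dual_lin scalerDl scalerA.
Qed.
Lemma contr_linear N M (f : dual M) : linear (@contr N M f).
Proof. exact/tliftP/contr_bilin. Qed.
Lemma contr_tens N M (f : dual M) (n : N) m : contr f (tens n m) = (f m : R) *: n.
Proof. by rewrite /contr (tlift_tens (contr_bilin _ _)). Qed.

(** For s = 1 a finite dual basis, which exhibits M as finitely generated projective. The factor s
    makes the notion local: the s that admit such a list form an ideal. *)
Definition dbasis M (s : R) (l : seq (M * dual M)) : Prop :=
  forall y, s *: y = \sum_(q <- l) (q.2 y : R) *: q.1.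

Lemma linear_sum M N (f : M -> N) I (r : seq I) (P : pred I) F : linear f ->
  f (\sum_(i <- r | P i) F i) = \sum_(i <- r | P i) f (F i).
Proof.
by move=> hf; apply: (big_morph f) => [x y|]; [exact: linD|exact: lin0].
Qed.

Lemma contr_dbasis N M (l : seq (M * dual M)) (z : tensor N M) : dbasis 1 l ->
  z = \sum_(q <- l) tens (contr q.2 z) q.1.
Proof.
move=> hl; move: z; apply: tlin_eq => //.
  move=> a x y; rewrite scaler_sumr -big_split /=; apply: eq_bigr => q _.
  by rewrite contr_linear (tens_bilin _ _).1.
move=> n m; under eq_bigr => q _.
  rewrite contr_tens (bilinZl (tens_bilin _ _)) -(bilinZr (tens_bilin _ _)); over.
by rewrite -(linear_sum _ _ _ ((tens_bilin _ _).2 n)) -hl scale1r.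
Qed.

Section LocalBasis.
Variables (dk : dedekind_like R) (M : lmodType R).
Hypotheses (fM : fingen M) (tM : torsion_free M).

(** n is minimal among families spanning M up to a factor outside p. A nontrivial relation could be
    made primitive at p by [dk_inv], as M is torsion free, and would then eliminate a generator;
    hence coordinates are unique. *)
Lemma local_basis (p : place R) : exists n (c : 'I_n -> M) (g : 'I_n -> dual M) (s : R),
  [/\ ~ p s, forall x, s *: x = \sum_i (g i x : R) *: c i
    & forall i j, (g i (c j) : R) = s * (i == j)%:R].
Proof.
pose P n := exists (c : 'I_n -> M) (s : R), ~ p s /\
  forall x, exists k : 'I_n -> R, s *: x = \sum_i k i *: c i.
have exP : exists n, `[< P n >].
  have [n [v hv]] := fM; exists n; apply/asboolP; exists v, 1; split; first exact: place_proper.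
  by move=> x; rewrite scale1r; exact: hv.
case: (ex_minnP exP) => n /asboolP [c [s [ps hs]]] nmin.
have ind (r : 'I_n -> R) : \sum_i r i *: c i = 0 -> forall i, r i = 0.
  move=> hr i; apply: contrapT => ri.
  have [|u [v [t [v0 hut [i0 pt]]]]] := dk_inv dk p (c := r); first by exists i.
  have ht : \sum_j t j *: c j = 0.
    apply: (tM v0); rewrite -[RHS](scaler0 _ u) -{2}hr !scaler_sumr.
    by apply: eq_bigr => j _; rewrite !scalerA hut.
  case: n c hs nmin r hr i ri t hut i0 pt ht {exP} => [c hs nmin r hr []//|n].
  move=> c hs nmin r hr i ri t hut i0 pt ht.
  suff /nmin : `[< P n >] by rewrite ltnn.
  apply/asboolP; exists (fun j => c (lift i0 j)), (t i0 * s); split.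
    by case/place_prime.
  move=> x; have [k hk] := hs x.
  exists (fun j => t i0 * k (lift i0 j) - k i0 * t (lift i0 j)).
  rewrite -scalerA hk (bigD1_ord i0) //= scalerDr scalerA mulrC -scalerA.
  have -> : t i0 *: c i0 = - \sum_j t (lift i0 j) *: c (lift i0 j).
    by apply/eqP; rewrite -addr_eq0; move: ht; rewrite (bigD1_ord i0) //= => ->.
  rewrite scalerN !scaler_sumr addrC -sumrB; apply: eq_bigr => j _.
  by rewrite scalerBl !scalerA.
have uniq (k k' : 'I_n -> R) : \sum_i k i *: c i = \sum_i k' i *: c i -> k =1 k'.
  move=> h i; apply/eqP; rewrite -subr_eq0; apply/eqP.
  apply: (ind (fun i => k i - k' i)).
  by under eq_bigr => j _ do rewrite scalerBl; rewrite sumrB h subrr.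
pose k x := projT1 (cid (hs x)).
have hk x : s *: x = \sum_i k x i *: c i := projT2 (cid (hs x)).
have klin i : linear (fun x => k x i : R^o).
  move=> a x y; move: i; apply: uniq; rewrite -hk scalerDr scalerA mulrC -scalerA !hk.
  rewrite scaler_sumr -big_split /=; apply: eq_bigr => i _.
  by rewrite scalerDl -scalerA.
exists n, c, (fun i => mkdual (klin i)), s; split=> //= i j; rewrite /=.
move: i; apply: uniq; rewrite -hk (bigD1 j) //= eqxx mulr1 big1 ?addr0 // => i /negPf ->.
by rewrite mulr0 scale0r.
Qed.

Lemma fg_dbasis : exists l : seq (M * dual M), dbasis 1 l.
Proof.
apply: (place_cover (dk_fin dk) (dk_place dk) (J := fun s => exists l, dbasis s l)).
  split.
  - by exists [::] => y; rewrite big_nil scale0r.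
  - move=> a b [l hl] [l' hl']; exists (l ++ [seq (- q.1, q.2) | q <- l']) => y.
    rewrite big_cat /= -hl big_map scalerBl hl'; congr (_ + _); rewrite -sumrN.
    by apply: eq_bigr => q _; rewrite scalerN.
  - move=> a b [l hl]; exists [seq (a *: q.1, q.2) | q <- l] => y.
    rewrite -scalerA hl big_map scaler_sumr; apply: eq_bigr => q _.
    by rewrite !scalerA mulrC.
move=> p; have [n [c [g [s [ps hs _]]]]] := local_basis p; exists s => //.
exists [seq (c i, g i) | i : 'I_n] => y; rewrite hs big_map /=.
by rewrite big_enum.
Qed.
End LocalBasis.
End ModuleTheory.

(** * Locally free modules of rank one *)

Section IdealMultiples.
Variables (B : comPzRingType) (I : B -> Prop) (M : lmodType B).

Inductive idmod : M -> Prop :=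
| idmod0 : idmod 0
| idmodD x y : idmod x -> idmod y -> idmod (x + y)
| idmodM a y : I a -> idmod (a *: y).

Lemma idmodZ b x : idmod x -> idmod (b *: x).
Proof.
elim=> [|u v _ hu _ hv|a y Ia]; first by rewrite scaler0; exact: idmod0.
  by rewrite scalerDr; exact: idmodD.
by rewrite scalerA mulrC -scalerA; exact: idmodM.
Qed.
Lemma idmod_submod : submod idmod.
Proof. split; [exact: idmod0|exact: idmodD|exact: idmodZ]. Qed.

Lemma idmod_gen n (x : 'I_n -> M) y : ideal I ->
  (forall y, exists c, y = \sum_i c i *: x i) -> idmod y ->
  exists2 c : 'I_n -> B, (forall i, I (c i)) & y = \sum_i c i *: x i.
Proof.
move=> hI gen hy.
elim: hy => [|_ _ _ [c hc ->] _ [d hd ->]|a z Ia].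
- by exists (fun=> 0) => [i|]; [exact: ideal0|rewrite big1 // => i _; rewrite scale0r].
- exists (fun i => c i + d i) => [i|]; first exact: idealD.
  by rewrite -big_split /=; apply: eq_bigr => i _; rewrite scalerDl.
have [c ->] := gen z; exists (fun i => a * c i) => [i|]; first exact: idealMr.
by rewrite scaler_sumr; apply: eq_bigr => i _; rewrite scalerA.
Qed.
End IdealMultiples.

Lemma fin_mod_fg (R : comPzRingType) (M : lmodType R) (p : R -> Prop) :
  ideal p -> fin_mod p -> fingen M -> fin_mod (@idmod R p M).
Proof.
move=> ip [s hs] [n [x gen]].
exists [seq \sum_i s`_(f i) *: x i | f : {ffun 'I_n -> 'I_(size s)}] => y.
have [c ->] := gen y.
have hc i : exists j : 'I_(size s), p (c i - s`_j).
  have [r rs hr] := hs (c i); have lt : (index r s < size s)%N by rewrite index_mem.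
  by exists (Ordinal lt); rewrite nth_index.
pose f := [ffun i => projT1 (cid (hc i))].
exists (\sum_i s`_(f i) *: x i); first by apply/mapP; exists f; rewrite ?mem_enum.
rewrite -sumrB; apply: submod_sum; first exact: idmod_submod.
move=> i _; rewrite -scalerBl; apply: idmodM; rewrite ffunE.
exact: (projT2 (cid (hc i))).
Qed.

Section LocalGeneration.
Variables (R : comPzRingType) (dk : dedekind_like R) (A : calg R).
Hypothesis fA : fingen A.
Implicit Types (p : place R) (M : lmodType (calg_ring A)).

Definition pideal p : calg_ring A -> Prop := @idmod R p A.

Lemma pideal_str p s : p s -> pideal p (calg_str A s).
Proof. by move=> ps; have := idmodM (M := A) 1 ps; rewrite -[_ *: _]/(calg_str A s * 1) mulr1. Qed.

Lemma pideal_fin p : fin_mod (pideal p).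
Proof. exact: fin_mod_fg (place_idealP p) (place_fin (dk_fin dk) p) fA. Qed.

Lemma pideal_unit p m s : maxideal m -> (forall x, pideal p x -> m x) -> ~ p s -> ~ m (calg_str A s).
Proof.
move=> hm pm ps ms; have [y py] := place_invert (dk_fin dk) ps.
case: (hm) => im m1 _; apply: m1; have := pm _ (pideal_str py).
rewrite rmorphB rmorphM rmorph1 => h.
by rewrite -(subrK (calg_str A s * calg_str A y) 1); apply: idealD => //; exact: idealMr.
Qed.

Lemma fingen_res M : fingen (res M) -> exists n (x : 'I_n -> M),
  (forall y : res M, exists c : 'I_n -> R, y = \sum_i c i *: (x i : res M)) /\
  (forall y, exists c : 'I_n -> calg_ring A, y = \sum_i c i *: x i).
Proof.
case=> n [x gen]; exists n, x; split=> // y; have [c hc] := gen y.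
by exists (fun i => calg_str A (c i)).
Qed.

(** Nakayama's lemma twice: over A, at the maximal ideals above p, to get M = N + pM; then over R,
    to absorb pM after multiplication by some s outside p. *)
Lemma local_gen M (N : M -> Prop) p : fingen (res M) -> submod N ->
  (forall m, maxideal m -> (forall x, pideal p x -> m x) ->
     forall x, exists2 y, N y & idmod m (x - y)) ->
  exists s, ~ p s /\ forall x, N (calg_str A s *: x).
Proof.
move=> /fingen_res [n [x [genR genA]]] hN hm.
pose J0 := pideal p; pose N' x := exists2 y, N y & idmod J0 (x - y).
have hI := @idmod_submod _ J0 M.
have hN' : submod N'.
  split; first by exists 0; [case: hN|rewrite subr0; case: hI].
    move=> u v [u' Nu hu] [v' Nv hv]; exists (u' + v'); first by case: hN => _ h _; exact: h.
    by rewrite opprD addrACA; exact: idmodD.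
  move=> a u [u' Nu hu]; exists (a *: u'); first by case: hN => _ _; exact.
  by rewrite -scalerBr; exact: idmodZ.
have all y : N' y.
  apply: (semilocal_gen (pideal_fin p) hN' genA).
    by move=> a z Ja; exists 0; [case: hN|rewrite subr0; exact: (@idmodM _ J0 M)].
  move=> m mm pm i; have [z Nz hz] := hm m mm pm (x i).
  have [c mc hc] := idmod_gen (maxidealP mm) genA hz; exists c => //.
  by exists z => //; rewrite -hc subKr subrr; exact: idmod0.
have hNR : @submod R (res M) N.
  by case: hN => N0 ND NZ; split=> // a y; exact: NZ.
have sub (y : M) : idmod J0 y -> @idmod R p (res M) y.
  elim=> [|u v _ hu _ hv|a z]; [exact: idmod0|exact: idmodD|].
  elim=> [|b c _ hb _ hc|r b pr]; first by rewrite scale0r; exact: idmod0.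
    by rewrite scalerDl; exact: idmodD.
  by rewrite -[r *: b]/(calg_str A r * b) -scalerA; exact: (@idmodM R p (res M)).
have [|s ps hs] := @nakayama R (res M) p N _ x (place_idealP p) hNR.
  move=> i; have [z Nz /sub hz] := all (x i).
  have [c pc hc] := idmod_gen (place_idealP p) genR hz; exists c => //.
  by rewrite -hc subKr.
exists s; split=> [p1|y].
  apply: (place_proper (p := p)); rewrite -(subrK s 1).
  by apply: idealD => //; exact: place_idealP.
have [c ->] := genR y; rewrite -[_ *: _]/(s *: (_ : res M)) scaler_sumr.
apply: submod_sum => // i _; rewrite scalerA mulrC -scalerA.
by case: hNR => _ _; apply; exact: hs.
Qed.

Definition gen_at M p (l : M) : Prop :=
  exists s, ~ p s /\ forall x : M, exists a, calg_str A s *: x = a *: l.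
Definition free_elt M (l : M) : Prop := forall a, a *: l = 0 -> a = 0.
(** Local freeness of rank one. The generator at p is an element of M itself, which generates after
    inverting one s outside p. *)
Definition is_line M : Prop := forall p, exists l : M, gen_at p l /\ free_elt l.

Lemma ex_gen_at M p : fingen (res M) ->
  (forall m, maxideal m -> (forall x, pideal p x -> m x) ->
     exists l : M, forall x, exists a, idmod m (x - a *: l)) ->
  exists l : M, gen_at p l.
Proof.
move=> fM hm.
have [||l hl] := @semilocal_choice _ _ (pideal_fin p) M
    (fun m l => forall x, exists a, idmod m (x - a *: l)).
- exact: hm.
- move=> m mm pm a l x ma gl y; have [b hb] := gl y; exists b.
  rewrite scalerDr opprD addrA; apply: (submodB (idmod_submod _ _) hb).
  by rewrite scalerA; apply: idmodM; exact: idealMl (maxidealP mm) ma.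
exists l.
have [||s [ps hs]] := @local_gen M (fun x => exists a, x = a *: l) p fM.
- split; first by exists 0; rewrite scale0r.
    by move=> _ _ [a ->] [b ->]; exists (a + b); rewrite scalerDl.
  by move=> a _ [b ->]; exists (a * b); rewrite scalerA.
- move=> m mm pm x; have [a ha] := hl m mm pm x; exists (a *: l) => //.
  by exists a.
by exists s.
Qed.
End LocalGeneration.

(** * The dual algebra as an R-module *)

Section GroupScheme.
Variables (R : comPzRingType) (dk : dedekind_like R) (G : group_scheme R).
Local Notation O := (gs_alg G).
Local Notation A := (cdual G).
Local Notation AR := (cdual_ring G).

(** A carries two actions of R, multiplication by the image under [cdual_str] and pointwise scaling
    of linear forms; here they are identified. *)
Lemma cdual_scaleE (c : R) (a : A) (h : O) : (c *: a : AR) h = c * (a : AR) h.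
Proof.
have -> : c *: a = (c *: (a : AR) : AR); last by [].
rewrite -[LHS]/((c *: (1 : AR)) * (a : AR)).
rewrite -{2}(mul1r (a : AR)); apply: dual_eq => x.
rewrite -[LHS]/(tlift (fun u v => (c *: (1 : AR)) u * (a : AR) v : R^o) (gs_mul x)).
rewrite -[RHS]/(c *: tlift (fun u v => (1 : AR) u * (a : AR) v : R^o) (gs_mul x)).
rewrite /tlift /tsum scaler_sumr; apply: eq_bigr => q _.
by rewrite -[LHS]/((c * _) * _) regE mulrA.
Qed.

Lemma O_tf : torsion_free O.
Proof. exact: flat_torsion_free (dk_dom dk) (@gs_flat _ G). Qed.

Lemma O_dbasis : exists l : seq (O * dual O), dbasis 1 l.
Proof. exact: (@fg_dbasis R dk O (@gs_finite _ G) (@O_tf)). Qed.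

Lemma eval_linear (h : O) : linear (fun a : A => (a : AR) h : R^o).
Proof. by move=> c a b; rewrite -[LHS]/((c *: a : AR) h + (b : AR) h) cdual_scaleE. Qed.
Definition eval (h : O) : dual A := mkdual (eval_linear h).

Lemma cdual_sum I (r : seq I) (F : I -> A) (h : O) :
  ((\sum_(i <- r) F i : A) : AR) h = \sum_(i <- r) (F i : AR) h.
Proof. exact: (linear_sum _ _ _ (eval_linear h)). Qed.

Lemma A_dbasis (l : seq (O * dual O)) : dbasis 1 l ->
  dbasis 1 [seq ((q.2 : A), eval q.1) | q <- l].
Proof.
move=> hl a; rewrite scale1r big_map /=; apply: dual_eq => h; rewrite cdual_sum.
rewrite -{1}[h]scale1r hl (linear_sum _ _ _ (dual_lin (a : AR))).
apply: eq_bigr => q _; rewrite cdual_scaleE.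
by rewrite (linZ (dual_lin (a : AR))) regE mulrC.
Qed.

Lemma dbasis_fingen (M : lmodType R) (l : seq (M * dual M)) : dbasis 1 l -> fingen M.
Proof.
move=> hl; exists (size l), (fun i => (tnth (in_tuple l) i).1) => x.
exists (fun i => (tnth (in_tuple l) i).2 x).
by rewrite -[x in LHS]scale1r hl big_tnth.
Qed.

Lemma A_fingen : fingen A.
Proof. by have [l /A_dbasis /dbasis_fingen] := O_dbasis. Qed.
End GroupScheme.

(** * Torsors as line bundles on the dual group *)

Section TorsorTheory.
Variables (R : comPzRingType) (dk : dedekind_like R) (G : group_scheme R).
Local Notation O := (gs_alg G).
Local Notation A := (cdual G).
Local Notation AR := (cdual_ring G).
Local Notation D := (@gs_mul R G).

Lemma space_scaleE (X : gspace G) (a : AR) (c : space_mod X) :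
  a *: c = contr (a : dual O) (gsp_act (c : gsp_alg X)).
Proof. by []. Qed.

Lemma space_str (X : gspace G) r (c : space_mod X) :
  calg_str A r *: c = (r *: (c : gsp_alg X) : gsp_alg X).
Proof.
rewrite space_scaleE -{2}[c](@gsp_act1 _ _ X) /contr /tlift /tsum scaler_sumr.
by apply: eq_bigr => q _; rewrite scalerA.
Qed.

Lemma contr_mull (B C : calg R) (f : dual C) (b : B) (z : tensor B C) :
  contr f (tens b (1 : C) * z) = b * contr f z.
Proof.
move: z; apply: tlin_eq.
- exact: linear_comp (contr_linear _) (tensM_linr _).
- exact: linear_comp (lmul_linear b) (contr_linear _).
by move=> b' c; rewrite tensM !contr_tens mul1r cscalerAr.
Qed.

Variable X : torsor G.
Local Notation C := (gsp_alg X).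

Definition galois : tensor C C -> tensor C O :=
  tlift (fun a b : C => (tens a (1 : O) : tensor C O) * gsp_act b).

Lemma galois_bilin : bilin (fun a b : C => (tens a (1 : O) : tensor C O) * gsp_act b).
Proof.
split=> [b r a a'|a r b b'] /=.
  by rewrite (tens_bilin _ _).1 tensM_linl.
by rewrite (gsp_act_hom X).1 tensM_linr.
Qed.
Lemma galois_linear : linear galois. Proof. exact/tliftP/galois_bilin. Qed.
Lemma galois_tens a b : galois (tens a b) = tens a (1 : O) * gsp_act b.
Proof. by rewrite /galois (tlift_tens galois_bilin). Qed.
Lemma galois_mull (c : C) (z : tensor C C) : galois (tens c (1 : C) * z) = tens c (1 : O) * galois z.
Proof.
move: z; apply: tlin_eq.
- exact: linear_comp galois_linear (tensM_linr _).
- exact: linear_comp (tensM_linr _) galois_linear.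
by move=> a b; rewrite tensM !galois_tens mul1r mulrA tensM mulr1.
Qed.
Lemma galois_bij : bijective galois. Proof. exact: tors_free. Qed.
Lemma galois_surj w : exists z, galois z = w.
Proof. by have [g _ h] := galois_bij; exists (g w). Qed.

Lemma tors_neq0 : 1 <> 0 :> C.
Proof.
move=> C0; apply: (dk_nz dk).
have := (tors_fflat X).2 (R : comPzRingType)^o; apply=> z.
rewrite (tensE z) big1 // => q _.
have -> : q.2 = 0 :> C by rewrite -[q.2 : C]mul1r C0 mul0r.
exact: (bilin0r (tens_bilin _ _)).
Qed.

Lemma tors_tf : torsion_free C.
Proof. exact: (flat_torsion_free (dk_dom dk) (@proj1 _ _ (tors_fflat X))). Qed.

(** Faithfully flat descent of finiteness. Through the Galois isomorphism C (x) C is finitely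
    generated over C; if N is the span of the second factors occurring in generators, then C (x)
    (C/N) = 0, so C = N. *)
Lemma tors_fingen : fingen C.
Proof.
have [l hl] := O_dbasis dk G.
pose z (o : O) := projT1 (cid (galois_surj (tens (1 : C) o))).
have hz o : galois (z o) = tens (1 : C) o := projT2 (cid (galois_surj (tens (1 : C) o))).
(* All second tensor factors in the preimages of the generators 1 (x) o of C (x) O. *)
pose E : seq C := flatten [seq [seq r.2 | r <- repr (z q.1)] | q <- l].
pose N (y : C) := exists k : 'I_(size E) -> R, y = \sum_i k i *: E`_i.
have hN : submod N.
  split; first by exists (fun=> 0); rewrite big1 // => i _; rewrite scale0r.
    move=> _ _ [k ->] [k' ->]; exists (fun i => k i + k' i); rewrite -big_split /=.
    by apply: eq_bigr => i _; rewrite scalerDl.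
  move=> a _ [k ->]; exists (fun i => a * k i); rewrite scaler_sumr.
  by apply: eq_bigr => i _; rewrite scalerA.
have NE y : y \in E -> N y.
  move=> yE; have lt : (index y E < size E)%N by rewrite index_mem.
  exists (fun i => (i == Ordinal lt)%:R); rewrite (bigD1 (Ordinal lt)) //= eqxx scale1r.
  by rewrite nth_index // big1 ?addr0 // => i /negPf ->; rewrite scale0r.
suff all y : N y by exists (size E), (fun i => E`_i).
apply/(mproj_eq0 hN); apply: (tors_fflat X).2 => {y} z0.
have sb : bilin (fun (c y : C) => tens (mproj hN y) c).
  split=> [y|c] /=; first exact: (tens_bilin _ _).2.
  by move=> a u v; rewrite mproj_lin (tens_bilin _ _).1.
suff key (c y : C) : tens (mproj hN y) c = 0.
  rewrite (tensE z0) big1 // => -[y c] _; have [y' ->] := mprojP y; exact: key.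
rewrite -(tlift_tens sb).
have -> : tens c y = \sum_(q <- l) tens (contr q.2 (galois (tens c y))) (1 : C) * z q.1.
  have [g gK _] := galois_bij; apply: (can_inj gK).
  rewrite (linear_sum _ _ _ galois_linear) {1}(contr_dbasis (galois (tens c y)) hl).
  by apply: eq_bigr => q _; rewrite galois_mull hz tensM mulr1 mul1r.
rewrite (linear_sum _ _ _ (tliftP sb)) big_seq big1 // => q ql.
rewrite {1}(tensE (z q.1)) mulr_sumr (linear_sum _ _ _ (tliftP sb)) big_seq big1 // => r rz.
rewrite tensM mul1r (tlift_tens sb); have -> : mproj hN r.2 = 0.
  apply/mproj_eq0/NE; apply/flattenP.
  exists [seq r.2 | r <- repr (z q.1)]; first by apply/mapP; exists q.
  by apply/mapP; exists r.
exact: (bilin0l (tens_bilin _ _)).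
Qed.

Lemma tors_dbasis : exists l : seq (C * dual C), dbasis 1 l.
Proof. exact: (@fg_dbasis R dk C tors_fingen (@tors_tf)). Qed.

Lemma res_space_fingen : fingen (res (A := A) (space_mod X)).
Proof.
have [n [x gen]] := tors_fingen; exists n, x => y; have [c hc] := gen y.
by exists c; rewrite [LHS]hc; apply: eq_bigr => i _; rewrite resE space_str.
Qed.

Lemma inv_linear_cst : linear (fun h : O => tens (1 : C) (gs_inv h)).
Proof. by move=> a x y; rewrite (gs_inv_hom G).1 (tens_bilin _ _).2. Qed.

Let Phi : tensor (tensor C O) O -> tensor C O :=
  tlift (fun (w : tensor C O) (h : O) => w * tens (1 : C) (gs_inv h)).

Lemma Phi_bilin : bilin (fun (w : tensor C O) (h : O) => w * tens (1 : C) (gs_inv h)).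
Proof.
split=> [h|w] a x y /=; first exact: tensM_linl.
by rewrite inv_linear_cst tensM_linr.
Qed.

(** u_0 (x) u_1 S(u_2) = u (x) 1, by coassociativity and the antipode axiom; the axiom is given with
    S on the left factor and is turned around by cocommutativity. *)
Lemma act_inv (u : C) : Phi (tmap (@gsp_act _ _ X) id (gsp_act u)) = tens u (1 : O).
Proof.
pose S (y : tensor O O) : O := tlift (fun a b : O => a * gs_inv b) y.
have hSb : bilin (fun a b : O => a * gs_inv b).
  split=> [b r a a'|a r b b'] /=; first by rewrite mulrDl cscalerAl.
  by rewrite (gs_inv_hom G).1 mulrDr cscalerAr.
have hSb' : bilin (fun a b : O => gs_inv a * b).
  split=> [b r a a'|a r b b'] /=; first by rewrite (gs_inv_hom G).1 mulrDl cscalerAl.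
  by rewrite mulrDr cscalerAr.
have hS : linear S by exact: tliftP.
have SD h : S (D h) = calg_str O (gs_unit h).
  rewrite -gs_mulV -{1}gs_mulC; move: (D h); apply: tlin_eq.
  - exact: linear_comp hS (tliftP (tswap_bilin _ _)).
  - exact: tliftP hSb'.
  move=> m n; rewrite /tswap (tlift_tens (tswap_bilin _ _)).
  by rewrite /S (tlift_tens hSb) (tlift_tens hSb') mulrC.
have hP' : bilin (fun (c : C) (y : tensor O O) => tens c (S y)).
  exact: bilin_comp (tens_bilin _ _) (@id_linear _ _) hS.
transitivity (tlift (fun (c : C) (y : tensor O O) => tens c (S y))
    (tassoc (tmap (@gsp_act _ _ X) id (gsp_act u)))).
  move: (tmap _ id (gsp_act u)); apply: tens3_eq.
  - exact: tliftP Phi_bilin.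
  - exact: linear_comp (tliftP hP') (@tassoc_linear _ _ _ _).
  move=> m n p; rewrite tassoc_tens /Phi (tlift_tens Phi_bilin) (tlift_tens hP').
  by rewrite /S (tlift_tens hSb) tensM mulr1.
rewrite gsp_actA (tlift_tmap _ hP' (@id_linear _ _) (gs_mul_hom G).1).
rewrite -{2}[u](@gsp_act1 _ _ X).
have hb : bilin (fun (c : C) (h : O) => gs_unit h *: c).
  split=> [h r x y|c r x y]; first by rewrite /= scalerDr !scalerA mulrC.
  by rewrite /= (gs_unit_hom G).1 scalerDl scalerA.
have ht : linear (fun c : C => tens c (1 : O)) by exact: (tens_bilin _ _).1.
move: (gsp_act u); apply: tlin_eq.
- apply: tliftP; exact: bilin_comp hP' (@id_linear _ _) (gs_mul_hom G).1.
- exact: linear_comp ht (tliftP hb).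
move=> c h; rewrite (tlift_tens (bilin_comp hP' (@id_linear _ _) (gs_mul_hom G).1)).
rewrite (tlift_tens hb) SD (bilinZl (tens_bilin _ _)) -(bilinZr (tens_bilin _ _)).
by congr tens; rewrite -[RHS]/(calg_str O (gs_unit h) * 1) mulr1.
Qed.

Lemma twist_linear (a : AR) (h : O) : linear (fun o : O => (a : dual O) (o * h) : R^o).
Proof. by move=> c x y; rewrite mulrDl -cscalerAl (dual_lin (a : dual O)). Qed.
Definition twist (a : AR) (h : O) : AR := mkdual (twist_linear a h).

Lemma contr_twist (a : AR) h (w : tensor C O) :
  contr (twist a h : dual O) w = contr (a : dual O) (w * tens (1 : C) h).
Proof.
move: w; apply: tlin_eq; first exact: contr_linear.
  exact: linear_comp (contr_linear _) (tensM_linl _).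
by move=> c o; rewrite tensM !contr_tens mulr1.
Qed.

(* In the smash product: u a = sum of a(- S(u_1)) u_0. *)
Lemma mul_action (u x : C) (a : AR) :
  u * (a *: (x : space_mod X) : C) =
  \sum_(q <- repr (gsp_act u)) (twist a (gs_inv q.2)) *: (q.1 * x : space_mod X).
Proof.
transitivity (contr (a : dual O) (tens u (1 : O) * gsp_act x) : C).
  by rewrite contr_mull.
rewrite -act_inv /Phi (tlift_tmap _ Phi_bilin (gsp_act_hom X).1 (@id_linear _ _)).
rewrite {1}/tlift /tsum mulr_suml (linear_sum _ _ _ (contr_linear _)).
apply: eq_bigr => q _.
by rewrite space_scaleE contr_twist (gsp_act_hom X).2.2 mulrAC.
Qed.

(* This expresses that C is a Galois object over the dual algebra. *)
Lemma endo_span (E : C -> C) : linear E -> exists l : seq (AR * C),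
  forall x : C, E x = \sum_(q <- l) q.1 *: (q.2 * x : space_mod X).
Proof.
move=> hE; have [l hl] := O_dbasis dk G; have [g gK Kg] := galois_bij.
pose F (z : tensor C C) : C := tlift (fun c x : C => c * E x) z.
have hFb : bilin (fun c x : C => c * E x).
  split=> [x r c c'|c r x x'] /=; first by rewrite mulrDl cscalerAl.
  by rewrite hE mulrDr cscalerAr.
have FM (c : C) (z : tensor C C) : F (tens c (1 : C) * z) = c * F z.
  move: z; apply: tlin_eq.
  - exact: linear_comp (tliftP hFb) (tensM_linr _).
  - exact: linear_comp (lmul_linear c) (tliftP hFb).
  by move=> a b; rewrite tensM /F !(tlift_tens hFb) mul1r mulrA.
have gM (c : C) (w : tensor C O) : g (tens c (1 : O) * w) = tens c (1 : C) * g w.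
  by apply: (can_inj gK); rewrite galois_mull !Kg.
have gD : {morph g : x y / x + y}.
  by move=> x y; apply: (can_inj gK); rewrite (linD galois_linear) !Kg.
have g0 : g 0 = 0 by apply: (@addrI _ (g 0)); rewrite -gD !addr0.
pose u (o : O) : C := F (g (tens (1 : C) o)).
(* rho(x) is the Galois image of 1 (x) x; expanding rho(x) along a dual basis of O and pulling back
   writes E as a C-combination of the actions of elements of A. *)
have hEx x : E x = \sum_(q <- l) u q.1 * ((q.2 : AR) *: (x : space_mod X) : C).
  have -> : E x = F (g (gsp_act x)).
    have -> : gsp_act x = galois (tens (1 : C) x).
      by rewrite galois_tens -[tens (1 : C) (1 : O)]/(1 : tensor C O) mul1r.
    by rewrite gK /F (tlift_tens hFb) mul1r.
  rewrite {1}(contr_dbasis (gsp_act x) hl) (big_morph g gD g0) (linear_sum _ _ _ (tliftP hFb : linear F)).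
  apply: eq_bigr => q _; rewrite space_scaleE mulrC -FM -gM tensM mulr1 mul1r.
  by [].
exists (flatten [seq [seq (twist (q.2 : AR) (gs_inv r.2), r.1) | r <- repr (gsp_act (u q.1))] | q <- l]).
move=> x; rewrite big_flatten big_map hEx /=; apply: eq_bigr => q _.
by rewrite mul_action big_map.
Qed.

(** If a kills C, then id (x) a kills all c rho(x), and these span C (x) O by the torsor
    condition. *)
Lemma space_faithful (a : AR) : (forall x : space_mod X, a *: x = 0) -> a = 0.
Proof.
move=> h; apply: dual_eq => o.
have key w : contr (a : dual O) w = 0 :> C.
  have [z <-] := galois_surj w; move: z; apply: tlin_eq.
  - exact: linear_comp (contr_linear _) galois_linear.
  - by move=> r x y; rewrite scaler0 addr0.
  by move=> c x; rewrite galois_tens contr_mull -space_scaleE h mulr0.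
have := key (tens (1 : C) o); rewrite contr_tens => e.
apply: contrapT => ao; apply: tors_neq0.
exact: tors_tf ao e.
Qed.

(** Let m be a maximal ideal over p and n the rank of C at p. By [endo_span] each map x |-> s g_i(x)
    d is an A-combination of the n maps x |-> c_j x. If z were outside A l + mC with l outside mC,
    the n maps with d = l and one with d = z would contradict [prime_dependent]. *)
Lemma space_gen_at p : exists l : space_mod X, gen_at (A := A) p l.
Proof.
have [n [c [g [s [ps hs gc]]]]] := local_basis dk tors_fingen (@tors_tf) p.
apply: (ex_gen_at dk (A_fingen dk G) res_space_fingen) => m mm pm.
(* If C = mC, the element 0 already generates modulo m; freeness of a generator is a separate
   matter, settled in [gen_free]. *)
have [C0|/existsNP [l hl]] := pselect (forall x : space_mod X, idmod m x).
  by exists 0 => x; exists 0; rewrite scaler0 subr0; exact: C0.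
exists l => z; apply: contrapT => hz.
have im := maxidealP mm.
have hE (i : 'I_n) (d : C) : exists al : 'I_n -> AR, forall x : C,
    (s * g i x) *: d = \sum_j al j *: (c j * x : space_mod X).
  have hlin : linear (fun x : C => (g i x : R) *: d).
    by move=> r x y; rewrite dual_lin scalerDl scalerA.
  have [L hL] := endo_span hlin.
  exists (fun j => \sum_(q <- L) calg_str A (g j q.2) * q.1) => x.
  rewrite -scalerA hL scaler_sumr.
  under [RHS]eq_bigr => j _ do rewrite scaler_suml.
  rewrite exchange_big /=; apply: eq_bigr => q _.
  have -> : s *: (q.1 *: (q.2 * x : space_mod X) : C) = q.1 *: (s *: (q.2 * x) : space_mod X).
    by rewrite -space_str -[in RHS]space_str !scalerA mulrC.
  rewrite cscalerAl hs mulr_suml.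
  rewrite (linear_sum (R := AR) _ _ _ (f := fun y : space_mod X => q.1 *: y)).
    apply: eq_bigr => j _; rewrite -cscalerAl -space_str scalerA.
    by rewrite mulrC.
  by move=> b x1 x2; rewrite scalerDr !scalerA mulrC.
have n0 : (0 < n)%N.
  rewrite lt0n; apply/eqP => n0; apply: tors_neq0; apply: (tors_tf (r := s)).
    by move=> s0; apply: ps; rewrite s0; exact: ideal0 (place_idealP p).
  by rewrite hs; move: c g {hs gc hE}; rewrite n0 => c g; rewrite big_ord0.
pose k0 := Ordinal n0.
(* Row k holds the coefficients of x |-> s g_k(x) l, the last row those of x |-> s g_k0(x) z. The
   dependency is then evaluated at c_i, where g_k(c_i) is s or 0. *)
pose v (i : 'I_n.+1) : 'I_n -> AR :=
  if unlift ord_max i is Some k then projT1 (cid (hE k l)) else projT1 (cid (hE k0 z)).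
have [nu [[i0 hi0] hnu]] := prime_dependent v (maxideal_primeideal mm).
have key (i : 'I_n) : idmod m (nu (lift ord_max i) *: l + ((i == k0)%:R * nu ord_max) *: (z : space_mod X)).
  have h1 : idmod m (\sum_j (\sum_a nu a * v a j) *: (c j * c i : space_mod X)).
    by apply: submod_sum; [exact: idmod_submod|move=> j _; apply: idmodM; exact: hnu].
  have e1 : \sum_j (\sum_a nu a * v a j) *: (c j * c i : space_mod X) =
     calg_str A (s * s) *: (nu (lift ord_max i) *: l + ((i == k0)%:R * nu ord_max) *: (z : space_mod X)).
    under eq_bigr => j _ do rewrite scaler_suml.
    rewrite exchange_big /=.
    under eq_bigr => a _.
      under eq_bigr => j _ do rewrite -scalerA.
      rewrite -scaler_sumr; over.
    rewrite big_ord_recr /=.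
    have wl (k : 'I_n) : widen_ord (leqnSn n) k = lift ord_max k.
      by apply: val_inj; rewrite /= /bump leqNgt ltn_ord.
    have vl (k : 'I_n) : \sum_j v (lift ord_max k) j *: (c j * c i : space_mod X) = ((s * g k (c i)) *: l : C).
      by rewrite /v liftK -(projT2 (cid (hE k l))).
    have vm : \sum_j v ord_max j *: (c j * c i : space_mod X) = ((s * g k0 (c i)) *: z : C).
      by rewrite /v unlift_none -(projT2 (cid (hE k0 z))).
    rewrite vm; under eq_bigr => k _ do rewrite wl vl gc.
    rewrite (bigD1 i) //= eqxx mulr1 big1 ?addr0; last first.
      by move=> k /negPf ki; rewrite ki mulr0 mulr0 scale0r scaler0.
    rewrite gc -!space_str scalerDr !scalerA; congr (_ *: _ + _ *: _); first by rewrite mulrC.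
    rewrite (eq_sym k0); case: (i == k0); rewrite ?mulr1 ?mulr0 ?rmorph0 ?mulr0 ?mul0r ?mulr0 //.
    by rewrite mul1r mulrC.
  rewrite e1 in h1.
  have [_ _ hm] := mm; have ss : ~ m (calg_str A (s * s)).
    by apply: pideal_unit mm pm _ => // /place_prime [].
  have [y my] := hm _ ss.
  set w := (X in idmod m X).
  rewrite -[w]scale1r -(subrK (calg_str A (s * s) * y) 1) scalerDl.
  by apply: idmodD; [exact: idmodM|rewrite mulrC -scalerA; exact: idmodZ].
have [_ _ hm] := mm.
have nuz : m (nu ord_max).
  apply: contrapT => nz; have [y my] := hm _ nz.
  apply: hz; exists (- (y * nu (lift ord_max k0))).
  have := key k0; rewrite eqxx mul1r => /(idmodZ y) h2.
  rewrite -[z in X in idmod m X]scale1r -(subrK (nu ord_max * y) 1) scalerDl scaleNr opprK -addrA.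
  apply: idmodD; first exact: idmodM.
  by move: h2; rewrite scalerDr !scalerA [y * nu ord_max]mulrC addrC.
have nul i : idmod m (nu (lift ord_max i) *: l).
  have := key i; rewrite -[X in _ -> idmod m X](addrK (((i == k0)%:R * nu ord_max) *: (z : space_mod X))) => h2.
  by apply: (submodB (idmod_submod _ _) h2); apply: idmodM; exact: idealMl.
case: (unliftP ord_max i0) hi0 => [i ->|->] hi0; last by [].
have [y my] := hm _ hi0; apply: hl.
rewrite -[l]scale1r -(subrK (nu (lift ord_max i) * y) 1) scalerDl.
by apply: idmodD; [exact: idmodM|rewrite mulrC -scalerA; exact: idmodZ].
Qed.

Lemma gen_free (p : place R) (l : space_mod X) : gen_at (A := A) p l -> free_elt (A := A) l.
Proof.
case=> s [ps hs] a al; apply: space_faithful => x.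
have s0 : s <> 0 by move=> s0; apply: ps; rewrite s0; exact: ideal0 (place_idealP p).
have [b hb] := hs x; apply: (@tors_tf s _ s0).
by rewrite -space_str scalerA mulrC -scalerA hb scalerA mulrC -scalerA al scaler0.
Qed.

Lemma space_line : is_line (A := A) (space_mod X).
Proof. by move=> p; have [l hl] := space_gen_at p; exists l; split=> //; exact: gen_free hl. Qed.
End TorsorTheory.

Section DualBasis.
Variables (B : comPzRingType) (M : lmodType B).

Lemma dbasis_fgproj (l : seq (M * dual M)) : dbasis 1 l -> fgproj M.
Proof.
move=> hl; pose t := in_tuple l.
pose i (x : M) : 'rV[B]_(size l) := \row_k ((tnth t k).2 x : B).
pose p (v : 'rV[B]_(size l)) : M := \sum_k v 0 k *: (tnth t k).1.
have hi : linear i by move=> a x y; apply/rowP => k; rewrite !mxE dual_lin.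
have hp : linear p.
  move=> a x y; rewrite /p scaler_sumr -big_split /=; apply: eq_bigr => k _.
  by rewrite !mxE scalerDl scalerA.
pose i' := GRing.isLinear.Build _ _ _ _ i hi.
pose p' := GRing.isLinear.Build _ _ _ _ p hp.
pose iL : {linear M -> 'rV[B]_(size l)} := HB.pack i i'.
pose pL : {linear 'rV[B]_(size l) -> M} := HB.pack p p'.
exists (size l), iL, pL => x; rewrite /= /p /i -[RHS]scale1r hl [RHS]big_tnth.
by apply: eq_bigr => k _; rewrite mxE.
Qed.

Lemma dbasis_ideal : ideal (fun s => exists l : seq (M * dual M), dbasis s l).
Proof.
split.
- by exists [::] => y; rewrite big_nil scale0r.
- move=> a b [l hl] [l' hl']; exists (l ++ [seq (- q.1, q.2) | q <- l']) => y.
  rewrite big_cat /= -hl big_map scalerBl hl'; congr (_ + _); rewrite -sumrN.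
  by apply: eq_bigr => q _; rewrite scalerN.
- move=> a b [l hl]; exists [seq (a *: q.1, q.2) | q <- l] => y.
  rewrite -scalerA hl big_map scaler_sumr; apply: eq_bigr => q _.
  by rewrite !scalerA mulrC.
Qed.
End DualBasis.

(** * Lines over A: duals, tensor products, base change *)

Section Lines.
Variables (R : comPzRingType) (dk : dedekind_like R) (A : calg R).
Hypothesis tA : torsion_free A.
Implicit Types (p : place R) (M L : lmodType (calg_ring A)) (S T : calg R).
Local Notation str := (calg_str A).

Lemma place_neq0 p s : ~ p s -> s <> 0.
Proof. by move=> ps s0; apply: ps; rewrite s0; exact: ideal0 (place_idealP p). Qed.

Lemma str_reg s a : s <> 0 -> str s * a = 0 -> a = 0.
Proof. by move=> s0; exact: (tA s0). Qed.

(** The contraction of J to R is an ideal contained in no place, so it contains 1. *)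
Lemma str_cover (J : calg_ring A -> Prop) : ideal J ->
  (forall p, exists2 s, J (str s) & ~ p s) -> J 1.
Proof.
move=> iJ h; rewrite -(rmorph1 str).
apply: (place_cover (dk_fin dk) (dk_place dk) (J := fun s => J (str s))) => //; split.
- by rewrite rmorph0; exact: ideal0.
- by move=> x y hx hy; rewrite rmorphB; exact: idealB.
- by move=> a x hx; rewrite rmorphM; exact: idealMl.
Qed.

Definition gen_by M s (l : M) : Prop := forall x : M, exists a, str s *: x = a *: l.

Lemma gen_free_line M p (l : M) : is_line M -> gen_at p l -> free_elt l.
Proof.
move=> /(_ p) [l' [[s' [ps' _]] fl']] [s [ps hs]] b bl.
have [a ha] := hs l'; apply: (str_reg (place_neq0 ps)); apply: fl'.
by rewrite mulrC -scalerA ha scalerA mulrC -scalerA bl scaler0.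
Qed.

Section Coordinate.
Variables (M : lmodType (calg_ring A)) (l : M) (s : R).
Hypotheses (fl : free_elt l) (hs : gen_by s l).

(** The coordinate along l multiplied by s, which makes it defined on all of M; it takes the value s
    at l. *)
Definition coord_fun (x : M) : calg_ring A := projT1 (cid (hs x)).
Lemma coord_funE x : str s *: x = coord_fun x *: l. Proof. exact: (projT2 (cid (hs x))). Qed.
Lemma free_inj a b : a *: l = b *: l -> a = b.
Proof.
move=> /eqP; rewrite -subr_eq0 -scalerBl => /eqP /fl /eqP.
by rewrite subr_eq0 => /eqP.
Qed.
Lemma coord_linear : linear (coord_fun : M -> (calg_ring A)^o).
Proof.
move=> a x y; apply: free_inj; rewrite -coord_funE scalerDr scalerA mulrC -scalerA.
by rewrite !coord_funE scalerA -scalerDl.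
Qed.
Definition coord : dual M := mkdual coord_linear.
Lemma coordE x : str s *: x = (coord x : calg_ring A) *: l. Proof. exact: coord_funE. Qed.
Lemma coord_gen : coord l = str s :> calg_ring A.
Proof. by apply: free_inj; rewrite -coordE. Qed.
End Coordinate.

Lemma line_dbasis M : is_line M -> exists l : seq (M * dual M), dbasis 1 l.
Proof.
move=> hM; apply: (str_cover (dbasis_ideal M)) => p.
have [l [[s [ps hs]] fl]] := hM p; exists s => //.
by exists [:: (l, coord fl hs)] => y; rewrite big_seq1 /= -coordE.
Qed.

Lemma line_fgproj M : is_line M -> fgproj M.
Proof. by move=> /line_dbasis [l /dbasis_fgproj]. Qed.

Lemma dual_gen M s (l : M) (fl : free_elt l) (hs : gen_by s l) :
  gen_by s (coord fl hs).
Proof.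
move=> f; exists (f l); apply: dual_eq => x.
rewrite -[LHS]/(str s *: (f x : (calg_ring A)^o)) -(linZ (dual_lin f)) (coordE fl hs).
by rewrite (linZ (dual_lin f)) regE mulrC.
Qed.

Lemma dual_line M : is_line M -> is_line (dual M).
Proof.
move=> hM p; have [l [[s [ps hs]] fl]] := hM p; exists (coord fl hs); split.
  by exists s; split=> //; exact: dual_gen.
move=> a /(congr1 (fun f : dual M => f l)) h; apply: (str_reg (place_neq0 ps)).
rewrite -[RHS]h mulrC -[RHS]/(a *: (coord fl hs l : (calg_ring A)^o)).
by rewrite coord_gen.
Qed.

Section TensorLine.
Variables (M N : lmodType (calg_ring A)).

Lemma tens_gen_by s t (l : M) (n : N) : gen_by s l -> gen_by t n ->
  gen_by (M := tensor M N) (s * t) (tens l n).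
Proof.
move=> hs ht x; rewrite (tensE x).
elim: (repr x) => [|q r [a ha]].
  by exists 0; rewrite big_nil scaler0 scale0r.
have [b hb] := hs q.1; have [c hc] := ht q.2.
exists (b * c + a); rewrite big_cons scalerDr ha scalerDl; congr (_ + _).
rewrite rmorphM -scalerA -(bilinZr (tens_bilin _ _)) hc -(bilinZl (tens_bilin _ _)) hb.
by rewrite (bilinZl (tens_bilin _ _)) (bilinZr (tens_bilin _ _)) scalerA.
Qed.

Lemma tens_gen_at p (l : M) (n : N) : gen_at p l -> gen_at p n ->
  gen_at (M := tensor M N) p (tens l n).
Proof.
case=> s [ps hs] [t [pt ht]]; exists (s * t); split; first by case/place_prime.
exact: tens_gen_by.
Qed.

Lemma tens_line : is_line M -> is_line N -> is_line (tensor M N).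
Proof.
move=> hM hN p; have [l [gl fl]] := hM p; have [n [gn fn]] := hN p.
exists (tens l n); split; first exact: tens_gen_at.
case: (gl) => s [ps hs]; case: (gn) => t [pt ht] a ha.
have hb : bilin (fun (x : M) (y : N) => (coord fn ht y : calg_ring A) *: x) by exact: contr_bilin.
have := congr1 (tlift (fun (x : M) (y : N) => (coord fn ht y : calg_ring A) *: x)) ha.
rewrite (linZ (tliftP hb)) (lin0 (tliftP hb)) (tlift_tens hb) coord_gen scalerA mulrC => /fl.
exact: str_reg (place_neq0 pt).
Qed.
End TensorLine.

Section ExtGen.
Variables (M : lmodType (calg_ring A)) (T : calg R).

Lemma ext_fun_linear (N : lmodType (calg_ring A)) (f : M -> N) : linear f -> linear (@ext_fun _ A T M N f).
Proof.
move=> hf.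
have hfR : linear (f : res M -> res N) by move=> a x y; rewrite /= resE -hf.
have hR : linear (@ext_fun _ A T M N f : tensor (res M) T -> tensor (res N) T).
  exact: tmap_linear.
have key (z : tensor A T) (x : ext M T) : ext_fun (f : M -> N) (z *: x) = z *: ext_fun f x.
  move: z; apply: tlin_eq => [||a s].
  - exact: linear_comp hR (extZ_linl x).
  - exact: extZ_linl.
  move: x; apply: tlin_eq => [||l t].
  - exact: linear_comp hR (@extZ_linr _ _ M T (tens a s)).
  - exact: linear_comp (@extZ_linr _ _ N T (tens a s)) hR.
  rewrite extZ_tens /ext_fun !tmap_tens // extZ_tens.
  by rewrite (linZ hf).
by move=> z x y; rewrite (linD hR) key.
Qed.

Lemma ext_fun_tens (N : lmodType (calg_ring A)) (f : M -> N) (l : res M) (t : T) : linear f ->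
  ext_fun f (tens l t : ext M T) = (tens (f l : res N) t : ext N T).
Proof.
move=> hf; rewrite /ext_fun tmap_tens // => a x y; by rewrite /= resE -hf.
Qed.

Lemma ext_gen_by s (l : M) (x : ext M T) : gen_by s l ->
  exists z : tensor A T, tens (str s : A) (1 : T) *: x = z *: (tens (l : res M) (1 : T) : ext M T).
Proof.
move=> hs; rewrite {1}[x](tensE (x : tensor (res M) T)).
elim: (repr _) => [|q r [z hz]].
  by exists 0; rewrite big_nil scaler0 scale0r.
have [a ha] := hs q.1; exists (tens (a : A) q.2 + z).
rewrite big_cons scalerDr hz scalerDl; congr (_ + _).
by rewrite !extZ_tens mul1r mulr1 ha.
Qed.

Local Notation reg := ((calg_ring A)^o).

Definition reg_id : ext (A := A) reg T -> tensor A T :=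
  tmap (fun a : res (A := A) reg => a : A) (fun t : T => t).

Lemma reg_id_linear : linear (reg_id : tensor (res (A := A) reg) T -> tensor A T).
Proof. exact: tmap_linear. Qed.
Lemma reg_id_tens (a : A) (t : T) : reg_id (tens (a : res (A := A) reg) t) = tens a t.
Proof. exact: tmap_tens. Qed.

Lemma ext_regE (x : ext (A := A) reg T) :
  x = reg_id x *: (tens (1 : res (A := A) reg) (1 : T) : ext (A := A) reg T).
Proof.
move: x; apply: tlin_eq; first by [].
  exact: linear_comp (extZ_linl (L := reg) _) reg_id_linear.
by move=> a t; rewrite reg_id_tens extZ_tens mulr1 regE mulr1.
Qed.

Lemma reg_id_scale (z : tensor A T) (x : ext (A := A) reg T) : reg_id (z *: x) = z * reg_id x.
Proof.
move: z; apply: tlin_eq.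
- exact: linear_comp reg_id_linear (extZ_linl (L := reg) _).
- exact: tensM_linl.
move=> a s; move: x; apply: tlin_eq.
- exact: linear_comp reg_id_linear (extZ_linr (L := reg) _).
- exact: linear_comp (tensM_linr _) reg_id_linear.
by move=> b t; rewrite extZ_tens !reg_id_tens tensM.
Qed.

Lemma tens_str (s : R) (t : T) :
  (tens (str s : A) (1 : T) : tensor A T) * tens (1 : A) t = tens (1 : A) (calg_str T s * t : T).
Proof.
rewrite tensM mulr1 mul1r.
have -> : str s = s *: (1 : A) by rewrite -[RHS]/(str s * 1) mulr1.
by rewrite (bilinZl (tens_bilin _ _)) -(bilinZr (tens_bilin _ _)).
Qed.

(** The scalar extension of [coord fl hs] sends z l to s z. *)
Lemma ext_gen_inj s (l : M) (z : tensor A T) : free_elt l -> gen_by s l ->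
  z *: (tens (l : res M) (1 : T) : ext M T) = 0 -> tens (str s : A) (1 : T) * z = 0.
Proof.
move=> fl hs hz.
have hk : linear (coord fl hs : M -> (calg_ring A)^o) by exact: dual_lin.
have := congr1 (fun y => reg_id (ext_fun (coord fl hs : M -> (calg_ring A)^o) y)) hz.
rewrite (linZ (ext_fun_linear hk)) (lin0 (ext_fun_linear hk)) reg_id_scale.
by rewrite ext_fun_tens // coord_gen reg_id_tens (lin0 reg_id_linear) mulrC.
Qed.

Lemma ext_gen_basis s (t : T) (l : M) : free_elt l -> gen_by s l -> calg_str T s * t = 1 ->
  is_basis (fun _ : 'I_1 => tens (l : res M) (1 : T) : ext M T).
Proof.
move=> fl hs st x.
have inv : (tens (str s : A) (1 : T) : tensor A T) * tens (1 : A) t = 1.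
  by rewrite tens_str st.
have [z hz] := ext_gen_by x hs.
exists (\row_(i < 1) (tens (1 : A) t * z)); split.
  by rewrite big_ord1 mxE -scalerA -hz scalerA mulrC inv scale1r.
move=> c; rewrite big_ord1 => hc; apply/rowP => i; rewrite mxE ord1.
have : tens (str s : A) (1 : T) * (tens (1 : A) t * z - c 0 0) = 0.
  apply: (ext_gen_inj fl hs); rewrite scalerBl -hc -scalerA -hz scalerA mulrC inv scale1r.
  by rewrite subrr.
move=> h; apply/eqP; rewrite -subr_eq0; apply/eqP.
by rewrite -[LHS]mul1r -inv mulrAC h mul0r.
Qed.
End ExtGen.

Section LineIso.
Variables (M N : lmodType (calg_ring A)) (S : calg R).
Hypotheses (hM : is_line M) (hN : is_line N).
Variable phi : ext M S -> ext N S.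
Hypotheses (lphi : linear phi) (bphi : bijective phi).
Local Notation L := (tensor M (dual N)).
Local Notation reg := ((calg_ring A)^o).

Let strS : calg_ring A -> tensor A S := fun a => tens (a : A) (1 : S).
Fact strS_zmod : zmod_morphism strS.
Proof. by move=> a b; rewrite /strS (bilinDl (tens_bilin A S)) (bilinNl (tens_bilin A S)). Qed.
Fact strS_monoid : monoid_morphism strS.
Proof. by split=> // a b; rewrite /strS tensM mulr1. Qed.
HB.instance Definition _ := GRing.isZmodMorphism.Build (calg_ring A) (tensor A S) strS strS_zmod.
HB.instance Definition _ := GRing.isMonoidMorphism.Build (calg_ring A) (tensor A S) strS strS_monoid.
(** A (x) S is viewed as an A-algebra and A (x) S-modules are restricted to A: the map (m, f) |->
    f(phi(m)) is then A-bilinear and factors through the tensor product of M and dual N over A. *)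
Let AS : calg (calg_ring A) := CAlg strS.
Let W : lmodType (calg_ring A) := res (A := AS) (ext (A := A) reg S).

Let e0 (m : M) (f : dual N) : W := ext_fun (f : N -> reg) (phi (tens (m : res M) (1 : S))).

Fact e0_bilin : bilin e0.
Proof.
split=> [f a m m'|m a f f'] /=.
  rewrite /e0 resE /=.
  have -> : tens (a *: m + m' : res M) (1 : S) =
    strS a *: (tens (m : res M) (1 : S) : ext M S) + (tens (m' : res M) (1 : S) : ext M S).
    by rewrite /strS extZ_tens mulr1 -(bilinDl (tens_bilin _ _)).
  by rewrite lphi (ext_fun_linear (dual_lin f)).
rewrite /e0 resE /=; move: (phi _) => y; move: y; apply: tlin_eq.
- exact: ext_linear_res (ext_fun_linear (dual_lin (a *: f + f'))).
- move=> c u v.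
  have lf := ext_linear_res (ext_fun_linear (T := S) (dual_lin f)).
  have lf' := ext_linear_res (ext_fun_linear (T := S) (dual_lin f')).
  by rewrite lf lf' (extZ_linr (L := reg)) scalerDr addrACA.
move=> n s; rewrite (ext_fun_tens _ _ (dual_lin f)) (ext_fun_tens _ _ (dual_lin f')).
rewrite (ext_fun_tens _ _ (dual_lin (a *: f + f'))).
by rewrite /strS extZ_tens mul1r -(bilinDl (tens_bilin _ _)).
Qed.

Definition line_xi (x : ext L S) : ext (A := A) reg S :=
  tlift (fun (y : res L) (s : S) => (tens (1 : A) s : tensor A S) *:
    (tlift e0 (y : L) : ext (A := A) reg S) : tensor (res (A := A) reg) S) x.

Fact line_xi_bilin : bilin (fun (y : res L) (s : S) => (tens (1 : A) s : tensor A S) *: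
    (tlift e0 (y : L) : ext (A := A) reg S) : tensor (res (A := A) reg) S).
Proof.
split=> [s r y y'|y r s s'] /=.
  have -> : tlift e0 (r *: y + y' : res L) =
    strS (str r) *: (tlift e0 (y : L) : ext (A := A) reg S) + (tlift e0 (y' : L) : ext (A := A) reg S).
    by rewrite resE (tliftP e0_bilin).
  rewrite scalerDr scalerA mulrC -scalerA; congr (_ + _).
  have -> : strS (str r) = r *: (1 : tensor A S).
    transitivity (tens (r *: (1 : A)) (1 : S)).
      by rewrite -[r *: (1 : A)]/(str r * 1) mulr1.
    exact: (bilinZl (tens_bilin A S)).
  by rewrite -ext_scale_str.
by rewrite (tens_bilin _ _).2 (extZ_linl (L := reg)).
Qed.

Lemma line_xiE m f s : line_xi (tens (tens m f : res L) s) =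
  ext_fun (f : N -> reg) (phi (tens (m : res M) s)).
Proof.
rewrite /line_xi (tlift_tens line_xi_bilin) (tlift_tens e0_bilin) /e0.
have -> : (tens (m : res M) s : ext M S) = tens (1 : A) s *: (tens (m : res M) (1 : S) : ext M S).
  by rewrite extZ_tens scale1r mulr1.
by rewrite (linZ lphi) (linZ (ext_fun_linear (dual_lin f))).
Qed.

Lemma line_xi_linear : linear line_xi.
Proof.
have hR : linear (line_xi : tensor (res L) S -> tensor (res (A := A) reg) S).
  exact: tliftP line_xi_bilin.
have key (z : tensor A S) (x : ext L S) : line_xi (z *: x) = z *: line_xi x.
  move: z; apply: tlin_eq => [||a s].
  - exact: linear_comp hR (extZ_linl x).
  - exact: (extZ_linl (L := reg)).
  move: x; apply: tlin_eq => [||l t].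
  - exact: linear_comp hR (@extZ_linr _ _ L S (tens a s)).
  - exact: linear_comp (@extZ_linr _ _ (reg : lmodType _) S (tens a s)) hR.
  rewrite extZ_tens /line_xi !(tlift_tens line_xi_bilin) scalerA tensM mulr1.
  by rewrite (linZ (tliftP e0_bilin)) resE /= /strS scalerA tensM mul1r mulr1.
by move=> z x y; rewrite (linD hR) key.
Qed.

(** z expresses the preimage of the generator n in terms of l, as s phi^-1(n) = z l; the coordinate
    of n then contributes the factor t. *)
Lemma line_xi_local p : exists (s : R) (l : L) (z : tensor A S), [/\ ~ p s, gen_by s l &
  tens (str s : A) (1 : S) = z * reg_id (line_xi (tens (l : res L) (1 : S)))].
Proof.
have [l [[s [ps hs]] fl]] := hM p; have [n [[t [pt ht]] fn]] := hN p.
have [g phiK gK] := bphi.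
have [z hz] := ext_gen_by (g (tens (n : res N) (1 : S))) hs.
exists (s * t), (tens l (coord fn ht)), z; split.
- by case/place_prime.
- exact: tens_gen_by hs (dual_gen fn ht).
have := congr1 (fun y => reg_id (ext_fun (coord fn ht : N -> reg) (phi y))) hz.
have lf : linear (coord fn ht : N -> reg) by exact: dual_lin.
rewrite !(linZ lphi) !(linZ (ext_fun_linear lf)) gK !reg_id_scale (ext_fun_tens _ _ lf) coord_gen.
by rewrite -line_xiE => <-; rewrite reg_id_tens tensM mulr1 rmorphM.
Qed.

(** Surjectivity and injectivity are each reduced to an ideal [J] of A containing 1, which
    [str_cover] checks place by place on the local generator. *)
Lemma line_xi_bij : bijective line_xi.
Proof.
have surj z : exists x, line_xi x = z.
  suff [x hx] : exists x, line_xi x = tens (1 : res (A := A) reg) (1 : S).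
    by exists (reg_id z *: x); rewrite (linZ line_xi_linear) hx -ext_regE.
  pose J a := exists x, reg_id (line_xi x) = tens (a : A) (1 : S).
  suff [x hx] : J 1.
    by exists x; rewrite [LHS]ext_regE hx -[tens (1 : A) (1 : S)]/(1 : tensor A S) scale1r.
  apply: str_cover; first split.
  - exists 0; rewrite (lin0 line_xi_linear) (lin0 (@reg_id_linear S)); symmetry.
    exact: (bilin0l (tens_bilin A S)).
  - move=> a b [x hx] [y hy]; exists (x - y).
    rewrite -scaleN1r (linD line_xi_linear) (linZ line_xi_linear) (linD (@reg_id_linear S)).
    rewrite reg_id_scale hx hy mulN1r (bilinDl (tens_bilin A S)) (bilinNl (tens_bilin A S)).
    by [].
  - move=> a b [x hx]; exists (tens (a : A) (1 : S) *: x).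
    by rewrite (linZ line_xi_linear) reg_id_scale hx tensM mulr1.
  move=> p; have [s [l [w [ps _ hw]]]] := line_xi_local p; exists s => //.
  exists (w *: (tens (l : res L) (1 : S) : ext L S)).
  by rewrite (linZ line_xi_linear) reg_id_scale hw.
have inj0 x : line_xi x = 0 -> x = 0.
  move=> hx; rewrite -[x]scale1r -[1 : tensor A S]/(tens (1 : A) (1 : S)).
  pose J a := tens (a : A) (1 : S) *: x = 0.
  suff : J 1 by [].
  apply: str_cover; rewrite /J; first split.
  - by rewrite (bilin0l (tens_bilin A S)) scale0r.
  - move=> a b ha hb; rewrite (bilinDl (tens_bilin A S)) (bilinNl (tens_bilin A S)).
    by rewrite scalerBl ha hb subrr.
  - move=> a b hb; have -> : tens (a * b : A) (1 : S) = tens (a : A) (1 : S) * tens (b : A) (1 : S).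
      by rewrite tensM mulr1.
    by rewrite -scalerA hb scaler0.
  move=> p; have [s [l [w [ps hs hw]]]] := line_xi_local p.
  (* One s to write x as a multiple z of the generator, another to cancel the value of [line_xi] on
     the generator, which divides s. *)
  exists (s * s); last by case/place_prime.
  have [z hz] := ext_gen_by x hs.
  have h0 : z * reg_id (line_xi (tens (l : res L) (1 : S))) = 0.
    by rewrite -reg_id_scale -(linZ line_xi_linear) -hz (linZ line_xi_linear) hx scaler0 (lin0 (@reg_id_linear S)).
  have -> : tens (str (s * s) : A) (1 : S) = tens (str s : A) (1 : S) * tens (str s : A) (1 : S).
    by rewrite tensM mulr1 rmorphM.
  by rewrite -scalerA hz scalerA hw mulrAC -mulrA h0 mulr0 scale0r.
have inj : injective line_xi.
  move=> x y hxy; apply/eqP; rewrite -subr_eq0; apply/eqP; apply: inj0.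
  by rewrite -scaleN1r addrC line_xi_linear hxy scaleN1r addNr.
exists (fun z => projT1 (cid (surj z))) => [x|z]; last exact: (projT2 (cid (surj z))).
by apply: inj; exact: (projT2 (cid (surj (line_xi x)))).
Qed.
End LineIso.
End Lines.

(** * Idelic data of a line *)

Section TensorMapRing.
Variable R : comPzRingType.

Lemma talg_scaleE (B C : calg R) (c : R) (x : talg B C) :
  c *: x = (c *: (x : tensor B C) : tensor B C).
Proof. by rewrite -[LHS]/((c *: (1 : tensor B C)) * x) -tscalerAl mul1r. Qed.

Lemma tmap_ring (A B C : calg R) (h : B -> C) : linear h -> monoid_morphism h ->
  let f := tmap (fun a : A => a) h in linear f /\ monoid_morphism f.
Proof.
move=> lh [h1 hM]; have lf : linear (tmap (fun a : A => a) h) by exact: tmap_linear.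
split=> //; split; first by rewrite tmap_tens // h1.
move=> x y; move: x; apply: tlin_eq => [||a b].
- exact: linear_comp lf (tensM_linl y).
- exact: linear_comp (tensM_linl _) lf.
move: y; apply: tlin_eq => [||a' b'].
- exact: linear_comp lf (tensM_linr _).
- exact: linear_comp (tensM_linr _) lf.
by rewrite tensM !tmap_tens // tensM hM.
Qed.
End TensorMapRing.

Section LineClass.
Variables (R : comPzRingType) (dk : dedekind_like R) (A : calg R).
Hypothesis tA : torsion_free A.
Variables (K C : calg R) (ffK : frac_field K) (j : K -> C).
Hypothesis hj : linear j /\ monoid_morphism j.
Local Notation str := (calg_str A).
Local Notation AK := (tensor A K).
Local Notation AC := (tensor A C).
Local Notation Rv v := (completion_alg (@place_ideal R v)).
Local Notation reg := ((calg_ring A)^o).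

Lemma K_to_Kv_hom v : linear (@K_to_Kv R K v) /\ monoid_morphism (@K_to_Kv R K v).
Proof.
split=> [a x y|]; first by rewrite talg_scaleE /K_to_Kv (tens_bilin _ _).1.
split=> // x y; rewrite -[RHS]/((tens x (1 : Rv v) : tensor K (Rv v)) * tens y (1 : Rv v)).
by rewrite tensM mulr1.
Qed.
Lemma Rv_to_Kv_hom v : linear (@Rv_to_Kv R K v) /\ monoid_morphism (@Rv_to_Kv R K v).
Proof.
split=> [a x y|]; first by rewrite talg_scaleE /Rv_to_Kv (tens_bilin _ _).2.
split=> // x y; rewrite -[RHS]/((tens (1 : K) x : tensor K (Rv v)) * tens (1 : K) y).
by rewrite tensM mulr1.
Qed.

Lemma AK_to_Av_hom v : linear (@AK_to_Av R A K v) /\ monoid_morphism (@AK_to_Av R A K v).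
Proof. by apply: tmap_ring; case: (K_to_Kv_hom v). Qed.

Lemma completion_inv (v : place R) s : ~ v s -> exists t : Rv v, calg_str (Rv v) s * t = 1.
Proof.
move=> vs; have [y py] := place_invert (dk_fin dk) vs.
exact: completion_unit py.
Qed.

(** A place containing s is determined by the representatives modulo s that it contains. *)
Lemma places_over_finite (s : R) : s <> 0 -> finite_set [set v : place R | v s]%classic.
Proof.
move=> s0; have [l hl] := dk_fin dk s0.
pose f (v : place R) : {set 'I_(size l)} := finset (fun i : 'I_(size l) => `[< v l`_i >]).
have finj (v w : place R) : v s -> w s -> f v = f w -> v = w.
  move=> vs ws fvw.
  have vw (u : place R) : u s -> forall x, u x <-> exists i : 'I_(size l), i \in f u /\ exists y, x - l`_i = s * y.
    move=> us x; have iu := place_idealP u; split.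
      move=> ux; have [r rl [y hy]] := hl x.
      have lt : (index r l < size l)%N by rewrite index_mem.
      exists (Ordinal lt); rewrite nth_index // inE /= nth_index //; split; last by exists y.
      apply/asboolP; rewrite -(subKr x r) hy; apply: (idealB iu ux); exact: idealMr.
    case=> i []; rewrite inE => /asboolP ui [y hy].
    by rewrite -(subrK l`_i x) hy; apply: idealD => //; exact: idealMr.
  have e : place_ideal v = place_ideal w.
    apply/funext => x; apply/propext; rewrite (vw v vs) (vw w ws) fvw.
    by split.
  case: v w e {vs ws fvw vw} => [I a b c d] [I' a' b' c' d'] /= e.
  by move: a b c d; rewrite e => a b c d; congr Place; exact: Prop_irrelevance.
have [v0 _] := dk_place dk.
pose g (X : {set 'I_(size l)}) : place R :=
  if pselect (exists2 v : place R, v s & f v = X) is left h then projT1 (cid2 h) else v0.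
apply: sub_finite_set (finite_image g (@finite_finset _ [set: {set 'I_(size l)}]%classic)).
move=> v /= vs; exists (f v) => //; rewrite /g; case: pselect => [h|[]]; last by exists v.
by case: (cid2 h) => w /= ws fw; exact: finj.
Qed.

(* x = alpha l in L (x) K. *)
Definition ratio (L : lmodType (calg_ring A)) (x l : L) (alpha : AK) : Prop :=
  exists d b, [/\ d <> 0, str d *: x = b *: l &
    tens (str d : A) (1 : K) * alpha = tens (b : A) (1 : K)].

Lemma str_unit (T : calg R) (d : R) (t : T) : calg_str T d * t = 1 ->
  (tens (str d : A) (1 : T) : tensor A T) * tens (1 : A) t = 1.
Proof. by move=> h; rewrite tens_str h. Qed.

Lemma ratioE (L : lmodType (calg_ring A)) (x l : L) (alpha : AK) (T : calg R) (h : K -> T) :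
  linear h -> monoid_morphism h -> ratio x l alpha ->
  (tens (x : res L) (1 : T) : ext L T) =
  tmap (fun a : A => a) h alpha *: (tens (l : res L) (1 : T) : ext L T).
Proof.
move=> lh mh [d [b [d0 dx dal]]].
have [k hk] := ff_inv ffK d0.
have [lf [f1 fM]] := @tmap_ring R A K T h lh mh.
have dk' : calg_str T d * h k = 1.
  have := congr1 h hk; rewrite mh.1 => <-.
  by rewrite -[calg_str K d * k]/(d *: k) (linZ lh).
have inv := str_unit dk'.
rewrite -[LHS](@scale1r (tensor A T) (ext L T)) -inv mulrC -scalerA extZ_tens mulr1 dx.
have -> : (tens (b *: l : res L) (1 : T) : ext L T) =
    (tens (b : A) (1 : T) : tensor A T) *: (tens (l : res L) (1 : T) : ext L T).
  by rewrite extZ_tens mulr1.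
have -> : tens (b : A) (1 : T) = tens (str d : A) (1 : T) * tmap (fun a : A => a) h alpha.
  have := congr1 (tmap (fun a : A => a) h) dal.
  by rewrite fM !tmap_tens // mh.1 => ->.
by rewrite !scalerA mulrA [_ * tens (str d : A) _]mulrC inv mul1r.
Qed.

Section LineData.
Variables (L : lmodType (calg_ring A)) (l : L) (s0 : R) (e : place R -> L).
Hypotheses (fl : free_elt l) (s0n : s0 <> 0) (gl : gen_by s0 l).
Hypotheses (ge : forall v : place R, gen_at v (e v)) (el : forall v : place R, ~ v s0 -> e v = l).

Lemma gen_at_free (v : place R) (x : L) : gen_at v x -> free_elt x.
Proof.
case=> s [vs hs] a ax; have [b hb] := hs l.
apply: (str_reg tA (place_neq0 vs)); apply: fl.
by rewrite mulrC -scalerA hb scalerA mulrC -scalerA ax scaler0.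
Qed.

Lemma ratio_unit (v : place R) (x : L) : gen_at v x ->
  exists alpha : units AK, ratio x l (uval alpha).
Proof.
case=> s [vs hs]; have [b hb] := gl x; have [b' hb'] := hs l.
have sn := place_neq0 vs.
have [k hk] := ff_inv ffK s0n; have [k' hk'] := ff_inv ffK sn.
have bb : b * b' = str s0 * str s.
  apply: (free_inj fl); rewrite mulrC -scalerA -hb scalerA mulrC -scalerA -hb' scalerA.
  by [].
have i1 := str_unit hk; have i2 := str_unit hk'.
have pr : (tens (b : A) (1 : K) * tens (1 : A) k) * (tens (b' : A) (1 : K) * tens (1 : A) k') == 1 :> AK.
  have -> : (tens (b : A) (1 : K) * tens (1 : A) k) * (tens (b' : A) (1 : K) * tens (1 : A) k') =
     (tens (b : A) (1 : K) * tens (b' : A) (1 : K)) * (tens (1 : A) k * tens (1 : A) k') :> AK by ring.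
  rewrite [X in X * _]tensM bb mulr1.
  have -> : tens (str s0 * str s : A) (1 : K) = tens (str s0 : A) (1 : K) * tens (str s : A) (1 : K) :> AK.
    by rewrite tensM mulr1.
  by rewrite mulrACA i1 i2 mulr1.
exists (Units (upair := (tens (b : A) (1 : K) * tens (1 : A) k, tens (b' : A) (1 : K) * tens (1 : A) k')) pr).
exists s0, b; split=> //; rewrite /uval /= mulrCA i1 mulr1.
by [].
Qed.

Lemma umap_proof (B B' : comPzRingType) (f : B -> B') (u : units B) :
  monoid_morphism f -> f (upair u).1 * f (upair u).2 == 1.
Proof. by case=> f1 fM; rewrite -fM (eqP (upairP u)) f1. Qed.
Definition umap (B B' : comPzRingType) (f : B -> B') (hf : monoid_morphism f) (u : units B) : units B' :=
  Units (upair := (f (upair u).1, f (upair u).2)) (umap_proof u hf).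

(** Unit groups are written additively, so 0 is the unit 1: where [e v] is l the ratio is trivial,
    and the remaining places contain s0, hence are finite in number. *)
Lemma line_ideles : exists (alpha : place R -> units AK) (i : ideles A K),
  forall v, ratio (e v) l (uval (alpha v)) /\ uval (i v) = AK_to_Av v (uval (alpha v)).
Proof.
have hal (v : place R) : exists alpha : units AK, ratio (e v) l (uval alpha) /\ (~ v s0 -> alpha = 0).
  have [vs|vs] := pselect (v s0).
    by have [al hal] := ratio_unit (ge v); exists al.
  exists 0; split=> //; rewrite el //; exists 1, 1; split.
  - exact: dk_nz.
  - by rewrite rmorph1.
  by rewrite rmorph1 mulr1.
pose alpha v := projT1 (cid (hal v)).
have [h1 h2] : (forall v, ratio (e v) l (uval (alpha v))) /\ (forall v : place R, ~ v s0 -> alpha v = 0).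
  by split=> v; case: (projT2 (cid (hal v))).
pose x (v : place R) : units (tensor A (Kv K v)) := umap (AK_to_Av_hom v).2 (alpha v).
have hx : finite_set [set v | ~ max_order_unit (x v)]%classic.
  apply: sub_finite_set (places_over_finite s0n) => v /= hv.
  apply: contrapT => /h2 a0; apply: hv.
  have -> : x v = 0; last exact: max_order_unit0.
  apply: val_inj; rewrite /x a0 /=; case: (AK_to_Av_hom v) => _ [f1 _].
  by congr (_, _); exact: f1.
exists alpha, (Ideles hx) => v; split; [exact: h1|by []].
Qed.

Variables (S : calg R) (g : S -> C) (hg : linear g /\ monoid_morphism g).
Variables (hL : fgproj L) (hreg : fgproj reg).
Variables (xi : ext L S -> ext (A := A) reg S) (lin : linear xi) (bij : bijective xi).

Lemma ext_reg_map (y : ext (A := A) reg S) : ext_map g y =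
  tmap (fun a : A => a) g (reg_id y) *: (tens (1 : res (A := A) reg) (1 : C) : ext (A := A) reg C).
Proof.
move: y; apply: tlin_eq.
- exact: ext_map_linear.
- apply: linear_comp (extZ_linl (L := reg) _) _.
  apply: linear_comp (tmap_linear (@id_linear _ _) hg.1) (@reg_id_linear _ _ S).
move=> a t; rewrite reg_id_tens ext_map_tens // tmap_tens //; last exact: hg.1.
by rewrite extZ_tens mulr1 regE mulr1.
Qed.

Lemma line_unit : exists u : units AC,
  uval u = tmap (fun a : A => a) g (reg_id (xi (tens (l : res L) (1 : S)))).
Proof.
have [h xiK hK] := bij.
have [z hz] := ext_gen_by (h (tens (1 : res (A := A) reg) (1 : S))) gl.
have [lf [f1 fM]] := @tmap_ring R A S C g hg.1 hg.2.
set u := tmap _ _ _.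
have hu : tens (str s0 : A) (1 : C) = tmap (fun a : A => a) g z * u.
  have := congr1 (fun y => tmap (fun a : A => a) g (reg_id (xi y))) hz.
  rewrite !(linZ lin) hK !reg_id_scale reg_id_tens !fM => <-.
  by rewrite !tmap_tens //; [rewrite hg.2.1 tensM !mulr1|exact: hg.1|exact: hg.1].
have [k hk] := ff_inv ffK s0n.
have st : calg_str C s0 * j k = 1.
  have := congr1 j hk; rewrite hj.2.1 => <-.
  by rewrite -[calg_str K s0 * k]/(s0 *: k) (linZ hj.1).
have pr : u * (tmap (fun a : A => a) g z * tens (1 : A) (j k)) == 1.
  by rewrite mulrA [u * _]mulrC -hu; apply/eqP; exact: str_unit.
by exists (Units (upair := (u, tmap (fun a : A => a) g z * tens (1 : A) (j k))) pr).
Qed.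

(** All matrices are 1 x 1. The bases are l and the [e v] on one side and 1 on the other, so M2 is
    1, M1 is the image of [alpha v] and mu the value of xi at l. *)
Lemma line_idelic (alpha : place R -> units AK) (i : ideles A K) (u : units AC) :
  (forall v, ratio (e v) l (uval (alpha v))) ->
  (forall v, uval (i v) = AK_to_Av v (uval (alpha v))) ->
  uval u = tmap (fun a : A => a) g (reg_id (xi (tens (l : res L) (1 : S)))) ->
  idelic_class (j := j) (triple_ext hg (Triple hL hreg lin bij))
    (qproj (principal j) (qproj (@unit_ideles R A K) i, u)).
Proof.
move=> hal hi hu.
have f1 : free_elt (1 : reg) by move=> a; rewrite regE mulr1.
have g1 : gen_by 1 (1 : reg) by move=> x; exists x; rewrite rmorph1 scale1r regE mulr1.
exists 1%N, (fun _ => tens (l : res L) (1 : K)), (fun _ => tens (1 : res (A := A) reg) (1 : K)),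
  (fun v _ => tens (e v : res L) (1 : Rv v)), (fun v _ => tens (1 : res (A := A) reg) (1 : Rv v)),
  (fun v => (uval (i v))%:M), (fun v => 1%:M), ((uval u)%:M), i, u.
have [k hk] := ff_inv ffK s0n; split.
- split; first exact: ext_gen_basis fl gl hk.
  by apply: (ext_gen_basis (t := 1) f1 g1); rewrite rmorph1 mul1r.
- move=> v; split; last by apply: (ext_gen_basis (t := 1) f1 g1); rewrite rmorph1 mul1r.
  have [s [vs hs]] := ge v; have [t ht] := completion_inv vs.
  exact: ext_gen_basis (gen_at_free (ge v)) hs ht.
- move=> v k'; rewrite !big_ord1 !ord1 !mxE eqxx !mulr1n.
  have h1 : ext_map (@Rv_to_Kv R K v) (tens (e v : res L) (1 : Rv v) : ext L (Rv v)) =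
      tens (e v : res L) (1 : Kv K v).
    by rewrite (ext_map_tens (Rv_to_Kv_hom v)) (Rv_to_Kv_hom v).2.1.
  have h2 : ext_map (@K_to_Kv R K v) (tens (l : res L) (1 : K) : ext L K) =
      tens (l : res L) (1 : Kv K v).
    by rewrite (ext_map_tens (K_to_Kv_hom v)) (K_to_Kv_hom v).2.1.
  rewrite h1 h2 hi; split.
    exact: ratioE (K_to_Kv_hom v).1 (K_to_Kv_hom v).2 (hal v).
  rewrite scale1r (ext_map_tens (K_to_Kv_hom v)) (ext_map_tens (Rv_to_Kv_hom v)).
  by rewrite (K_to_Kv_hom v).2.1 (Rv_to_Kv_hom v).2.1.
- move=> k'; rewrite big_ord1 !ord1 !mxE eqxx !mulr1n.
  rewrite (ext_map_tens hj) hj.2.1 [LHS](base_change_tens hg lin).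
  rewrite -[tens (1 : A) (1 : C)]/(1 : AC) scale1r ext_reg_map -hu.
  by rewrite (ext_map_tens hj) hj.2.1.
split=> [v||//]; last by rewrite det_scalar1.
by rewrite !det_scalar1 mulr1.
Qed.
End LineData.
End LineClass.

(** * Determinants of maps between images of idempotents *)

Section Idempotents.
Variable B : comPzRingType.

(** This is what lets determinants be compared between idempotents of different sizes presenting
    isomorphic modules. *)
Lemma det_sylvester m n (X : 'M[B]_(m, n)) (Y : 'M[B]_(n, m)) :
  \det (1%:M + X *m Y) = \det (1%:M + Y *m X).
Proof.
pose P := block_mx 1%:M (- X) Y 1%:M; pose U := block_mx 1%:M X 0 1%:M.
have dU : \det U = 1 by rewrite det_ublock !det1 mulr1.
have h1 : \det P = \det (1%:M + Y *m X).
  have : \det (P *m U) = \det (1%:M + Y *m X).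
    rewrite mulmx_block !mul1mx !mulmx1 !mulmx0 !addr0 subrr det_lblock det1 mul1r.
    by rewrite addrC.
  by rewrite det_mulmx dU mulr1.
have h2 : \det P = \det (1%:M + X *m Y).
  have : \det (U *m P) = \det (1%:M + X *m Y).
    rewrite mulmx_block !mul1mx !mulmx1 !mul0mx !add0r addNr det_lblock det1 mulr1.
    by [].
  by rewrite det_mulmx dU mul1r.
by rewrite -h1 -h2.
Qed.

(* Mutually inverse isomorphisms between the images of two idempotents. *)
Definition mxiso m n (E : 'M[B]_m) (E' : 'M[B]_n) (X : 'M[B]_(m, n)) (Y : 'M[B]_(n, m)) : Prop :=
  [/\ X *m Y = E, Y *m X = E', E *m X = X, X *m E' = X & E' *m Y = Y /\ Y *m E = Y].

(* The determinant of the automorphism [a] of the image of E. *)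
Definition autdet m (E a : 'M[B]_m) : B := \det (1%:M + (a - E)).

Lemma mxisoC m n E E' X Y : @mxiso m n E E' X Y -> mxiso E' E Y X.
Proof. by case=> ? ? ? ? []. Qed.

Lemma mxiso_comp m n k E E' E'' X Y X' Y' : @mxiso m n E E' X Y -> @mxiso n k E' E'' X' Y' ->
  mxiso E E'' (X *m X') (Y' *m Y).
Proof.
case=> h1 h2 h3 h4 [h5 h6] [g1 g2 g3 g4 [g5 g6]]; split.
- by rewrite mulmxA -[X *m X' *m Y']mulmxA g1 h4.
- by rewrite mulmxA -[Y' *m Y *m X]mulmxA h2 g6.
- by rewrite mulmxA h3.
- by rewrite -mulmxA g4.
- by split; rewrite ?mulmxA ?g5 // -mulmxA h6.
Qed.

Lemma autdet_id m (E : 'M[B]_m) : autdet E E = 1.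
Proof. by rewrite /autdet subrr addr0 det1. Qed.

Lemma autdet_1 m (a : 'M[B]_m) : autdet 1%:M a = \det a.
Proof. by rewrite /autdet addrC subrK. Qed.

Lemma autdetM m (E a b : 'M[B]_m) : E *m E = E -> a *m E = a -> E *m b = b ->
  autdet E (a *m b) = autdet E a * autdet E b.
Proof.
move=> EE aE Eb; rewrite /autdet -det_mulmx; congr (\det _).
have k : (a - E) *m (b - E) = a *m b - a - b + E.
  by rewrite mulmxBl !mulmxBr aE Eb EE opprD opprK addrA.
rewrite mulmxDl mul1mx mulmxDr mulmx1 k; move: (a *m b) => ab.
by apply/matrixP => i l; rewrite !mxE; ring.
Qed.

Lemma autdet_conj m n E E' X Y a : @mxiso m n E E' X Y -> E' *m a = a -> a *m E' = a ->
  autdet E (X *m a *m Y) = autdet E' a.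
Proof.
case=> h1 h2 h3 h4 [h5 h6] E'a aE'; rewrite /autdet.
have -> : X *m a *m Y - E = (X *m (a - E')) *m Y.
  by rewrite mulmxBr mulmxBl h4 h1.
rewrite det_sylvester mulmxA h2 mulmxBr E'a.
have -> : E' *m E' = E' by rewrite -{1}h2 -mulmxA h4.
by [].
Qed.

Lemma mxiso_idem m n E E' X Y : @mxiso m n E E' X Y -> E *m E = E.
Proof. by case=> h1 h2 h3 h4 [h5 h6]; rewrite -{2}h1 mulmxA h3. Qed.
End Idempotents.

Definition mk_rmorph (B B' : pzRingType) (f : B -> B') (h1 : zmod_morphism f)
  (h2 : monoid_morphism f) : {rmorphism B -> B'} :=
  HB.pack f (GRing.isZmodMorphism.Build B B' f h1) (GRing.isMonoidMorphism.Build B B' f h2).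

(** * Local isomorphisms between images of idempotents *)

Section LocalFreeness.
Variables (B : comPzRingType) (m : B -> Prop) (mm : maxideal m).

Lemma det_cong n (M N : 'M[B]_n) : (forall i j, m (M i j - N i j)) -> m (\det M - \det N).
Proof.
move=> h; have im := maxidealP mm.
have e x y : rproj m x = rproj m y <-> m (x - y).
  rewrite rproj_eq; split=> [g|g J _]; last exact.
  by apply: g.
pose f := mk_rmorph (fun x y => rprojB m x y)
  (conj (erefl : rproj m 1 = 1) (fun x y => rprojM m x y)).
apply/e; rewrite -[LHS]/(f _) -[RHS]/(f _) -!det_map_mx; congr (\det _).
by apply/matrixP => i j; rewrite !mxE; apply/e.
Qed.

Lemma proj_local_free n (E : 'M[B]_n) : E *m E = E ->
  exists r (X : 'M[B]_(n, r)) (Y : 'M[B]_(r, n)) u,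
    [/\ ~ m u, X *m Y = u *: E, Y *m X = u%:M, E *m X = X & Y *m E = Y].
Proof.
move=> EE; have im := maxidealP mm; case: (mm) => _ m1 hm.
pose P r := exists (X : 'M[B]_(n, r)) (Y : 'M[B]_(r, n)) u,
  [/\ ~ m u, X *m Y = u *: E, E *m X = X & Y *m E = Y].
have exP : exists r, `[< P r >].
  by exists n; apply/asboolP; exists E, E, 1; split=> //; rewrite scale1r.
case: (ex_minnP exP) => r /asboolP [X [Y [u [mu XY EX YE]]]] rmin.
pose N := Y *m X - u%:M.
have NY : N *m Y = 0.
  by rewrite /N mulmxBl -mulmxA XY -scalemxAr YE mul_scalar_mx subrr.
have mN i k : m (N i k).
  apply: contrapT => nik.
  case: r X Y XY EX YE rmin N NY i k nik => [|r] X Y XY EX YE rmin N NY i k nik; first by case: i nik.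
  suff /rmin : `[< P r >] by rewrite ltnn.
  apply/asboolP.
  (* the k-th generator is superfluous *)
  exists (N i k *: col' k X - col k X *m row i (col' k N)), (row' k Y), (N i k * u).
  split.
  - by case/(maxideal_prime mm).
  - have hk : N i k *: row k Y = - (row i (col' k N) *m row' k Y).
      apply/eqP; rewrite -addr_eq0; apply/eqP; apply/rowP => j.
      have := congr1 (fun M : 'M_(_, _) => M i j) NY; rewrite !mxE (bigD1_ord k) //= => h0.
      by rewrite -[RHS]h0; congr (_ + _); apply: eq_bigr => a _; rewrite !mxE.
    have dec : X *m Y = col k X *m row k Y + col' k X *m row' k Y.
      apply/matrixP => a b; rewrite !mxE (bigD1_ord k) //= big_ord1 !mxE; congr (_ + _).
      by apply: eq_bigr => c _; rewrite !mxE.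
    rewrite mulmxBl -scalemxAl -mulmxA -[row i _ *m _]opprK -hk mulmxN opprK.
    by rewrite -scalemxAr -scalerDr addrC -dec XY scalerA.
  - have h1 : E *m col' k X = col' k X.
      by rewrite -{2}EX; apply/matrixP => a b; rewrite !mxE; apply: eq_bigr => c _; rewrite !mxE.
    have h2 : E *m col k X = col k X.
      by rewrite -{2}EX; apply/matrixP => a b; rewrite !mxE; apply: eq_bigr => c _; rewrite !mxE.
    by rewrite mulmxBr -scalemxAr mulmxA h1 h2.
  by rewrite -{2}YE; apply/matrixP => a b; rewrite !mxE; apply: eq_bigr => c _; rewrite !mxE.
set D := Y *m X; pose dl := \det D.
have md : ~ m dl.
  have : m (\det D - \det (u%:M : 'M_r)).
    by apply: det_cong => i k; have := mN i k; rewrite !mxE.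
  rewrite det_scalar => h md; have : m (u ^+ r) by have := idealB im md h; rewrite subKr.
  elim: r {X Y XY EX YE rmin N NY mN D dl md h} => [//|r ih]; rewrite exprS.
  by case/(maxideal_prime mm).
have hD : dl *: D = (dl * u)%:M.
  have : N *m D = 0 by rewrite /D mulmxA NY mul0mx.
  move=> /(congr1 (mulmxr (\adj D))) /=; rewrite mul0mx -mulmxA mul_mx_adj.
  rewrite /N -/D mul_mx_scalar scalerBr -/dl => /eqP; rewrite subr_eq0 => /eqP ->.
  by rewrite scale_scalar_mx.
exists r, (dl *: X), Y, (dl * u); split.
- by case/(maxideal_prime mm).
- by rewrite -scalemxAl XY scalerA.
- by rewrite -scalemxAr.
- by rewrite -scalemxAr EX.
- exact: YE.
Qed.
End LocalFreeness.

Lemma rank_bound (B : comPzRingType) r r' (P : 'M[B]_(r, r')) (Q : 'M[B]_(r', r)) w :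
  P *m Q = w%:M -> (r' < r)%N -> w ^+ r = 0.
Proof.
move=> PQ lt; have [k ek] : exists k, r = (r' + k.+1)%N.
  by exists (r - r'.+1)%N; rewrite addnS -addSn subnKC.
subst r; rewrite -det_scalar -PQ.
have -> : P *m Q = row_mx P (0 : 'M_(_, k.+1)) *m col_mx Q 0 by rewrite mul_row_col mulmx0 addr0.
rewrite det_mulmx (expand_det_col _ (rshift r' ord0)) big1 ?mul0r // => i _.
by rewrite row_mxEr mxE mul0r.
Qed.

Lemma fingen_fin (R : comPzRingType) (M : lmodType R) (T : finType) (v : T -> M) :
  (forall x, exists c : T -> R, x = \sum_t c t *: v t) -> fingen M.
Proof.
move=> h; exists #|T|, (fun i => v (enum_val i)) => x; have [c ->] := h x.
exists (fun i => c (enum_val i)).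
rewrite (reindex (@enum_val T T)) //=; exact: onW_bij (@enum_val_bij T).
Qed.

Section LocalIso.
Variables (R : comPzRingType) (dk : dedekind_like R) (A : calg R).
Hypotheses (fA : fingen A).
Local Notation str := (calg_str A).
Variables (B : comPzRingType) (f : {rmorphism calg_ring A -> B}).
Hypothesis finj : injective f.
Variables (n1 n2 : nat) (E1 : 'M[calg_ring A]_n1) (E2 : 'M[calg_ring A]_n2).
Hypotheses (EE1 : E1 *m E1 = E1) (EE2 : E2 *m E2 = E2).
Variables (L : 'M[B]_(n1, n2)) (L' : 'M[B]_(n2, n1)).
Hypothesis hL : mxiso (map_mx f E1) (map_mx f E2) L L'.

(** The isomorphism exists over B only. There it factors u' u times the identity of size r1 through
    size r2; if r2 < r1, a power of u' u vanishes in B, hence in A by injectivity, although u' u is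
    outside m. *)
Lemma rank_le (m1 m2 r1 r2 : nat) (E : 'M[calg_ring A]_m1) (E' : 'M[calg_ring A]_m2)
   (L0 : 'M[B]_(m1, m2)) (L0' : 'M[B]_(m2, m1))
   (X : 'M_(m1, r1)) (Y : 'M_(r1, m1)) u (X' : 'M_(m2, r2)) (Y' : 'M_(r2, m2)) u'
   (m : calg_ring A -> Prop) :
  maxideal m -> mxiso (map_mx f E) (map_mx f E') L0 L0' -> ~ m u -> ~ m u' ->
  X *m Y = u *: E -> Y *m X = u%:M -> E *m X = X -> Y *m E = Y ->
  X' *m Y' = u' *: E' -> (r1 <= r2)%N.
Proof.
move=> mm [h1 h2 h3 h4 [h5 h6]] mu mu' XY YX EX YE XY'.
rewrite leqNgt; apply/negP => lt.
pose P := map_mx f Y *m L0 *m map_mx f X'; pose Q := map_mx f Y' *m L0' *m map_mx f X.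
have PQ : P *m Q = (f (u' * u))%:M.
  rewrite /P /Q !mulmxA -[_ *m map_mx f X' *m map_mx f Y']mulmxA -map_mxM XY' map_mxZ.
  rewrite -scalemxAr -!scalemxAl -[_ *m L0 *m map_mx f E']mulmxA h4 -[_ *m L0 *m L0']mulmxA h1.
  by rewrite -map_mxM YE -map_mxM YX map_scalar_mx scale_scalar_mx rmorphM.
have /eqP := rank_bound PQ lt.
rewrite -rmorphXn -(rmorph0 f) => /eqP /finj h.
have : m ((u' * u) ^+ r1) by rewrite h; exact: ideal0 (maxidealP mm).
have nm : ~ m (u' * u) by case/(maxideal_prime mm).
case: (mm) => _ m1' _.
by elim: (r1) => [//|k ih]; rewrite exprS; case/(maxideal_prime mm).
Qed.

Local Notation M12 := 'M[calg_ring A]_(n1, n2).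

Let cong (m : calg_ring A -> Prop) k l (X Y : 'M[calg_ring A]_(k, l)) := forall i j, m (X i j - Y i j).

Lemma congM m k l r (X X' : 'M_(k, l)) (Y Y' : 'M_(l, r)) : maxideal m ->
  cong m X X' -> cong m Y Y' -> cong m (X *m Y) (X' *m Y').
Proof.
move=> mm hX hY i j; have im := maxidealP mm; rewrite !mxE -sumrB.
apply: ideal_sum => // a _.
have -> : X i a * Y a j - X' i a * Y' a j = (X i a - X' i a) * Y a j + X' i a * (Y a j - Y' a j) by ring.
by apply: idealD => //; [exact: idealMr|exact: idealMl].
Qed.
Lemma cong_refl m k l (X : 'M_(k, l)) : maxideal m -> cong m X X.
Proof. by move=> mm i j; rewrite subrr; exact: ideal0 (maxidealP mm). Qed.
Lemma cong_sym m k l (X Y : 'M_(k, l)) : maxideal m -> cong m X Y -> cong m Y X.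
Proof. by move=> mm h i j; apply: idealBC; [exact: maxidealP|exact: h]. Qed.
Lemma cong_trans m k l (X Y Z : 'M_(k, l)) : maxideal m -> cong m X Y -> cong m Y Z -> cong m X Z.
Proof.
move=> mm h h' i j; have im := maxidealP mm.
have -> : X i j - Z i j = (X i j - Y i j) + (Y i j - Z i j) by ring.
exact: idealD.
Qed.

Lemma cong_scale m t k l (X Y : 'M_(k, l)) : maxideal m -> cong m X Y -> cong m (t *: X) (t *: Y).
Proof. by move=> mm g i j; rewrite !mxE -mulrBr; apply: idealMl; [exact: maxidealP|exact: g]. Qed.
Lemma cong_inv m (t u : calg_ring A) k l (X : 'M_(k, l)) : maxideal m -> m (1 - t * u) ->
  cong m (t *: (u *: X)) X.
Proof.
move=> mm g i j; rewrite !mxE mulrA.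
have -> : t * u * X i j - X i j = - (1 - t * u) * X i j by ring.
by apply: idealMr; [exact: maxidealP|apply: idealN => //; exact: maxidealP].
Qed.

(** E1 h E2 in place of h: Chinese remaindering runs over all matrices h, and the idempotents bring
    the result back between the two images. *)
Let good (m : calg_ring A -> Prop) (h : M12) := exists (k : 'M[calg_ring A]_(n2, n1)) u,
  [/\ ~ m u, cong m (E1 *m h *m E2 *m k) (u *: E1) & cong m (k *m (E1 *m h *m E2)) (u *: E2)].

Lemma good_exists m : maxideal m -> exists h, good m h.
Proof.
move=> mm.
have [r1 [X1 [Y1 [u1 [m1 XY1 YX1 EX1 YE1]]]]] := proj_local_free mm EE1.
have [r2 [X2 [Y2 [u2 [m2 XY2 YX2 EX2 YE2]]]]] := proj_local_free mm EE2.
have e : r1 = r2.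
  apply/eqP; rewrite eqn_leq (rank_le mm hL m1 m2 XY1 YX1 EX1 YE1 XY2).
  by rewrite (rank_le mm (mxisoC hL) m2 m1 XY2 YX2 EX2 YE2 XY1).
subst r2; exists (X1 *m Y2), (X2 *m Y1), (u2 * u1).
have h12 : X1 *m Y2 *m (X2 *m Y1) = (u2 * u1) *: E1.
  rewrite mulmxA -[X1 *m Y2 *m X2]mulmxA YX2 mul_mx_scalar -scalemxAl XY1.
  by rewrite scalerA.
have h21 : X2 *m Y1 *m (X1 *m Y2) = (u2 * u1) *: E2.
  rewrite mulmxA -[X2 *m Y1 *m X1]mulmxA YX1 mul_mx_scalar -scalemxAl XY2.
  by rewrite scalerA mulrC.
have hE : E1 *m (X1 *m Y2) *m E2 = X1 *m Y2 by rewrite mulmxA EX1 -mulmxA YE2.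
rewrite hE h12 h21; split; [|exact: cong_refl|exact: cong_refl].
by case/(maxideal_prime mm).
Qed.

Lemma good_stable m a (h x : M12) : maxideal m -> m a -> good m h -> good m (h + a *: x).
Proof.
move=> mm ma [k [u [mu c1 c2]]]; exists k, u; have im := maxidealP mm.
have ch : cong m (E1 *m (h + a *: x) *m E2) (E1 *m h *m E2).
  do ![apply: congM => //; try exact: cong_refl].
  move=> i j; rewrite !mxE.
    have -> : h i j + a * x i j - h i j = a * x i j by ring.
    exact: idealMr.
split=> //; first by apply: cong_trans c1 => //; apply: congM => //; exact: cong_refl.
by apply: cong_trans c2 => //; apply: congM => //; exact: cong_refl.
Qed.

Lemma cong_idmod m n (x y : 'rV[calg_ring A]_n) : cong m x y -> idmod m (x - y).
Proof.
move=> h; have -> : x - y = \sum_j (x 0 j - y 0 j) *: delta_mx 0 j.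
  rewrite [LHS]row_sum_delta; apply: eq_bigr => j _; by rewrite !mxE.
by apply: submod_sum; [exact: idmod_submod|move=> j _; apply: idmodM; exact: h].
Qed.

Lemma row_fingen n : fingen (res (A := A) ('rV[calg_ring A]_n : lmodType (calg_ring A))).
Proof.
have [k [v gen]] := fA.
apply: (@fingen_fin R (res (A := A) ('rV[calg_ring A]_n : lmodType (calg_ring A))) ('I_n * 'I_k)%type
  (fun q => v q.2 *: (delta_mx 0 q.1 : 'rV[calg_ring A]_n))) => x.
pose c i := projT1 (cid (gen (x 0 i))).
exists (fun q => c q.1 q.2).
rewrite -(pair_bigA _ (fun i a => c i a *: (v a *: delta_mx 0 i : res (A := A) 'rV[calg_ring A]_n))) /=.
rewrite [LHS](row_sum_delta (x : 'rV_n)); apply: eq_bigr => i _.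
rewrite {1}(projT2 (cid (gen (x 0 i)))) scaler_suml; apply: eq_bigr => a _.
by rewrite resE scalerA.
Qed.

(** [local_gen] is applied to the row vectors v such that v E is a combination of the rows of H. *)
Lemma local_factor (p : place R) n k (E : 'M[calg_ring A]_n) (H : 'M[calg_ring A]_(k, n)) :
  E *m E = E -> H *m E = H ->
  (forall m, maxideal m -> (forall x, pideal (A := A) p x -> m x) ->
     exists Z : 'M_(n, k), cong m (Z *m H) E) ->
  exists s (W : 'M_(n, k)), ~ p s /\ W *m H = str s *: E.
Proof.
move=> EE HE hm.
pose N (v : 'rV[calg_ring A]_n) := exists w : 'rV_k, v *m E = w *m H.
have hN : submod N.
  split; first by exists 0; rewrite !mul0mx.
    by move=> x y [w hw] [w' hw']; exists (w + w'); rewrite !mulmxDl hw hw'.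
  by move=> a x [w hw]; exists (a *: w); rewrite -!scalemxAl hw.
have [|||s [ps hs]] := local_gen dk fA (M := 'rV[calg_ring A]_n) (N := N) (p := p).
- exact: row_fingen.
- exact: hN.
- move=> m mm pm x; have [Z hZ] := hm m mm pm.
  exists (x - x *m E + x *m (Z *m H)).
    exists (x *m Z); rewrite mulmxDl mulmxBl -!mulmxA EE subrr add0r HE.
    by rewrite !mulmxA.
  have -> : x - (x - x *m E + x *m (Z *m H)) = x *m E - x *m (Z *m H).
    by move: (x *m E) (x *m (Z *m H)) => a b; apply/rowP => l; rewrite !mxE; ring.
  apply: cong_idmod; apply: congM => //; first exact: cong_refl.
  exact: cong_sym.
have hw i : exists w : 'rV_k, str s *: row i E = w *m H.
  have [w hw] := hs (row i E); exists w; rewrite -hw -scalemxAl -row_mul EE.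
  by [].
exists s, (\matrix_i projT1 (cid (hw i))); split=> //.
apply/row_matrixP => i; rewrite row_mul rowK -(projT2 (cid (hw i))).
by apply/rowP => j; rewrite !mxE.
Qed.

(** A matrix invertible between the images modulo every maximal ideal over p is found by
    [semilocal_choice]; [local_factor] then gives it a left inverse up to some s outside p. *)
Lemma local_iso (p : place R) : exists s (X : 'M[calg_ring A]_(n1, n2)) (Y : 'M_(n2, n1)),
  [/\ ~ p s, X *m Y = str s *: E1, Y *m X = str s *: E2, E1 *m X *m E2 = X & E2 *m Y *m E1 = Y].
Proof.
have [h hh] := semilocal_choice (pideal_fin dk fA p) (good := good)
  (fun m mm _ => good_exists mm) (fun m mm _ a h x ma => @good_stable m a h x mm ma).
pose H := E1 *m h *m E2.
have EH : E1 *m H = H by rewrite /H !mulmxA EE1.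
have HE : H *m E2 = H by rewrite /H -!mulmxA EE2.
have hH (m : calg_ring A -> Prop) : maxideal m -> (forall x, pideal (A := A) p x -> m x) ->
    exists (k : 'M[calg_ring A]_(n2, n1)) u,
      [/\ ~ m u, cong m (H *m k) (u *: E1) & cong m (k *m H) (u *: E2)] by exact: hh.
clearbody H; clear h hh.
have inv (m : calg_ring A -> Prop) u : maxideal m -> ~ m u -> exists t, m (1 - t * u).
  by move=> [_ _ hm] mu; have [t ht] := hm u mu; exists t; rewrite mulrC.
have [s [W [ps hW]]] : exists s (W : 'M_(n2, n1)), ~ p s /\ W *m H = str s *: E2.
  apply: local_factor => // m mm pm; have [k [u [mu c1 c2]]] := hH m mm pm.
  have [t ht] := inv m u mm mu; exists (t *: k).
  rewrite -scalemxAl; exact: (cong_trans mm (cong_scale t mm c2) (cong_inv E2 mm ht)).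
pose W' := E2 *m W *m E1.
have W'H : W' *m H = str s *: E2.
  by rewrite /W' -!mulmxA EH hW -scalemxAr EE2.
have EW : E2 *m W' = W' by rewrite /W' !mulmxA EE2.
have WE : W' *m E1 = W' by rewrite /W' -!mulmxA EE1.
clearbody W'.
(* W' H = s E2 is one-sided. Modulo each m over p, H is invertible and s is a unit, so H W' is s E1
   there, and the factorization argument applies to W' in turn. *)
have [s' [V [ps' hV]]] : exists s' (V : 'M_(n1, n2)), ~ p s' /\ V *m W' = str s' *: E1.
  apply: local_factor => //.
  move=> m mm pm; have [k [u [mu c1 c2]]] := hH m mm pm.
  have [t ht] := inv m u mm mu.
  have ms := pideal_unit dk mm pm ps.
  have [t' ht'] := inv m _ mm ms.
  exists (t' *: H); rewrite -scalemxAl.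
  have w1 : cong m (u *: W') (str s *: (E2 *m k *m E1)).
    have -> : u *: W' = W' *m (u *: E1) by rewrite -scalemxAr WE.
    apply: (@cong_trans _ _ _ _ (W' *m (H *m k *m E1))) => //.
      apply: congM => //; first exact: cong_refl.
      have -> : u *: E1 = (u *: E1) *m E1 by rewrite -scalemxAl EE1.
      by apply: congM => //; [exact: cong_sym|exact: cong_refl].
    rewrite !mulmxA W'H -!scalemxAl; exact: cong_refl.
  have w2 : cong m (u *: (H *m W')) (u *: (str s *: E1)).
    rewrite scalemxAr.
    apply: (@cong_trans _ _ _ _ (H *m (str s *: (E2 *m k *m E1)))) => //.
      by apply: congM => //; exact: cong_refl.
    rewrite -scalemxAr !mulmxA HE scalerA mulrC -scalerA; apply: cong_scale => //.
    have -> : u *: E1 = (u *: E1) *m E1 by rewrite -scalemxAl EE1.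
    by apply: congM => //; exact: cong_refl.
  have w3 : cong m (H *m W') (str s *: E1).
    apply: (cong_trans mm (cong_sym mm (cong_inv (H *m W') mm ht))).
    exact: (cong_trans mm (cong_scale t mm w2) (cong_inv (str s *: E1) mm ht)).
  exact: (cong_trans mm (cong_scale t' mm w3) (cong_inv E1 mm ht')).
(* Reading V W' H in two ways shows that the left inverse V of W' is H up to s and s', so the
   inverse is two-sided. *)
have VH : str s *: (E1 *m V *m E2) = str s' *: H.
  have : E1 *m V *m W' *m H = str s' *: H by rewrite -[E1 *m V *m W']mulmxA hV -scalemxAr EE1 -scalemxAl EH.
  by rewrite -!mulmxA W'H -scalemxAr -scalemxAr => ->.
have ip := place_idealP p.
exists (s' * s), (str s' *: H), W'; split.
- by case/place_prime.
- rewrite -VH -!scalemxAl -mulmxA.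
  by rewrite EW -mulmxA hV -scalemxAr EE1 scalerA -rmorphM mulrC.
- by rewrite -scalemxAr W'H scalerA -rmorphM.
- by rewrite -scalemxAr EH -scalemxAl HE.
by rewrite EW WE.
Qed.
End LocalIso.

(** * Determinant invariants of the relative K-group *)

Section Frames.
Variables (R : comPzRingType) (A : calg R).
Implicit Types L : lmodType (calg_ring A).

Definition frame L := {n : nat & (('I_n -> L) * ('I_n -> dual L))%type}.
Definition is_frame L (f : frame L) : Prop := forall x : L,
  x = \sum_k ((tagged f).2 k x : calg_ring A) *: (tagged f).1 k.

Lemma fgproj_frame L : fgproj L -> exists f : frame L, is_frame f.
Proof.
case=> n [i [p pK]].
have hc k : linear (fun x : L => i x 0 k : (calg_ring A)^o).
  by move=> a x y; rewrite linearP !mxE.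
exists (Tagged (fun n => (('I_n -> L) * ('I_n -> dual L))%type)
  ((fun k => p (delta_mx 0 k)), (fun k => mkdual (hc k)))) => x /=.
by rewrite -{1}[x]pK {1}[i x]row_sum_delta raddf_sum; apply: eq_bigr => k _; rewrite [LHS]linearZ.
Qed.

(** A dual basis chosen once for each proof h, so that all matrices below are functions of h: [fe]
    are the generators, [fc] the coordinates, and [pmx] the idempotent presenting L. *)
Definition fr L (h : fgproj L) : frame L := projT1 (cid (fgproj_frame h)).
Definition fn L (h : fgproj L) : nat := tag (fr h).
Definition fe L (h : fgproj L) : 'I_(fn h) -> L := (tagged (fr h)).1.
Definition fc L (h : fgproj L) : 'I_(fn h) -> dual L := (tagged (fr h)).2.
Arguments fe {L} h k.
Arguments fc {L} h k.
Lemma frP L (h : fgproj L) x : x = \sum_k (fc h k x : calg_ring A) *: fe h k.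
Proof. exact: (projT2 (cid (fgproj_frame h))). Qed.

Definition pmx L (h : fgproj L) : 'M[calg_ring A]_(fn h) := \matrix_(k, l) (fc h l (fe h k) : calg_ring A).

Lemma pmx_idem L (h : fgproj L) : pmx h *m pmx h = pmx h.
Proof.
apply/matrixP => k l; rewrite [RHS]mxE [X in fc h l X](frP h (fe h k)).
rewrite (linear_sum _ _ _ (dual_lin (fc h l))) mxE; apply: eq_bigr => q _.
by rewrite !mxE (linZ (dual_lin (fc h l))).
Qed.

Section Scalars.
Variable T : calg R.

Definition cst (a : calg_ring A) : tensor A T := tens (a : A) (1 : T).
Fact cst_zmod : zmod_morphism cst.
Proof. by move=> a b; rewrite /cst (bilinDl (tens_bilin A T)) (bilinNl (tens_bilin A T)). Qed.
Fact cst_monoid : monoid_morphism cst.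
Proof. by split=> // a b; rewrite /cst tensM mulr1. Qed.
HB.instance Definition _ := GRing.isZmodMorphism.Build (calg_ring A) (tensor A T) cst cst_zmod.
HB.instance Definition _ := GRing.isMonoidMorphism.Build (calg_ring A) (tensor A T) cst cst_monoid.

Definition ec L (h : fgproj L) k (x : ext L T) : tensor A T :=
  reg_id (ext_fun (fc h k : L -> (calg_ring A)^o) x).
Definition eg L (h : fgproj L) k : ext L T := tens (fe h k : res L) (1 : T).
Arguments ec {L} h k x.
Arguments eg {L} h k.

Lemma ecZ L (h : fgproj L) k z x : ec h k (z *: x) = z * ec h k x.
Proof. by rewrite /ec (linZ (ext_fun_linear (dual_lin (fc h k)))) reg_id_scale. Qed.
Lemma ecD L (h : fgproj L) k x y : ec h k (x + y) = ec h k x + ec h k y.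
Proof. by rewrite /ec (linD (ext_fun_linear (dual_lin (fc h k)))) (linD (@reg_id_linear _ A T)). Qed.
Lemma ec_lin L (h : fgproj L) k : linear (ec h k : ext L T -> (tensor A T)^o).
Proof. by move=> z x y; rewrite ecD ecZ. Qed.
Arguments ec_lin {L} h k.
Lemma ec_tens L (h : fgproj L) k (l : L) (t : T) :
  ec h k (tens (l : res L) t) = tens (fc h k l : A) t.
Proof. by rewrite /ec (ext_fun_tens _ _ (dual_lin (fc h k))) reg_id_tens. Qed.
Lemma ec_eg L (h : fgproj L) k l : ec h k (eg h l) = cst (pmx h l k).
Proof. by rewrite /eg ec_tens /cst mxE. Qed.

Lemma egP L (h : fgproj L) x : x = \sum_k ec h k x *: eg h k.
Proof.
move: x; apply: tensor_eq => [//|x y|l t].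
  by rewrite -big_split /=; apply: eq_bigr => k _; rewrite ecD scalerDl.
transitivity (tens (\sum_k (fc h k l : calg_ring A) *: fe h k : res L) t); first by rewrite -frP.
rewrite (linear_sum _ _ _ ((tens_bilin (res L) T).1 t)); apply: eq_bigr => k _.
by rewrite ec_tens /eg extZ_tens mulr1.
Qed.

Definition Mx L1 L2 (h1 : fgproj L1) (h2 : fgproj L2) (f : ext L1 T -> ext L2 T) :
  'M[tensor A T]_(fn h1, fn h2) := \matrix_(k, l) ec h2 l (f (eg h1 k)).

Lemma Mx_comp L1 L2 L3 (h1 : fgproj L1) (h2 : fgproj L2) (h3 : fgproj L3)
    (f : ext L1 T -> ext L2 T) (g : ext L2 T -> ext L3 T) : linear g ->
  Mx h1 h3 (g \o f) = Mx h1 h2 f *m Mx h2 h3 g.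
Proof.
move=> lg; apply/matrixP => k l; rewrite !mxE /= {1}(egP h2 (f (eg h1 k))).
rewrite (linear_sum _ _ _ lg) (linear_sum _ _ _ (ec_lin h3 l)); apply: eq_bigr => q _.
by rewrite (linZ lg) ecZ !mxE.
Qed.

Lemma Mx_id L (h : fgproj L) : Mx h h id = map_mx cst (pmx h).
Proof. by apply/matrixP => k l; rewrite !mxE ec_eg mxE. Qed.

Lemma Mx_iso L1 L2 (h1 : fgproj L1) (h2 : fgproj L2) (f : ext L1 T -> ext L2 T) g :
  linear f -> linear g -> cancel f g -> cancel g f ->
  mxiso (map_mx cst (pmx h1)) (map_mx cst (pmx h2)) (Mx h1 h2 f) (Mx h2 h1 g).
Proof.
move=> lf lg fK gK; have cf : g \o f = id by apply/funext => x /=; rewrite fK.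
have cg : f \o g = id by apply/funext => x /=; rewrite gK.
by split; [| | | |split]; rewrite -?Mx_id -Mx_comp //; congr Mx.
Qed.

Lemma Mx_ext L1 L2 (h1 : fgproj L1) (h2 : fgproj L2) (f g : ext L1 T -> ext L2 T) :
  f =1 g -> Mx h1 h2 f = Mx h1 h2 g.
Proof. by move=> e; congr Mx; apply/funext. Qed.

(* A basis of L (x) T gives an isomorphism of its image of [pmx] with a free module. *)
Lemma basis_mxiso L (h : fgproj L) n (b : 'I_n -> ext L T) : is_basis b ->
  exists Y : 'M[tensor A T]_(fn h, n),
    mxiso (map_mx cst (pmx h)) 1%:M Y (\matrix_(k, l) ec h l (b k)).
Proof.
move=> hb; pose co x : 'rV[tensor A T]_n := projT1 (cid (hb x)).
have hco x : x = \sum_i co x 0 i *: b i by case: (projT2 (cid (hb x))).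
have uco x (c : 'rV[tensor A T]_n) : x = \sum_i c 0 i *: b i -> co x = c.
  by case: (projT2 (cid (hb x))) => _ h1 h2; exact: h1.
pose Y := \matrix_(k, l) co (eg h k) 0 l; exists Y.
set B := \matrix_(k, l) _.
have YB : Y *m B = map_mx cst (pmx h).
  apply/matrixP => k l; rewrite [RHS]mxE -ec_eg [X in ec h l X](hco (eg h k)).
  rewrite (linear_sum _ _ _ (ec_lin h l)) mxE; apply: eq_bigr => q _.
  by rewrite !mxE ecZ.
have BE : B *m map_mx cst (pmx h) = B.
  apply/matrixP => k l; rewrite [RHS]mxE [X in ec h l X](egP h (b k)) (linear_sum _ _ _ (ec_lin h l)) mxE.
  by apply: eq_bigr => q _; rewrite !mxE ecZ ec_eg mxE.
have BY : B *m Y = 1%:M.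
  apply/row_matrixP => k.
  transitivity (co (b k)).
    symmetry; apply: uco; rewrite {1}(egP h (b k)).
    under eq_bigr => q _ do rewrite {1}(hco (eg h q)) scaler_sumr.
    rewrite exchange_big /=; apply: eq_bigr => i _; rewrite !mxE scaler_suml.
    by apply: eq_bigr => q _; rewrite !mxE scalerA.
  apply: uco; rewrite (bigD1 k) //= !mxE eqxx scale1r big1 ?addr0 // => i /negPf ik.
  by rewrite !mxE eq_sym ik scale0r.
split=> //; rewrite ?mulmx1 ?mul1mx //.
by rewrite -YB -mulmxA BY mulmx1.
Qed.

Lemma tr_mx (t : triple A T) :
  exists X, mxiso (map_mx cst (pmx (tr_dom_fgproj t))) (map_mx cst (pmx (tr_cod_fgproj t)))
    (Mx (tr_dom_fgproj t) (tr_cod_fgproj t) (tr_iso t)) X.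
Proof.
case: (tr_iso_bij t) => k fk kf; exists (Mx (tr_cod_fgproj t) (tr_dom_fgproj t) k).
apply: Mx_iso => //; first exact: tr_iso_linear.
by move=> c x y; apply: (can_inj fk); rewrite tr_iso_linear !kf.
Qed.
End Scalars.

Definition Lx L1 L2 (h1 : fgproj L1) (h2 : fgproj L2) (f : L1 -> L2) :
  'M[calg_ring A]_(fn h1, fn h2) := \matrix_(k, l) (fc h2 l (f (fe h1 k)) : calg_ring A).

Lemma Lx_comp L1 L2 L3 (h1 : fgproj L1) (h2 : fgproj L2) (h3 : fgproj L3)
    (f : L1 -> L2) (g : L2 -> L3) : linear g -> Lx h1 h3 (g \o f) = Lx h1 h2 f *m Lx h2 h3 g.
Proof.
move=> lg; apply/matrixP => k l; rewrite !mxE /= {1}(frP h2 (f (fe h1 k))).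
rewrite (linear_sum _ _ _ lg) (linear_sum _ _ _ (dual_lin (fc h3 l))); apply: eq_bigr => q _.
by rewrite (linZ lg) (linZ (dual_lin (fc h3 l))) !mxE.
Qed.

Lemma LxD L1 L2 (h1 : fgproj L1) (h2 : fgproj L2) (f g : L1 -> L2) :
  Lx h1 h2 (fun x => f x + g x) = Lx h1 h2 f + Lx h1 h2 g.
Proof. by apply/matrixP => k l; rewrite !mxE (linD (dual_lin (fc h2 l))). Qed.

Lemma Lx0 L1 L2 (h1 : fgproj L1) (h2 : fgproj L2) : Lx h1 h2 (fun=> 0) = 0.
Proof. by apply/matrixP => k l; rewrite !mxE (lin0 (dual_lin (fc h2 l))). Qed.

Lemma Mx_ext_fun T L1 L2 (h1 : fgproj L1) (h2 : fgproj L2) (f : L1 -> L2) : linear f ->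
  Mx h1 h2 (ext_fun f : ext L1 T -> ext L2 T) = map_mx (cst T) (Lx h1 h2 f).
Proof.
by move=> lf; apply/matrixP => k l; rewrite !mxE /eg (ext_fun_tens _ _ lf) ec_tens.
Qed.

Lemma exact_split L' L L'' (h'' : fgproj L'') (i : {linear L' -> L}) (p : {linear L -> L''}) :
  short_exact i p -> exists (r : L -> L') (s : L'' -> L),
    [/\ linear r, linear s, cancel i r & cancel s p] /\
    (forall x, i (r x) + s (p x) = x).
Proof.
case=> iI pS ex; have /choice [y hy] : forall k, exists y, p y = fe h'' k by move=> k; exact: pS.
pose s x := \sum_k (fc h'' k x : calg_ring A) *: y k.
have ls : linear s.
  move=> a u w; rewrite /s scaler_sumr -big_split /=; apply: eq_bigr => k _.
  by rewrite dual_lin scalerDl scalerA.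
have sK : cancel s p.
  by move=> x; rewrite [RHS](frP h'') raddf_sum; apply: eq_bigr => k _; rewrite [LHS]linearZ /= hy.
have /choice [r hr] : forall x, exists z, i z = x - s (p x).
  by move=> x; have /ex [z ->] : p (x - s (p x)) = 0; [rewrite raddfB /= sK subrr|exists z].
exists r, s; split; first split=> //.
- by move=> a u w; apply: iI; rewrite linearP !hr !linearP ls scalerBr opprD addrACA.
- move=> x; apply: iI; rewrite hr (_ : p (i x) = 0) ?(lin0 ls) ?subr0 //.
  by apply/ex; exists x.
by move=> x; rewrite hr subrK.
Qed.
End Frames.
Arguments fe {R A L} h k.
Arguments fc {R A L} h k.
Arguments ec {R A T L} h k x.
Arguments eg {R A T L} h k.
Arguments ec_lin {R A T L} h k.

(** * Determinants in split exact sequences *)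

Section SplitDet.
Variable B : comPzRingType.

(** A split exact sequence of images of idempotents, matrices acting on rows: I is the inclusion, P
    the projection, Q a retraction and S a section. *)
Definition mxsplit m' m m'' (E' : 'M[B]_m') (E : 'M[B]_m) (E'' : 'M[B]_m'')
    (I : 'M[B]_(m', m)) (P : 'M[B]_(m, m'')) (Q : 'M[B]_(m, m')) (S : 'M[B]_(m'', m)) : Prop :=
  [/\ I *m Q = E', S *m P = E'', I *m P = 0, S *m Q = 0 & Q *m I + P *m S = E] /\
  [/\ Q *m E' = Q, P *m E'' = P, E' *m I = I, E'' *m S = S & I *m E = I /\ E *m P = P].

Lemma mxsplit_idem m' m m'' (E' : 'M_m') (E : 'M_m) (E'' : 'M_m'') I P Q S :
  mxsplit E' E E'' I P Q S -> E' *m E' = E' /\ E'' *m E'' = E''.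
Proof.
by case=> -[<- <- _ _ _] [QE PE _ _ _]; rewrite -!mulmxA QE PE.
Qed.

Section Split.
Variables (m' m m'' : nat) (E' : 'M[B]_m') (E : 'M[B]_m) (E'' : 'M[B]_m'')
  (I : 'M[B]_(m', m)) (P : 'M[B]_(m, m'')) (Q : 'M[B]_(m, m')) (S : 'M[B]_(m'', m)).
Hypothesis h : mxsplit E' E E'' I P Q S.

Lemma split_rules : [/\ E *m E = E, E *m Q = Q & S *m E = S].
Proof.
have [[IQ SP IP SQ QP] [QE PE EI ES [IE EP]]] := h.
have EQ : E *m Q = Q by rewrite -QP mulmxDl -!mulmxA IQ SQ mulmx0 addr0 QE.
have SE : S *m E = S by rewrite -QP mulmxDr !mulmxA SQ SP mul0mx add0r ES.
split=> //; rewrite -{2}QP mulmxDr !mulmxA EQ EP; exact: QP.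
Qed.

Let g1 l (X : 'M_(m', l)) : I *m (Q *m X) = E' *m X.
Proof. by case: h => -[<- *]; rewrite !mulmxA. Qed.
Let g2 l (X : 'M_(m'', l)) : S *m (P *m X) = E'' *m X.
Proof. by case: h => -[_ <- *]; rewrite !mulmxA. Qed.
Let g3 l (X : 'M_(m'', l)) : I *m (P *m X) = 0.
Proof. by case: h => -[_ _ e *]; rewrite !mulmxA e mul0mx. Qed.
Let g4 l (X : 'M_(m', l)) : S *m (Q *m X) = 0.
Proof. by case: h => -[_ _ _ e *]; rewrite !mulmxA e mul0mx. Qed.

(** Block triangular determinant: the automorphism is T1 T2 T3 with T1 acting as a on the submodule,
    T2 unipotent and T3 acting as b on the quotient. *)
Lemma autdet_split (a : 'M_m') (b : 'M_m'') (c : 'M_(m'', m')) :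
  E' *m a = a -> a *m E' = a -> E'' *m b = b -> b *m E'' = b -> E'' *m c = c -> c *m E' = c ->
  autdet E (Q *m a *m I + P *m c *m I + P *m b *m S) = autdet E' a * autdet E'' b.
Proof.
move=> Ea aE Eb bE Ec cE; have [[IQ SP IP SQ QP] [QE PE EI ES [IE EP]]] := h.
have [EE EQ SE] := split_rules.
have Eb' l (X : 'M_(m'', l)) : E'' *m (b *m X) = b *m X by rewrite mulmxA Eb.
have Ec' l (X : 'M_(m', l)) : E'' *m (c *m X) = c *m X by rewrite mulmxA Ec.
pose T1 := Q *m a *m I + P *m S; pose T2 := Q *m I + P *m c *m I + P *m S.
pose T3 := Q *m I + P *m b *m S.
have -> : Q *m a *m I + P *m c *m I + P *m b *m S = T1 *m T2 *m T3.
  rewrite /T1 /T2 /T3 !(mulmxDl, mulmxDr) -!mulmxA !(g1, g2, g3, g4, mulmx0).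
  by rewrite !EI !Eb' !Ec' !(addr0, add0r).
have F1 X Y Z W : X *m I + Y *m I + W *m S = Z -> Z *m E = Z.
  by move=> <-; rewrite !mulmxDl -!mulmxA IE SE.
have F2 X Y Z W : Q *m X + P *m Y + P *m W = Z -> E *m Z = Z.
  by move=> <-; rewrite !mulmxDr !mulmxA EQ EP.
have F1' X Z W : X *m I + W *m S = Z -> Z *m E = Z.
  by move=> <-; rewrite !mulmxDl -!mulmxA IE SE.
have F2' X Z W : Q *m X + P *m W = Z -> E *m Z = Z.
  by move=> <-; rewrite !mulmxDr !mulmxA EQ EP.
have e1 : T1 *m E = T1 by apply: F1'; reflexivity.
have e2 : E *m T2 = T2 by apply: (F2 _ I (c *m I) T2 S); rewrite /T2 !mulmxA.
have e2' : T2 *m E = T2 by apply: F1; reflexivity.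
have e3 : E *m T3 = T3 by apply: (F2' _ I T3 (b *m S)); rewrite /T3 !mulmxA.
rewrite !autdetM //; last by rewrite -mulmxA e2'.
have -> : autdet E T1 = autdet E' a.
  rewrite /autdet /T1 -[in LHS]QP opprD addrACA subrr addr0.
  have -> : Q *m a *m I - Q *m I = Q *m ((a - E') *m I) by rewrite mulmxBl mulmxBr EI !mulmxA.
  by rewrite det_sylvester -mulmxA IQ mulmxBl aE; case: (mxsplit_idem h) => ->.
have -> : autdet E T3 = autdet E'' b.
  rewrite /autdet /T3 -[in LHS]QP opprD addrACA subrr add0r.
  have -> : P *m b *m S - P *m S = P *m ((b - E'') *m S) by rewrite mulmxBl mulmxBr ES !mulmxA.
  by rewrite det_sylvester -mulmxA SP mulmxBl bE; case: (mxsplit_idem h) => _ ->.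
have -> : autdet E T2 = 1.
  rewrite /autdet /T2 -[in LHS]QP [X in 1%:M + X](_ : _ = P *m (c *m I)).
    by rewrite det_sylvester -mulmxA IP mulmx0 addr0 det1.
  by rewrite [X in X - _]addrAC [X in X - _]addrC addrK mulmxA.
by rewrite mulr1.
Qed.
End Split.
End SplitDet.

(** * The determinant class of an isomorphism given over C *)

Section Invariant.
Variables (A K C : comPzRingType) (I : Type) (Ro Kh : I -> comPzRingType).
Variables (aK : {rmorphism A -> K}) (aC : {rmorphism A -> C}) (kC : {rmorphism K -> C}).
Variables (aR : forall v, {rmorphism A -> Ro v}) (kK : forall v, {rmorphism K -> Kh v})
  (rK : forall v, {rmorphism Ro v -> Kh v}).
Hypotheses (kaC : forall a, kC (aK a) = aC a) (kra : forall v a, kK v (aK a) = rK v (aR v a)).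

Let mC m n (M : 'M_(m, n)) : map_mx kC (map_mx aK M) = map_mx aC M.
Proof. by apply/matrixP => i j; rewrite !mxE. Qed.
Let mR v m n (M : 'M_(m, n)) : map_mx (kK v) (map_mx aK M) = map_mx (rK v) (map_mx (aR v) M).
Proof. by apply/matrixP => i j; rewrite !mxE. Qed.

Lemma map_mxiso (B B' : comPzRingType) (f : {rmorphism B -> B'}) m n E E' X Y :
  @mxiso B m n E E' X Y -> mxiso (map_mx f E) (map_mx f E') (map_mx f X) (map_mx f Y).
Proof.
by case=> h1 h2 h3 h4 [h5 h6]; split; [| | | |split]; rewrite -map_mxM; congr map_mx.
Qed.

Lemma map_mxsplit (B B' : comPzRingType) (f : {rmorphism B -> B'}) m' m m'' E' E E'' X P Q S :
  @mxsplit B m' m m'' E' E E'' X P Q S ->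
  mxsplit (map_mx f E') (map_mx f E) (map_mx f E'') (map_mx f X) (map_mx f P) (map_mx f Q) (map_mx f S).
Proof.
case=> -[h1 h2 h3 h4 h5] [g1 g2 g3 g4 [g5 g6]].
split; split; rewrite -?map_mxM -?map_mxD ?h1 ?h2 ?h3 ?h4 ?h5 ?g1 ?g2 ?g3 ?g4 ?map_mx0 //.
by split; rewrite -?map_mxM ?g5 ?g6.
Qed.

Lemma map_autdet (B B' : comPzRingType) (f : {rmorphism B -> B'}) m (E a : 'M_m) :
  autdet (map_mx f E) (map_mx f a) = f (autdet E a).
Proof. by rewrite /autdet -map_mxB -(map_mx1 f) -map_mxD det_map_mx. Qed.

(* The class of [L1, L2; L], the modules being the images of E1 and E2, is
   computed from isomorphisms L1 -> L2 over K and over the completed local rings. *)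
Definition minv m1 m2 (E1 : 'M[A]_m1) (E2 : 'M[A]_m2) (L : 'M[C]_(m1, m2))
    (d : forall v, Kh v) (u : C) : Prop :=
  exists X Y, [/\ mxiso (map_mx aK E1) (map_mx aK E2) X Y,
    (forall v, exists Xv Yv, mxiso (map_mx (aR v) E1) (map_mx (aR v) E2) Xv Yv /\
      d v = autdet (map_mx (kK v) (map_mx aK E1)) (map_mx (kK v) X *m map_mx (rK v) Yv))
    & u = autdet (map_mx aC E1) (L *m map_mx kC Y)].

(** Equality in the cokernel of Delta' at the level of elements: a is a unit over K with inverse b,
    as in a |-> (a, a^-1), and the w are local units. *)
Definition nrel (d : forall v, Kh v) (u : C) (d' : forall v, Kh v) (u' : C) : Prop :=
  exists a b, [/\ a * b = 1, u = kC b * u' &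
    forall v, exists w w', w * w' = 1 /\ d v = kK v a * rK v w * d' v].

Lemma nrel_refl d u : nrel d u d u.
Proof.
by exists 1, 1; split=> [||v]; rewrite ?mul1r ?rmorph1 ?mul1r //; exists 1, 1; rewrite !rmorph1 !mul1r.
Qed.
Lemma nrel_sym d u d' u' : nrel d u d' u' -> nrel d' u' d u.
Proof.
case=> a [b [ab -> h]]; exists b, a; split; first by rewrite mulrC.
  by rewrite mulrA -rmorphM ab rmorph1 mul1r.
move=> v; have [w [w' [ww ->]]] := h v; exists w', w; split; first by rewrite mulrC.
transitivity (kK v (a * b) * rK v (w * w') * d' v); first by rewrite ab ww !rmorph1 !mul1r.
by rewrite !rmorphM; ring.
Qed.
Lemma nrelM d1 u1 d1' u1' d2 u2 d2' u2' : nrel d1 u1 d1' u1' -> nrel d2 u2 d2' u2' ->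
  nrel (fun v => d1 v * d2 v) (u1 * u2) (fun v => d1' v * d2' v) (u1' * u2').
Proof.
case=> a [b [ab -> h]] [a2 [b2 [ab2 -> h2]]]; exists (a * a2), (b * b2); split.
- by rewrite mulrACA ab ab2 mulr1.
- by rewrite rmorphM mulrACA.
move=> v; have [w [w' [ww ->]]] := h v; have [w2 [w2' [ww2 ->]]] := h2 v.
exists (w * w2), (w' * w2'); split; first by rewrite mulrACA ww ww2 mulr1.
by rewrite !rmorphM; ring.
Qed.
Lemma nrel_trans d1 u1 d2 u2 d3 u3 : nrel d1 u1 d2 u2 -> nrel d2 u2 d3 u3 -> nrel d1 u1 d3 u3.
Proof.
case=> a [b [ab -> h]] [a2 [b2 [ab2 -> h2]]]; exists (a * a2), (b * b2); split.
- by rewrite mulrACA ab ab2 mulr1.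
- by rewrite rmorphM mulrA.
move=> v; have [w [w' [ww ->]]] := h v; have [w2 [w2' [ww2 ->]]] := h2 v.
exists (w * w2), (w' * w2'); split; first by rewrite mulrACA ww ww2 mulr1.
by rewrite !rmorphM; ring.
Qed.

Lemma autdet_iso (B : comPzRingType) m n (E : 'M[B]_m) (E' : 'M[B]_n) X Y X' Y' :
  mxiso E E' X Y -> mxiso E E' X' Y' -> autdet E (X *m Y') * autdet E (X' *m Y) = 1.
Proof.
move=> [h1 h2 h3 h4 [h5 h6]] [g1 g2 g3 g4 [g5 g6]].
rewrite -autdetM //.
- by rewrite mulmxA -(mulmxA X) g2 h4 h1 autdet_id.
- by rewrite -{2}h1 mulmxA h3.
- by rewrite -mulmxA g6.
- by rewrite mulmxA g3.
Qed.

Lemma autdet_iso3 (B : comPzRingType) m n (E : 'M[B]_m) (E' : 'M[B]_n) X Y X' Y' X2 Y2 :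
  mxiso E E' X Y -> mxiso E E' X' Y' -> mxiso E E' X2 Y2 ->
  autdet E (X *m Y') * autdet E (X' *m Y2) = autdet E (X *m Y2).
Proof.
move=> hX [g1 g2 g3 g4 [g5 g6]] [k1 k2 k3 k4 [k5 k6]].
have EE := mxiso_idem hX; case: hX => h1 h2 h3 h4 [h5 h6].
rewrite -autdetM //.
- by rewrite mulmxA -(mulmxA X) g2 h4.
- by rewrite -mulmxA g6.
- by rewrite mulmxA g3.
Qed.

Lemma autdet_comp (B : comPzRingType) m n k (E : 'M[B]_m) (E' : 'M[B]_n) (E'' : 'M[B]_k)
    X Y X' Y' Z W Z' W' :
  mxiso E E' X Y -> mxiso E E' X' Y' -> mxiso E' E'' Z W -> mxiso E' E'' Z' W' ->
  autdet E (X *m Z *m (W' *m Y')) = autdet E (X *m Y') * autdet E' (Z *m W').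
Proof.
move=> hX hX' hZ hZ'; rewrite -(autdet_conj hX) //; last 2 first.
- by case: hZ => *; rewrite mulmxA; congr (_ *m _).
- by case: hZ' => _ _ _ _ [_ e]; rewrite -mulmxA e.
have EE := mxiso_idem hX.
case: hX => h1 h2 h3 h4 [h5 h6]; case: hX' => g1 g2 g3 g4 [g5 g6].
case: hZ => k1 k2 k3 k4 [k5 k6]; case: hZ' => l1 l2 l3 l4 [l5 l6].
rewrite mulrC -autdetM //.
- by rewrite -!mulmxA (mulmxA Y X) h2 g5.
- by rewrite -!mulmxA h6.
- by rewrite mulmxA h3.
Qed.

Lemma minv_uniq m1 m2 (E1 : 'M_m1) (E2 : 'M_m2) L L' d u d' u' :
  mxiso (map_mx aC E1) (map_mx aC E2) L L' ->
  minv E1 E2 L d u -> minv E1 E2 L d' u' -> nrel d u d' u'.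
Proof.
move=> hL [X [Y [h hv ->]]] [X2 [Y2 [h2 hv2 ->]]].
exists (autdet (map_mx aK E1) (X *m Y2)), (autdet (map_mx aK E1) (X2 *m Y)); split.
- exact: autdet_iso h h2.
- rewrite -map_autdet mC map_mxM mulrC.
  have a := map_mxiso kC h2; have b := map_mxiso kC h; rewrite !mC in a b.
  by rewrite (autdet_iso3 hL a b).
move=> v; have [Xv [Yv [k ->]]] := hv v; have [Xv2 [Yv2 [k2 ->]]] := hv2 v.
exists (autdet (map_mx (aR v) E1) (Xv2 *m Yv)), (autdet (map_mx (aR v) E1) (Xv *m Yv2)).
split; first exact: autdet_iso k2 k.
rewrite -!map_autdet !map_mxM -!mR mulrAC.
have a := map_mxiso (kK v) h2; have b := map_mxiso (kK v) h.
have a' := map_mxiso (rK v) k2; have b' := map_mxiso (rK v) k; rewrite -!mR in a' b'.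
by rewrite (autdet_iso3 b a a') (autdet_iso3 b a' b').
Qed.

Lemma minv_unit m1 m2 (E1 : 'M_m1) (E2 : 'M_m2) L L' d u :
  mxiso (map_mx aC E1) (map_mx aC E2) L L' -> minv E1 E2 L d u ->
  exists d' u', (forall v, d v * d' v = 1) /\ u * u' = 1.
Proof.
move=> hL [X [Y [h hv ->]]].
have inv v : exists e, d v * e = 1.
  have [Xv [Yv [k ->]]] := hv v.
  have a := map_mxiso (kK v) h; have a' := map_mxiso (rK v) k; rewrite -!mR in a'.
  by eexists; exact: (autdet_iso a a').
have b := map_mxiso kC h; rewrite !mC in b.
exists (fun v => projT1 (cid (inv v))), (autdet (map_mx aC E1) (map_mx kC X *m L')); split.
  by move=> v; exact: projT2 (cid (inv v)).
exact: (autdet_iso hL b).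
Qed.

Lemma minv_comp m1 m2 m3 (E1 : 'M_m1) (E2 : 'M_m2) (E3 : 'M_m3) L L' Z Z' d u d' u' :
  mxiso (map_mx aC E1) (map_mx aC E2) L L' -> mxiso (map_mx aC E2) (map_mx aC E3) Z Z' ->
  minv E1 E2 L d u -> minv E2 E3 Z d' u' -> minv E1 E3 (L *m Z) (fun v => d v * d' v) (u * u').
Proof.
move=> hL hZ [X [Y [h hv ->]]] [X2 [Y2 [h2 hv2 ->]]].
exists (X *m X2), (Y2 *m Y); split; first exact: mxiso_comp h h2.
  move=> v; have [Xv [Yv [k ->]]] := hv v; have [Xv2 [Yv2 [k2 ->]]] := hv2 v.
  exists (Xv *m Xv2), (Yv2 *m Yv); split; first exact: mxiso_comp k k2.
  have a := map_mxiso (kK v) h2; have b := map_mxiso (kK v) h.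
  have a' := map_mxiso (rK v) k2; have b' := map_mxiso (rK v) k; rewrite -!mR in a' b'.
  by rewrite !map_mxM (autdet_comp b b' a a').
have a := map_mxiso kC h2; have b := map_mxiso kC h; rewrite !mC in a b.
by rewrite !map_mxM (autdet_comp hL b hZ a).
Qed.

Section Exact.
Variables (B : comPzRingType).
Variables (m' m m'' n' n n'' : nat) (E' : 'M[B]_m') (E : 'M[B]_m) (E'' : 'M[B]_m'')
  (F' : 'M[B]_n') (F : 'M[B]_n) (F'' : 'M[B]_n'').
Variables (I1 : 'M[B]_(m', m)) (P : 'M[B]_(m, m'')) (Q : 'M[B]_(m, m')) (S : 'M[B]_(m'', m)).
Variables (I2 : 'M[B]_(n', n)) (P2 : 'M[B]_(n, n'')) (Q2 : 'M[B]_(n, n')) (S2 : 'M[B]_(n'', n)).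
Hypotheses (h1 : mxsplit E' E E'' I1 P Q S) (h2 : mxsplit F' F F'' I2 P2 Q2 S2).

(** Isomorphisms of the outer terms are assembled along the chosen splittings into one of the middle
    terms; this provides the comparison isomorphisms for [minv_exact]. *)
Lemma split_iso X' Y' X'' Y'' : mxiso E' F' X' Y' -> mxiso E'' F'' X'' Y'' ->
  mxiso E F (Q *m X' *m I2 + P *m X'' *m S2) (Q2 *m Y' *m I1 + P2 *m Y'' *m S).
Proof.
move=> [x1 x2 x3 x4 [x5 x6]] [y1 y2 y3 y4 [y5 y6]].
have [EE EQ SE] := split_rules h1; have [EE2 EQ2 SE2] := split_rules h2.
have [[IQ SP IP SQ QP] [QE PE EI ES [IE EP]]] := h1.
have [[IQ2 SP2 IP2 SQ2 QP2] [QE2 PE2 EI2 ES2 [IE2 EP2]]] := h2.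
split; last split.
- rewrite mulmxDl !mulmxDr -!mulmxA !(mulmxA I2) !(mulmxA S2) IQ2 IP2 SP2 SQ2.
  rewrite !mul0mx !mulmx0 addr0 add0r !(mulmxA F') !(mulmxA F'') x5 y5 !(mulmxA X') !(mulmxA X'').
  by rewrite x1 y1 EI ES.
- rewrite mulmxDl !mulmxDr -!mulmxA !(mulmxA I1) !(mulmxA S) IQ IP SP SQ.
  rewrite !mul0mx !mulmx0 addr0 add0r !(mulmxA E') !(mulmxA E'') x3 y3 !(mulmxA Y') !(mulmxA Y'').
  by rewrite x2 y2 EI2 ES2.
- by rewrite mulmxDr !mulmxA EQ EP.
- by rewrite mulmxDl -!mulmxA IE2 SE2.
- by rewrite mulmxDr !mulmxA EQ2 EP2.
- by rewrite mulmxDl -!mulmxA IE SE.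
Qed.

Lemma split_autdet X' Y' X'' Y'' L L' Z' W' Z'' W'' :
  mxiso E' F' X' Y' -> mxiso E'' F'' X'' Y'' ->
  mxiso E F L L' -> mxiso E' F' Z' W' -> mxiso E'' F'' Z'' W'' ->
  I1 *m L = Z' *m I2 -> P *m Z'' = L *m P2 ->
  autdet E (L *m (Q2 *m Y' *m I1 + P2 *m Y'' *m S)) = autdet E' (Z' *m Y') * autdet E'' (Z'' *m Y'').
Proof.
move=> [_ _ _ _ [x5 x6]] [_ _ _ _ [y5 y6]] [l1 l2 l3 l4 [l5 l6]] [z1 z2 z3 z4 [z5 z6]].
move=> [w1 w2 w3 w4 [w5 w6]] IL PL.
have [[IQ SP IP SQ QP] [QE PE EI ES [IE EP]]] := h1.
have [[IQ2 SP2 IP2 SQ2 QP2] [QE2 PE2 EI2 ES2 [IE2 EP2]]] := h2.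
(* L decomposed along the two splittings: S L Q2 is the off-diagonal block, which does not affect
   the determinant. *)
have [e1 e2] : L *m Q2 = Q *m Z' + P *m (S *m L *m Q2) /\ True.
  split=> //; rewrite -{1}l3 -QP !mulmxDl -!mulmxA; congr (_ + _).
  by rewrite (mulmxA I1) IL -mulmxA IQ2 z4.
rewrite -(autdet_split h1 (c := S *m L *m Q2 *m Y')) ?mulmxA ?z3 ?w3 ?ES -?mulmxA ?x6 ?y6 //.
congr autdet; rewrite mulmxDr !mulmxA e1 -PL; congr (_ + _).
by rewrite !mulmxDl !mulmxA.
Qed.
End Exact.

Lemma minv_exact m' m m'' n' n n'' (E' : 'M_m') (E : 'M_m) (E'' : 'M_m'')
    (F' : 'M_n') (F : 'M_n) (F'' : 'M_n'') I1 P Q S I2 P2 Q2 S2 L L' Z' W' Z'' W'' d' u' d'' u'' :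
  mxsplit E' E E'' I1 P Q S -> mxsplit F' F F'' I2 P2 Q2 S2 ->
  mxiso (map_mx aC E) (map_mx aC F) L L' -> mxiso (map_mx aC E') (map_mx aC F') Z' W' ->
  mxiso (map_mx aC E'') (map_mx aC F'') Z'' W'' ->
  map_mx aC I1 *m L = Z' *m map_mx aC I2 -> map_mx aC P *m Z'' = L *m map_mx aC P2 ->
  minv E' F' Z' d' u' -> minv E'' F'' Z'' d'' u'' ->
  minv E F L (fun v => d' v * d'' v) (u' * u'').
Proof.
move=> h1 h2 hL hZ hZ' IL PL [X' [Y' [h hv ->]]] [X2 [Y2 [h' hv2 ->]]].
eexists; eexists; split; first exact: (split_iso (map_mxsplit aK h1) (map_mxsplit aK h2) h h').
- move=> v; have [Xv [Yv [k ->]]] := hv v; have [Xv2 [Yv2 [k2 ->]]] := hv2 v.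
  eexists; eexists; split; first exact: (split_iso (map_mxsplit (aR v) h1) (map_mxsplit (aR v) h2) k k2).
  rewrite !map_mxD !map_mxM -!mR.
  have a := map_mxiso (kK v) h; have b := map_mxiso (kK v) h'.
  have a' := map_mxiso (rK v) k; have b' := map_mxiso (rK v) k2; rewrite -!mR in a' b'.
  have s1 := map_mxsplit (kK v) (map_mxsplit aK h1); have s2 := map_mxsplit (kK v) (map_mxsplit aK h2).
  rewrite (split_autdet s1 s2 a' b' (split_iso s1 s2 a b) a b) //.
    case: s1 => -[t1 t2 t3 t4 t5] [t6 t7 t8 t9 [t10 t11]]; case: a => a1 a2 a3 a4 _.
    by rewrite mulmxDr !mulmxA t1 t3 !mul0mx addr0 a3.
  case: s2 => -[t1 t2 t3 t4 t5] [t6 t7 t8 t9 [t10 t11]]; case: b => a1 a2 a3 a4 _.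
  by rewrite mulmxDl -!mulmxA t2 t3 !mulmx0 add0r a4.
rewrite !map_mxD !map_mxM !mC.
have a := map_mxiso kC h; have b := map_mxiso kC h'; rewrite !mC in a b.
by rewrite (split_autdet (map_mxsplit aC h1) (map_mxsplit aC h2) a b hL hZ hZ').
Qed.
End Invariant.

(** * The determinant class as an invariant of K_0 *)

Section K0Invariant.
Variables (R : comPzRingType) (dk : dedekind_like R) (A : calg R).
Hypotheses (fA : fingen A) (tA : torsion_free A).
Variables (K C : calg R) (ffK : frac_field K) (j : K -> C).
Hypothesis hj : linear j /\ monoid_morphism j.
Hypothesis cI : injective (@cst R A C).
Local Notation str := (calg_str A).
Local Notation AK := (tensor A K).
Local Notation AC := (tensor A C).
Local Notation Rv v := (completion_alg (@place_ideal R v)).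

Fact tm_zmod (S T : calg R) (g : S -> T) (hg : linear g /\ monoid_morphism g) :
  zmod_morphism (tmap (fun a : A => a) g).
Proof.
have [l _] := @tmap_ring R A S T g hg.1 hg.2.
by move=> x y; rewrite (linD l) -scaleN1r (linZ l) scaleN1r.
Qed.
Definition tm (S T : calg R) (g : S -> T) (hg : linear g /\ monoid_morphism g) :
    {rmorphism tensor A S -> tensor A T} :=
  mk_rmorph (tm_zmod hg) (@tmap_ring R A S T g hg.1 hg.2).2.

Lemma tm_cst (S T : calg R) (g : S -> T) hg a : @tm S T g hg (cst S a) = cst T a.
Proof. by rewrite /cst /= tmap_tens ?hg.2.1 //; exact: hg.1. Qed.

Lemma ec_map (S T : calg R) (g : S -> T) (hg : linear g /\ monoid_morphism g) L (h : fgproj L) k (x : ext L S) :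
  ec h k (ext_map g x) = tm hg (ec h k x).
Proof.
have lg := hg.1; move: x; apply: tensor_eq => [x y|x y|l s].
- by rewrite (linD (@ext_map_linear R A S T g hg L)) ecD.
- by rewrite ecD /= (linD (@tmap_ring R A S T g lg hg.2).1).
by rewrite (ext_map_tens hg) !ec_tens /= tmap_tens.
Qed.

Lemma ec_Mx (T : calg R) (L1 L2 : lmodType (calg_ring A)) (h1 : fgproj L1) (h2 : fgproj L2)
    (f : ext L1 T -> ext L2 T) x l :
  linear f -> ec h2 l (f x) = \sum_k ec h1 k x * Mx h1 h2 f k l.
Proof.
move=> lf; rewrite {1}(egP h1 x) (linear_sum _ _ _ lf) (linear_sum _ _ _ (ec_lin h2 l)).
by apply: eq_bigr => k _; rewrite (linZ lf) ecZ mxE.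
Qed.

Definition aC : {rmorphism calg_ring A -> AC} := @cst R A C.
Definition aK : {rmorphism calg_ring A -> AK} := @cst R A K.
Definition aR (v : place R) : {rmorphism calg_ring A -> tensor A (Rv v)} := @cst R A (Rv v).
Definition kC : {rmorphism AK -> AC} := tm hj.
Definition kK (v : place R) : {rmorphism AK -> tensor A (Kv K v)} := tm (K_to_Kv_hom K v).
Definition rK (v : place R) : {rmorphism tensor A (Rv v) -> tensor A (Kv K v)} := tm (Rv_to_Kv_hom K v).

Lemma kaC a : kC (aK a) = aC a. Proof. exact: tm_cst. Qed.
Lemma kra v a : kK v (aK a) = rK v (aR v a).
Proof. by rewrite [LHS]tm_cst [RHS]tm_cst. Qed.

(** For T = K any place serves, for T = R_v the place v: every s outside p becomes invertible in T,
    so the isomorphism up to s of [local_iso] becomes an isomorphism. *)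
Lemma local_mxiso (p : place R) (T : calg R) m1 m2 (E1 : 'M_m1) (E2 : 'M_m2) L L' :
  (forall s, ~ p s -> exists t, calg_str T s * t = 1) ->
  E1 *m E1 = E1 -> E2 *m E2 = E2 -> mxiso (map_mx aC E1) (map_mx aC E2) L L' ->
  exists X Y, mxiso (map_mx (@cst R A T) E1) (map_mx (@cst R A T) E2) X Y.
Proof.
move=> hT EE1 EE2 hL.
have [s [X [Y [ps XY YX eX eY]]]] := local_iso dk fA (f := aC) cI EE1 EE2 hL p.
have [t st] := hT s ps; have e := @str_unit R A T s t st.
have EX : E1 *m X = X by rewrite -eX !mulmxA EE1.
have XE : X *m E2 = X by rewrite -eX -!mulmxA EE2.
have EY : E2 *m Y = Y by rewrite -eY !mulmxA EE2.
have YE : Y *m E1 = Y by rewrite -eY -!mulmxA EE1.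
have k m (M : 'M_m) : tens (1 : A) (t : T) *: map_mx (cst T) (str s *: M) = map_mx (cst T) M.
  by rewrite map_mxZ scalerA mulrC [X in X *: _]e scale1r.
exists (map_mx (cst T) X), (tens (1 : A) (t : T) *: map_mx (cst T) Y); split; [| | | |split].
- by rewrite -scalemxAr -map_mxM XY k.
- by rewrite -scalemxAl -map_mxM YX k.
- by rewrite -map_mxM EX.
- by rewrite -map_mxM XE.
- by rewrite -scalemxAr -map_mxM EY.
- by rewrite -scalemxAl -map_mxM YE.
Qed.

Lemma exact_mxsplit (L' L L'' : lmodType (calg_ring A)) (h' : fgproj L') (h : fgproj L)
    (h'' : fgproj L'') (i : {linear L' -> L}) (p : {linear L -> L''}) : short_exact i p ->
  exists Q S, mxsplit (pmx h') (pmx h) (pmx h'') (Lx h' h i) (Lx h h'' p) Q S.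
Proof.
move=> ex; have [r [s [[lr ls ir sp] e]]] := exact_split h'' ex.
have li := @linearP _ _ _ _ i; have lp := @linearP _ _ _ _ p.
have id_ M (k : fgproj M) : pmx k = Lx k k id by apply/matrixP => a b; rewrite !mxE.
have pi x : p (i x) = 0 by case: ex => _ _ ex; apply/ex; exists x.
have rs x : r (s x) = 0.
  by case: ex => iI _ _; apply: iI; apply: (addIr (s (p (s x)))); rewrite e sp (lin0 li) add0r.
exists (Lx h h' r), (Lx h'' h s); rewrite !id_.
split; split; rewrite -?Lx_comp //.
- by congr Lx; apply/funext.
- by congr Lx; apply/funext.
- by rewrite -Lx0; congr Lx; apply/funext.
- by rewrite -Lx0; congr Lx; apply/funext.
- by rewrite -LxD; congr Lx; apply/funext.
Qed.

Definition tinv (t : triple A C) := minv aK aC kC aR kK rK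
  (pmx (tr_dom_fgproj t)) (pmx (tr_cod_fgproj t)) (Mx (tr_dom_fgproj t) (tr_cod_fgproj t) (tr_iso t)).

Lemma tinv_ex t : exists d u, tinv t d u.
Proof.
have [L' hL] := tr_mx t.
have [i1 i2] := (pmx_idem (tr_dom_fgproj t), pmx_idem (tr_cod_fgproj t)).
have [v0 _] := dk_place dk.
have [|X [Y hX]] := local_mxiso (p := v0) (T := K) _ i1 i2 hL.
  move=> s vs; apply: (ff_inv ffK) => s0; apply: vs; rewrite s0; exact: ideal0 (place_idealP v0).
have hv (v : place R) : exists Xv Yv, mxiso (map_mx (aR v) (pmx (tr_dom_fgproj t)))
    (map_mx (aR v) (pmx (tr_cod_fgproj t))) Xv Yv.
  by apply: (local_mxiso (p := v) _ i1 i2 hL); exact: completion_inv.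
pose Yv v := projT1 (cid (projT2 (cid (hv v)))).
exists (fun v => autdet (map_mx (kK v) (map_mx aK (pmx (tr_dom_fgproj t))))
  (map_mx (kK v) X *m map_mx (rK v) (Yv v))).
eexists; exists X, Y; split=> // v; exists (projT1 (cid (hv v))), (Yv v); split=> //.
exact: (projT2 (cid (projT2 (cid (hv v))))).
Qed.

Lemma tinv_unit t d u : tinv t d u -> exists d' u', (forall v, d v * d' v = 1) /\ u * u' = 1.
Proof.
by have [L' hL] := tr_mx t; exact: (minv_unit kaC kra hL).
Qed.

Local Notation nrel := (nrel kC kK rK).

Lemma tinv_uniq t d u d' u' : tinv t d u -> tinv t d' u' -> nrel d u d' u'.
Proof. have [L' hL] := tr_mx t; exact: (minv_uniq kaC kra hL). Qed.

Definition sinv (b : bool) t (d : forall v, tensor A (Kv K v)) (u : AC) : Prop :=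
  if b then tinv t d u else
  exists d' u', [/\ tinv t d' u', forall v, d v * d' v = 1 & u * u' = 1].

Lemma sinv_ex b t : exists d u, sinv b t d u.
Proof.
have [d [u h]] := tinv_ex t; case: b; first by exists d, u.
have [d' [u' [h1 h2]]] := tinv_unit h.
exists d', u', d, u; split=> //; last by rewrite mulrC.
by move=> v; rewrite mulrC h1.
Qed.

Lemma mul_inv_eq (B : comPzRingType) (x y x' y' : B) : x * x' = 1 -> y * y' = 1 ->
  forall a b : B, a * b = 1 -> x = a * y -> x' = b * y'.
Proof.
move=> hx hy a b ab e; transitivity (a * b * (y * y') * x'); first by rewrite ab hy !mul1r.
have -> : a * b * (y * y') * x' = b * y' * (a * y * x') by ring.
by rewrite -e hx mulr1.
Qed.

Lemma sinv_uniq b t d u d' u' : sinv b t d u -> sinv b t d' u' -> nrel d u d' u'.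
Proof.
case: b; first exact: tinv_uniq.
case=> d1 [u1 [h1 e1 f1]] [d2 [u2 [h2 e2 f2]]].
have [a [b [ab hu hd]]] := tinv_uniq h1 h2.
exists b, a; split; first by rewrite mulrC.
  rewrite mulrC in f1; rewrite mulrC in f2.
  by apply: (mul_inv_eq f1 f2 _ hu); rewrite -rmorphM mulrC ab rmorph1.
move=> v; have [w [w' [ww hw]]] := hd v; exists w', w; split; first by rewrite mulrC.
have f v' : d1 v' * d v' = 1 by rewrite mulrC e1.
have g v' : d2 v' * d' v' = 1 by rewrite mulrC e2.
apply: (mul_inv_eq (f v) (g v) _ hw).
by rewrite mulrACA -!rmorphM ab ww !rmorph1 mul1r.
Qed.

(** A relation and not a function, the class of a term being determined only up to [nrel]; negative
    terms contribute inverses. *)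
Fixpoint linv (s : seq (bool * triple A C)) (d : forall v, tensor A (Kv K v)) (u : AC) : Prop :=
  if s is q :: s' then exists d1 u1 d2 u2,
    [/\ sinv q.1 q.2 d1 u1, linv s' d2 u2, d = (fun v => d1 v * d2 v) & u = u1 * u2]
  else d = (fun=> 1) /\ u = 1.

Lemma linv_ex s : exists d u, linv s d u.
Proof.
elim: s => [|[b t] s [d2 [u2 h2]]]; first by exists (fun=> 1), 1.
have [d1 [u1 h1]] := sinv_ex b t.
by exists (fun v => d1 v * d2 v), (u1 * u2), d1, u1, d2, u2.
Qed.

Lemma linv_uniq s d u d' u' : linv s d u -> linv s d' u' -> nrel d u d' u'.
Proof.
elim: s d u d' u' => [|[b t] s ih] d u d' u'.
  by case=> -> -> [-> ->]; exact: nrel_refl.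
case=> d1 [u1 [d2 [u2 [h1 h2 -> ->]]]] [d3 [u3 [d4 [u4 [h3 h4 -> ->]]]]].
by apply: nrelM; [exact: sinv_uniq h1 h3|exact: ih].
Qed.

Lemma linv_cat s t d u d' u' : linv s d u -> linv t d' u' ->
  linv (s ++ t) (fun v => d v * d' v) (u * u').
Proof.
move=> hs ht; elim: s d u hs => [|[b q] s ih] d u.
  case=> -> ->; rewrite mul1r.
  suff -> : (fun v => 1 * d' v) = d' by [].
  by apply: functional_extensionality_dep => v; rewrite mul1r.
case=> d1 [u1 [d2 [u2 [h1 h2 -> ->]]]].
exists d1, u1, (fun v => d2 v * d' v), (u2 * u'); split; rewrite ?mulrA //; first exact: ih.
by apply: functional_extensionality_dep => v; rewrite mulrA.
Qed.

Lemma linv1 t d u : tinv t d u -> linv [:: (true, t)] d u.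
Proof.
move=> h; exists d, u, (fun=> 1), 1; split; rewrite ?mulr1 //.
by apply: functional_extensionality_dep => v; rewrite mulr1.
Qed.

(** Induction on the derivation. Transitivity passes through an arbitrary formal sum, whose
    invariant exists by [linv_ex]; the two module relations are [minv_exact] and [minv_comp]. *)
Lemma k0_eq_linv s s' : k0_eq s s' -> forall d u d' u',
  linv s d u -> linv s' d' u' -> nrel d u d' u'.
Proof.
elim=> {s s'} [s|s s' _ ih|s s' s'' _ ih _ ih'|s s' t t' _ ih _ ih'|s t|t||].
- exact: linv_uniq.
- by move=> d u d' u' h h'; apply: nrel_sym; exact: ih.
- move=> d u d' u' h h'; have [d1 [u1 h1]] := linv_ex s'.
  by apply: nrel_trans (ih _ _ _ _ h h1) (ih' _ _ _ _ h1 h').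
- move=> d u d' u' h h'.
  have [[d1 [u1 h1]] [d2 [u2 h2]]] := (linv_ex s, linv_ex t).
  have [[d3 [u3 h3]] [d4 [u4 h4]]] := (linv_ex s', linv_ex t').
  apply: nrel_trans (linv_uniq h (linv_cat h1 h2)) _.
  apply: nrel_trans _ (linv_uniq (linv_cat h3 h4) h').
  by apply: nrelM; [exact: ih|exact: ih'].
- move=> d u d' u' h h'.
  have [[d1 [u1 h1]] [d2 [u2 h2]]] := (linv_ex s, linv_ex t).
  apply: nrel_trans (linv_uniq h (linv_cat h1 h2)) _.
  have -> : (fun v => d1 v * d2 v) = (fun v => d2 v * d1 v).
    by apply: functional_extensionality_dep => v; rewrite mulrC.
  by rewrite mulrC; exact: linv_uniq (linv_cat h2 h1) h'.
- move=> d u d' u' [d1 [u1 [d2 [u2 [h1 [d3 [u3 [d4 [u4 [[d5 [u5 [h5 e5 f5]]] [-> ->] -> ->]]]]] -> ->]]]]] [-> ->] /=.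
  rewrite !mulr1 in f5 *.
  have -> : (fun v => d1 v * (d3 v * 1)) = (fun v => d1 v * d3 v).
    by apply: functional_extensionality_dep => v; rewrite mulr1.
  rewrite -f5 mulrC.
  have -> : (fun=> 1) = (fun v => d5 v * d3 v).
    by apply: functional_extensionality_dep => v; rewrite mulrC e5.
  rewrite [u3 * u5]mulrC [u3 * u1]mulrC; apply: nrelM; first exact: tinv_uniq h1 h5.
  exact: nrel_refl.
- move=> t' t t'' i1 p1 i2 p2 ex1 ex2 c1 c2 d u d' u' h.
  have [[d1 [u1 h1]] [d2 [u2 h2]]] := (tinv_ex t', tinv_ex t'').
  move=> h'; apply: nrel_trans _ (linv_uniq (linv_cat (linv1 h1) (linv1 h2)) h').
  apply: (linv_uniq h); apply: linv1.
  have hL := tr_mx t; have hL' := tr_mx t'; have hL'' := tr_mx t''.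
  case: hL hL' hL'' => [L hL] [L' hL'] [L'' hL''].
  have [Q [S s1]] := exact_mxsplit (tr_dom_fgproj t') (tr_dom_fgproj t) (tr_dom_fgproj t'') ex1.
  have [Q2 [S2 s2]] := exact_mxsplit (tr_cod_fgproj t') (tr_cod_fgproj t) (tr_cod_fgproj t'') ex2.
  apply: (minv_exact kaC kra s1 s2 hL hL' hL'') => //; rewrite -!Mx_ext_fun; try exact: linearP.
    rewrite -!Mx_comp; [|exact: ext_fun_linear (@linearP _ _ _ _ i2)|exact: tr_iso_linear].
    by apply: Mx_ext => x /=; rewrite c1.
  rewrite -!Mx_comp; [|exact: ext_fun_linear (@linearP _ _ _ _ p2)|exact: tr_iso_linear].
  by apply: Mx_ext => x /=; rewrite c2.
- move=> L1 L2 L3 k1 k2 k3 f12 l12 b12 f23 l23 b23 l13 b13 d u d' u' h.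
  set t1 := Triple k1 k2 l12 b12; set t2 := Triple k2 k3 l23 b23.
  have [[d1 [u1 h1]] [d2 [u2 h2]]] := (tinv_ex t1, tinv_ex t2).
  move=> h'; apply: nrel_trans _ (linv_uniq (linv_cat (linv1 h1) (linv1 h2)) h').
  apply: (linv_uniq h); apply: linv1.
  rewrite /tinv /= (Mx_comp k1 k2 k3 f12 l23).
  have [L' hL] := tr_mx t1; have [Z' hZ] := tr_mx t2.
  exact: (minv_comp kaC kra hL hZ).
Qed.
End K0Invariant.

(** * The idelic class depends only on the class in K_0 *)

Section K0Class.
Variables (R : comPzRingType) (dk : dedekind_like R) (A : calg R).
Hypotheses (fA : fingen A) (tA : torsion_free A).
Variables (K C : calg R) (ffK : frac_field K) (j : K -> C).
Hypothesis hj : linear j /\ monoid_morphism j.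
Hypothesis cI : injective (@cst R A C).
Local Notation str := (calg_str A).
Local Notation AK := (tensor A K).
Local Notation AC := (tensor A C).
Local Notation Rv v := (completion_alg (@place_ideal R v)).
Local Notation aC := (aC A C).
Local Notation aK := (aK A K).
Local Notation aR := (aR A).
Local Notation kC := (kC A hj).
Local Notation kK := (kK A K).
Local Notation rK := (rK A K).

Definition ecmx (T : calg R) (L : lmodType (calg_ring A)) (h : fgproj L) n (b : 'I_n -> ext L T) :
  'M[tensor A T]_(n, fn h) := \matrix_(k, l) ec h l (b k).

Lemma ecmx_map (S T : calg R) (g : S -> T) (hg : linear g /\ monoid_morphism g)
    (L : lmodType (calg_ring A)) (h : fgproj L) n (b : 'I_n -> ext L S) :
  ecmx h (fun k => ext_map g (b k)) = map_mx (tm A hg) (ecmx h b).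
Proof. by apply/matrixP => k l; rewrite !mxE (ec_map hg). Qed.

Lemma ecmx_lin (T : calg R) (L : lmodType (calg_ring A)) (h : fgproj L) m n
    (M : 'M[tensor A T]_(m, n)) (b : 'I_n -> ext L T) :
  ecmx h (fun k => \sum_l M k l *: b l) = M *m ecmx h b.
Proof.
apply/matrixP => k l; rewrite !mxE (linear_sum _ _ _ (ec_lin h l)).
by apply: eq_bigr => q _; rewrite ecZ mxE.
Qed.

Lemma ecmx_fun (T : calg R) (L1 L2 : lmodType (calg_ring A)) (h1 : fgproj L1) (h2 : fgproj L2)
    (f : ext L1 T -> ext L2 T) n (b : 'I_n -> ext L1 T) : linear f ->
  ecmx h2 (fun k => f (b k)) = ecmx h1 b *m Mx h1 h2 f.
Proof.
move=> lf; apply/matrixP => k l; rewrite !mxE (ec_Mx h1 _ _ lf).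
by apply: eq_bigr => q _; congr (_ * _); rewrite mxE.
Qed.

Lemma mxiso_free (B : comPzRingType) m1 m2 n (E1 : 'M[B]_m1) (E2 : 'M[B]_m2) X1 Y1 X2 Y2 :
  mxiso E1 (1%:M : 'M_n) Y1 X1 -> mxiso E2 (1%:M : 'M_n) Y2 X2 ->
  mxiso E1 E2 (Y1 *m X2) (Y2 *m X1).
Proof. by move=> h1 h2; exact: mxiso_comp h1 (mxisoC h2). Qed.

Lemma map_mxiso1 (B B' : comPzRingType) (f : {rmorphism B -> B'}) m n (E : 'M[B]_m) X Y :
  mxiso E (1%:M : 'M_n) X Y -> mxiso (map_mx f E) 1%:M (map_mx f X) (map_mx f Y).
Proof. by move/(map_mxiso f); rewrite map_mx1. Qed.

(** The comparison isomorphism over K carries b1 to b2, the one over R_v carries e1 to e2; going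
    forth by the first and back by the second is M2^-1 M1 in the basis b1. *)
Lemma idelic_tinv (t : triple A C) c : idelic_class (j := j) t c -> exists (i : ideles A K) (u : units AC),
  [/\ c = qproj (principal j) (qproj (@unit_ideles R A K) i, u),
      tinv hj t (fun v => uval (i v)) (uval u) & True].
Proof.
case=> n [b1 [b2 [e1 [e2 [M1 [M2 [mu [i [u [[hb1 hb2] he hM hmu [hi hu ->]]]]]]]]]]].
exists i, u; split=> //.
set h1 := tr_dom_fgproj t; set h2 := tr_cod_fgproj t.
have [Y1 i1] := basis_mxiso h1 hb1; have [Y2 i2] := basis_mxiso h2 hb2.
rewrite -!/(ecmx _ _) in i1 i2.
exists (Y1 *m ecmx h2 b2), (Y2 *m ecmx h1 b1); split.
- exact: mxiso_free i1 i2.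
- move=> v; have [hv1 hv2] := he v.
  have [Z1 k1] := basis_mxiso h1 hv1; have [Z2 k2] := basis_mxiso h2 hv2.
  rewrite -!/(ecmx _ _) in k1 k2.
  exists (Z1 *m ecmx h2 (e2 v)), (Z2 *m ecmx h1 (e1 v)); split.
    exact: mxiso_free k1 k2.
  have r1 : map_mx (rK v) (ecmx h1 (e1 v)) = M1 v *m map_mx (kK v) (ecmx h1 b1).
    rewrite -!ecmx_map -ecmx_lin; congr ecmx; apply/funext => k.
    by case: (hM v k).
  have r2 : map_mx (rK v) (ecmx h2 (e2 v)) = M2 v *m map_mx (kK v) (ecmx h2 b2).
    rewrite -!ecmx_map -ecmx_lin; congr ecmx; apply/funext => k.
    by case: (hM v k).
  have I1 := map_mxiso1 (kK v) i1.
  rewrite !map_mxM r1.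
  (* N is the inverse of M2. *)
  set N := map_mx (kK v) (ecmx h2 b2) *m map_mx (rK v) Z2.
  have e : M2 v *m N = 1%:M.
    rewrite /N mulmxA -r2 -map_mxM; case: k2 => _ -> _ _ _; exact: map_mx1.
  transitivity (autdet (map_mx (kK v) (map_mx aK (pmx h1)))
     (map_mx (kK v) Y1 *m (N *m M1 v) *m map_mx (kK v) (ecmx h1 b1))).
    rewrite (autdet_conj I1) ?mul1mx ?mulmx1 // autdet_1 det_mulmx -(hi v).
    by rewrite mulrCA -[_ * \det (M2 v)]mulrC -det_mulmx e det1 mulr1.
  by rewrite /N !mulmxA.
have r : map_mx kC (ecmx h1 b1) *m Mx h1 h2 (tr_iso t) = mu *m map_mx kC (ecmx h2 b2).
  rewrite -!ecmx_map -ecmx_lin -(ecmx_fun _ _ _ (@tr_iso_linear _ _ _ t)).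
  by congr ecmx; apply/funext => k; exact: hmu.
have I1 := map_mxiso1 kC i1; have I2 := map_mxiso1 kC i2.
have [L' hL] := tr_mx t.
have e1' : map_mx aC (pmx h1) = map_mx kC Y1 *m map_mx kC (ecmx h1 b1).
  case: I1 => -> _ _ _ _; rewrite -map_mx_comp; apply: eq_map_mx => a.
  by rewrite /= -[RHS]/(kC (aK a)) kaC.
transitivity (autdet (map_mx kC (map_mx aK (pmx h1))) (map_mx kC Y1 *m mu *m map_mx kC (ecmx h1 b1))).
  by rewrite (autdet_conj I1) ?mul1mx ?mulmx1 // autdet_1.
congr autdet.
  by rewrite -map_mx_comp; apply: eq_map_mx => a; exact: kaC.
rewrite map_mxM; case: (hL) => _ _ <- _ _; rewrite e1' -!mulmxA; congr (_ *m _).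
rewrite !mulmxA r -[mu *m _ *m _]mulmxA; case: I2 => _ -> _ _ _.
by rewrite mulmx1.
Qed.

Lemma image_order : is_order (fun x : AK => exists a : A, x = tens a (1 : K)).
Proof.
have [n [e he]] := fA; split.
- by exists 1.
- by move=> _ _ [a ->] [b ->]; exists (a - b); rewrite (bilinDl (tens_bilin A K)) (bilinNl (tens_bilin A K)).
- by move=> _ _ [a ->] [b ->]; exists (a * b); rewrite tensM mulr1.
- exists n, (fun i => tens (e i) (1 : K)) => x; split.
    case=> a ->; have [c ->] := he a; exists c.
    rewrite (linear_sum _ _ _ ((tens_bilin A K).1 1)); apply: eq_bigr => i _.
    by rewrite (bilinZl (tens_bilin A K)).
  case=> c ->; exists (\sum_i c i *: e i).
  rewrite (linear_sum _ _ _ ((tens_bilin A K).1 1)); apply: eq_bigr => i _.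
  by rewrite (bilinZl (tens_bilin A K)).
have key (x : AK) : exists2 r : R, r <> 0 & exists a : A, r *: x = tens a (1 : K).
  rewrite (tensE x); elim: (repr x) => [|[a k] s [r r0 [b hb]]].
    have [v0 _] := dk_place dk; exists 1.
      by move=> e1; apply: (@place_proper _ v0); rewrite e1; exact: ideal0 (place_idealP v0).
    by exists 0; rewrite big_nil scaler0 (bilin0l (tens_bilin A K)).
  have [d [c [d0 hd]]] := ff_frac ffK k.
  exists (d * r); first by move=> /(dk_dom dk) [].
  exists (r *: (c *: a) + d *: b); rewrite big_cons scalerDr -[(d * r) *: \sum_(_ <- _) _]scalerA hb.
  rewrite (bilinDl (tens_bilin A K)) !(bilinZl (tens_bilin A K)); congr (_ + _).
  rewrite mulrC -scalerA; congr (_ *: _); rewrite -(bilinZl (tens_bilin A K)) (bilinZl (tens_bilin A K)).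
  rewrite /= -!(bilinZr (tens_bilin A K)); congr (tens _ _).
  by rewrite -[LHS]/(calg_str K d * k) hd -[RHS]/(calg_str K c * 1) mulr1.
by move=> x; have [r r0 h] := key x; exists r.
Qed.

(** The image of A is an order, hence inside the maximal order, so units of A (x) R_v satisfy the
    condition of the restricted product at v. *)
Lemma local_unit_max (v : place R) (w : units (tensor A (Rv v))) (w' : units (tensor A (Kv K v))) :
  uval w' = rK v (uval w) -> max_order_unit w'.
Proof.
have key (z : tensor A (Rv v)) : max_order_at (rK v z).
  move=> T T1 TB TM Tm Tr.
  have T0 : T 0 by rewrite -(subrr 1); exact: (TB).
  have TD x y : T x -> T y -> T (x + y).
    by move=> hx hy; rewrite -(opprK y); apply: (TB) => //; rewrite -sub0r; exact: (TB).
  rewrite (tensE z); elim: (repr z) => [|[a r] s ih]; first by rewrite big_nil rmorph0.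
  rewrite big_cons rmorphD; apply: TD => //.
  have -> : rK v (tens a r) = AK_to_Av v (tens a (1 : K)) * tens (1 : A) (Rv_to_Kv K r).
    rewrite /AK_to_Av tmap_tens //; last by case: (K_to_Kv_hom K v).
    rewrite [LHS](tmap_tens a r) //; last by case: (Rv_to_Kv_hom K v).
    by rewrite tensM mulr1 (K_to_Kv_hom K v).2.1 mul1r.
  apply: (TM) => //; apply: Tm; exists (fun x : AK => exists a : A, x = tens a (1 : K)); first exact: image_order.
  by exists a.
move=> e; split; first by rewrite e; exact: key.
suff -> : uval (- w') = rK v (uval (- w)) by exact: key.
have h1 : uval w' * uval (- w') = 1 by exact: (eqP (upairP w')).
have h2 : uval w * uval (- w) = 1 by exact: (eqP (upairP w)).
have h3 : rK v (uval (- w)) * uval w' = 1 by rewrite e mulrC -rmorphM h2 rmorph1.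
by rewrite -[LHS]mul1r -h3 -mulrA h1 mulr1.
Qed.

Lemma uval_eq (B : comPzRingType) (u w : units B) : uval u = uval w -> u = w.
Proof.
case: u w => [[a b] h] [[c d] k]; rewrite /uval /= => e; apply: val_inj => /=.
move: (eqP h) (eqP k) => /= h' k'; rewrite e in h' *; congr (_, _).
by rewrite -[b]mul1r -k' -mulrA mulrCA h' mulr1.
Qed.

Lemma uvalD (B : comPzRingType) (u w : units B) : uval (u + w) = uval u * uval w.
Proof. by []. Qed.
Lemma uvalN (B : comPzRingType) (u : units B) : uval u * uval (- u) = 1.
Proof. exact: (eqP (upairP u)). Qed.

Lemma mk_unit (B : comPzRingType) (x y : B) : x * y = 1 -> exists u : units B, uval u = x /\ uval (- u) = y.
Proof. by move=> /eqP h; exists (Units (upair := (x, y)) h). Qed.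

Lemma nrel_cok (i i' : ideles A K) (u u' : units AC) :
  nrel kC kK rK (fun v => uval (i v)) (uval u) (fun v => uval (i' v)) (uval u') ->
  qproj (principal j) (qproj (@unit_ideles R A K) i, u) =
  qproj (principal j) (qproj (@unit_ideles R A K) i', u').
Proof.
case=> a [b [ab hu hd]].
have [ua [ea eb]] := mk_unit ab.
have hw (v : place R) : exists w : units (tensor A (Rv v)), uval (i v) = kK v a * rK v (uval w) * uval (i' v).
  have [w [w' [ww h]]] := hd v; have [x [ex _]] := mk_unit ww.
  by exists x; rewrite ex.
pose w v := projT1 (cid (hw v)).
have hw' v : uval (i v) = kK v a * rK v (uval (w v)) * uval (i' v) := projT2 (cid (hw v)).
have uu (S T : calg R) (g : S -> T) (hg : linear g /\ monoid_morphism g) (x : units (tensor A S)) :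
  { y : units (tensor A T) | uval y = tm A hg (uval x) }.
  apply: cid; have [y [ey _]] : exists y : units (tensor A T),
    uval y = tm A hg (uval x) /\ uval (- y) = tm A hg (uval (- x)).
    by apply: mk_unit; rewrite -rmorphM uvalN rmorph1.
  by exists y.
pose iw v := projT1 (uu _ _ _ (Rv_to_Kv_hom K v) (w v)).
have eiw v : uval (iw v) = rK v (uval (w v)) := projT2 (uu _ _ _ (Rv_to_Kv_hom K v) (w v)).
pose ia v := projT1 (uu _ _ _ (K_to_Kv_hom K v) ua).
have eia v : uval (ia v) = kK v a by rewrite -ea; exact: projT2 (uu _ _ _ (K_to_Kv_hom K v) ua).
have e v : i v = ia v + iw v + i' v.
  by apply: uval_eq; rewrite !uvalD eiw eia hw'.
have fw : finite_set [set v | ~ max_order_unit (iw v)]%classic.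
  suff -> : [set v | ~ max_order_unit (iw v)]%classic = set0 by exact: finite_set0.
  by rewrite -subset0 => v /=; apply; apply: local_unit_max (eiw v).
pose Iw := Ideles fw.
(* Finiteness for the principal idele is read off from i = Ia + Iw + i'; Iw has no exceptional
   place, by [local_unit_max]. *)
have fa : finite_set [set v | ~ max_order_unit (ia v)]%classic.
  have h := idelesP (i - i' - Iw); apply: sub_finite_set h => v /=.
  by rewrite e !addrK.
pose Ia := Ideles fa.
have ei : i = Ia + Iw + i' by apply: ideles_eq => v; exact: e.
apply/qproj_eq => S hS hN; apply: hN; exists ua, Ia; split.
- by move=> v /=; rewrite eia ea.
- rewrite /= ei; apply: (addIr (qproj (@unit_ideles R A K) i')); rewrite subrK.
  rewrite -[RHS]/(qg_add _ _) qg_add_proj; apply/qproj_eq.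
  have -> : Ia + Iw + i' - (Ia + i') = Iw by rewrite [Ia + Iw]addrC -[Iw + Ia + i']addrA addrK.
  by move=> S' _ hN'; apply: hN' => v; exists (w v); exact: eiw.
rewrite [LHS]uvalD /= eb hu -mulrA uvalN mulr1; by [].
Qed.

Lemma k0_class_eq (S : calg R) (s s' : seq (bool * triple A S)) : k0_eq s s' -> k0_class s = k0_class s'.
Proof.
move=> h; apply: eq_exist => /=; apply/funext => x; apply/propext; split=> g.
  exact: k0_trans (k0_sym h) g.
exact: k0_trans h g.
Qed.

Lemma k0_eq_class (S : calg R) (s s' : seq (bool * triple A S)) : k0_class s = k0_class s' -> k0_eq s s'.
Proof. by move=> /(congr1 (@proj1_sig _ _)) /= ->; exact: k0_refl. Qed.

Lemma idelic_uniq (t t' : triple A C) c c' : k0_class [:: (true, t)] = k0_class [:: (true, t')] ->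
  idelic_class (j := j) t c -> idelic_class (j := j) t' c' -> c = c'.
Proof.
move=> /k0_eq_class e /idelic_tinv [i [u [-> h _]]] /idelic_tinv [i' [u' [-> h' _]]].
by apply: nrel_cok; exact: (k0_eq_linv dk fA ffK cI e (linv1 h) (linv1 h')).
Qed.

(** Whichever triple [xget] has picked, its idelic class is c by [idelic_uniq]. *)
Lemma k0_to_cokE (t : triple A C) c : idelic_class (j := j) t c -> k0_to_cok j (k0_class [:: (true, t)]) = c.
Proof.
move=> h; rewrite /k0_to_cok; case: xgetP => [x _ [t' e h']|]; last by move/(_ c) => []; exists t.
exact: (esym (idelic_uniq e h h')).
Qed.

(** Independence of the chosen representative: a subgroup of the target pulls back to a subgroup
    containing the principal pairs. *)
Lemma cok_to_k0barE (Gamma : units AC -> Prop) x u :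
  @cok_to_k0bar R A K C j Gamma (qproj (principal j) (x, u)) =
  qproj (@principal_bar R A K C j Gamma) (x, qproj Gamma u).
Proof.
apply/qproj_eq => S [S0 SB] hN.
have e y1 y2 (z1 : quotg (@unit_ideles R A K)) z2 : (y1, qproj Gamma y2) - (z1, qproj Gamma z2) =
    (y1 - z1, qproj Gamma (y2 - z2)) :> (quotg (@unit_ideles R A K) * quotg Gamma)%type.
  rewrite -[LHS]/(y1 - z1, qg_add (qproj Gamma y2) (qg_opp (qproj Gamma z2))).
  by rewrite qg_opp_proj qg_add_proj.
have := @gen_repr _ (principal j) (x, u); move: (repr _) => [x' u'] h; rewrite e.
apply: (h (fun y => S (y.1, qproj Gamma y.2))) => [|y hy]; last by apply: hN; exists y.
split; first exact: S0.
by move=> [y1 y2] [z1 z2] hy hz; have := SB _ _ hy hz; rewrite e.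
Qed.
End K0Class.

(** * Extension of scalars on K_0 *)

Section K0Ext.
Variables (R : comPzRingType) (A S T : calg R) (g : S -> T).
Hypothesis hg : linear g /\ monoid_morphism g.

Lemma triple_eq (L1 L2 : lmodType (calg_ring A)) h1 h2 (f f' : ext L1 T -> ext L2 T) l b l' b' :
  f = f' -> Triple (A := A) h1 h2 (tr_iso := f) l b = Triple h1 h2 (tr_iso := f') l' b'.
Proof. by move=> e; subst f'; congr Triple; exact: Prop_irrelevance. Qed.

Lemma base_change_ext_fun (L1 L2 L3 L4 : lmodType (calg_ring A)) (f : ext L1 S -> ext L3 S)
    (f' : ext L2 S -> ext L4 S) (i1 : L1 -> L2) (i2 : L3 -> L4) :
  linear f -> linear f' -> linear i1 -> linear i2 ->
  (forall x, f' (ext_fun i1 x) = ext_fun i2 (f x)) ->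
  forall x, base_change g f' (ext_fun i1 x) = ext_fun i2 (base_change g f x).
Proof.
move=> lf lf' li1 li2 e x.
have le1 : linear (ext_fun i1 : ext L1 T -> ext L2 T) := ext_fun_linear li1.
have le2 : linear (ext_fun i2 : ext L3 T -> ext L4 T) := ext_fun_linear li2.
have le3 : linear (ext_fun i2 : ext L3 S -> ext L4 S) := ext_fun_linear li2.
move: x; apply: tensor_eq => [x y|x y|l t].
- by rewrite (linD le1) (linD (base_change_linear hg lf')).
- by rewrite (linD (base_change_linear hg lf)) (linD le2).
rewrite (ext_fun_tens _ _ li1) !(base_change_tens hg) // (linZ le2); congr (_ *: _).
rewrite -(ext_fun_tens _ _ li1) e; move: (f _); apply: tensor_eq => [x y|x y|m s].
- by rewrite (linD le3) (linD (@ext_map_linear R A S T g hg L4)).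
- by rewrite (linD (@ext_map_linear R A S T g hg L3)) (linD le2).
by rewrite (ext_fun_tens _ _ li2) !(ext_map_tens hg) (ext_fun_tens _ _ li2).
Qed.

Definition sext (p : bool * triple A S) : bool * triple A T := (p.1, triple_ext hg p.2).

(** [k0_ext] works on a chosen representative; compatibility with the relations makes it computable
    on any other one. *)
Lemma k0_eq_ext s s' : k0_eq s s' -> k0_eq (map sext s) (map sext s').
Proof.
elim=> {s s'} [s|s s' _ ih|s s' s'' _ ih _ ih'|s s' t t' _ ih _ ih'|s t|t||].
- exact: k0_refl.
- exact: k0_sym.
- exact: k0_trans ih ih'.
- by rewrite !map_cat; exact: k0_cat.
- by rewrite !map_cat; exact: k0_comm.
- exact: k0_cancel.
- move=> t' t t'' i1 p1 i2 p2 ex1 ex2 c1 c2.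
  apply: (@k0_exact R A T (triple_ext hg t') (triple_ext hg t) (triple_ext hg t'') i1 p1 i2 p2) => //= x.
    by apply: base_change_ext_fun => //; try exact: tr_iso_linear; exact: linearP.
  by apply: base_change_ext_fun => //; try exact: tr_iso_linear; exact: linearP.
move=> L1 L2 L3 h1 h2 h3 f12 l12 b12 f23 l23 b23 l13 b13 /=.
set t12 := triple_ext hg (Triple h1 h2 l12 b12); set t23 := triple_ext hg (Triple h2 h3 l23 b23).
(* Base change respects composition as an equality of functions; [triple_eq] then replaces the
   proofs carried by the triple so that [k0_comp] applies. *)
have e : base_change g (f23 \o f12) = base_change g f23 \o base_change g f12.
  apply/funext; apply: tensor_eq => [x y|x y|l t].
  - by rewrite (linD (base_change_linear hg l13)).
  - by rewrite /= (linD (base_change_linear hg l12)) (linD (base_change_linear hg l23)).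
  rewrite /= !(base_change_tens hg) // (linZ (base_change_linear hg l23)).
  by rewrite (base_change_ext_map hg l23).
have l : linear (base_change g f23 \o base_change g f12) by rewrite -e; exact: base_change_linear.
have b : bijective (base_change g f23 \o base_change g f12) by rewrite -e; exact: base_change_bij.
have := @k0_comp R A T L1 L2 L3 h1 h2 h3 _ (base_change_linear hg l12) (base_change_bij hg l12 b12)
  _ (base_change_linear hg l23) (base_change_bij hg l23 b23) l b.
by rewrite -(triple_eq h1 h3 (base_change_linear hg l13) (base_change_bij hg l13 b13) l b e).
Qed.

Lemma k0_extE (t : triple A S) : k0_ext hg (k0_class [:: (true, t)]) = k0_class [:: (true, triple_ext hg t)].
Proof.
apply: k0_class_eq; rewrite -[[:: (true, triple_ext hg t)]]/(map sext [:: (true, t)]).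
apply: k0_eq_ext; rewrite /k0_repr; case: cid => s /= e.
by have : k0_eq [:: (true, t)] s; [rewrite e; exact: k0_refl|exact: k0_sym].
Qed.
End K0Ext.

(** * Trivializations and points *)

Section TrivialTorsor.
Variables (R : comPzRingType) (G : group_scheme R).
Local Notation O := (gs_alg G).
Local Notation D := (@gs_mul R G).

Lemma tmap_id (M N : lmodType R) (z : tensor M N) : tmap id id z = z.
Proof. by move: z; apply: tlin_eq => [||m n]; [exact: tmap_linear|exact: id_linear|rewrite tmap_tens]. Qed.

Lemma tmap_comp (M N M' N' M'' N'' : lmodType R) (f : M -> M') (g : N -> N')
    (f' : M' -> M'') (g' : N' -> N'') z : linear f -> linear g -> linear f' -> linear g' ->
  tmap f' g' (tmap f g z) = tmap (f' \o f) (g' \o g) z.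
Proof.
move=> lf lg lf' lg'; move: z; apply: tlin_eq => [||m n].
- exact: linear_comp (tmap_linear lf' lg') (tmap_linear lf lg).
- exact: tmap_linear (linear_comp lf' lf) (linear_comp lg' lg).
rewrite !tmap_tens //; [exact: (linear_comp lf')|exact: (linear_comp lg')].
Qed.

Lemma bilin_scaled (g : O -> R) (N : lmodType R) : linear (g : O -> R^o) ->
  bilin (fun (a : O) (b : N) => g a *: b).
Proof.
by move=> lg; split=> [b r x y|a r x y] /=; rewrite ?lg ?scalerDl ?scalerDr !scalerA // mulrC.
Qed.

(** a (x) b |-> a h(b_1) (x) b_2: the Galois map of the trivial torsor for h = id, and its inverse
    when h is the antipode. *)
Definition gal (h : O -> O) : tensor O O -> tensor O O :=
  tlift (fun a b => tens a (1 : O) * tmap h id (D b)).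

Lemma gal_bilin h : linear h -> bilin (fun a b : O => tens a (1 : O) * tmap h id (D b)).
Proof.
move=> lh; split=> [b r a a'|a r b b'] /=.
  by rewrite (tens_bilin _ _).1 tensM_linl.
by rewrite (gs_mul_hom G).1 (tmap_linear lh (@id_linear _ _)) tensM_linr.
Qed.

Lemma galK (h g : O -> O) : linear h -> linear g ->
  (forall x, tlift (fun a b : O => h a * g b) (D x) = calg_str O (gs_unit x)) ->
  cancel (gal h) (gal g).
Proof.
move=> lh lg hg; have lD := (gs_mul_hom G).1; have le := (gs_unit_hom G).1.
have lgal k : linear k -> linear (gal k) by move=> lk; apply/tliftP/gal_bilin.
have bhg : bilin (fun a b : O => h a * g b).
  by split=> [b|a] r x y /=; rewrite ?lh ?lg ?mulrDl ?mulrDr -?cscalerAl -?cscalerAr.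
have lstr : linear (fun x : O => calg_str O (gs_unit x) : O).
  by move=> r x y; rewrite le rmorphD regE rmorphM.
pose Psi (y : tensor O (tensor O O)) : tensor O O :=
  tlift (fun a w => tens (h a) (1 : O) * tmap g id w) y.
have bPsi : bilin (fun (a : O) (w : tensor O O) => tens (h a) (1 : O) * tmap g id w).
  split=> [w r x y|a r x y] /=; first by rewrite lh (tens_bilin _ _).1 tensM_linl.
  by rewrite (tmap_linear lg (@id_linear _ _)) tensM_linr.
have mull a z : gal g (tens a (1 : O) * z) = tens a (1 : O) * gal g z.
  move: z; apply: tlin_eq => [||b c].
  - exact: linear_comp (lgal _ lg) (tensM_linr _).
  - exact: linear_comp (tensM_linr _) (lgal _ lg).
  by rewrite tensM mul1r /gal !(tlift_tens (gal_bilin lg)) mulrA tensM mul1r.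
move=> z; move: z; apply: tlin_eq => [|//|a b]; first exact: linear_comp (lgal _ lg) (lgal _ lh).
rewrite [gal h _](tlift_tens (gal_bilin lh)) mull.
have -> : gal g (tmap h id (D b)) = Psi (tmap id D (D b)).
  rewrite /Psi (tlift_tmap _ bPsi (@id_linear _ _) lD).
  move: (D b); apply: tlin_eq => [||c d].
  - exact: linear_comp (lgal _ lg) (tmap_linear lh (@id_linear _ _)).
  - exact/tliftP/(bilin_comp bPsi (@id_linear _ _) lD).
  rewrite tmap_tens // /gal (tlift_tens (gal_bilin lg)).
  by rewrite (tlift_tens (bilin_comp bPsi (@id_linear _ _) lD)).
rewrite -gs_mulA.
have e y : Psi (tassoc y) = tmap (tlift (fun a b : O => h a * g b)) id y.
  move: y; apply: tens3_eq => [||c d x].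
  - exact: linear_comp (tliftP bPsi) (@tassoc_linear _ _ _ _).
  - exact: tmap_linear (tliftP bhg) (@id_linear _ _).
  rewrite tassoc_tens [LHS](tlift_tens bPsi) tmap_tens // tensM mul1r tmap_tens //; last exact: tliftP.
  by rewrite (tlift_tens bhg).
rewrite e (tmap_comp _ lD (@id_linear _ _) (tliftP bhg) (@id_linear _ _)).
have -> : tmap (tlift (fun a b : O => h a * g b) \o D) (id \o id) (D b) = tens (1 : O) b.
  rewrite -{2}(gs_mul1 b).
  have be := @bilin_scaled (@gs_unit R G) O le.
  move: (D b); apply: tlin_eq => [||c d].
  - exact: tmap_linear (linear_comp (tliftP bhg) lD) (@id_linear _ _).
  - exact: linear_comp ((tens_bilin O O).2 1) (tliftP be).
  rewrite tmap_tens //; last exact: linear_comp (tliftP bhg) lD.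
  rewrite (tlift_tens be) /= hg (bilinZr (tens_bilin O O)) -(bilinZl (tens_bilin O O)).
  by congr (tens _ _); rewrite -[RHS]/(calg_str O _ * 1) mulr1.
by rewrite tensM mulr1 mul1r.
Qed.

Lemma trivial_free : bijective (tlift (fun a b : gsp_alg (trivial_space G) =>
  (tens a (1 : O) : tensor (gsp_alg (trivial_space G)) O) * gsp_act b)).
Proof.
have lS := (gs_inv_hom G).1.
have hV : forall x, tlift (fun a b : O => gs_inv a * id b) (D x) = calg_str O (gs_unit x) by exact: gs_mulV.
have b1 : bilin (fun a b : O => gs_inv a * id b).
  by split=> [b|a] r x y /=; rewrite ?lS ?mulrDl ?mulrDr -?cscalerAl -?cscalerAr.
have b2 : bilin (fun a b : O => id a * gs_inv b).
  by split=> [b|a] r x y /=; rewrite ?lS ?mulrDl ?mulrDr -?cscalerAl -?cscalerAr.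
have hV' : forall x, tlift (fun a b : O => id a * gs_inv b) (D x) = calg_str O (gs_unit x).
  move=> x; rewrite -(gs_mulV x) -[in LHS](gs_mulC x); move: (D x); apply: tlin_eq => [||c d].
  - exact: linear_comp (tliftP b2) (tliftP (tswap_bilin _ _)).
  - exact: tliftP.
  by rewrite /tswap (tlift_tens (tswap_bilin _ _)) (tlift_tens b1) (tlift_tens b2) mulrC.
have e : gal id =1 tlift (fun a b : gsp_alg (trivial_space G) =>
  (tens a (1 : O) : tensor (gsp_alg (trivial_space G)) O) * gsp_act b).
  move=> z; rewrite /gal; congr (tlift _ z); apply/funext => a; apply/funext => b.
  by rewrite tmap_id.
apply: (@eq_bij _ _ (gal id)); last exact: e.
by exists (gal (@gs_inv R G)); apply: galK.
Qed.

Lemma trivial_fflat : faithfully_flat (gsp_alg (trivial_space G)).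
Proof.
split=> [|N hN y]; first exact: (@gs_flat _ G).
have be : bilin (fun (n : N) (o : O) => (gs_unit o : R) *: n).
  by split=> [o r x z|n r x z] /=; rewrite ?(gs_unit_hom G).1 ?scalerDl ?scalerDr !scalerA // mulrC.
have := congr1 (tlift (fun (n : N) (o : O) => (gs_unit o : R) *: n)) (hN (tens y (1 : O))).
rewrite (tlift_tens be) (gs_unit_hom G).2.1 scale1r => ->; exact: (lin0 (tliftP be)).
Qed.

Definition trivial_torsor : torsor G := Torsor trivial_fflat trivial_free.
End TrivialTorsor.

(** * Trivializations given by points *)

Section Points.
Variables (R : comPzRingType) (dk : dedekind_like R) (G : group_scheme R).
Local Notation O := (gs_alg G).
Local Notation A := (cdual G).
Local Notation AR := (cdual_ring G).
Local Notation D := (@gs_mul R G).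
Local Notation M0 := (space_mod (trivial_space G)).

Definition alg_hom (B B' : calg R) (f : B -> B') : Prop := linear f /\ monoid_morphism f.

Lemma alg_hom_comp (B B' B'' : calg R) (f : B -> B') (g : B' -> B'') :
  alg_hom f -> alg_hom g -> alg_hom (g \o f).
Proof.
move=> [lf [f1 fM]] [lg [g1 gM]]; split; first exact: linear_comp.
by split=> [|x y] /=; rewrite ?f1 ?fM ?g1 ?gM.
Qed.

Section Space.
Variable X : gspace G.
Local Notation C := (gsp_alg X).
Local Notation rho := (@gsp_act _ _ X).
Let lrho : linear rho := (gsp_act_hom X).1.

Lemma space_scale_lin (a : AR) : linear (fun c : C => a *: (c : space_mod X) : C).
Proof. exact: space_scale_linear. Qed.

Lemma act_scale (a : AR) (c : C) :
  rho (a *: (c : space_mod X) : C) = tmap id (fun o : O => a *: (o : M0) : O) (rho c).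
Proof.
have lD := (gs_mul_hom G).1.
have lc : linear (contr (N := O) (a : dual O)) by exact: contr_linear.
pose k (y : tensor C (tensor O O)) : tensor C O := tmap id (contr (a : dual O)) y.
transitivity (k (tassoc (tmap rho id (rho c)))); last first.
  rewrite gsp_actA /k (tmap_comp _ (@id_linear _ _) lD (@id_linear _ _) lc).
  by [].
rewrite space_scaleE; move: (rho c); apply: tlin_eq => [||d o].
- exact: linear_comp lrho (contr_linear _).
- apply: linear_comp (tmap_linear (@id_linear _ _) lc) _.
  exact: linear_comp (@tassoc_linear _ _ _ _) (tmap_linear lrho (@id_linear _ _)).
rewrite contr_tens (linZ lrho) tmap_tens //; move: (rho d); apply: tlin_eq => [x y z||e h].
- by rewrite !scalerDr !scalerA mulrC.
- apply: linear_comp (tmap_linear (@id_linear _ _) lc) _.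
  exact: linear_comp (@tassoc_linear _ _ _ _) ((tens_bilin _ _).1 o).
rewrite tassoc_tens /k tmap_tens // contr_tens; last first.
by rewrite (bilinZr (tens_bilin _ _)).
Qed.

(* val chi c g = sum g(c_1) (x) chi(c_0) *)
Section Val.
Variables (T : calg R) (chi : C -> T) (hchi : alg_hom chi).

Lemma dual_space_lin (g : dual M0) : linear (fun o : O => (g (o : M0) : A)).
Proof.
move=> r x y; rewrite (linD (dual_lin g)) -(space_str (X := trivial_space G) r x).
by rewrite (linZ (dual_lin g)).
Qed.

Lemma val_bilin (g : dual M0) : bilin (fun (c : C) (o : O) => tens (g (o : M0) : A) (chi c)).
Proof.
have [lc _] := hchi; have lg := @dual_space_lin g.
split=> [o|c] r x y /=; first by rewrite lc (tens_bilin A T).2.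
by rewrite lg (tens_bilin A T).1.
Qed.

Definition val (c : C) (g : dual M0) : tensor A T :=
  tlift (fun (c : C) (o : O) => tens (g (o : M0) : A) (chi c)) (rho c).

Lemma val_scalel (a : AR) (c : C) g :
  val (a *: (c : space_mod X) : C) g = tens (a : A) (1 : T) * val c g.
Proof.
have la : linear (fun o : O => a *: (o : M0) : O) by exact: (@space_scale_linear R G (trivial_space G) a).
rewrite /val act_scale (tlift_tmap _ (val_bilin g) (@id_linear _ _) la).
move: (rho c); apply: tlin_eq => [||d o].
- exact/tliftP/(bilin_comp (val_bilin g) (@id_linear _ _) la).
- exact: linear_comp (tensM_linr _) (tliftP (val_bilin g)).
rewrite (tlift_tens (val_bilin g)) (tlift_tens (bilin_comp (val_bilin g) (@id_linear _ _) la)).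
by rewrite tensM mul1r (linZ (dual_lin g)).
Qed.

Lemma val_scaler (a : AR) (c : C) g : val c (a *: g) = tens (a : A) (1 : T) * val c g.
Proof.
rewrite /val; move: (rho c); apply: tlin_eq => [||d o].
- exact/tliftP/val_bilin.
- exact: linear_comp (tensM_linr _) (tliftP (val_bilin g)).
by rewrite !(tlift_tens (val_bilin _)) tensM mul1r.
Qed.

(** c |-> c_1 (x) chi(c_0), that is, the function g |-> c(x g) on G over T, where x is the T-point
    of X given by chi. *)
Definition triv0 (c : C) : tensor O T := tmap id chi (tswap (rho c)).

Lemma val_triv (c : C) (g : dual M0) : val c g = tmap (fun o : O => (g (o : M0) : A)) id (triv0 c).
Proof.
have [lc _] := hchi; have lg := @dual_space_lin g.
rewrite /val /triv0; move: (rho c); apply: tlin_eq => [||d o].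
- exact/tliftP/val_bilin.
- apply: linear_comp (tmap_linear lg (@id_linear _ _)) _.
  exact: linear_comp (tmap_linear (@id_linear _ _) lc) (tliftP (tswap_bilin _ _)).
by rewrite (tlift_tens (val_bilin g)) /tswap (tlift_tens (tswap_bilin _ _)) !tmap_tens.
Qed.
End Val.

Lemma val_comp (S T : calg R) (chi : C -> S) (h : S -> T) c g : alg_hom chi -> alg_hom h ->
  val (h \o chi) c g = tmap (fun a : A => a) h (val chi c g).
Proof.
move=> hc hh; have hhc := alg_hom_comp hc hh.
rewrite /val; move: (rho c); apply: tlin_eq => [||d o].
- exact/tliftP/(val_bilin hhc).
- exact: linear_comp (tmap_linear (@id_linear _ _) hh.1) (tliftP (val_bilin hc g)).
by rewrite (tlift_tens (val_bilin hhc g)) (tlift_tens (val_bilin hc g)) tmap_tens //; exact: hh.1.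
Qed.

Lemma tswap_ring (B B' : calg R) : monoid_morphism (@tswap R B B').
Proof.
have ls := tliftP (tswap_bilin B B').
split; first by rewrite /tswap (tlift_tens (tswap_bilin _ _)).
move=> x y; move: x; apply: tlin_eq => [||a b].
- exact: linear_comp ls (tensM_linl y).
- exact: linear_comp (tensM_linl _) ls.
move: y; apply: tlin_eq => [||a' b'].
- exact: linear_comp ls (tensM_linr _).
- exact: linear_comp (tensM_linr _) ls.
by rewrite tensM /tswap !(tlift_tens (tswap_bilin _ _)) tensM.
Qed.

Section Triv.
Variables (T : calg R) (chi : C -> T) (hchi : alg_hom chi).

Lemma triv0_hom : linear (triv0 chi) /\ monoid_morphism (triv0 chi).
Proof.
have [lc mc] := hchi; have [l2 m2] := @tmap_ring R O C T chi lc mc.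
have ls := tliftP (tswap_bilin C O); have ms := @tswap_ring C O; have mr := (gsp_act_hom X).2.
split; first by apply: linear_comp (linear_comp l2 ls) lrho.
by split=> [|x y]; rewrite /triv0 ?mr.1 ?ms.1 ?m2.1 // mr.2 ms.2 m2.2.
Qed.

Lemma triv_bilin : bilin (fun (c : C) (t : T) => tens (1 : O) t * triv0 chi c).
Proof.
split=> [t|c] r x y /=; first by rewrite triv0_hom.1 tensM_linr.
by rewrite (tens_bilin O T).2 tensM_linl.
Qed.

Definition triv : tensor C T -> tensor O T := tlift (fun (c : C) (t : T) => tens (1 : O) t * triv0 chi c).

Lemma triv_tens c t : triv (tens c t) = tens (1 : O) t * triv0 chi c.
Proof. exact: (tlift_tens triv_bilin). Qed.
Lemma triv_linear : linear triv. Proof. exact/tliftP/triv_bilin. Qed.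

Lemma triv_monoid : monoid_morphism triv.
Proof.
split; first by rewrite triv_tens triv0_hom.2.1 mulr1.
move=> x y; move: x; apply: tlin_eq => [||a b].
- exact: linear_comp triv_linear (tensM_linl y).
- exact: linear_comp (tensM_linl _) triv_linear.
move: y; apply: tlin_eq => [||a' b'].
- exact: linear_comp triv_linear (tensM_linr _).
- exact: linear_comp (tensM_linr _) triv_linear.
by rewrite tensM !triv_tens triv0_hom.2.2 mulrACA tensM mulr1.
Qed.

Lemma triv_scalar t : triv (tens (1 : C) t) = tens (1 : O) t.
Proof. by rewrite triv_tens triv0_hom.2.1 mulr1. Qed.

Lemma act_ext_bilin (Y : gspace G) :
  bilin (fun (c : gsp_alg Y) (s : T) => tmap (fun d : gsp_alg Y => tens d s) id (gsp_act c)).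
Proof.
have lY := (gsp_act_hom Y).1.
split=> [s|c] r x y /=; first by rewrite lY (tmap_linear ((tens_bilin _ _).1 s) (@id_linear _ _)).
move: (gsp_act c); apply: tlin_eq => [||d o].
- exact: tmap_linear ((tens_bilin _ _).1 _) (@id_linear _ _).
- have k (s : T) := tmap_linear ((tens_bilin (gsp_alg Y) T).1 s) (@id_linear _ O).
  by move=> q z w; rewrite !k !scalerDr !scalerA (mulrC r) addrACA.
rewrite !tmap_tens //; try exact: (tens_bilin _ _).1.
by rewrite (tens_bilin _ _).2 (tens_bilin _ _).1.
Qed.
Lemma act_ext_linear (Y : gspace G) : linear (@act_ext R G T Y).
Proof. exact/tliftP/act_ext_bilin. Qed.
Lemma act_ext_tens (Y : gspace G) (c : gsp_alg Y) (s : T) :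
  act_ext (tens c s) = tmap (fun d : gsp_alg Y => tens d s) id (gsp_act c).
Proof. exact: (tlift_tens (act_ext_bilin Y)). Qed.

Lemma triv_equivariant z :
  act_ext (Y := trivial_space G) (triv z) = tmap triv id (act_ext z).
Proof.
have [lc mc] := hchi; have lD := (gs_mul_hom G).1; have lt1 := triv_linear.
have lt2 := tmap_linear triv_linear (@id_linear _ O).
move: z; apply: tlin_eq => [||c t].
- exact: linear_comp (@act_ext_linear (trivial_space G)) triv_linear.
- exact: linear_comp lt2 (@act_ext_linear X).
rewrite triv_tens act_ext_tens.
(* both sides are the image of (id (x) D)(rho c) under c (x) (o (x) o') |-> (o (x) chi c t) (x) o' *)
pose b (c : C) (y : tensor O O) : tensor (tensor O T) O := tmap (fun o : O => tens o (t * chi c : T)) id y.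
have hb : bilin b.
  split=> [y|d] r x x'; rewrite /b /=; last exact: (tmap_linear ((tens_bilin O T).1 _) (@id_linear _ O) r x x').
  move: y; apply: tlin_eq => [||o o'].
  - exact: tmap_linear ((tens_bilin _ _).1 _) (@id_linear _ _).
  - have k (s : T) := tmap_linear ((tens_bilin O T).1 s) (@id_linear _ O).
    by move=> q z w; rewrite !k !scalerDr !scalerA (mulrC r) addrACA.
  rewrite !tmap_tens //; try exact: (tens_bilin _ _).1.
  by rewrite lc mulrDr -cscalerAr (tens_bilin _ _).2 (tens_bilin _ _).1.
transitivity (tlift b (tmap id D (rho c))).
  rewrite (tlift_tmap _ hb (@id_linear _ _) lD) /triv0; move: (rho c); apply: tlin_eq => [||d o].
  - apply: linear_comp (@act_ext_linear (trivial_space G)) _.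
    apply: linear_comp (tensM_linr _) _.
    exact: linear_comp (tmap_linear (@id_linear _ _) lc) (tliftP (tswap_bilin _ _)).
  - exact/tliftP/(bilin_comp hb (@id_linear _ _) lD).
  rewrite /tswap (tlift_tens (tswap_bilin _ _)) tmap_tens // tensM mul1r.
  by rewrite (tlift_tens (bilin_comp hb (@id_linear _ _) lD)) (@act_ext_tens (trivial_space G)).
rewrite -gsp_actA; move: (rho c); apply: tlin_eq => [||d o].
- apply: linear_comp (tliftP hb) _.
  exact: linear_comp (@tassoc_linear _ _ _ _) (tmap_linear lrho (@id_linear _ _)).
- exact: linear_comp lt2 (tmap_linear ((tens_bilin _ _).1 _) (@id_linear _ _)).
rewrite !tmap_tens //; try exact: (tens_bilin _ _).1.
rewrite triv_tens /triv0; move: (rho d); apply: tlin_eq => [||e h].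
- apply: linear_comp (tliftP hb) _.
  exact: linear_comp (@tassoc_linear _ _ _ _) ((tens_bilin _ _).1 o).
- apply: linear_comp ((tens_bilin _ _).1 o) _; apply: linear_comp (tensM_linr _) _.
  exact: linear_comp (tmap_linear (@id_linear _ _) lc) (tliftP (tswap_bilin _ _)).
rewrite tassoc_tens (tlift_tens hb) /b tmap_tens //; last exact: (tens_bilin _ _).1.
by rewrite /tswap (tlift_tens (tswap_bilin _ _)) tmap_tens // tensM mul1r.
Qed.
End Triv.
End Space.
End Points.

(** * Points of a torsor *)

Section TorsorPoints.
Variables (R : comPzRingType) (dk : dedekind_like R) (G : group_scheme R).
Local Notation O := (gs_alg G).
Local Notation A := (cdual G).
Local Notation AR := (cdual_ring G).
Local Notation D := (@gs_mul R G).
Local Notation M0 := (space_mod (trivial_space G)).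
Variable X : torsor G.
Local Notation C := (gsp_alg X).
Local Notation rho := (@gsp_act _ _ X).

Section PairHom.
Variables (B B' T : calg R) (f : B -> T) (g : B' -> T).
Hypotheses (hf : alg_hom f) (hg : alg_hom g).

Definition pair_hom : tensor B B' -> T := tlift (fun b b' => f b * g b').

Lemma pair_bilin : bilin (fun b b' => f b * g b' : T).
Proof.
have [[lf _] [lg _]] := (hf, hg).
by split=> [b|a] r x y /=; rewrite ?lf ?lg ?mulrDl ?mulrDr -?cscalerAl -?cscalerAr.
Qed.
Lemma pair_tens b b' : pair_hom (tens b b') = f b * g b'.
Proof. exact: (tlift_tens pair_bilin). Qed.
Lemma pair_linear : linear pair_hom. Proof. exact/tliftP/pair_bilin. Qed.
Lemma pair_monoid : monoid_morphism pair_hom.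
Proof.
have [[lf mf] [lg mg]] := (hf, hg).
split; first by rewrite pair_tens mf.1 mg.1 mulr1.
move=> x y; move: x; apply: tlin_eq => [||a b].
- exact: linear_comp pair_linear (tensM_linl y).
- by move=> r x z; rewrite pair_linear mulrDl cscalerAl.
move: y; apply: tlin_eq => [||a' b'].
- exact: linear_comp pair_linear (tensM_linr _).
- by move=> r x z; rewrite pair_linear mulrDr cscalerAr.
by rewrite tensM !pair_tens mf.2 mg.2 mulrACA.
Qed.
Lemma pair_comp_hom (B0 : calg R) (d : B0 -> tensor B B') : linear d /\ monoid_morphism d ->
  alg_hom (fun c => pair_hom (d c)).
Proof.
move=> [ld md]; split; first exact: linear_comp pair_linear ld.
by split=> [|x y]; rewrite ?md.1 ?md.2 ?pair_monoid.1 ?pair_monoid.2.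
Qed.
End PairHom.

Lemma galois_monoid : monoid_morphism (@galois R G X).
Proof.
have mr := (gsp_act_hom X).2; have lg := @galois_linear R G X.
split; first by rewrite galois_tens mr.1 mulr1.
move=> x y; move: x; apply: tlin_eq => [||a b].
- exact: linear_comp lg (tensM_linl y).
- exact: linear_comp (tensM_linl _) lg.
move: y; apply: tlin_eq => [||a' b'].
- exact: linear_comp lg (tensM_linr _).
- exact: linear_comp (tensM_linr _) lg.
by rewrite tensM !galois_tens mr.2 mulrACA tensM mulr1.
Qed.

Definition galois_inv : tensor C O -> tensor C C := fun w => projT1 (cid (galois_surj w)).
Lemma galois_invK w : galois (galois_inv w) = w. Proof. exact: projT2 (cid (galois_surj w)). Qed.
Lemma galoisK z : galois_inv (galois z) = z.
Proof. by have [g gK _] := @galois_bij R G X; apply: (can_inj gK); rewrite galois_invK. Qed.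
Lemma galois_inv_linear : linear galois_inv.
Proof.
by move=> r x y; rewrite -[r *: galois_inv x + _]galoisK galois_linear !galois_invK.
Qed.
Lemma galois_inv_monoid : monoid_morphism galois_inv.
Proof.
split; first by rewrite -{1}galois_monoid.1 galoisK.
by move=> x y; rewrite -[RHS]galoisK galois_monoid.2 !galois_invK.
Qed.
Lemma galois_inv_mull (c : C) w : galois_inv (tens c (1 : O) * w) = tens c (1 : C) * galois_inv w.
Proof. by rewrite -[RHS]galoisK galois_mull galois_invK. Qed.

Section OnePoint.
Variables (T : calg R) (chi : C -> T) (hchi : alg_hom chi).

(** [triv chi] is the Galois isomorphism base changed along chi on its first factor, and so is the
    inverse [psi]; [kap] and [kapO] are the base change maps from C (x) C and C (x) O. *)
Lemma triv_bij : bijective (triv chi).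
Proof.
have [lc mc] := hchi; have lt1 := triv_linear hchi.
have lr := (gsp_act_hom X).1.
have lsw (M N : lmodType R) := tliftP (tswap_bilin M N).
pose kap (z : tensor C C) : tensor C T := tmap id chi (tswap z).
pose kapO (z : tensor C O) : tensor O T := tmap id chi (tswap z).
have lkap : linear kap by exact: linear_comp (tmap_linear (@id_linear _ _) lc) (lsw _ _).
have lkapO : linear kapO by exact: linear_comp (tmap_linear (@id_linear _ _) lc) (lsw _ _).
have kapE a b : kap (tens a b) = tens b (chi a).
  by rewrite /kap /tswap (tlift_tens (tswap_bilin _ _)) tmap_tens.
have kapOE a b : kapO (tens a b) = tens b (chi a).
  by rewrite /kapO /tswap (tlift_tens (tswap_bilin _ _)) tmap_tens.
have kapM a z : kap (tens a (1 : C) * z) = tens (1 : C) (chi a) * kap z.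
  move: z; apply: tlin_eq => [||b c].
  - exact: linear_comp lkap (tensM_linr _).
  - exact: linear_comp (tensM_linr _) lkap.
  by rewrite tensM mul1r !kapE tensM mul1r mc.2.
have kapOM a z : kapO (tens a (1 : O) * z) = tens (1 : O) (chi a) * kapO z.
  move: z; apply: tlin_eq => [||b c].
  - exact: linear_comp lkapO (tensM_linr _).
  - exact: linear_comp (tensM_linr _) lkapO.
  by rewrite tensM mul1r !kapOE tensM mul1r mc.2.
have tM t z : triv chi (tens (1 : C) t * z) = tens (1 : O) t * triv chi z.
  by rewrite (triv_monoid hchi).2 (triv_scalar hchi).
have tk z : triv chi (kap z) = kapO (galois z).
  move: z; apply: tlin_eq => [||a b].
  - exact: linear_comp lt1 lkap.
  - exact: linear_comp lkapO (@galois_linear R G X).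
  by rewrite kapE (triv_tens hchi) galois_tens kapOM.
have hps : bilin (fun (o : O) (t : T) => tens (1 : C) t * kap (galois_inv (tens (1 : C) o))).
  split=> [t|o] r x y /=; last by rewrite (tens_bilin C T).2 tensM_linl.
  by rewrite (tens_bilin C O).2 galois_inv_linear lkap tensM_linr.
pose psi : tensor O T -> tensor C T :=
    tlift (fun (o : O) (t : T) => tens (1 : C) t * kap (galois_inv (tens (1 : C) o))).
have lpsi : linear psi by exact/tliftP/hps.
have psE o t : psi (tens o t) = tens (1 : C) t * kap (galois_inv (tens (1 : C) o)).
  exact: (tlift_tens hps).
have psk w : psi (kapO w) = kap (galois_inv w).
  move: w; apply: tlin_eq => [||a o].
  - exact: linear_comp lpsi lkapO.
  - exact: linear_comp lkap galois_inv_linear.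
  by rewrite kapOE psE -kapM -galois_inv_mull tensM mulr1 mul1r.
have psM t z : psi (tens (1 : O) t * z) = tens (1 : C) t * psi z.
  move: z; apply: tlin_eq => [||o s].
  - exact: linear_comp lpsi (tensM_linr _).
  - exact: linear_comp (tensM_linr _) lpsi.
  by rewrite tensM mul1r !psE mulrA tensM mul1r.
exists psi => z; move: z; apply: tlin_eq => [|//|a t].
- exact: linear_comp lpsi lt1.
- rewrite (triv_tens hchi) psM -[triv0 chi a]/(kapO (rho a)) psk.
  have <- : galois (tens (1 : C) a) = rho a by rewrite galois_tens mul1r.
  by rewrite galoisK kapE mc.1 tensM mul1r mulr1.
- exact: linear_comp lt1 lpsi.
by rewrite psE tM tk galois_invK kapOE mc.1 tensM mul1r mulr1.
Qed.

Lemma triv_iso : equivariant_iso (triv chi).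
Proof.
split; [by split; [exact: triv_linear|exact: triv_monoid]|exact: triv_scalar|exact: triv_bij|].
exact: triv_equivariant.
Qed.
End OnePoint.

(** The point is phi followed by the counit, the preimage of the unit section; equivariance then
    determines phi on C. *)
Lemma iso_point (T : calg R) (phi : tensor C T -> tensor O T) : equivariant_iso phi ->
  exists2 chi : C -> T, alg_hom chi & forall c, phi (tens c (1 : T)) = triv0 chi c.
Proof.
move=> [[lp mp] ps _ pe]; have [le me] := gs_unit_hom G.
have be := @bilin_scaled R G (@gs_unit R G) T le.
pose ev : tensor O T -> T := tlift (fun (o : O) (t : T) => (gs_unit o : R) *: t).
have lev : linear ev by exact: tliftP.
have evE o t : ev (tens o t) = gs_unit o *: t by exact: (tlift_tens be).
have mev : monoid_morphism ev.
  split; first by rewrite evE me.1 scale1r.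
  move=> x y; move: x; apply: tlin_eq => [||a b].
  - exact: linear_comp lev (tensM_linl y).
  - by move=> r x z; rewrite lev mulrDl cscalerAl.
  move: y; apply: tlin_eq => [||a' b'].
  - exact: linear_comp lev (tensM_linr _).
  - by move=> r x z; rewrite lev mulrDr cscalerAr.
  by rewrite tensM !evE me.2 -cscalerAl -cscalerAr scalerA.
have lone : linear (fun c : C => tens c (1 : T)) by exact: (tens_bilin C T).1.
pose chi (c : C) : T := ev (phi (tens c (1 : T))).
have hchi : alg_hom chi.
  split; first exact: linear_comp lev (linear_comp lp lone).
  split; first by rewrite /chi mp.1 mev.1.
  by move=> x y; rewrite /chi -mev.2 -mp.2 tensM mulr1.
exists chi => // c.
have lc : linear chi := hchi.1.
(* Apply the counit to the first factor in phi (c_0 (x) 1) (x) c_1 = act_ext (phi (c (x) 1)). *)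
pose h (y : tensor (tensor O T) O) : tensor O T := tswap (tmap ev id y).
have lsw := tliftP (tswap_bilin T O).
have lh : linear h by exact: linear_comp lsw (tmap_linear lev (@id_linear _ _)).
have lt w : h (act_ext (Y := trivial_space G) w) = w.
  move: w; apply: tlin_eq => [|//|o t].
    exact: linear_comp lh (@act_ext_linear R G T (trivial_space G)).
  rewrite (@act_ext_tens R G T (trivial_space G)) -{2}(gs_mul1 o).
  rewrite -[@gsp_act _ _ (trivial_space G) o]/(D o).
  move: (D o); apply: tlin_eq => [||a b].
  - exact: linear_comp lh (tmap_linear ((tens_bilin _ _).1 t) (@id_linear _ _)).
  - apply: linear_comp ((tens_bilin _ _).1 t) _; exact: tliftP (bilin_scaled _ le).
  rewrite (tlift_tens (bilin_scaled _ le)) tmap_tens //; last exact: (tens_bilin _ _).1.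
  rewrite /h tmap_tens // evE /tswap (tlift_tens (tswap_bilin _ _)).
  by rewrite (bilinZr (tens_bilin _ _)) (bilinZl (tens_bilin _ _)).
rewrite -[LHS]lt pe act_ext_tens /triv0; move: (rho c); apply: tlin_eq => [||d o].
- apply: linear_comp lh _; exact: linear_comp (tmap_linear lp (@id_linear _ _)) (tmap_linear lone (@id_linear _ _)).
- exact: linear_comp (tmap_linear (@id_linear _ _) lc) (tliftP (tswap_bilin _ _)).
rewrite !tmap_tens // /h tmap_tens // /tswap !(tlift_tens (tswap_bilin _ _)) tmap_tens //.
Qed.

(** The pair (chi, chi') is a point of X x X; the inverse of the Galois isomorphism turns it into a
    point of X x G, whose second component is g. *)
Lemma point_diff (T : calg R) (chi chi' : C -> T) : alg_hom chi -> alg_hom chi' ->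
  exists2 g : O -> T, alg_hom g & forall c, chi' c = pair_hom chi g (rho c).
Proof.
move=> hc hc'; have lp := pair_linear hc hc'; have mp := pair_monoid hc hc'.
have l1 : linear (fun o : O => tens (1 : C) o) by exact: (tens_bilin C O).2.
exists (fun o => pair_hom chi chi' (galois_inv (tens (1 : C) o))).
  split; first exact: linear_comp lp (linear_comp galois_inv_linear l1).
  split; first by rewrite galois_inv_monoid.1 mp.1.
  by move=> x y; rewrite -mp.2 -galois_inv_monoid.2 tensM mulr1.
set g := fun o => _; move=> c.
have hg : alg_hom g.
  split; first exact: linear_comp lp (linear_comp galois_inv_linear l1).
  split; first by rewrite /g galois_inv_monoid.1 mp.1.
  by move=> x y; rewrite /g -mp.2 -galois_inv_monoid.2 tensM mulr1.
have key w : pair_hom chi chi' (galois_inv w) = pair_hom chi g w.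
  move: w; apply: tlin_eq => [||d o].
  - exact: linear_comp lp galois_inv_linear.
  - exact: pair_linear.
  rewrite (pair_tens hc hg) /g -[tens d o](_ : tens d (1 : O) * tens (1 : C) o = _).
    by rewrite galois_inv_mull mp.2 (pair_tens hc hc') hc'.2.1 mulr1.
  by rewrite tensM mulr1 mul1r.
rewrite -key; have <- : galois (tens (1 : C) c) = rho c by rewrite galois_tens mul1r.
by rewrite galoisK (pair_tens hc hc') hc.2.1 mul1r.
Qed.

End TorsorPoints.

(** * Points of finite algebras over an algebraically closed field *)

Lemma linN (R : pzRingType) (M N : lmodType R) (f : M -> N) : linear f -> {morph f : x / - x}.
Proof.
move=> lf x; rewrite -scaleN1r -[RHS]scaleN1r; have := lf (-1) x 0; rewrite (_ : f 0 = 0) ?addr0 //.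
by have := lf (-1) 0 0; rewrite scaleN1r addNr scaleN1r addNr.
Qed.

(** B may have zero divisors, so the argument goes through Cayley-Hamilton: the characteristic
    polynomial evaluated at c kills every v i, hence their combination 1. *)
Lemma finite_monic (R B : comNzRingType) (f : {rmorphism R -> B}) n (v : 'I_n -> B) (e : 'I_n -> R)
    (c : B) (M : 'I_n -> 'I_n -> R) : 1 = \sum_i f (e i) * v i ->
  (forall i, c * v i = \sum_j f (M i j) * v j) ->
  exists2 p : {poly R}, p \is monic & (map_poly f p).[c] = 0.
Proof.
case: n v e M => [|n] v e M; first by rewrite big_ord0 => /eqP; rewrite oner_eq0.
move=> h1 hM; pose N : 'M_n.+1 := \matrix_(i, j) M i j; pose V : 'cV_n.+1 := \col_i v i.
have NV : map_mx f N *m V = c *: V.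
  by apply/colP => i; rewrite !mxE hM; apply: eq_bigr => j _; rewrite !mxE.
have key (q : {poly R}) : map_mx f (horner_mx N q) *m V = (map_poly f q).[c] *: V.
  elim/poly_ind: q => [|q a ih]; first by rewrite !rmorph0 horner0 mul0mx scale0r.
  rewrite !rmorphD !rmorphM /= map_polyX map_polyC /= hornerMXaddC horner_mx_X horner_mx_C.
  rewrite map_scalar_mx mulmxDl -[_ * _ in LHS]/(_ *m _) -mulmxA NV -scalemxAr ih mul_scalar_mx scalerA.
  by rewrite scalerDl mulrC.
exists (char_poly N); first exact: char_poly_monic.
have := key (char_poly N); rewrite Cayley_Hamilton map_mx0 mul0mx => z.
rewrite -[LHS]mulr1 h1 mulr_sumr big1 // => i _; rewrite mulrCA.
by move/colP: z => /(_ i); rewrite !mxE => <-; rewrite mulr0.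
Qed.

Section ClosedPoints.
Variables (R : comNzRingType) (Fc : closedFieldType) (s : {rmorphism R -> Fc}).
Variables (C : calg R) (n : nat) (v : 'I_n -> C).
Hypothesis gen : forall x : C, exists c : 'I_n -> R, x = \sum_i c i *: v i.
Variables (B : comNzRingType) (g : {rmorphism Fc -> B}) (em : {rmorphism calg_ring C -> B}).
Hypothesis emZ : forall r (x : C), em (r *: x) = g (s r) * em x.

Lemma em_lin I (r : seq I) (c : I -> R) (x : I -> C) :
  em (\sum_(i <- r) c i *: x i) = \sum_(i <- r) g (s (c i)) * em (x i).
Proof. by rewrite [LHS]rmorph_sum; apply: eq_bigr => i _; exact: emZ. Qed.

Lemma gen_root (c : C) : exists l : seq Fc, \prod_(z <- l) (em c - g z) = 0.
Proof.
pose e := projT1 (cid (gen 1)); have he : 1 = \sum_i e i *: v i := projT2 (cid (gen 1)).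
pose M i := projT1 (cid (gen (c * v i))).
have hM i : c * v i = \sum_j M i j *: v j := projT2 (cid (gen (c * v i))).
have [||p pm hp] := @finite_monic R B (g \o s) n (fun i => em (v i)) e (em c) M.
- by rewrite -[LHS](rmorph1 em) -[1](_ : \sum_i e i *: v i = _) // em_lin.
- by move=> i; rewrite -rmorphM -em_lin; exact: (congr1 em (hM i)).
have [l hl] := closed_field_poly_normal (map_poly s p).
exists l; rewrite -hp map_poly_comp hl (monicP (monic_map s pm)) scale1r map_prod_XsubC horner_prod.
by apply: eq_bigr => z _; rewrite hornerXsubC.
Qed.

(** If J + (x - g z) contains 1, the product of the remaining factors already lies in J. *)
Lemma proper_step (J : B -> Prop) (x : B) (l : seq Fc) : ideal J -> ~ J 1 ->
  J (\prod_(z <- l) (x - g z)) ->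
  exists z, exists2 J' : B -> Prop, ideal J' /\ ~ J' 1 & (forall y, J y -> J' y) /\ J' (x - g z).
Proof.
move=> hJ J1; elim: l => [|z l ih]; first by rewrite big_nil.
rewrite big_cons => hp.
pose J' y := exists a b, J a /\ y = a + b * (x - g z).
have [J0 JB JM] := hJ.
have hJ' : ideal J'.
  split; first by exists 0, 0; split=> //; rewrite mul0r addr0.
    move=> _ _ [a [b [ha ->]]] [a' [b' [ha' ->]]]; exists (a - a'), (b - b'); split; first exact: JB.
    by rewrite mulrBl opprD addrACA.
  move=> q _ [a [b [ha ->]]]; exists (q * a), (q * b); split; first exact: JM.
  by rewrite mulrDr mulrA.
have [[a [b [ha e]]]|n1] := pselect (J' 1); last first.
  exists z, J'; split=> //; first by move=> y hy; exists y, 0; split=> //; rewrite mul0r addr0.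
  by exists 0, 1; split=> //; rewrite mul1r add0r.
apply: ih; set Q := \prod_(_ <- _) _ in hp *.
have -> : Q = Q * a + b * ((x - g z) * Q).
  by rewrite -[LHS]mulr1 e mulrDr [Q * (b * _)]mulrC -mulrA.
by apply: (idealD hJ); exact: JM.
Qed.

Lemma proper_seq (l : seq C) : exists2 J : B -> Prop, ideal J /\ ~ J 1 &
  forall c, c \in l -> exists z, J (em c - g z).
Proof.
elim: l => [|c l [J [hJ J1] h]].
  exists (fun x => x = 0); last by [].
  split; last by move/eqP; rewrite oner_eq0.
  by split=> [|x y -> ->|a x ->]; rewrite ?subr0 ?mulr0.
have [q hq] := gen_root c.
have [|z [J' hJ' [sub hz]]] := proper_step (x := em c) (l := q) hJ J1.
  by rewrite hq; case: hJ.
exists J' => // d; rewrite inE => /orP [/eqP ->|/h [w hw]]; first by exists z.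
by exists w; exact: sub.
Qed.

(** Killing one linear factor for each generator gives a proper ideal J modulo which every element
    of C is a scalar; the scalar is unique, as J contains no nonzero scalar. *)
Lemma closed_point : exists chi : C -> CAlg s, alg_hom chi.
Proof.
have [J [hJ J1] h] := proper_seq (codom v).
have [J0 JB JM] := hJ.
have all c : exists z, J (em c - g z).
  have [a ->] := gen c.
  have hz i : exists z, J (em (v i) - g z) by apply: h; exact: codom_f.
  exists (\sum_i s (a i) * projT1 (cid (hz i))).
  rewrite em_lin rmorph_sum -sumrB; apply: ideal_sum => // i _.
  by rewrite rmorphM -mulrBr; apply: JM; exact: projT2 (cid (hz i)).
have uniq z : J (g z) -> z = 0.
  move=> hz; apply/eqP; case: eqP => // /eqP z0; case: J1.
  by have := JM (g z^-1) _ hz; rewrite -rmorphM mulVf // rmorph1.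
have uniq2 c z w : J (em c - g z) -> J (em c - g w) -> z = w.
  move=> hz hw; apply/eqP; rewrite -subr_eq0; apply/eqP; apply: uniq; rewrite rmorphB.
  have -> : g z - g w = (em c - g w) - (em c - g z) by ring.
  exact: JB.
pose chi c : CAlg s := projT1 (cid (all c)).
have hchi c : J (em c - g (chi c)) := projT2 (cid (all c)).
exists chi; split=> [r x y|]; [|split=> [|x y]]; apply: uniq2 (hchi _) _.
- rewrite -[g _]/(g (s r * chi x + chi y)) [g _]rmorphD rmorphM [em _]rmorphD emZ opprD addrACA.
  by apply: (idealD hJ); [rewrite -mulrBr; apply: JM|]; exact: hchi.
- by rewrite [em _]rmorph1 [g _]rmorph1 subrr.
have -> : em (x * y) - g (chi x * chi y) = em y * (em x - g (chi x)) + g (chi x) * (em y - g (chi y)).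
  by rewrite [em _]rmorphM [g (_ * _)]rmorphM; ring.
by apply: (idealD hJ); apply: JM; exact: hchi.
Qed.
End ClosedPoints.

Lemma fin_closed_point (R : comNzRingType) (Fc : closedFieldType) (s : {rmorphism R -> Fc}) (C : calg R) :
  fingen C -> (1 : tensor C (CAlg s)) != 0 -> exists chi : C -> CAlg s, alg_hom chi.
Proof.
move=> [n [v gen]] nz; pose T := CAlg s.
(* C (x) F^c is repacked as a nonzero ring, the setting of the polynomial and matrix theory used for
   the roots. *)
pose B : comNzRingType := HB.pack (tensor C T) (GRing.PzSemiRing_isNonZero.Build (tensor C T) nz).
pose g (t : Fc) : B := tens (1 : C) (t : T).
pose em (c : calg_ring C) : B := tens (c : C) (1 : T).
have l2 := (tens_bilin C T).2 (1 : C); have l1 := (tens_bilin C T).1 (1 : T).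
have g_zmod : zmod_morphism g by move=> x y; rewrite /g -[LHS]/(tens (1 : C) ((x : T) - (y : T))) (linD l2) (linN l2).
have e_zmod : zmod_morphism em by move=> x y; rewrite /em (linD l1) (linN l1).
have g_monoid : monoid_morphism g.
  by split=> // x y; rewrite -[RHS]/((tens (1 : C) (x : T) : tensor C T) * tens (1 : C) (y : T)) tensM mulr1.
have e_monoid : monoid_morphism em.
  by split=> // x y; rewrite -[RHS]/((tens (x : C) (1 : T) : tensor C T) * tens (y : C) (1 : T)) tensM mulr1.
apply: (@closed_point R Fc s C n v gen B (mk_rmorph g_zmod g_monoid) (mk_rmorph e_zmod e_monoid)) => r x.
rewrite -[RHS]/((tens (1 : C) (s r : T) : tensor C T) * tens x (1 : T)) tensM mul1r mulr1.
rewrite -[LHS]/(tens (r *: x : C) (1 : T)) (bilinZl (tens_bilin C T)) -(bilinZr (tens_bilin C T)).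
by congr (tens _ _); rewrite -[LHS]/(s r * 1) mulr1.
Qed.

(** * The pairing of the dual algebra with O *)

Section Pairing.
Variables (R : comPzRingType) (dk : dedekind_like R) (G : group_scheme R).
Local Notation O := (gs_alg G).
Local Notation A := (cdual G).
Local Notation AR := (cdual_ring G).
Local Notation D := (@gs_mul R G).
Local Notation M0 := (space_mod (trivial_space G)).
Variable T : calg R.

(* A (x) T is identified with Hom_R (O, T). *)
Lemma evt_bilin (h : O) : bilin (fun (f : A) (t : T) => ((f : dual O) h : R) *: t).
Proof.
split=> [t r x y|f r x y]; last by rewrite scalerDr !scalerA mulrC.
have e : ((r *: x + y : A) : dual O) h = r * (x : dual O) h + (y : dual O) h := eval_linear h r x y.
by transitivity ((((r *: x + y : A) : dual O) h : R) *: t); rewrite // e scalerDl scalerA.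
Qed.

Definition evt (z : tensor A T) (h : O) : T :=
  tlift (fun (f : A) (t : T) => ((f : dual O) h : R) *: t) z.

Lemma evt_tens (f : A) (t : T) h : evt (tens f t) h = ((f : dual O) h : R) *: t.
Proof. exact: (tlift_tens (evt_bilin h)). Qed.
Lemma evt_linear h : linear (evt^~ h). Proof. exact/tliftP/evt_bilin. Qed.
Lemma evt_linearr z : linear (evt z).
Proof.
move=> r x y; move: z; apply: tlin_eq => [||f t].
- exact: evt_linear.
- by move=> s z w; rewrite !(evt_linear _ s z w) !scalerDr !scalerA (mulrC r) addrACA.
by rewrite !evt_tens (dual_lin (f : dual O)) scalerDl scalerA.
Qed.

Lemma evt_inj z w : evt z =1 evt w -> z = w.
Proof.
have [l hl] := O_dbasis dk G => e.
have key x : x = \sum_(q <- l) tens (q.2 : A) (evt x q.1).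
  move: x; apply: tlin_eq => [||f t].
  - exact: id_linear.
  - move=> r x y; rewrite scaler_sumr -big_split; apply: eq_bigr => q _ /=.
    by rewrite evt_linear ((tens_bilin A T).2 _ r).
  under eq_bigr => q _ do rewrite evt_tens (bilinZr (tens_bilin A T)) -(bilinZl (tens_bilin A T)).
  rewrite -(linear_sum _ _ _ ((tens_bilin A T).1 t)); congr (tens _ _).
  have := A_dbasis hl (f : A); rewrite scale1r big_map => {1}->.
  by [].
rewrite (key z) (key w); apply: eq_bigr => q _; by rewrite e.
Qed.

Lemma conv_evt_bilin z w : bilin (fun a b : O => evt z a * evt w b : T).
Proof.
by split=> [b|a] r x y /=; rewrite ?(evt_linearr z) ?(evt_linearr w) ?mulrDl ?mulrDr -?cscalerAl -?cscalerAr.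
Qed.

Lemma evtM z w h : evt (z * w) h = tlift (fun a b : O => evt z a * evt w b : T) (D h).
Proof.
have lz : linear (fun x : tensor A T => tlift (fun a b : O => evt x a * evt w b : T) (D h)).
  move=> r x y; rewrite /tlift /tsum scaler_sumr -big_split; apply: eq_bigr => q _ /=.
  by rewrite evt_linear mulrDl cscalerAl.
have lw x : linear (fun w : tensor A T => tlift (fun a b : O => evt x a * evt w b : T) (D h)).
  move=> r y y'; rewrite /tlift /tsum scaler_sumr -big_split; apply: eq_bigr => q _ /=.
  by rewrite evt_linear mulrDr cscalerAr.
move: z lz => z _; move: z; apply: tlin_eq => [||f t].
- exact: linear_comp (evt_linear h) (tensM_linl w).
- move=> r x y; rewrite /tlift /tsum scaler_sumr -big_split; apply: eq_bigr => q _ /=.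
  by rewrite evt_linear mulrDl cscalerAl.
move: w {lw}; apply: tlin_eq => [||f' t'].
- exact: linear_comp (evt_linear h) (tensM_linr _).
- move=> r x y; rewrite /tlift /tsum scaler_sumr -big_split; apply: eq_bigr => q _ /=.
  by rewrite evt_linear mulrDr cscalerAr.
rewrite tensM evt_tens.
rewrite -[((f * f' : A) : dual O) h]/(tlift (fun u v => (f : dual O) u * (f' : dual O) v : R^o) (D h)).
rewrite /tlift /tsum scaler_suml; apply: eq_bigr => q _.
by rewrite !evt_tens -cscalerAl -cscalerAr scalerA.
Qed.

Lemma evt1 h : evt 1 h = calg_str T (gs_unit h).
Proof. by rewrite -[1]/(tens (1 : A) (1 : T)) evt_tens -[LHS]/(calg_str T _ * 1) mulr1. Qed.

Lemma evt_ex (g : O -> T) : linear g -> exists z, evt z =1 g.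
Proof.
move=> lg; have [l hl] := O_dbasis dk G.
exists (\sum_(q <- l) tens (q.2 : A) (g q.1)) => h.
rewrite (linear_sum _ _ _ (evt_linear h)) -[h in RHS]scale1r hl (linear_sum _ _ _ lg).
by apply: eq_bigr => q _; rewrite evt_tens (linZ lg).
Qed.

Lemma alg_str (B B' : calg R) (g : B -> B') r : alg_hom g -> g (calg_str B r) = calg_str B' r.
Proof.
move=> [lg mg]; have -> : calg_str B r = r *: (1 : B) by rewrite -[RHS]/(_ * 1) mulr1.
by rewrite (linZ lg) mg.1 -[LHS]/(_ * 1) mulr1.
Qed.

Lemma unit_hom : alg_hom (fun h : O => calg_str T (gs_unit h) : T).
Proof.
have [le me] := gs_unit_hom G; split=> [r x y|]; first by rewrite le rmorphD rmorphM.
by split=> [|x y]; rewrite ?me.1 ?rmorph1 // me.2 rmorphM.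
Qed.

Lemma pointsP (u : units (tensor A T)) : points u <-> alg_hom (evt (uval u)).
Proof.
split; last by move=> h; exists (evt (uval u)).
case=> g [hg e]; suff -> : evt (uval u) = g by [].
by apply/funext => h; rewrite e.
Qed.

Lemma point_inv (g : O -> T) z w : alg_hom g -> evt z =1 g -> evt w =1 g \o @gs_inv R G -> z * w = 1.
Proof.
move=> hg ez ew; apply: evt_inj => h; rewrite evtM evt1 -(alg_str _ hg).
have [lg mg] := hg; have lS := (gs_inv_hom G).1.
have b1 : bilin (fun a b : O => gs_inv a * b).
  by split=> [b|a] r x y /=; rewrite ?lS ?mulrDl ?mulrDr -?cscalerAl -?cscalerAr.
rewrite -gs_mulV -[in LHS](gs_mulC h); move: (D h); apply: tlin_eq => [||a b].
- exact: linear_comp (tliftP (conv_evt_bilin z w)) (tliftP (tswap_bilin _ _)).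
- exact: linear_comp lg (tliftP b1).
rewrite /tswap (tlift_tens (tswap_bilin _ _)) (tlift_tens (conv_evt_bilin z w)) (tlift_tens b1).
by rewrite ez ew mg.2 mulrC.
Qed.

Lemma point_unit (g : O -> T) : alg_hom g -> exists u : units (tensor A T), points u /\ evt (uval u) =1 g.
Proof.
move=> hg; have [z hz] := evt_ex hg.1.
have [w hw] := evt_ex (alg_hom_comp (gs_inv_hom G) hg).1.
have [u [eu _]] := mk_unit (point_inv hg hz hw).
exists u; split; last by rewrite eu.
by apply/pointsP; rewrite eu (_ : evt z = g) //; apply/funext.
Qed.

Lemma points_subgroup : subgroup (@points R G T).
Proof.
split.
  apply/pointsP; rewrite (_ : evt _ = fun h => calg_str T (gs_unit h)); first exact: unit_hom.
  by apply/funext => h; exact: evt1.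
move=> u u' /pointsP hu /pointsP hu'; apply/pointsP.
have hS := alg_hom_comp (gs_inv_hom G) hu'.
have [w hw] := evt_ex hS.1.
have e : uval (- u') = w.
  have h1 := point_inv hu' (fun=> erefl) hw.
  by rewrite -[LHS]mulr1 -h1 mulrA [_ * uval u']mulrC uvalN mul1r.
rewrite uvalD e.
have hP : alg_hom (pair_hom (evt (uval u)) (evt (uval u') \o @gs_inv R G) \o D).
  exact: pair_comp_hom hu hS _ _ (gs_mul_hom G).
rewrite (_ : evt _ = pair_hom (evt (uval u)) (evt (uval u') \o @gs_inv R G) \o D) //.
apply/funext => h; rewrite evtM /= /pair_hom; congr (tlift _ _).
by apply/funext => a; apply/funext => b; rewrite hw.
Qed.

Section Translate.
Variables (X : gspace G) (chi : gsp_alg X -> T) (hchi : alg_hom chi).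
Variables (z : tensor A T) (hg : alg_hom (evt z)).
Local Notation C := (gsp_alg X).

(** The left side is f(c_2) (x) chi(c_0) z(c_1). Cocommutativity exchanges c_1 and c_2, and
    A-linearity of f turns the evaluation at z into multiplication by z. *)
Lemma val_translate (c : C) (f : dual M0) :
  val (fun c => pair_hom chi (evt z) (gsp_act c)) c f = z * val chi c f.
Proof.
have [lr mr] := gsp_act_hom X; have lD := (gs_mul_hom G).1; have lc := hchi.1.
have lf := @dual_space_lin R G f.
have hchi' : alg_hom (fun c => pair_hom chi (evt z) (gsp_act c)).
  exact: pair_comp_hom hchi hg _ _ (gsp_act_hom X).
pose k (c : C) (o1 o2 : O) : tensor A T := tens (f (o1 : M0) : A) (chi c * evt z o2 : T).
have kb c' : bilin (k c').
  split=> [o|o] r x y; rewrite /k /=; first by rewrite lf (tens_bilin A T).1.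
  by rewrite (evt_linearr z) mulrDr -cscalerAr (tens_bilin A T).2.
pose K (c : C) (y : tensor O O) := tlift (k c) y.
have hK : bilin K.
  split=> [y|c'] r x x'; rewrite /K; last exact: tliftP.
  rewrite /tlift /tsum scaler_sumr -big_split; apply: eq_bigr => q _ /=.
  by rewrite /k lc mulrDl -cscalerAl (tens_bilin A T).2.
transitivity (tlift K (tmap id D (gsp_act c))).
  have hK' : bilin (fun (c : C) y => K c (tswap y)).
    exact: bilin_comp hK (@id_linear _ _) (tliftP (tswap_bilin _ _)).
  have -> : tlift K (tmap id D (gsp_act c)) = tlift (fun (c : C) y => K c (tswap y)) (tmap id D (gsp_act c)).
    rewrite (tlift_tmap _ hK (@id_linear _ _) lD) (tlift_tmap _ hK' (@id_linear _ _) lD).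
    by congr (tlift _ _); apply/funext => c'; apply/funext => o; rewrite gs_mulC.
  rewrite -gsp_actA /val; move: (gsp_act c); apply: tlin_eq => [||d o].
  - exact/tliftP/(val_bilin hchi' f).
  - apply: linear_comp (tliftP hK') _.
    exact: linear_comp (@tassoc_linear _ _ _ _) (tmap_linear lr (@id_linear _ _)).
  rewrite (tlift_tens (val_bilin hchi' f)) tmap_tens //; move: (gsp_act d); apply: tlin_eq => [||e o'].
  - exact: linear_comp ((tens_bilin A T).2 _) (pair_linear hchi hg).
  - apply: linear_comp (tliftP hK') _.
    exact: linear_comp (@tassoc_linear _ _ _ _) ((tens_bilin _ _).1 o).
  rewrite tassoc_tens (tlift_tens hK') /K /tswap (tlift_tens (tswap_bilin _ _)) (tlift_tens (kb e)).
  by rewrite (pair_tens hchi hg).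
rewrite (tlift_tmap _ hK (@id_linear _ _) lD) /val.
have hb := bilin_comp hK (@id_linear _ _) lD.
move: (gsp_act c); apply: tlin_eq => [||d o].
- exact/tliftP.
- exact: linear_comp (tensM_linr _) (tliftP (val_bilin hchi f)).
rewrite (tlift_tens hb) (tlift_tens (val_bilin hchi f)) /K.
have kz w : tlift (fun o1 o2 : O => tens (f (o1 : M0) : A) (chi d * evt w o2 : T)) (D o) =
    w * tens (f (o : M0) : A) (chi d).
  move: w; apply: tlin_eq => [||a t].
  - move=> r x y; rewrite /tlift /tsum scaler_sumr -big_split; apply: eq_bigr => q _ /=.
    by rewrite evt_linear mulrDr -cscalerAr (tens_bilin A T).2.
  - exact: tensM_linl.
  have fa : ((a : AR) * f (o : M0) : A) = f ((a : AR) *: (o : M0)) := esym (linZ (dual_lin f) (a : AR) (o : M0)).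
  transitivity (tens (f ((a : AR) *: (o : M0)) : A) (t * chi d : T)); last by rewrite tensM -fa.
  rewrite space_scaleE -[@gsp_act _ _ (trivial_space G) o]/(D o).
  have hb2 : bilin (fun o1 o2 : O => tens (f (o1 : M0) : A) (chi d * evt (tens a t) o2 : T)).
    split=> [o2|o1] r x y /=; first by rewrite lf (tens_bilin A T).1.
    by rewrite (evt_linearr _ r) mulrDr -cscalerAr (tens_bilin A T).2.
  move: (D o); apply: tlin_eq => [||o1 o2].
  - exact: tliftP.
  - apply: linear_comp ((tens_bilin A T).1 _) _; exact: linear_comp lf (contr_linear _).
  rewrite (tlift_tens hb2) contr_tens evt_tens (linZ lf) (bilinZl (tens_bilin A T)).
  by rewrite -cscalerAr (bilinZr (tens_bilin A T)) mulrC.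
exact: kz.
Qed.
End Translate.
End Pairing.

(** * From points to isomorphisms of lines *)

Section Trivializations.
Variables (R : comPzRingType) (dk : dedekind_like R) (G : group_scheme R).
Local Notation O := (gs_alg G).
Local Notation A := (cdual G).
Local Notation AR := (cdual_ring G).
Local Notation D := (@gs_mul R G).
Local Notation M0 := (space_mod (trivial_space G)).

Lemma cdual_tf : torsion_free A.
Proof.
move=> r a r0 ra; apply: dual_eq => h.
have : r * (a : dual O) h = 0 by rewrite -(cdual_scaleE r a h) ra.
by case/(dk_dom dk).
Qed.

Lemma trivial_line : is_line (A := A) M0.
Proof. exact: (space_line dk (trivial_torsor G)). Qed.

Section Transport.
Variables (Y : gspace G) (S : calg R).
Local Notation C := (gsp_alg Y).
Local Notation M := (space_mod Y).

Lemma res_id_linear : linear (fun c : res (A := A) M => (c : C)).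
Proof. by move=> r x y; rewrite resE space_str. Qed.
Lemma id_res_linear : linear (fun c : C => (c : res (A := A) M)).
Proof. by move=> r x y; rewrite resE space_str. Qed.

(** [space_mod Y] restricted to R and the algebra of Y have the same elements but differently
    defined R-actions, equal by [space_str]; the tensor products are therefore identified by
    explicit maps. *)
Definition to_alg : ext (A := A) M S -> tensor C S := tmap (fun c : res (A := A) M => (c : C)) (fun s : S => s).
Definition of_alg : tensor C S -> ext (A := A) M S := tmap (fun c : C => (c : res (A := A) M)) (fun s : S => s).

Lemma to_alg_linear : linear (to_alg : tensor (res (A := A) M) S -> tensor C S).
Proof. exact: tmap_linear res_id_linear (@id_linear _ _). Qed.
Lemma of_alg_linear : linear (of_alg : tensor C S -> tensor (res (A := A) M) S).
Proof. exact: tmap_linear id_res_linear (@id_linear _ _). Qed.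
Lemma to_alg_tens (c : C) (s : S) : to_alg (tens (c : res (A := A) M) s) = tens c s.
Proof. exact: (tmap_tens _ _ res_id_linear (@id_linear _ _)). Qed.
Lemma of_alg_tens (c : C) (s : S) : of_alg (tens c s) = tens (c : res (A := A) M) s.
Proof. exact: (tmap_tens _ _ id_res_linear (@id_linear _ _)). Qed.
Lemma to_algK : cancel to_alg of_alg.
Proof.
move=> z; move: z; apply: tlin_eq => [|//|c s]; first exact: linear_comp of_alg_linear to_alg_linear.
by rewrite to_alg_tens of_alg_tens.
Qed.
Lemma of_algK : cancel of_alg to_alg.
Proof.
move=> z; move: z; apply: tlin_eq => [|//|c s]; first exact: linear_comp to_alg_linear of_alg_linear.
by rewrite of_alg_tens to_alg_tens.
Qed.

Definition act2 (a : AR) (s : S) : tensor C S -> tensor C S :=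
  tmap (fun c : C => a *: (c : M) : C) (fun t : S => s * t).

Lemma to_alg_scale (a : A) (s : S) (x : ext (A := A) M S) :
  to_alg ((tens a s : tensor A S) *: x) = act2 a s (to_alg x).
Proof.
have la := @space_scale_lin R G Y a; have ls := @lmul_linear R S s.
move: x; apply: tlin_eq => [||c t].
- exact: linear_comp to_alg_linear (@extZ_linr R A M S (tens a s)).
- exact: linear_comp (tmap_linear la ls) to_alg_linear.
by rewrite extZ_tens !to_alg_tens /act2 tmap_tens.
Qed.
End Transport.

Section Phi.
Variables (X : torsor G) (S : calg R) (chi : gsp_alg X -> S) (hchi : alg_hom chi).
Local Notation C := (gsp_alg X).
Local Notation M := (space_mod X).

Lemma triv_act2 (a : AR) (s : S) (z : tensor C S) :
  triv chi (act2 a s z) = act2 (Y := trivial_space G) a s (triv chi z).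
Proof.
have la := @space_scale_lin R G X a; have ls := @lmul_linear R S s.
have l0 := @space_scale_lin R G (trivial_space G) a.
have lt := triv_linear hchi.
move: z; apply: tlin_eq => [||c t].
- exact: linear_comp lt (tmap_linear la ls).
- exact: linear_comp (tmap_linear l0 ls) lt.
rewrite /act2 tmap_tens // !(triv_tens hchi) /triv0 act_scale; move: (gsp_act c).
have lsw := tliftP (tswap_bilin C O); have lc := hchi.1.
apply: tlin_eq => [||d o].
- apply: linear_comp (tensM_linr _) _; apply: linear_comp (tmap_linear (@id_linear _ _) lc) _.
  exact: linear_comp lsw (tmap_linear (@id_linear _ _) l0).
- apply: linear_comp (tmap_linear l0 ls) _; apply: linear_comp (tensM_linr _) _.
  exact: linear_comp (tmap_linear (@id_linear _ _) lc) lsw.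
rewrite tmap_tens // /tswap !(tlift_tens (tswap_bilin _ _)) !tmap_tens // !tensM !mul1r tmap_tens //.
by rewrite mulrA.
Qed.

Definition phi (x : ext (A := A) M S) : ext (A := A) M0 S :=
  of_alg (Y := trivial_space G) (triv chi (to_alg x)).

Lemma phi_linear : linear phi.
Proof.
have lR : linear (phi : tensor (res (A := A) M) S -> tensor (res (A := A) M0) S).
  exact: linear_comp (@of_alg_linear (trivial_space G) S) (linear_comp (triv_linear hchi) (@to_alg_linear X S)).
have key (z : tensor A S) x : phi (z *: x) = z *: phi x.
  move: z; apply: tlin_eq => [||a s].
  - exact: linear_comp lR (extZ_linl x).
  - exact: (extZ_linl (phi x)).
  have e1 : phi ((tens a s : tensor A S) *: x) = of_alg (Y := trivial_space G) (triv chi (act2 a s (to_alg x))).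
    exact: (congr1 (fun y => of_alg (Y := trivial_space G) (triv chi y)) (to_alg_scale a s x)).
  rewrite e1 triv_act2; apply: (can_inj (@to_algK (trivial_space G) S)).
  apply: etrans (@of_algK (trivial_space G) S _) _.
  apply: etrans _ (esym (@to_alg_scale (trivial_space G) S a s (phi x))).
  by congr (act2 _ _ _); exact: (esym (@of_algK (trivial_space G) S _)).
by move=> z x y; rewrite (linD lR) key.
Qed.

Lemma phi_bij : bijective phi.
Proof.
have [h k1 k2] := triv_bij hchi.
exists (fun y => of_alg (Y := X) (h (to_alg (Y := trivial_space G) y))) => x.
  by rewrite /phi (@of_algK (trivial_space G) S) k1 (@to_algK X S).
by rewrite /phi (@of_algK X S) k2 (@to_algK (trivial_space G) S).
Qed.

Lemma dual_res_linear (f : dual M0) : linear (f : O -> res (A := A) (dual_regular G)).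
Proof.
move=> r x y; rewrite -[r *: x + y]/((r *: x : O) + y) -(space_str (X := trivial_space G) r x).
by rewrite [LHS](dual_lin f) resE.
Qed.

Lemma xi_ex : exists xi : ext (A := A) (torsor_line X) S -> ext (A := A) (dual_regular G) S,
  [/\ linear xi, bijective xi & induced_by (triv chi) xi].
Proof.
have hM := space_line dk X; have hN := trivial_line.
exists (line_xi (phi : ext (A := A) M S -> ext (A := A) M0 S)); split.
- exact: line_xi_linear phi_linear.
- exact: (line_xi_bij dk hM hN phi_linear phi_bij).
move=> m f s; rewrite (line_xiE phi_linear m f s) /phi to_alg_tens.
have lf := dual_res_linear f.
have lf' : linear (f : res (A := A) M0 -> res (A := A) (dual_regular G)).
  by move=> r x y; exact: (dual_lin f (calg_str A r) x y).
have lef : linear (@ext_fun R A S M0 (dual_regular G) f :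
      tensor (res (A := A) M0) S -> tensor (res (A := A) (dual_regular G)) S).
  exact: tmap_linear lf' (@id_linear _ _).
move: (triv chi _); apply: tlin_eq => [||o t].
- exact: linear_comp lef (@of_alg_linear (trivial_space G) S).
- exact: tmap_linear lf (@id_linear _ _).
by rewrite of_alg_tens [LHS](tmap_tens _ _ lf' (@id_linear _ _)) tmap_tens.
Qed.
End Phi.

Lemma induced_val (X : torsor G) (S : calg R) (chi : gsp_alg X -> S) ph xi : alg_hom chi ->
  (forall c, ph (tens c (1 : S)) = triv0 chi c) -> @induced_by R G X S ph xi ->
  forall (m : space_mod X) (f : dual M0),
    reg_id (xi (tens (tens m f : res (A := A) (torsor_line X)) (1 : S))) = val chi (m : gsp_alg X) f.
Proof.
move=> hchi e hxi m f; rewrite hxi e (val_triv hchi).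
have lf := dual_res_linear f; have lg := @dual_space_lin R G f.
move: (triv0 chi _); apply: tlin_eq => [||o t].
- exact: linear_comp (@reg_id_linear R A S) (tmap_linear lf (@id_linear _ _)).
- exact: tmap_linear lg (@id_linear _ _).
by rewrite !tmap_tens // reg_id_tens.
Qed.

Lemma triv_triv0 (X : torsor G) (S : calg R) (chi : gsp_alg X -> S) c : alg_hom chi ->
  triv chi (tens c (1 : S)) = triv0 chi c.
Proof. by move=> hchi; rewrite (triv_tens hchi) mul1r. Qed.
End Trivializations.

Section LineDatum.
Variables (R : comPzRingType) (dk : dedekind_like R) (A : calg R).
Variables (K : calg R) (ffK : frac_field K).
Local Notation str := (calg_str A).
Local Notation AK := (tensor A K).

(* A generator l over K and local generators e, with e_v = alpha_v l. *)
Definition line_data (L : lmodType (calg_ring A)) (l : L) (e : place R -> L)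
    (alpha : place R -> units AK) (i : ideles A K) : Prop :=
  [/\ free_elt l, exists2 s0, s0 <> 0 & gen_by s0 l, forall v, gen_at v (e v),
      forall v, ratio (e v) l (uval (alpha v)) & forall v, uval (i v) = AK_to_Av v (uval (alpha v))].

Lemma line_data_ex (L : lmodType (calg_ring A)) : is_line L ->
  exists l e alpha i, @line_data L l e alpha i.
Proof.
move=> hL; have [v0 _] := dk_place dk.
have [l [[s0 [vs gl]] fl]] := hL v0; have s0n := place_neq0 vs.
pose e (v : place R) := if pselect (v s0) is left _ then projT1 (cid (hL v)) else l.
have ge v : gen_at v (e v).
  rewrite /e; case: pselect => [h|h]; last by exists s0.
  by case: (projT2 (cid (hL v))).
have el (v : place R) : ~ v s0 -> e v = l by rewrite /e; case: pselect.
have [alpha [i h]] := line_ideles dk ffK fl s0n gl ge el.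
exists l, e, alpha, i; split=> //; first by exists s0.
  by move=> v; case: (h v).
by move=> v; case: (h v).
Qed.

Lemma ratio_tens (M N : lmodType (calg_ring A)) (x l : M) (y n : N) (a b : AK) :
  (forall r s : R, r <> 0 -> s <> 0 -> r * s <> 0) ->
  ratio x l a -> ratio y n b -> ratio (L := tensor M N) (tens x y) (tens l n) (a * b).
Proof.
move=> dom [d [c [d0 dx da]]] [d' [c' [d0' dy db]]]; exists (d * d'), (c * c'); split; first exact: dom.
  rewrite rmorphM -scalerA -(bilinZr (tens_bilin M N)) -(bilinZl (tens_bilin M N)) dx dy.
  by rewrite (bilinZl (tens_bilin M N)) (bilinZr (tens_bilin M N)) scalerA.
have e (u w : calg_ring A) : tens (u * w : A) (1 : K) = tens (u : A) (1 : K) * tens (w : A) (1 : K).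
  by rewrite tensM mulr1.
by rewrite rmorphM !e -da -db mulrACA.
Qed.
End LineDatum.

(** * The value of psi on a torsor *)

Section LineTransport.
Variables (R : comPzRingType) (A K : calg R) (L L' : lmodType (calg_ring A)) (h : L -> L').
Hypotheses (lh : linear h) (bh : bijective h).

Lemma line_data_iso l e alpha (i : ideles A K) : line_data l e alpha i ->
  line_data (h l) (fun v => h (e v)) alpha i.
Proof.
have [k hk kh] := bh.
have gen s x : gen_by s x -> gen_by s (h x).
  by move=> g y; have [a ha] := g (k y); exists a; rewrite -(linZ lh) -ha (linZ lh) kh.
case=> fl [s0 s0n gl] ge hr hi; split=> //.
- by move=> a; rewrite -(linZ lh) => e0; apply: fl; apply: (can_inj hk); rewrite e0 (lin0 lh).
- by exists s0 => //; exact: gen.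
- by move=> v; have [s [vs g]] := ge v; exists s; split=> //; exact: gen.
move=> v; have [d [b [d0 dx da]]] := hr v; exists d, b; split=> //.
by rewrite -!(linZ lh) dx.
Qed.
End LineTransport.

Section PsiValue.
Variables (R : comPzRingType) (dk : dedekind_like R) (G : group_scheme R).
Local Notation O := (gs_alg G).
Local Notation A := (cdual G).
Local Notation M0 := (space_mod (trivial_space G)).
Variables (K S T : calg R) (ffK : frac_field K) (j : K -> T) (g : S -> T).
Hypotheses (hj : linear j /\ monoid_morphism j) (hg : linear g /\ monoid_morphism g).
Hypothesis cI : injective (@cst R A T).
Local Notation Gamma := (@points R G T).

Definition kval (i : ideles A K) (u : units (tensor A T)) : k0bar j Gamma :=
  qproj (@principal_bar R A K T j Gamma) (qproj (@unit_ideles R A K) i, qproj Gamma u).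

Lemma kval_point i u w : Gamma w -> kval i (w + u) = kval i u.
Proof.
move=> hw; congr (qproj _ (_, _)); apply/qproj_eq; rewrite addrK.
by move=> P _; apply.
Qed.

Lemma kvalD i u i' u' : kval (i + i') (u + u') = kval i u + kval i' u'.
Proof.
rewrite -[RHS]/(qg_add _ _) qg_add_proj.
by congr (qproj _ (_, _)); rewrite -[RHS]/(qg_add _ _) qg_add_proj.
Qed.

Variables (f0 : dual M0) (ef : place R -> dual M0) (af : place R -> units (tensor A K)) (i0 : ideles A K).
Hypothesis hf0 : line_data (A := A) (L := dual M0) f0 ef af i0.

Section OneTorsor.
Variable X : torsor G.
Local Notation C := (gsp_alg X).
Local Notation M := (space_mod X).

Lemma torsor_line_line : is_line (A := A) (torsor_line X).
Proof.
have h2 := dual_line (@cdual_tf _ dk G) (trivial_line dk G).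
exact: (@tens_line R A (@cdual_tf _ dk G) (space_mod X) (dual M0) (space_line dk X) h2).
Qed.

Lemma line_data_tens m em am (im : ideles A K) : line_data (A := A) (L := M) m em am im ->
  [/\ free_elt (A := A) (M := torsor_line X) (tens m f0),
     exists2 s0, s0 <> 0 & gen_by (A := A) (M := torsor_line X) s0 (tens m f0),
     forall v : place R, gen_at (A := A) (M := torsor_line X) v (tens (em v) (ef v)) &
     forall v, ratio (A := A) (L := torsor_line X) (tens (em v) (ef v)) (tens m f0) (uval (am v + af v))].
Proof.
move=> [fm [s s0 gm] gem rm im_]; have [ff [t t0 gf] gef rf if_] := hf0.
have dom := dom_neq0 (dk_dom dk).
split.
- have [v0 _] := dk_place dk; have [d [b [d0 dx _]]] := ratio_tens dom (rm v0) (rf v0).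
  have fe := gen_free_line (@cdual_tf _ dk G) torsor_line_line (tens_gen_at (gem v0) (gef v0)).
  move=> a al; apply: (str_reg (@cdual_tf _ dk G) d0); rewrite mulrC; apply: fe.
  by rewrite -scalerA dx scalerA mulrC -scalerA al scaler0.
- by exists (s * t); [exact: dom|exact: tens_gen_by gm gf].
- by move=> v; exact: tens_gen_at (gem v) (gef v).
by move=> v; rewrite uvalD; exact: ratio_tens dom (rm v) (rf v).
Qed.

Lemma val_unit (chi : C -> S) m em am (im : ideles A K) : alg_hom chi -> line_data (A := A) (L := M) m em am im ->
  exists u : units (tensor A T), uval u = val (g \o chi) m f0.
Proof.
move=> hchi hm; have [xi [lxi bxi ixi]] := xi_ex dk hchi.
have [fl [s s0 gl] ge hr] := line_data_tens hm.
have [u hu] := line_unit ffK hj s0 gl hg lxi bxi.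
exists u; rewrite hu (val_comp _ _ hchi hg).
by rewrite (induced_val hchi (fun c => triv_triv0 c hchi) ixi).
Qed.

(** L_X has the rank one bases m (x) f0 over K and em v (x) ef v over R_v, so [line_idelic] gives an
    idelic class of the extended triple, and [k0_to_cokE] makes it the value. *)
Lemma class_value (chi : C -> S) xi hL lin bij m em am (im : ideles A K) u : alg_hom chi ->
  (forall (m : M) (f : dual M0), reg_id (xi (tens (tens m f : res (A := A) (torsor_line X)) (1 : S))) =
    val chi (m : C) f) ->
  line_data (A := A) (L := M) m em am im -> uval u = val (g \o chi) (m : C) f0 ->
  k0_to_k0bar j Gamma (k0_ext hg (k0_class [:: (true, @Triple R A S (torsor_line X) (dual_regular G)
     hL (fgproj_regular G) xi lin bij)])) = kval (im + i0) u.
Proof.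
move=> hchi hxi hm hu; have [fl [s s0 gl] ge hr] := line_data_tens hm.
rewrite k0_extE /k0_to_k0bar.
have him : forall v, uval ((im + i0) v) = AK_to_Av v (uval (am v + af v)).
  case: hm hf0 => _ _ _ _ h1 [_ _ _ _ h2] v.
  by rewrite [LHS]uvalD h1 h2 uvalD (@AK_to_Av_hom R A K v).2.2.
have := line_idelic dk (@cdual_tf _ dk G) ffK hj fl s0 gl ge hg hL (fgproj_regular G) lin bij hr him.
move=> /(_ u) hid; rewrite (k0_to_cokE dk (A_fingen dk G) ffK hj cI (hid _)) ?cok_to_k0barE //.
by rewrite hu (val_comp _ _ hchi hg) hxi.
Qed.

(** A value computed from some choice of point, generator and local data; [pval_uniq] shows that all
    choices agree. *)
Definition pval (k : k0bar j Gamma) : Prop := exists (chi : C -> S) m em am (im : ideles A K) u,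
  [/\ alg_hom chi, line_data (A := A) (L := M) m em am im, uval u = val (g \o chi) (m : C) f0 & k = kval (im + i0) u].

(** For fixed chi both sides are the class of one and the same triple. *)
Lemma kval_same (chi : C -> S) m em am (im : ideles A K) u m' em' am' (im' : ideles A K) u' : alg_hom chi ->
  line_data (A := A) (L := M) m em am im -> uval u = val (g \o chi) (m : C) f0 ->
  line_data (A := A) (L := M) m' em' am' im' -> uval u' = val (g \o chi) (m' : C) f0 ->
  kval (im + i0) u = kval (im' + i0) u'.
Proof.
move=> hchi h1 h2 h3 h4; have [xi [lxi bxi ixi]] := xi_ex dk hchi.
have hL := line_fgproj dk torsor_line_line.
have hxi := induced_val hchi (fun c => triv_triv0 c hchi) ixi.
by rewrite -(class_value hL lxi bxi hchi hxi h1 h2) -(class_value hL lxi bxi hchi hxi h3 h4).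
Qed.

(** By [point_diff] the two points differ by a point of G over T, which by [val_translate]
    multiplies the unit by an element of Gamma. *)
Lemma kval_move (chi chi' : C -> S) m em am (im : ideles A K) u u' : alg_hom chi -> alg_hom chi' ->
  line_data (A := A) (L := M) m em am im -> uval u = val (g \o chi) (m : C) f0 ->
  uval u' = val (g \o chi') (m : C) f0 ->
  kval (im + i0) u = kval (im + i0) u'.
Proof.
move=> hchi hchi' hm hu hu'.
have gchi := alg_hom_comp hchi hg; have gchi' := alg_hom_comp hchi' hg.
have [h hh e] := point_diff gchi gchi'.
have [w [pw ew]] := point_unit dk hh.
have hw := (pointsP w).1 pw.
rewrite -(kval_point _ u pw); congr kval; apply: uval_eq.
rewrite uvalD hu hu' -(val_translate gchi hw); congr (val _ m f0).
apply/funext => c; rewrite -[RHS]/((g \o chi') c) e; congr (pair_hom _ _ _).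
by apply/funext => o; rewrite ew.
Qed.

Lemma pval_uniq k k' : pval k -> pval k' -> k = k'.
Proof.
move=> [chi [m [em [am [im [u [h1 h2 h3 ->]]]]]]] [chi' [m' [em' [am' [im' [u' [k1 k2 k3 ->]]]]]]].
have [w hw] := val_unit k1 h2.
by rewrite (kval_move h1 k1 h2 h3 hw) (kval_same k1 h2 hw k2 k3).
Qed.

Lemma pval_ex : (exists chi : C -> S, alg_hom chi) -> exists k, pval k.
Proof.
case=> chi hchi; have [m [em [am [im hm]]]] := line_data_ex dk ffK (space_line dk X).
have [u hu] := val_unit hchi hm.
by exists (kval (im + i0) u), chi, m, em, am, im, u.
Qed.
End OneTorsor.

Lemma iso_scale (X Y : gspace G) (h : gsp_alg X -> gsp_alg Y) : linear h ->
  (forall c, gsp_act (h c) = tmap h id (gsp_act c)) -> linear (h : space_mod X -> space_mod Y).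
Proof.
move=> lh hh; have key (a : calg_ring A) (c : space_mod X) : h (a *: c) = a *: (h c : space_mod Y).
  rewrite !space_scaleE hh; move: (gsp_act (c : gsp_alg X)); apply: tlin_eq => [||d o].
  - exact: linear_comp lh (contr_linear _).
  - exact: linear_comp (contr_linear _) (tmap_linear lh (@id_linear _ _)).
  by rewrite tmap_tens // !contr_tens (linZ lh).
by move=> a x y; rewrite -key -(linD lh).
Qed.

Lemma val_iso (X Y : gspace G) (h : gsp_alg X -> gsp_alg Y) (chi : gsp_alg Y -> T) c f :
  alg_hom h -> alg_hom chi -> (forall c, gsp_act (h c) = tmap h id (gsp_act c)) ->
  val chi (h c) f = val (chi \o h) c f.
Proof.
move=> hh hchi e; rewrite /val e (tlift_tmap _ (val_bilin hchi f) hh.1 (@id_linear _ _)).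
by [].
Qed.

Lemma pval_iso (X Y : torsor G) k k' : torsor_iso X Y -> pval X k -> pval Y k' -> k = k'.
Proof.
case=> h [lh mh bh eh] hk hk'; case: (hk') => chi [m' [em' [am' [im' [u' [k1 k2 k3 e']]]]]].
case: (hk) => chi0 [m [em [am [im [u [h1 h2 h3 e]]]]]].
have hh : alg_hom h by [].
have hc := alg_hom_comp hh k1.
have [w hw] := val_unit hc h2.
have gchi := alg_hom_comp k1 hg.
rewrite e (kval_move h1 hc h2 h3 hw); apply: (pval_uniq _ hk').
exists chi, (h m), (fun v => h (em v)), am, im, w; split=> //.
  exact: (@line_data_iso R A K (space_mod X) (space_mod Y) h (iso_scale lh eh) bh m em am im h2).
by rewrite hw (val_iso _ _ hh gchi eh).
Qed.
End PsiValue.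

(** * Contracted products *)

Section Contracted.
Variables (R : comPzRingType) (dk : dedekind_like R) (G : group_scheme R).
Local Notation O := (gs_alg G).
Local Notation A := (cdual G).
Local Notation AR := (cdual_ring G).
Local Notation D := (@gs_mul R G).
Local Notation M0 := (space_mod (trivial_space G)).

Lemma dbasis_sep (M : lmodType R) (l : seq (M * dual M)) (x y : M) : dbasis 1 l ->
  (forall a : dual M, a x = a y) -> x = y.
Proof.
move=> hl e; rewrite -[x]scale1r -[y]scale1r !hl.
by apply: eq_bigr => q _; rewrite e.
Qed.

Lemma trivial_scaleE (a : AR) (o : O) : a *: (o : M0) = contr (a : dual O) (D o) :> O.
Proof. exact: (@space_scaleE R G (trivial_space G) a o). Qed.

(* Sum of o_1 f(o_2)(h) = sum of h_1 f(o)(h_2): linearity of f over the dual algebra. *)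
Lemma dual_space_sym (f : dual M0) (o h : O) :
  tlift (fun o1 o2 : O => ((f (o2 : M0) : AR) h : R) *: o1) (D o) =
  contr (f (o : M0) : dual O) (D h).
Proof.
have [l hl] := O_dbasis dk G; apply: (dbasis_sep hl) => a.
have lf : linear (fun o2 : O => ((f (o2 : M0) : AR) h : R^o)).
  by move=> r x y; rewrite (dual_space_lin f r x y) (eval_linear h r).
have hb : bilin (fun o1 o2 : O => ((f (o2 : M0) : AR) h : R) *: o1).
  split=> [o2|o1] r x y /=; first by rewrite scalerDr !scalerA mulrC.
  by rewrite lf scalerDl scalerA.
transitivity ((f ((a : AR) *: (o : M0) : M0) : AR) h).
  rewrite trivial_scaleE -[in LHS]gs_mulC; move: (D o); apply: tlin_eq => [||o1 o2].
  - exact: linear_comp (dual_lin a) (linear_comp (tliftP hb) (tliftP (tswap_bilin _ _))).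
  - exact: linear_comp lf (contr_linear _).
  rewrite /tswap (tlift_tens (tswap_bilin _ _)) (tlift_tens hb) contr_tens.
  by rewrite (linZ (dual_lin a)) (linZ lf) !regE mulrC.
rewrite (linZ (dual_lin f)).
rewrite -[LHS]/(tlift (fun u v => (a : dual O) u * (f (o : M0) : dual O) v : R^o) (D h)).
have hb2 : bilin (fun u v : O => (a : dual O) u * (f (o : M0) : dual O) v : R^o).
  exact: bilin_comp (regM_bilin R) (dual_lin a) (dual_lin _).
move: (D h); apply: tlin_eq => [||u v].
- exact: tliftP.
- exact: linear_comp (dual_lin a) (contr_linear _).
by rewrite (tlift_tens hb2) contr_tens (linZ (dual_lin a)) regE mulrC.
Qed.

Section Product.
Variables (X Y : gspace G).
Local Notation CX := (gsp_alg X).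
Local Notation CY := (gsp_alg Y).
Local Notation rX := (@gsp_act _ _ X).
Local Notation rY := (@gsp_act _ _ Y).
Let lX : linear rX := (gsp_act_hom X).1.
Let lY : linear rY := (gsp_act_hom Y).1.

Definition smul (Z : gspace G) (a : AR) (c : gsp_alg Z) : gsp_alg Z := a *: (c : space_mod Z).

Lemma smulE (Z : gspace G) a (c : gsp_alg Z) : smul a c = contr (a : dual O) (gsp_act c).
Proof. exact: space_scaleE. Qed.
Lemma smul_linear (Z : gspace G) a : linear (@smul Z a).
Proof. exact: space_scale_lin. Qed.
Lemma smulM (Z : gspace G) a b (c : gsp_alg Z) : smul (a * b) c = smul a (smul b c).
Proof. by rewrite /smul scalerA. Qed.
Lemma smul_str (Z : gspace G) r (c : gsp_alg Z) : smul (calg_str A r) c = r *: c.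
Proof. exact: space_str. Qed.
Lemma smul_linl (Z : gspace G) (c : gsp_alg Z) : linear (fun a : A => smul a c).
Proof.
by move=> r a b; rewrite /smul scalerDl -smul_str /smul scalerA.
Qed.

Definition bform (phi : O -> A) (m : CX) (m' : CY) : tensor CX CY :=
  tlift (fun (c : CX) (o : O) => tens c (smul (phi o) m')) (rX m).

Lemma bform_bilin (phi : O -> A) (m' : CY) : linear phi ->
  bilin (fun (c : CX) (o : O) => tens c (smul (phi o) m')).
Proof.
move=> lp; split=> [o|c]; first exact: (tens_bilin CX CY).1.
exact: linear_comp ((tens_bilin CX CY).2 c) (linear_comp (smul_linl m') lp).
Qed.

(** The left side is m_0 (x) m_1 (x) f(m_2) m'. The coaction of Y on f(m_1) m' lets f(m_1) act on
    the O-factor of m', and [dual_space_sym] identifies the two. *)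
Lemma bform_eq (f : dual M0) (m : CX) (m' : CY) (B := bform (fun o => f (o : M0)) m m') :
  tassoc (tmap rX id B) = tmap id (fun b => tswap (rY b)) B.
Proof.
have lf := @dual_space_lin R G f; have lD := (gs_mul_hom G).1.
have lsw (M N : lmodType R) := tliftP (tswap_bilin M N).
have hB := bform_bilin m' lf.
pose q (o1 o2 : O) : tensor O CY := tens o1 (smul (f (o2 : M0)) m').
have hq : bilin q.
  split=> [o2|o1]; first exact: (tens_bilin O CY).1.
  exact: linear_comp ((tens_bilin O CY).2 o1) (linear_comp (smul_linl m') lf).
have lQ := tliftP hq.
have hQ (o : O) : tlift q (D o) = tswap (rY (smul (f (o : M0)) m')).
  rewrite /smul act_scale.
  have lS := @space_scale_lin R G (trivial_space G) (f (o : M0)).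
  have e (w : tensor CY O) : tswap (tmap id (fun o' : O => f (o : M0) *: (o' : M0) : O) w) =
      tlift (fun o1 o2 : O => tens o1 (contr (f (o2 : M0) : dual O) w)) (D o).
    have hb w' : bilin (fun o1 o2 : O => tens o1 (contr (f (o2 : M0) : dual O) w' : CY)).
      split=> [o2|o1]; first exact: (tens_bilin O CY).1.
      apply: (linear_comp ((tens_bilin O CY).2 o1)) => r x y.
      move: w'; apply: tlin_eq => [||d o'].
      - exact: contr_linear.
      - by move=> t u v; rewrite !(contr_linear _ t) !scalerDr !scalerA (mulrC r) addrACA.
      by rewrite !contr_tens (lf r x y) (eval_linear o' r) scalerDl scalerA.
    move: w; apply: tlin_eq => [||d o'].
    - exact: linear_comp (lsw _ _) (tmap_linear (@id_linear _ _) lS).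
    - move=> r u v; rewrite /tlift /tsum scaler_sumr -big_split; apply: eq_bigr => p _ /=.
      by rewrite (contr_linear _ r) (tens_bilin O CY).2.
    rewrite tmap_tens // /tswap (tlift_tens (tswap_bilin _ _)) trivial_scaleE -dual_space_sym.
    move: (D o); apply: tlin_eq => [||o1 o2].
    - apply: linear_comp ((tens_bilin O CY).1 d) _; apply: tliftP.
      split=> [o2|o1] r x y /=; first by rewrite scalerDr !scalerA mulrC.
      by rewrite (lf r x y) (eval_linear o' r) scalerDl scalerA.
    - exact/tliftP/hb.
    rewrite (tlift_tens (hb _)) contr_tens tlift_tens; last first.
      split=> [p|p] r x y /=; first by rewrite scalerDr !scalerA mulrC.
      by rewrite (lf r x y) (eval_linear o' r) scalerDl scalerA.
    by rewrite (bilinZl (tens_bilin O CY)) (bilinZr (tens_bilin O CY)).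
  by rewrite e; congr (tlift _ _).
have hP : bilin (fun (c : CX) (y : tensor O O) => tens c (tlift q y)).
  exact: bilin_comp (tens_bilin _ _) (@id_linear _ _) lQ.
have lt2 : linear (fun b => tswap (rY b)) by exact: linear_comp (lsw _ _) lY.
transitivity (tlift (fun (c : CX) (y : tensor O O) => tens c (tlift q y)) (tmap id D (rX m))).
  rewrite -gsp_actA /B /bform; move: (rX m); apply: tlin_eq => [||c o].
  - apply: linear_comp (@tassoc_linear _ _ _ _) _.
    exact: linear_comp (tmap_linear lX (@id_linear _ _)) (tliftP hB).
  - apply: linear_comp (tliftP hP) _.
    exact: linear_comp (@tassoc_linear _ _ _ _) (tmap_linear lX (@id_linear _ _)).
  rewrite (tlift_tens hB) !tmap_tens //; move: (rX c); apply: tlin_eq => [||d o'].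
  - exact: linear_comp (@tassoc_linear _ _ _ _) ((tens_bilin _ _).1 _).
  - apply: linear_comp (tliftP hP) _.
    exact: linear_comp (@tassoc_linear _ _ _ _) ((tens_bilin _ _).1 _).
  by rewrite !tassoc_tens (tlift_tens hP) (tlift_tens hq).
rewrite (tlift_tmap _ hP (@id_linear _ _) lD) /B /bform.
have hPD := bilin_comp hP (@id_linear _ _) lD.
move: (rX m); apply: tlin_eq => [||c o].
- exact: tliftP.
- exact: linear_comp (tmap_linear (@id_linear _ _) lt2) (tliftP hB).
by rewrite (tlift_tens hPD) (tlift_tens hB) tmap_tens // hQ.
Qed.

Lemma bform_scale (phi : O -> A) (a : A) (m : CX) (m' : CY) : linear phi ->
  tmap id (smul a) (bform phi m m') = bform (fun o => (a : AR) * (phi o : AR) : A) m m'.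
Proof.
move=> lp; have la : linear (fun o => (a : AR) * (phi o : AR) : A).
  exact: linear_comp (@lmul_linear R A a) lp.
rewrite /bform; move: (rX m); apply: tlin_eq => [||c o].
- exact: linear_comp (tmap_linear (@id_linear _ _) (@smul_linear Y a)) (tliftP (bform_bilin m' lp)).
- exact/tliftP/(bform_bilin m' la).
rewrite (tlift_tens (bform_bilin m' lp)) (tlift_tens (bform_bilin m' la)) tmap_tens //; last exact: smul_linear.
by rewrite smulM.
Qed.

Lemma bform_scalel (f : dual M0) (a : A) (m : CX) (m' : CY) :
  bform (fun o => f (o : M0)) (smul a m) m' = bform (fun o => (a : AR) * (f (o : M0) : AR) : A) m m'.
Proof.
have lf := @dual_space_lin R G f; have lS := @space_scale_lin R G (trivial_space G) a.
rewrite /bform /smul act_scale (tlift_tmap _ (bform_bilin m' lf) (@id_linear _ _) lS).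
congr (tlift _ _); apply/funext => c; apply/funext => o.
by rewrite (linZ (dual_lin f)).
Qed.

Lemma bform_scaler (phi : O -> A) (a : A) (m : CX) (m' : CY) :
  bform phi m (smul a m') = bform (fun o => (a : AR) * (phi o : AR) : A) m m'.
Proof.
rewrite /bform; congr (tlift _ _); apply/funext => c; apply/funext => o.
by rewrite -smulM mulrC.
Qed.

Section Generation.
Variables (m : CX) (m' : CY) (s s' : R).
Hypotheses (fm : free_elt (A := A) (M := space_mod X) m) (fm' : free_elt (A := A) (M := space_mod Y) m').
Hypotheses (gm : gen_by (A := A) (M := space_mod X) s m) (gm' : gen_by (A := A) (M := space_mod Y) s' m').
Hypothesis sepX : exists l : seq (CX * dual CX), dbasis 1 l.

(** A presentation of the tensor product of the two algebras by A (x) A: onto up to s s', with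
    kernel annihilated by all the evaluations [ev2]. *)
Definition theta : tensor A A -> tensor CX CY := tlift (fun a b : A => tens (smul a m) (smul b m')).
Lemma theta_bilin : bilin (fun a b : A => tens (smul a m) (smul b m')).
Proof. exact: bilin_comp (tens_bilin CX CY) (smul_linl m) (smul_linl m'). Qed.
Lemma theta_linear : linear theta. Proof. exact/tliftP/theta_bilin. Qed.
Lemma theta_tens a b : theta (tens a b) = tens (smul a m) (smul b m').
Proof. exact: (tlift_tens theta_bilin). Qed.

Lemma theta_surj (w : tensor CX CY) : exists k, (s * s') *: w = theta k.
Proof.
rewrite (tensE w); elim: (repr w) => [|[c c'] l [k hk]].
  by exists 0; rewrite big_nil scaler0 (lin0 theta_linear).
have [a ha] := gm c; have [b hb] := gm' c'.
have ha' : s *: c = smul a m by rewrite -smul_str.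
have hb' : s' *: c' = smul b m' by rewrite -smul_str.
exists (tens (a : A) (b : A) + k); rewrite big_cons scalerDr hk (linD theta_linear) theta_tens -ha' -hb'.
by rewrite (bilinZl (tens_bilin CX CY)) (bilinZr (tens_bilin CX CY)) scalerA.
Qed.

Definition ev2 (o h : O) : tensor A A -> R^o := tlift (fun a b : A => (a : dual O) o * (b : dual O) h : R^o).
Lemma ev2_bilin o h : bilin (fun a b : A => (a : dual O) o * (b : dual O) h : R^o).
Proof. exact: bilin_comp (regM_bilin R) (eval_linear o) (eval_linear h). Qed.

Lemma theta_inj k o h : theta k = 0 -> ev2 o h k = 0.
Proof.
move=> k0; have [l hl] := sepX.
pose L2 : tensor A A -> A := tlift (fun a b : A => ((b : dual O) h : R) *: a).
have hL2 : bilin (fun a b : A => ((b : dual O) h : R) *: a).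
  split=> [b|a] r x y; first by rewrite scalerDr !scalerA mulrC.
  have e : ((r *: x + y : A) : dual O) h = r * (x : dual O) h + (y : dual O) h := eval_linear h r x y.
  by transitivity ((((r *: x + y : A) : dual O) h : R) *: a); rewrite // e scalerDl scalerA.
suff e : L2 k = 0.
  transitivity ((L2 k : dual O) o); last by rewrite e.
  move: (k); apply: tlin_eq => [||a b].
  - exact/tliftP/ev2_bilin.
  - exact: linear_comp (eval_linear o) (tliftP hL2).
  by rewrite /ev2 (tlift_tens (ev2_bilin o h)) /L2 (tlift_tens hL2) cdual_scaleE mulrC.
apply: fm; rewrite -[LHS]/(smul (L2 k) m).
apply: (dbasis_sep hl) => lam; rewrite (lin0 (dual_lin lam)).
pose L1 : tensor A A -> A := tlift (fun a b : A => (lam (smul a m) : R) *: b).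
have ll : linear (fun a : A => lam (smul a m) : R^o) by exact: linear_comp (dual_lin lam) (smul_linl m).
have hL1 : bilin (fun a b : A => (lam (smul a m) : R) *: b).
  split=> [b|a] r x y /=; last by rewrite scalerDr !scalerA mulrC.
  by rewrite ll scalerDl scalerA.
transitivity ((L1 k : dual O) h).
  move: (k); apply: tlin_eq => [||a b].
  - exact: linear_comp ll (tliftP hL2).
  - exact: linear_comp (eval_linear h) (tliftP hL1).
  by rewrite /L2 /L1 (tlift_tens hL2) (tlift_tens hL1) cdual_scaleE (linZ ll) regE mulrC.
suff -> : L1 k = 0 by [].
apply: fm'; rewrite -[LHS]/(smul (L1 k) m').
have hpi : bilin (fun (c : CX) (c' : CY) => (lam c : R) *: c').
  split=> [c'|c] r x y /=; last by rewrite scalerDr !scalerA mulrC.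
  by rewrite (dual_lin lam) scalerDl scalerA.
transitivity (tlift (fun (c : CX) (c' : CY) => (lam c : R) *: c') (theta k)); last first.
  by rewrite k0 (lin0 (tliftP hpi)).
move: (k); apply: tlin_eq => [||a b].
- exact: linear_comp (smul_linl m') (tliftP hL1).
- exact: linear_comp (tliftP hpi) theta_linear.
by rewrite theta_tens (tlift_tens hpi) /L1 (tlift_tens hL1) (linZ (smul_linl m')).
Qed.

(** theta(k) equals m_0 (x) gk(m_1) m', where gk(o) evaluates the first factor of k at o. For w in
    the equalizer gk is A-linear, hence an element of dual M_0 and up to s'' a multiple of f. *)
Lemma eq_gen (w : tensor CX CY) (f : dual M0) (s'' : R) : gen_by (A := A) (M := dual M0) s'' f ->
  tassoc (tmap rX id w) = tmap id (fun b => tswap (rY b)) w ->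
  exists a : A, (s * s' * s'') *: w = tmap id (smul a) (bform (fun o => f (o : M0)) m m').
Proof.
move=> gf ew; have [k hk] := theta_surj w.
have lsw (M N : lmodType R) := tliftP (tswap_bilin M N).
have lt2 : linear (fun b => tswap (rY b)) by exact: linear_comp (lsw _ _) lY.
have eW : tassoc (tmap rX id (theta k)) = tmap id (fun b => tswap (rY b)) (theta k).
  rewrite -hk (linZ (tmap_linear lX (@id_linear _ _))) (linZ (@tassoc_linear _ _ _ _)) ew.
  by rewrite -(linZ (tmap_linear (@id_linear _ _) lt2)).
(* Contracting the middle O-factor of the equalizer condition with b makes b act through X on one
   side and through Y on the other. *)
have sym (b : A) : theta (tens b (1 : A) * k) = theta (tens (1 : A) b * k).
  pose h (y : tensor O CY) : CY := contr (b : dual O) (tswap y).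
  have lh : linear h by exact: linear_comp (contr_linear _) (lsw _ _).
  transitivity (tmap id h (tassoc (tmap rX id (theta k)))).
    have lk := tmap_linear (@id_linear R CX) lh.
    have lk2 := linear_comp lk (linear_comp (@tassoc_linear _ _ _ _) (tmap_linear lX (@id_linear _ CY))).
    move: (k); apply: tlin_eq => [||a c].
    - exact: linear_comp theta_linear (tensM_linr _).
    - exact: linear_comp lk2 theta_linear.
    rewrite tensM mul1r !theta_tens smulM tmap_tens // [smul b _]smulE.
    move: (rX (smul a m)); apply: tlin_eq => [||d o].
    - exact: linear_comp ((tens_bilin CX CY).1 _) (contr_linear _).
    - exact: linear_comp lk (linear_comp (@tassoc_linear _ _ _ _) ((tens_bilin _ _).1 _)).
    rewrite tassoc_tens tmap_tens // /h /tswap (tlift_tens (tswap_bilin _ _)) !contr_tens.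
    by rewrite (bilinZl (tens_bilin CX CY)) (bilinZr (tens_bilin CX CY)).
  rewrite eW; move: (k); apply: tlin_eq => [||a c].
  - exact: linear_comp (tmap_linear (@id_linear _ _) lh) (linear_comp (tmap_linear (@id_linear _ _) lt2) theta_linear).
  - exact: linear_comp theta_linear (tensM_linr _).
  rewrite tensM mul1r !theta_tens !tmap_tens // /h smulM [smul b _]smulE; congr (tens _ _).
  move: (rY _); apply: tlin_eq => [||d o].
  - exact: linear_comp (contr_linear _) (linear_comp (lsw _ _) (lsw _ _)).
  - exact: contr_linear.
  by rewrite /tswap !(tlift_tens (tswap_bilin _ _)).
(* Its A-linearity comes from [sym], transferred to the evaluations of k by [theta_inj]. *)
pose gk (o : O) : A := tlift (fun a b : A => ((a : dual O) o : R) *: b) k.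
have hgk o : bilin (fun a b : A => ((a : dual O) o : R) *: b).
  split=> [b|a] r x y; last by rewrite scalerDr !scalerA mulrC.
  have e : ((r *: x + y : A) : dual O) o = r * (x : dual O) o + (y : dual O) o := eval_linear o r x y.
  by transitivity ((((r *: x + y : A) : dual O) o : R) *: b); rewrite // e scalerDl scalerA.
have lgk k' : linear (fun o : O => tlift (fun a b : A => ((a : dual O) o : R) *: b) k').
  move=> r x y; rewrite /tlift /tsum scaler_sumr -big_split; apply: eq_bigr => p _ /=.
  by rewrite (dual_lin (p.1 : dual O)) scalerDl scalerA.
have gkE o h : ((gk o : AR) : dual O) h = ev2 o h k.
  rewrite /gk; move: (k); apply: tlin_eq => [||a b].
  - exact: linear_comp (eval_linear h) (tliftP (hgk o)).
  - exact/tliftP/ev2_bilin.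
  by rewrite (tlift_tens (hgk o)) /ev2 (tlift_tens (ev2_bilin o h)) cdual_scaleE.
have gk_lin : linear (gk : M0 -> (AR)^o).
  have key (b : AR) (o : M0) : gk (b *: o) = b * gk o.
    apply: dual_eq => h.
    transitivity (ev2 o h (tens (b : A) (1 : A) * k)).
      rewrite [LHS](gkE (b *: o : O) h) trivial_scaleE.
      have lev y : linear (fun x : O => ev2 x h y).
        move=> r x x'; rewrite /ev2 /tlift /tsum scaler_sumr -big_split; apply: eq_bigr => p _ /=.
        by rewrite (dual_lin (p.1 : dual O)) mulrDl regE [in RHS]regE mulrA.
      move: (k); apply: tlin_eq => [||a c].
      - exact/tliftP/ev2_bilin.
      - exact: linear_comp (tliftP (ev2_bilin o h)) (tensM_linr _).
      rewrite tensM mul1r /ev2 !(tlift_tens (ev2_bilin _ h)); congr (_ * _).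
      rewrite mulrC -[RHS]/(tlift (fun u v => (a : dual O) u * (b : dual O) v : R^o) (D o)).
      have hb2 : bilin (fun u v : O => (a : dual O) u * (b : dual O) v : R^o).
        exact: bilin_comp (regM_bilin R) (dual_lin (a : dual O)) (dual_lin (b : dual O)).
      move: (D o); apply: tlin_eq => [||u v].
      - exact: linear_comp (dual_lin (a : dual O)) (contr_linear _).
      - exact: tliftP.
      by rewrite (tlift_tens hb2) contr_tens (linZ (dual_lin (a : dual O))) regE mulrC.
    transitivity (ev2 o h (tens (1 : A) (b : A) * k)).
      apply/eqP; rewrite -subr_eq0; apply/eqP.
      have le := tliftP (ev2_bilin o h).
      rewrite -(linN le) -(linD le); apply: theta_inj.
      by rewrite (linD theta_linear) (linN theta_linear) sym subrr.
    transitivity (((b * gk o : AR) : dual O) h) => //.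
    rewrite /gk; move: (k); apply: tlin_eq => [||a c].
    - exact: linear_comp (tliftP (ev2_bilin o h)) (tensM_linr _).
    - exact: linear_comp (eval_linear h) (linear_comp (@lmul_linear R A b) (tliftP (hgk o))).
    rewrite tensM mul1r /ev2 (tlift_tens (ev2_bilin o h)) (tlift_tens (hgk o)).
    have -> : (b * (((a : dual O) o : R) *: c : A) : AR) = (((a : dual O) o : R) *: (b * c : A) : A).
      by symmetry; exact: (@cscalerAr R A _ (b : A) (c : A)).
    by rewrite cdual_scaleE.
  move=> b x y; apply: (etrans (linD (lgk k) (b *: x : M0) y)).
  by congr (_ + _); exact: key.
pose gd : dual M0 := mkdual gk_lin.
have [a ha] := gf gd; exists a.
rewrite bform_scale; last exact: dual_space_lin.
have -> : (fun o => (a : AR) * (f (o : M0) : AR) : A) = (fun o => s'' *: gk o).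
  apply/funext => o; have := congr1 (fun d : dual M0 => d (o : M0)) ha.
  by move=> e; exact: (esym e).
rewrite mulrC -scalerA hk /bform.
have hb y : bilin (fun (c : CX) (o : O) =>
      tens c (smul (s'' *: tlift (fun a b : A => ((a : dual O) o : R) *: b) y) m')).
  split=> [o|c]; first exact: (tens_bilin CX CY).1.
  apply: (linear_comp ((tens_bilin CX CY).2 c)); apply: (linear_comp (smul_linl m')) => r x x'.
  by rewrite (lgk y) scalerDr !scalerA mulrC.
rewrite /gk; move: (k); apply: tlin_eq => [||b b'].
- by move=> r x y; rewrite theta_linear scalerDr !scalerA mulrC.
- move=> r x y; rewrite /tlift /tsum scaler_sumr -big_split; apply: eq_bigr => p _ /=.
  have -> : s'' *: (\sum_(q <- repr (r *: x + y)) ((q.1 : dual O) p.2 : R) *: q.2) =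
     r *: (s'' *: \sum_(q <- repr x) ((q.1 : dual O) p.2 : R) *: q.2) +
     s'' *: (\sum_(q <- repr y) ((q.1 : dual O) p.2 : R) *: q.2) :> A.
    have := tliftP (hgk p.2) r x y; rewrite /tlift /tsum => ->.
    by rewrite scalerDr !scalerA mulrC.
  by rewrite (smul_linl m' r) ((tens_bilin CX CY).2 _ r).
rewrite theta_tens smulE; move: (hb (tens b b')); move: (rX m) => y hbb; move: y; apply: tlin_eq => [||d o].
- by move=> r x y; rewrite (contr_linear _ r) ((tens_bilin CX CY).1 _ r) scalerDr !scalerA mulrC.
- exact: tliftP.
rewrite (tlift_tens hbb) contr_tens (tlift_tens (hgk o)) !(linZ (smul_linl m')).
by rewrite (bilinZl (tens_bilin CX CY)) !(bilinZr (tens_bilin CX CY)).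
Qed.
End Generation.
End Product.
End Contracted.

(** * Additivity on contracted products *)

Section ContractedPsi.
Variables (R : comPzRingType) (dk : dedekind_like R) (G : group_scheme R).
Local Notation O := (gs_alg G).
Local Notation A := (cdual G).
Local Notation AR := (cdual_ring G).
Local Notation M0 := (space_mod (trivial_space G)).
Variables (K S T : calg R) (ffK : frac_field K) (j : K -> T) (g : S -> T).
Hypotheses (hj : linear j /\ monoid_morphism j) (hg : linear g /\ monoid_morphism g).
Hypothesis cI : injective (@cst R A T).
Variables (f0 : dual M0) (ef : place R -> dual M0) (af : place R -> units (tensor A K)) (i0 : ideles A K).
Hypothesis hf0 : line_data (A := A) (L := dual M0) f0 ef af i0.
Variables (X Y Z : torsor G) (h : gsp_alg Z -> tensor (gsp_alg X) (gsp_alg Y)).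
Local Notation CX := (gsp_alg X).
Local Notation CY := (gsp_alg Y).
Local Notation CZ := (gsp_alg Z).
Hypotheses (hh : linear h /\ monoid_morphism h) (hI : injective h).
Hypothesis heq : forall z, (exists c, z = h c) <->
          tassoc (tmap (@gsp_act R G X) id z) = tmap id (fun b => tswap (@gsp_act R G Y b)) z.
Hypothesis hact : forall c, tassoc (tmap h id (gsp_act c)) = tmap id (@gsp_act R G Y) (h c).

Lemma h_scale (a : AR) (c : CZ) : h (smul a c) = tmap id (smul a) (h c).
Proof.
have lh := hh.1; have lY := (gsp_act_hom Y).1; have lc := @contr_linear R CY O (a : dual O).
transitivity (tmap id (contr (N := CY) (a : dual O)) (tassoc (tmap h id (gsp_act c)))).
  rewrite smulE; move: (gsp_act c); apply: tlin_eq => [||d o].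
  - exact: linear_comp lh (contr_linear _).
  - apply: linear_comp (tmap_linear (@id_linear _ _) lc) _.
    exact: linear_comp (@tassoc_linear _ _ _ _) (tmap_linear lh (@id_linear _ _)).
  rewrite contr_tens (linZ lh) tmap_tens //; move: (h d); apply: tlin_eq => [||x y].
  - by move=> r x y; rewrite !scalerDr !scalerA mulrC.
  - apply: linear_comp (tmap_linear (@id_linear _ _) lc) _.
    exact: linear_comp (@tassoc_linear _ _ _ _) ((tens_bilin _ _).1 o).
  by rewrite tassoc_tens tmap_tens // contr_tens (bilinZr (tens_bilin CX CY)).
rewrite hact (tmap_comp _ (@id_linear _ _) lY (@id_linear _ _) lc).
by congr (tmap _ _ _); apply/funext => y; rewrite /= smulE.
Qed.

Definition bz (f : dual M0) (m : CX) (m' : CY) : CZ :=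
  projT1 (cid ((heq (bform (fun o : O => f (o : M0)) m m')).2 (bform_eq dk f m m'))).
Lemma bzE f m m' : h (bz f m m') = bform (fun o : O => f (o : M0)) m m'.
Proof. by symmetry; exact: (projT2 (cid ((heq _).2 (bform_eq dk f m m')))). Qed.

Lemma bz_scale f (a : A) m m' : bz ((a : AR) *: f) m m' = smul a (bz f m m').
Proof. by apply: hI; rewrite h_scale !bzE (bform_scale _ _ _ (@dual_space_lin R G f)). Qed.
Lemma bz_scalel f (a : A) m m' : bz f (smul a m) m' = smul a (bz f m m').
Proof. by apply: hI; rewrite h_scale !bzE bform_scalel (bform_scale _ _ _ (@dual_space_lin R G f)). Qed.
Lemma bz_scaler f (a : A) m m' : bz f m (smul a m') = smul a (bz f m m').
Proof. by apply: hI; rewrite h_scale !bzE bform_scaler (bform_scale _ _ _ (@dual_space_lin R G f)). Qed.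

Lemma bz_gen f m m' s s' s'' :
  free_elt (A := A) (M := space_mod X) m -> free_elt (A := A) (M := space_mod Y) m' ->
  gen_by (A := A) (M := space_mod X) s m -> gen_by (A := A) (M := space_mod Y) s' m' ->
  gen_by (A := A) (M := dual M0) s'' f ->
  gen_by (A := A) (M := space_mod Z) (s * s' * s'') (bz f m m').
Proof.
move=> fm fm' gm gm' gf c; have lh := hh.1.
have ew : tassoc (tmap (@gsp_act R G X) id (h c)) = tmap id (fun b => tswap (@gsp_act R G Y b)) (h c).
  by apply/heq; exists c.
have [a ha] := eq_gen fm fm' gm gm' (tors_dbasis dk X) gf ew; exists a.
rewrite (@space_str R G Z (s * s' * s'') c) -[RHS]/(smul a (bz f m m')).
by apply: hI; rewrite (linZ lh) h_scale bzE.
Qed.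

Lemma val_pair (x : CX -> T) (y : CY -> T) f m m' : alg_hom x -> alg_hom y ->
  val (fun c => pair_hom x y (h c)) (bz f m m') f = val x m f * val y m' f.
Proof.
move=> hx hy; have hz := pair_comp_hom hx hy hh; have lh := hh.1.
have lY := (gsp_act_hom Y).1; have lf := @dual_space_lin R G f.
pose q (w : tensor CY O) : tensor A T := tlift (fun (c : CY) (o : O) => tens (f (o : M0) : A) (y c)) w.
have lq : linear q by exact/tliftP/(val_bilin hy f).
have hq : bilin (fun (c : CX) (w : tensor CY O) => tens (1 : A) (x c) * q w).
  split=> [w|c] r u u' /=; last by rewrite lq tensM_linr.
  by rewrite hx.1 (tens_bilin A T).2 tensM_linl.
have hqY := bilin_comp hq (@id_linear _ _) lY.
transitivity (tlift (fun (c : CX) (w : tensor CY O) => tens (1 : A) (x c) * q w)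
    (tassoc (tmap h id (gsp_act (bz f m m'))))).
  rewrite /val; move: (gsp_act _); apply: tlin_eq => [||d o].
  - exact/tliftP/(val_bilin hz f).
  - apply: linear_comp (tliftP hq) _.
    exact: linear_comp (@tassoc_linear _ _ _ _) (tmap_linear lh (@id_linear _ _)).
  rewrite (tlift_tens (val_bilin hz f)) tmap_tens //; move: (h d); apply: tlin_eq => [||c c'].
  - exact: linear_comp ((tens_bilin A T).2 _) (pair_linear hx hy).
  - apply: linear_comp (tliftP hq) _.
    exact: linear_comp (@tassoc_linear _ _ _ _) ((tens_bilin _ _).1 o).
  rewrite tassoc_tens (tlift_tens hq) /q (tlift_tens (val_bilin hy f)) (pair_tens hx hy) tensM mul1r.
  by [].
rewrite hact bzE (tlift_tmap _ hq (@id_linear _ _) lY) /bform.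
have hb := @bform_bilin R G X Y _ m' lf; have hv := val_bilin hx f.
transitivity (tlift (fun (c : CX) (o : O) => tens (f (o : M0) : A) (x c)) (gsp_act m) * val y m' f) => //.
move: (gsp_act m); apply: tlin_eq => [||c o].
- exact: linear_comp (tliftP hqY) (tliftP hb).
- exact: linear_comp (tensM_linl _) (tliftP hv).
rewrite (tlift_tens hb) (tlift_tens hqY) (tlift_tens hv).
rewrite -[q _]/(val y (smul (f (o : M0)) m') f) /smul (val_scalel hy).
by rewrite mulrA tensM mul1r mulr1.
Qed.

(** [bz] is balanced over A in its three arguments, so the ratios of m, m' and f0 multiply; the term
    i0 comes from f0. *)
Lemma contracted_data m em am (im : ideles A K) m' em' am' (im' : ideles A K) :
  line_data (A := A) (L := space_mod X) m em am im ->
  line_data (A := A) (L := space_mod Y) m' em' am' im' ->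
  line_data (A := A) (L := space_mod Z) (bz f0 m m') (fun v => bz (ef v) (em v) (em' v))
    (fun v => am v + am' v + af v) (im + im' + i0).
Proof.
move=> [fm [s s0 gm] gem rm im_] [fm' [s' s0' gm'] gem' rm' im'_].
have [ff [s'' s0'' gf] gef rf if_] := hf0.
have dom := dom_neq0 (dk_dom dk).
have gen v : gen_at (A := A) (M := space_mod Z) v (bz (ef v) (em v) (em' v)).
  have [t [vt gt]] := gem v; have [t' [vt' gt']] := gem' v; have [t'' [vt'' gt'']] := gef v.
  exists (t * t' * t''); split.
    by move/place_prime => [/place_prime [//|//]|//].
  apply: bz_gen => //; first exact: (gen_free dk (gem v)).
  exact: (gen_free dk (gem' v)).
have rat v : ratio (A := A) (L := space_mod Z) (bz (ef v) (em v) (em' v)) (bz f0 m m')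
    (uval (am v + am' v + af v)).
  have [d [b [d0 dx da]]] := rm v; have [d' [b' [d0' dx' da']]] := rm' v.
  have [d'' [b'' [d0'' dx'' da'']]] := rf v.
  exists (d * d' * d''), (b * b' * b''); split.
  - by apply: (dom) => //; exact: (dom).
  - have e1 : smul (calg_str A d) (em v) = smul b m := dx.
    have e2 : smul (calg_str A d') (em' v) = smul b' m' := dx'.
    have e : smul (calg_str A d * calg_str A d' * calg_str A d'') (bz (ef v) (em v) (em' v)) =
        smul (b * b' * b'') (bz f0 m m').
      rewrite [calg_str A d * _ * _]mulrC smulM smulM -bz_scaler e2 -bz_scalel e1.
      by rewrite -bz_scale dx'' bz_scale bz_scalel bz_scaler -!smulM; congr (smul _ _); ring.
    by rewrite !rmorphM.
  have e (u w : calg_ring A) : tens (u * w : A) (1 : K) = tens (u : A) (1 : K) * tens (w : A) (1 : K).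
    by rewrite tensM mulr1.
  by rewrite !uvalD !rmorphM !e -da -da' -da''; ring.
split=> //.
- have [v0 _] := dk_place dk; have fe := gen_free dk (gen v0); have [d [b [d0 dx _]]] := rat v0.
  move=> a al; apply: (str_reg (@cdual_tf _ dk G) d0); rewrite mulrC; apply: fe.
  by rewrite -scalerA dx scalerA mulrC -scalerA al scaler0.
- by exists (s * s' * s''); [apply: (dom) => //; exact: (dom)|exact: bz_gen].
move=> v; have hm := (@AK_to_Av_hom R A K v).2.2.
by rewrite [LHS]uvalD [X in X * _]uvalD im_ im'_ if_ !uvalD !hm.
Qed.

Lemma pval_contracted k k' :
  @pval R G K S T j g f0 i0 X k -> @pval R G K S T j g f0 i0 Y k' -> @pval R G K S T j g f0 i0 Z (k + k').
Proof.
move=> [x [m [em [am [im [u [h1 h2 h3 ->]]]]]]] [y [m' [em' [am' [im' [u' [k1 k2 k3 ->]]]]]]].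
exists (fun c => pair_hom x y (h c)), (bz f0 m m'), (fun v => bz (ef v) (em v) (em' v)).
exists (fun v => am v + am' v + af v), (im + im' + i0), (u + u'); split.
- exact: pair_comp_hom h1 k1 _ _ hh.
- exact: contracted_data h2 k2.
- rewrite uvalD h3 k3.
  have gx := alg_hom_comp h1 hg; have gy := alg_hom_comp k1 hg.
  rewrite -(val_pair _ _ _ gx gy); congr (val _ _ _); apply/funext => c /=.
  move: (h c); apply: tlin_eq => [||d d'].
  - exact: pair_linear.
  - exact: linear_comp hg.1 (pair_linear h1 k1).
  by rewrite (pair_tens gx gy) (pair_tens h1 k1) hg.2.2.
(* i0 occurs twice on both sides: for Z once in its line data and once from M_0^-1. *)
by rewrite -kvalD; congr kval; rewrite addrACA addrA.
Qed.
End ContractedPsi.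

(** * Injectivity *)

Section Injectivity.
Variables (R : comPzRingType) (dk : dedekind_like R) (G : group_scheme R).
Local Notation O := (gs_alg G).
Local Notation A := (cdual G).
Local Notation AR := (cdual_ring G).
Local Notation M0 := (space_mod (trivial_space G)).
Local Notation Rv v := (completion_alg (@place_ideal R v)).
Variables (K S T : calg R) (ffK : frac_field K) (j : K -> T) (g : S -> T).
Hypotheses (hj : linear j /\ monoid_morphism j) (hg : linear g /\ monoid_morphism g).
Hypothesis cI : injective (@cst R A T).
Hypothesis sT : injective (calg_str T).
Local Notation Gamma := (@points R G T).

(* The intersection of K and R_v in K_v is the localization of R at v. *)
Lemma scalar_descent (v : place R) (x : K) (r : Rv v) : K_to_Kv v x = Rv_to_Kv K r ->
  exists s c, ~ v s /\ calg_str K s * x = calg_str K c.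
Proof.
move=> e; have [d [a [d0 hd]]] := ff_frac ffK x.
have dom := dom_neq0 (dk_dom dk).
have l2 := (tens_bilin K (Rv v)).2 (1 : K).
have e0 : tens (1 : K) ((a *: (1 : Rv v)) - d *: r : Rv v) = 0.
  have bt := tens_bilin K (Rv v); have er : tens (1 : K) r = tens x (1 : Rv v) := esym e.
  transitivity (a *: tens (1 : K) (1 : Rv v) - d *: tens x (1 : Rv v)).
    by rewrite -er -(bilinZr bt) -(bilinZr bt d) (linD l2) (linN l2).
  apply/eqP; rewrite subr_eq0; apply/eqP; rewrite -(bilinZl bt) -(bilinZl bt d); congr (tens _ _).
  by rewrite -[RHS]/(calg_str K d * x) hd -[LHS]/(calg_str K a * 1) mulr1.
have [e1 e1n he] := frac_tens_eq0 (dk_dom dk) (dk_nz dk) ffK e0.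
have hc : to_completion v (e1 * a) = to_completion v (e1 * d) * (r : completion v).
  apply/eqP; rewrite -subr_eq0; apply/eqP; move: he.
  rewrite -[_ *: (_ - _)]/(to_completion v e1 * (to_completion v a * 1 - to_completion v d * (r : completion v))).
  by rewrite mulr1 mulrBr mulrA -!rmorphM.
(* n is so large that s v^n lies in e1 d R. With c approximating r modulo v^n, e1 d divides s (e1 a
   - e1 d c), and e1 cancels. *)
have [n [s [vs hs]]] := place_pow_sub (dk_fin dk) v (dom _ _ e1n d0).
have [c hn] := completion_approx hc n.
have [z hz] := hs _ hn.
have key : s * a = d * (s * c + z).
  have : e1 * (s * a - d * (s * c + z)) = 0.
    have -> : e1 * (s * a - d * (s * c + z)) = s * (e1 * a - e1 * d * c) - e1 * d * z by ring.
    by rewrite hz subrr.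
  by case/(dk_dom dk) => // /eqP; rewrite subr_eq0 => /eqP.
exists s, (s * c + z); split=> //.
have [k hk] := ff_inv ffK d0.
rewrite -[LHS]mul1r -[RHS]mul1r -hk ![_ * k]mulrC -!mulrA; congr (k * _).
by rewrite mulrCA hd -!rmorphM key.
Qed.

Lemma evt_tmap (B B' : calg R) (h : B -> B') (z : tensor A B) o : alg_hom h ->
  evt (tmap (fun a : A => a) h z) o = h (evt z o).
Proof.
move=> [lh mh]; move: z; apply: tlin_eq => [||a t].
- exact: linear_comp (evt_linear o) (tmap_linear (@id_linear _ _) lh).
- exact: linear_comp lh (evt_linear o).
by rewrite tmap_tens // !evt_tens (linZ lh).
Qed.

Lemma evt_expand (B : calg R) (l : seq (O * dual O)) (z : tensor A B) : dbasis 1 l ->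
  z = \sum_(q <- l) tens (q.2 : A) (evt z q.1).
Proof.
move=> hl; apply: (evt_inj dk) => h.
rewrite (linear_sum _ _ _ (evt_linear h)) -[h in LHS]scale1r hl (linear_sum _ _ _ (evt_linearr z)).
by apply: eq_bigr => q _; rewrite (linZ (evt_linearr z)) evt_tens.
Qed.

(** [scalar_descent] on the finitely many coordinates of z along a dual basis of O, with the
    multipliers outside v collected into one. *)
Lemma descent (v : place R) (z : tensor A K) (w : tensor A (Rv v)) :
  AK_to_Av v z = tmap (fun a : A => a) (@Rv_to_Kv R K v) w ->
  exists s (b : A), ~ v s /\ tens (calg_str A s : A) (1 : K) * z = tens b (1 : K).
Proof.
move=> e; have [l hl] := O_dbasis dk G.
have hx (q : O) : exists s c, ~ v s /\ calg_str K s * evt z q = calg_str K c.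
  apply: (@scalar_descent v _ (evt w q)).
  rewrite -(evt_tmap _ _ (K_to_Kv_hom K v)) -(evt_tmap _ _ (Rv_to_Kv_hom K v)).
  by congr (evt _ q).
rewrite (evt_expand z hl); elim: (l) => [|q l' [s [b [vs hs]]]].
  exists 1, 0; split; first exact: place_proper.
  by rewrite big_nil mulr0 (bilin0l (tens_bilin A K)).
have [s' [c [vs' hc]]] := hx q.1.
exists (s * s'), ((s * c) *: (q.2 : A) + s' *: b); split.
  by case/place_prime.
rewrite big_cons mulrDr (bilinDl (tens_bilin A K)) rmorphM.
have e1 (r : R) (y : tensor A K) : tens (calg_str A r : A) (1 : K) * y = r *: y.
  transitivity ((r *: (1 : tensor A K)) * y); last by rewrite -tscalerAl mul1r.
  congr (_ * _); rewrite -[RHS](bilinZl (tens_bilin A K) r (1 : A) (1 : K)); congr (tens _ _).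
  by rewrite -[RHS]/(_ * 1) mulr1.
have e2 : tens (calg_str A s * calg_str A s' : A) (1 : K) =
   tens (calg_str A s : A) (1 : K) * tens (calg_str A s' : A) (1 : K) by rewrite tensM mulr1.
congr (_ + _).
  rewrite e2 -mulrA !e1 -(bilinZr (tens_bilin A K) s') -[s' *: _]/(calg_str K s' * _) hc.
  rewrite -[calg_str K c](_ : c *: (1 : K) = _); last by rewrite -[LHS]/(_ * 1) mulr1.
  by rewrite (bilinZr (tens_bilin A K)) (bilinZl (tens_bilin A K)) scalerA.
rewrite e2 [_ * tens (calg_str A s' : A) _]mulrC -mulrA hs e1.
by rewrite -(bilinZl (tens_bilin A K)).
Qed.

Lemma uval_map (B B' : comPzRingType) (h : B -> B') (x : units B) (y : units B') : monoid_morphism h ->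
  uval y = h (uval x) -> uval (- y) = h (uval (- x)).
Proof.
move=> [h1 hM] e; have e1 := uvalN y; have e2 := congr1 h (uvalN x); rewrite hM h1 -e in e2.
by rewrite -[LHS]mulr1 -e2 mulrA [_ * uval y]mulrC e1 mul1r.
Qed.

(** Equality in the quotient puts the difference in every subgroup containing the principal pairs,
    and P, the set of their classes, is already a subgroup. *)
Lemma kval_eq i u i' u' : kval j i u = @kval R G K T j i' u' ->
  exists (a : units (tensor A K)) (w : forall v : place R, units (tensor A (Rv v))) (c : units (tensor A T)),
    [/\ Gamma c, forall v, uval (i v) = AK_to_Av v (uval a) * rK A K v (uval (w v)) * uval (i' v)
      & uval u = tmap (fun b : A => b) j (uval (- a)) * uval c * uval u'].
Proof.
move=> /qproj_eq h.
pose P (x : quotg (@unit_ideles R A K) * quotg Gamma) := exists (a : units (tensor A K)) (ia : ideles A K) ua,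
  [/\ forall v, uval (ia v) = AK_to_Av v (uval a), x.1 = qproj (@unit_ideles R A K) ia,
      uval ua = tmap (fun b : A => b) j (uval (- a)) & x.2 = qproj Gamma ua].
have mj := (@tmap_ring R A K T j hj.1 hj.2).2.
have mA v := (@AK_to_Av_hom R A K v).2.
have hP : subgroup P.
  split.
    exists 0, 0, 0; split=> //; first by move=> v; rewrite (mA v).1.
    by rewrite oppr0 mj.1.
  move=> [x1 x2] [y1 y2] [a [ia [ua [h1 /= -> h3 ->]]]] [b [ib [ub [k1 /= -> k3 ->]]]].
  exists (a - b), (ia - ib), (ua - ub); split=> /=.
  - by move=> v; rewrite [LHS]uvalD uvalD (mA v).2 h1 (uval_map (mA v) (k1 v)).
  - by rewrite -[LHS]/(qg_add _ (qg_opp _)) qg_opp_proj qg_add_proj.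
  - by rewrite opprD !uvalD mj.2 h3 (uval_map mj k3).
  by rewrite -[LHS]/(qg_add _ (qg_opp _)) qg_opp_proj qg_add_proj.
have hN y : principal_bar j (Gamma := Gamma) y -> P y.
  by case=> [[i1 u1] [b [ib [b1 b2 b3]]] ->]; exists b, ib, u1; split.
have [a [ia [ua [h1 h2 h3 h4]]]] := h P hP hN.
have h2' : qproj (@unit_ideles R A K) (i - i') = qproj (@unit_ideles R A K) ia.
  by rewrite -h2 -[RHS]/(qg_add _ (qg_opp _)) qg_opp_proj qg_add_proj.
have h4' : qproj Gamma (u - u') = qproj Gamma ua.
  by rewrite -h4 -[RHS]/(qg_add _ (qg_opp _)) qg_opp_proj qg_add_proj.
move/qproj_eq: h2' => /(_ (@unit_ideles R A K)) hw.
move/qproj_eq: h4' => /(_ Gamma (points_subgroup dk G T) (fun _ => id)) hc.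
have {}hw : unit_ideles (i - i' - ia).
  have mr v := (@tmap_ring R A (Rv v) (Kv K v) _ (Rv_to_Kv_hom K v).1 (Rv_to_Kv_hom K v).2).2.
  apply: hw => //; split; first by move=> v; exists 0; rewrite (mr v).1.
  move=> x y hx hy v; have [p hp] := hx v; have [q hq] := hy v; exists (p - q).
  by rewrite [LHS]uvalD hp (uval_map (mr v) hq) uvalD (mr v).2.
exists a, (fun v => projT1 (cid (hw v))), (u - u' - ua); split=> //.
  move=> v; have e := projT2 (cid (hw v)); rewrite -[rK A K v _]e -h1 -!uvalD.
  by congr uval; rewrite -[(i - i' - ia) v]/(i v - i' v - ia v) addrC [ia v + _]addrC subrK addrC subrK.
by rewrite -h3 -!uvalD; congr uval; rewrite [ua + _]addrC subrK subrK.
Qed.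

Lemma inv_str (d : R) : d <> 0 -> exists t, calg_str T d * t = 1.
Proof.
move=> d0; have [k hk] := ff_inv ffK d0; exists (j k).
have := congr1 j hk; rewrite hj.2.1 => <-.
by rewrite -[calg_str K d * k]/(d *: k) (linZ hj.1).
Qed.

Lemma str_cancel (d : R) (x y : tensor A T) : d <> 0 ->
  tens (calg_str A d : A) (1 : T) * x = tens (calg_str A d : A) (1 : T) * y -> x = y.
Proof.
move=> /inv_str [t /(@str_unit R A T d t) ht] e.
have cancel (p q : tensor A T) : p * q = 1 -> p * x = p * y -> x = y.
  by move=> pq h; rewrite -[x]mul1r -[y]mul1r -pq mulrAC h mulrAC.
exact: cancel ht e.
Qed.

Section Space.
Variables (X : torsor G) (x : gsp_alg X -> T) (hx : alg_hom x).
Local Notation C := (gsp_alg X).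

Lemma triv0_scale (a : AR) (c : C) : triv0 x (smul a c) = tmap (@smul _ _ (trivial_space G) a) id (triv0 x c).
Proof.
have lsw := tliftP (tswap_bilin C O); have l0 := @smul_linear R G (trivial_space G) a.
rewrite /triv0 /smul act_scale; move: (gsp_act c); apply: tlin_eq => [||d o].
- apply: linear_comp (tmap_linear (@id_linear _ _) hx.1) _.
  exact: linear_comp lsw (tmap_linear (@id_linear _ _) l0).
- apply: linear_comp (tmap_linear l0 (@id_linear _ _)) _.
  exact: linear_comp (tmap_linear (@id_linear _ _) hx.1) lsw.
have lx := hx.1.
by rewrite tmap_tens // /tswap !(tlift_tens (tswap_bilin _ _)) !tmap_tens.
Qed.

Lemma val_ratio (y l : space_mod X) (al : tensor A K) f : ratio (A := A) (L := space_mod X) y l al ->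
  val x (y : C) f = tmap (fun b : A => b) j al * val x (l : C) f.
Proof.
case=> d [b [d0 dx da]]; apply: (str_cancel d0).
rewrite -(val_scalel hx) -[LHS]/(val x (smul (calg_str A d) (y : C)) f).
have -> : smul (calg_str A d) (y : C) = smul b (l : C) := dx.
rewrite [LHS](val_scalel hx) mulrA; congr (_ * _).
have [lt mt] := @tmap_ring R A K T j hj.1 hj.2; have lj := hj.1.
have := congr1 (tmap (fun b : A => b) j) da; rewrite mt.2 !tmap_tens // hj.2.1.
by move=> ->.
Qed.

Lemma act_triv0 c : act_ext (Y := trivial_space G) (triv0 x c) = tmap (triv0 x) id (gsp_act c).
Proof.
rewrite -(triv_triv0 (X := X) c hx) (triv_equivariant hx) (@act_ext_tens R G T X).
rewrite (tmap_comp _ ((tens_bilin C T).1 (1 : T)) (@id_linear _ _) (triv_linear hx) (@id_linear _ _)).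
by congr (tmap _ _ _); apply/funext => d; rewrite /= (triv_triv0 _ hx).
Qed.
End Space.

Lemma triv0_inj (X : torsor G) (x : gsp_alg X -> T) : alg_hom x -> injective (triv0 x).
Proof.
move=> hx c c'; rewrite -!(triv_triv0 _ hx) => /(bij_inj (triv_bij hx)) e.
have [l hl] := tors_dbasis dk X; apply: (dbasis_sep hl) => lam; apply: sT.
have hb : bilin (fun (d : gsp_alg X) (t : T) => (lam d : R) *: t).
  split=> [t|d] r y y' /=; last by rewrite scalerDr !scalerA mulrC.
  by rewrite (dual_lin lam) scalerDl scalerA.
have := congr1 (tlift (fun (d : gsp_alg X) (t : T) => (lam d : R) *: t)) e.
by rewrite !(tlift_tens hb) -[LHS]/(calg_str T _ * 1) -[RHS]/(calg_str T _ * 1) !mulr1.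
Qed.

(** M_0 has a dual basis over A, so an element of O (x) T is recovered from its images under all
    f. *)
Lemma val_sep (X Y : torsor G) x y (c : gsp_alg X) (c' : gsp_alg Y) : alg_hom x -> alg_hom y ->
  (forall f : dual M0, val x c f = val y c' f) -> triv0 x c = triv0 y c' :> tensor O T.
Proof.
move=> hx hy e; have [l hl] := line_dbasis dk (trivial_line dk G).
have key (z : tensor O T) : z = \sum_(q <- l) tmap (fun a : A => smul (Z := trivial_space G) a q.1) id
    (tmap (fun o : O => q.2 (o : M0) : A) id z).
  have ls q := @smul_linl R G (trivial_space G) q; have lf q := @dual_space_lin R G q.
  move: z; apply: tlin_eq => [||o t].
  - exact: id_linear.
  - move=> r u w; rewrite scaler_sumr -big_split; apply: eq_bigr => q _ /=.
    rewrite (tmap_linear (lf q.2) (@id_linear _ _) r).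
    exact: (tmap_linear (ls q.1) (@id_linear _ _) r).
  transitivity (tens (\sum_(q <- l) smul (Z := trivial_space G) (q.2 (o : M0)) q.1 : O) t).
    by congr (tens _ _); rewrite -[LHS](@scale1r AR M0) (hl (o : M0)).
  rewrite (linear_sum _ _ _ ((tens_bilin O T).1 t)); apply: eq_bigr => q _.
  by rewrite !tmap_tens.
rewrite (key (triv0 x c)) (key (triv0 y c')); apply: eq_bigr => q _.
by rewrite -!val_triv // e.
Qed.

(** The r for which r [triv0 x c] lies in the image of [triv0 y] form an ideal, so the inclusion can
    be checked at each place on a local generator. *)
Lemma image_sub (X Y : torsor G) (x : gsp_alg X -> T) (y : gsp_alg Y -> T) em em' : alg_hom x -> alg_hom y ->
  (forall v : place R, gen_at (A := A) (M := space_mod X) v (em v)) ->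
  (forall v : place R, exists s (b : A), ~ v s /\ s *: triv0 x (em v) = triv0 y (smul b (em' v))) ->
  forall c, exists c', triv0 x c = triv0 y c'.
Proof.
move=> hx hy ge h c; have lx := (triv0_hom hx).1; have ly := (triv0_hom hy).1.
pose J r := exists c', r *: triv0 x c = triv0 y c'.
have [|||c' hc'] := @place_cover R (dk_fin dk) J; last by exists c'; rewrite -hc' scale1r.
- by have [v0 _] := dk_place dk; exists v0.
- split; first by exists 0; rewrite scale0r (lin0 ly).
    by move=> r r' [d hd] [d' hd']; exists (d - d'); rewrite scalerBl hd hd' (linD ly) (linN ly).
  by move=> r r' [d hd]; exists (r *: d); rewrite -scalerA hd (linZ ly).
move=> v; have [s1 [vs1 g1]] := ge v; have [a ha] := g1 c.
have [s2 [b [vs2 hb]]] := h v; exists (s2 * s1); last by case/place_prime.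
exists (smul a (smul b (em' v))).
have e : s1 *: c = smul a (em v) by rewrite -smul_str.
rewrite -scalerA -(linZ lx) e (triv0_scale hx) (triv0_scale hy) -hb.
by rewrite (linZ (tmap_linear (smul_linear a) (@id_linear _ _))).
Qed.

Lemma image_iso (X Y : torsor G) (x : gsp_alg X -> T) (y : gsp_alg Y -> T) : alg_hom x -> alg_hom y ->
  (forall c, exists c', triv0 x c = triv0 y c') -> (forall c', exists c, triv0 y c' = triv0 x c) ->
  torsor_iso X Y.
Proof.
move=> hx hy h1 h2; have [lx mx] := triv0_hom hx; have [ly my] := triv0_hom hy.
have xI := triv0_inj hx; have yI := triv0_inj hy.
pose F c := projT1 (cid (h1 c)); have hF c : triv0 y (F c) = triv0 x c := esym (projT2 (cid (h1 c))).
pose F' c := projT1 (cid (h2 c)); have hF' c : triv0 x (F' c) = triv0 y c := esym (projT2 (cid (h2 c))).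
have lF : linear F by move=> r c c'; apply: yI; rewrite hF lx ly !hF.
exists F; split=> //.
- split; first by apply: yI; rewrite hF mx.1 my.1.
  by move=> c c'; apply: yI; rewrite my.2 !hF mx.2.
- by exists F' => c; [apply: xI|apply: yI]; rewrite ?hF' hF ?hF'.
move=> c.
(* Equivariance is checked after [triv0 y] (x) id, which is injective because O is flat. *)
pose yL : {linear gsp_alg Y -> tensor O T} := HB.pack (triv0 y) (GRing.isLinear.Build _ _ _ _ (triv0 y) ly).
have fI := @gs_flat _ G _ _ yL yI.
apply: fI; rewrite /= -(act_triv0 hy) hF (act_triv0 hx).
rewrite (tmap_comp _ lF (@id_linear _ _) ly (@id_linear _ _)).
by congr (tmap _ _ _); apply/funext => d; rewrite /= hF.
Qed.

Variables (f0 : dual M0) (ef : place R -> dual M0) (af : place R -> units (tensor A K)) (i0 : ideles A K).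
Hypothesis hf0 : line_data (A := A) (L := dual M0) f0 ef af i0.

Lemma val_f0 (X Y : torsor G) x y (c : gsp_alg X) (c' : gsp_alg Y) : alg_hom x -> alg_hom y ->
  val x c f0 = val y c' f0 -> triv0 x c = triv0 y c' :> tensor O T.
Proof.
move=> hx hy e; apply: val_sep => // f; have [_ [s s0 gf] _ _ _] := hf0; have [a ha] := gf f.
apply: (str_cancel s0); rewrite -!val_scaler //.
by rewrite ha !val_scaler // e.
Qed.

(** The ratio al b / al' comes from a unit of A (x) R_v; by [descent] it becomes an element c of A
    after multiplication by some s outside v. *)
Lemma local_image (X Y : torsor G) (x : gsp_alg X -> T) (y : gsp_alg Y -> T)
    (m l : space_mod X) (m' l' : space_mod Y) (al al' : units (tensor A K)) (b : units (tensor A K))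
    (v : place R) (w : units (tensor A (Rv v))) : alg_hom x -> alg_hom y ->
  ratio (A := A) (L := space_mod X) m l (uval al) -> ratio (A := A) (L := space_mod Y) m' l' (uval al') ->
  val x (l : gsp_alg X) f0 = tmap (fun b : A => b) j (uval b) * val y (l' : gsp_alg Y) f0 ->
  AK_to_Av v (uval (al + b - al')) = rK A K v (uval w) ->
  exists s (c : A), ~ v s /\ s *: triv0 x (m : gsp_alg X) = triv0 y (smul c (m' : gsp_alg Y)).
Proof.
move=> hx hy hr hr' e hw; have [s [c [vs hs]]] := descent hw; exists s, c; split=> //.
have mj := (@tmap_ring R A K T j hj.1 hj.2).2; have lj := hj.1.
rewrite -(linZ (triv0_hom hx).1) -smul_str; apply: val_f0 => //.
rewrite [LHS](val_scalel hx) [RHS](val_scalel hy) (val_ratio hx _ hr) (val_ratio hy _ hr') e.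
have := congr1 (tmap (fun b : A => b) j) hs; rewrite mj.2 !tmap_tens // hj.2.1 => <-.
rewrite !uvalD !mj.2.
have := congr1 (tmap (fun b : A => b) j) (uvalN al'); rewrite mj.2 mj.1.
set p := tmap _ _ _; set q := tmap _ _ _ => pq.
rewrite !mulrA; congr (_ * _).
rewrite -[LHS]mulr1 -pq; ring.
Qed.

Lemma pval_inj (X Y : torsor G) k :
  @pval R G K S T j g f0 i0 X k -> @pval R G K S T j g f0 i0 Y k -> torsor_iso X Y.
Proof.
move=> [x [m [em [am [im [u [h1 h2 h3 ->]]]]]]] [y0 [m' [em' [am' [im' [u' [k1 k2 k3 e]]]]]]].
have [a [w [c [pc hi hu]]]] := kval_eq e.
have gx := alg_hom_comp h1 hg; have gy0 := alg_hom_comp k1 hg.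
have hc := (pointsP c).1 pc.
pose y (d : gsp_alg Y) := pair_hom (g \o y0) (evt (uval c)) (gsp_act d).
have gy : alg_hom y by exact: pair_comp_hom gy0 hc _ _ (gsp_act_hom Y).
have ey d f : val y d f = uval c * val (g \o y0) d f by exact: val_translate.
have [_ _ gem rm im_] := h2; have [_ _ gem' rm' im'_] := k2.
have mj := (@tmap_ring R A K T j hj.1 hj.2).2.
have e1 : val (g \o x) (m : gsp_alg X) f0 = tmap (fun b : A => b) j (uval (- a)) * val y (m' : gsp_alg Y) f0.
  by rewrite -h3 hu ey k3 mulrA.
have e2 : val y (m' : gsp_alg Y) f0 = tmap (fun b : A => b) j (uval a) * val (g \o x) (m : gsp_alg X) f0.
  by rewrite e1 mulrA -mj.2 uvalN mj.1 mul1r.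
have ew v : AK_to_Av v (uval (am v - a - am' v)) = rK A K v (uval (w v)).
  have mA := (@AK_to_Av_hom R A K v).2.
  have := hi v; rewrite ![uval ((_ + i0) v)]uvalD im_ im'_ => hv.
  have hv2 : AK_to_Av v (uval (am v)) = AK_to_Av v (uval a) * rK A K v (uval (w v)) * AK_to_Av v (uval (am' v)).
    rewrite -[LHS]mulr1 -(uvalN (i0 v)) mulrA hv -!mulrA; congr (_ * (_ * _)).
    by rewrite uvalN mulr1.
  rewrite !uvalD !mA.2 hv2.
  have n1 := congr1 (AK_to_Av v) (uvalN a); have n2 := congr1 (AK_to_Av v) (uvalN (am' v)).
  rewrite !mA.2 !mA.1 in n1 n2; move: n1 n2.
  move: (AK_to_Av v (uval a)) (AK_to_Av v (uval (- a))) (AK_to_Av v (uval (am' v))) (AK_to_Av v (uval (- am' v))).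
  move=> p p' q q' pp qq; transitivity (rK A K v (uval (w v)) * (p * p') * (q * q')); first by ring.
  by rewrite pp qq !mulr1.
have ew' v : AK_to_Av v (uval (am' v + a - am v)) = rK A K v (uval (- w v)).
  have mA := (@AK_to_Av_hom R A K v).2.
  have mr := (@tmap_ring R A (Rv v) (Kv K v) _ (Rv_to_Kv_hom K v).1 (Rv_to_Kv_hom K v).2).2.
  have -> : am' v + a - am v = - (am v - a - am' v) by rewrite !opprB [a - am v]addrC addrA addrAC.
  have n1 := congr1 (AK_to_Av v) (uvalN (am v - a - am' v)); rewrite mA.2 mA.1 ew in n1.
  have n2 := congr1 (rK A K v) (uvalN (w v)); rewrite rmorphM rmorph1 in n2.
  by rewrite -[LHS]mul1r -n2 mulrAC n1 mul1r.
apply: (image_iso gx gy).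
  apply: (image_sub gx gy gem (em' := em')) => v.
  exact: (local_image gx gy (rm v) (rm' v) e1 (ew v)).
apply: (image_sub gy gx gem' (em' := em)) => v.
exact: (local_image gy gx (rm' v) (rm v) e2 (ew' v)).
Qed.
End Injectivity.

(** * Number fields *)

Section NumberFields.
Variables (F : fieldExtType rat) (Fc : closedFieldType) (iota : {rmorphism F -> Fc}).
Local Notation R := (ring_of_integers F).
Local Notation K := (F_alg F).
Local Notation S := (Rc_alg iota).
Local Notation T := (Fc_alg iota).

Lemma F_frac_field : frac_field K.
Proof.
split=> [|x|d d0]; first exact: RF_inj.
  have [a [c [c0 ha]]] := RF_frac x; exists c%:~R, a; split.
    by move=> /(congr1 (@RF F)); rewrite RF_int rmorph0 => /eqP; rewrite intrF_eq0 (negbTE c0).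
  by rewrite -[LHS]/(RF F c%:~R * x) RF_int.
exists ((RF F d)^-1); rewrite -[LHS]/(RF F d * (RF F d)^-1) mulfV //.
by apply/eqP => h; apply: d0; apply: (@RF_inj F); rewrite h rmorph0.
Qed.

Lemma F_to_Fc_hom : linear (F_to_Fc iota) /\ monoid_morphism (F_to_Fc iota).
Proof.
split=> [r x y|]; last by split; [exact: rmorph1|exact: rmorphM].
by rewrite -[LHS]/(iota (RF F r * x + y)) rmorphD rmorphM.
Qed.

Lemma Fc_str_inj : injective (calg_str T).
Proof. by move=> a b /fmorph_inj /(@RF_inj F). Qed.

Variable G : group_scheme R.
Local Notation dk := (ROI_dedekind F).
Local Notation A := (cdual G).
Local Notation M0 := (space_mod (trivial_space G)).

Lemma cst_Fc_inj : injective (@cst R A T).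
Proof.
move=> a b e; apply: dual_eq => h; apply: Fc_str_inj.
have := congr1 (fun z => evt z h) e; rewrite /cst !evt_tens.
by rewrite -[LHS]/(calg_str T _ * 1) -[RHS]/(calg_str T _ * 1) !mulr1.
Qed.

Lemma torsor_Fc_neq0 (X : torsor G) : (1 : tensor (gsp_alg X) T) != 0.
Proof.
apply/eqP => e; apply: (tors_neq0 dk (X := X)); have [l hl] := tors_dbasis dk X.
apply: (dbasis_sep hl) => lam; apply: Fc_str_inj.
have hb : bilin (fun (d : gsp_alg X) (t : T) => (lam d : R) *: t).
  split=> [t|d] r y y' /=; last by rewrite scalerDr !scalerA mulrC.
  by rewrite (dual_lin lam) scalerDl scalerA.
have := congr1 (tlift (fun (d : gsp_alg X) (t : T) => (lam d : R) *: t)) e.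
rewrite (tlift_tens hb) (lin0 (tliftP hb)) -[LHS]/(calg_str T _ * 1) mulr1 => ->.
by rewrite (lin0 (dual_lin lam)) rmorph0.
Qed.

(** The algebra C is finite and nonzero over F^c, so it has an F^c-point chi. Each chi(c) maps the
    span of the chi(v i) into itself, hence is integral over R, and chi factors through R^c. *)
Lemma torsor_point (X : torsor G) : exists chi : gsp_alg X -> S, alg_hom chi.
Proof.
have hg := tors_fingen dk X.
have [chi [lchi mchi]] := fin_closed_point hg (torsor_Fc_neq0 X).
have [n [v gen]] := hg.
have expand (c : gsp_alg X) (k : 'I_n -> R) : c = \sum_i k i *: v i ->
    chi c = \sum_i RFc iota (k i) * chi (v i) :> Fc.
  move=> ->; rewrite (linear_sum _ _ _ lchi); apply: eq_bigr => i _.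
  by rewrite (linZ lchi).
have int c : integralOver (RFc iota) (chi c : Fc).
  have [i0 i0n] : exists i, (chi (v i) : Fc) != 0.
    apply/existsP; rewrite -negb_forall; apply/negP => /forallP h0.
    have [k hk] := gen 1; have := expand _ _ hk.
    rewrite mchi.1 big1 => [/eqP|i _]; first by rewrite oner_eq0.
    by rewrite (eqP (h0 i)) mulr0.
  pose M i := projT1 (cid (gen (c * v i))).
  have hM i : c * v i = \sum_j M i j *: v j := projT2 (cid (gen (c * v i))).
  apply: (eigen_integral (y := fun i => chi (v i) : Fc) (M := M) i0n) => i.
  by rewrite -(expand _ _ (hM i)) mchi.2.
exists (fun c => IntClosure (asboolT (int c)) : Rc iota); split.
  by move=> r c d; apply: val_inj; rewrite /= lchi.
by split=> [|c d]; apply: val_inj; rewrite /= (mchi.1, mchi.2).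
Qed.

Variables (f0 : dual M0) (ef : place R -> dual M0) (af : place R -> units (tensor A K)) (i0 : ideles A K).
Hypothesis hf0 : line_data (A := A) (L := dual M0) f0 ef af i0.
Local Notation pv := (@pval R G K S T (F_to_Fc iota) (@Rc_to_Fc F Fc iota) f0 i0).

Definition torsor_value (X : torsor G) : K0bar iota G :=
  projT1 (cid (pval_ex dk F_frac_field F_to_Fc_hom (Rc_to_Fc_hom iota) hf0 (torsor_point X))).

Lemma torsor_valueP X : pv X (torsor_value X).
Proof. exact: projT2 (cid _). Qed.

Lemma torsor_value_uniq X k : pv X k -> torsor_value X = k.
Proof. exact: (pval_uniq dk F_frac_field F_to_Fc_hom (Rc_to_Fc_hom iota) cst_Fc_inj hf0 (torsor_valueP X)). Qed.

Lemma torsor_isoE X Y : torsor_iso X Y <-> torsor_value X = torsor_value Y.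
Proof.
split=> [h|e].
  exact: (pval_iso dk F_frac_field F_to_Fc_hom (Rc_to_Fc_hom iota) cst_Fc_inj hf0 h
    (torsor_valueP X) (torsor_valueP Y)).
have hX := torsor_valueP X; rewrite e in hX.
exact: (pval_inj dk F_frac_field F_to_Fc_hom (Rc_to_Fc_hom iota) Fc_str_inj hf0 hX (torsor_valueP Y)).
Qed.

Definition psibar (x : H1 G) : K0bar iota G := torsor_value (projT1 (cid (proj2_sig x))).

Lemma psibar_class X : psibar (h1_class X) = torsor_value X.
Proof.
rewrite /psibar; case: cid => Y /= e; apply/torsor_isoE.
by have /torsor_isoE : torsor_value X = torsor_value X by []; rewrite e.
Qed.

Lemma h1_classP (x : H1 G) : exists X, x = h1_class X.
Proof. by case: x => P [X e]; subst P; exists X. Qed.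

Lemma psibar_inj : injective psibar.
Proof.
move=> x y; have [X ->] := h1_classP x; have [Y ->] := h1_classP y.
rewrite !psibar_class /h1_class => e.
apply: eq_exist; by apply/funext => Z; apply/propext; rewrite !torsor_isoE e.
Qed.

Lemma psibar_is_psibar : is_psibar psibar.
Proof.
move=> X; split.
  have [chi hchi] := torsor_point X; have [xi [lxi bxi ixi]] := xi_ex dk hchi.
  by exists xi; split=> //; exists (triv chi) => //; exact: triv_iso.
move=> xi [lin bij [ph hph ind]]; have hL := line_fgproj dk (torsor_line_line dk X).
exists hL, lin, bij; rewrite psibar_class.
have [chi hchi e] := iso_point hph; have hxi := induced_val hchi e ind.
have [m [em [am [im hm]]]] := line_data_ex dk F_frac_field (space_line dk X).
have [u hu] := val_unit dk F_frac_field F_to_Fc_hom (Rc_to_Fc_hom iota) hf0 hchi hm.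
apply: torsor_value_uniq; exists chi, m, em, am, im, u; split=> //.
exact: (class_value dk F_frac_field F_to_Fc_hom (Rc_to_Fc_hom iota) cst_Fc_inj hf0 hL lin bij hchi hxi hm hu).
Qed.
End NumberFields.

Theorem theorem6p8 (F : fieldExtType rat) (Fc : closedFieldType)
    (iota : {rmorphism F -> Fc}) (algFc : forall x : Fc, algebraicOver iota x)
    (G : group_scheme (ring_of_integers F)) :
  exists psi : H1 G -> K0bar iota G,
    [/\ is_psibar psi,
        forall x, K0bar_Rc (psi x),
        forall X Y Z : torsor G, contracted_product X Y Z ->
          psi (h1_class Z) = psi (h1_class X) + psi (h1_class Y)
      & injective psi].
Proof.
have dk := ROI_dedekind F.
have [f0 [ef [af [i0 hf0]]]] :=
  line_data_ex dk (F_frac_field F) (dual_line (@cdual_tf _ dk G) (trivial_line dk G)).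
have hpsi := psibar_is_psibar iota hf0.
exists (psibar iota hf0); split=> // [x|X Y Z [h [hh hI heq hact]]|]; last exact: psibar_inj.
  have [X ->] := h1_classP x; have [[xi hxi] hX] := hpsi X.
  by have [hL [lin [bij ->]]] := hX _ hxi; exists (line_class hL lin bij).
rewrite !psibar_class; apply: torsor_value_uniq.
exact: (pval_contracted dk (Rc_to_Fc_hom iota) hf0 hh hI heq hact
  (torsor_valueP iota hf0 X) (torsor_valueP iota hf0 Y)).
Qed.
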